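(* For $\lambda\in\mathbb C$ let $f_\lambda(z)=\lambda z+z^2$, and let $J(f_\lambda)$ denote its Julia set. Let $\lambda_0=e^{2\pi i p/q}$ be a primitive $q$-th root of unity ($q\ge 1$), and let $(\lambda_n)_{n\ge1}$ be a sequence in $\mathbb C$ with $\lambda_n\neq\lambda_0$ for all $n\geq 1$ and $\lambda_n\to\lambda_0$. Then $$J(f_{\lambda_n})\to J(f_{\lambda_0})\ \Longleftrightarrow\ \Big|\mathrm{Re}\Big(\frac{1}{1-\lambda_n^q}\Big)\Big|\to+\infty ,$$ where the convergence of Julia sets is in the Hausdorff topology.
   Context: The Hausdorff topology is the one on non-empty compact subsets of the Riemann sphere $\widehat{\mathbb C}$. Note that $\lambda_n^q\ne1$ for all large $n$, so the right-hand side is meaningful for large $n$. *)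

(* Defs.v *)
From HB Require Import structures.
From mathcomp Require Import all_boot all_order all_algebra.
From mathcomp Require Import all_classical all_reals all_analysis.
From mathcomp Require Import complex ring.

Set Implicit Arguments.
Unset Strict Implicit.
Unset Printing Implicit Defensive.

Import Order.TTheory GRing.Theory Num.Theory.
Import numFieldNormedType.Exports.
Import ComplexField.Normc.

Local Open Scope classical_set_scope.
Local Open Scope ring_scope.
Local Open Scope complex_scope.

Definition cis (R : realType) (t : R) : R[i] := cos t +i* sin t.

(* [None] is the point at infinity. *)
Definition riemann_sphere (R : realType) : Type := option R[i].

HB.instance Definition _ (R : realType) := Choice.on (riemann_sphere R).

Section chordal_metric.
Variable R : realType.
Implicit Types x y z : riemann_sphere R.

Definition chordal x y : R :=
  match x, y with
  | Some z, Some w =>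
      2 * normc (z - w) /
      (Num.sqrt (1 + normc z ^+ 2) * Num.sqrt (1 + normc w ^+ 2))
  | Some z, None | None, Some z => 2 / Num.sqrt (1 + normc z ^+ 2)
  | None, None => 0
  end.

(* The axioms of a distance are checked in homogeneous coordinates. *)
Let hnum x : R[i] := if x is Some z then z else 1.
Let hden x : R[i] := if x is Some _ then 1 else 0.
Let hnorm x : R := Num.sqrt (normc (hnum x) ^+ 2 + normc (hden x) ^+ 2).
Let hdet x y : R[i] := hnum x * hden y - hnum y * hden x.
Let hdot x y : R[i] := hnum x * (hnum y)^* + hden x * (hden y)^*.

Let normc_sqr (a b : R) : normc (a +i* b) ^+ 2 = a ^+ 2 + b ^+ 2.
Proof. by rewrite /normc sqr_sqrtr// addr_ge0// sqr_ge0. Qed.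

Let normc_ge0 (z : R[i]) : 0 <= normc z.
Proof. by case: z => a b; rewrite /normc sqrtr_ge0. Qed.

Let hnorm_gt0 x : 0 < hnorm x.
Proof.
rewrite sqrtr_gt0; case: x => [z|].
  by rewrite [normc (hden _)]normc1 expr1n ltr_wpDl// sqr_ge0.
by rewrite [normc (hnum _)]normc1 expr1n ltr_wpDr// sqr_ge0.
Qed.

Let chordalE x y : chordal x y = 2 * normc (hdet x y) / (hnorm x * hnorm y).
Proof.
have hS (z : R[i]) : hnorm (Some z) = Num.sqrt (1 + normc z ^+ 2).
  by rewrite /hnorm [normc (hden _)]normc1 expr1n addrC.
have hN : hnorm None = 1.
  by rewrite /hnorm [normc (hnum _)]normc1 [normc (hden _)]normc0 expr1n expr0n addr0 sqrtr1.
case: x y => [z|] [w|]; rewrite ?hS ?hN /chordal /hdet /hnum /hden.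
- by rewrite !mulr1.
- by rewrite mulr0 !mul1r sub0r normcN normc1 !mulr1.
- by rewrite mulr0 !mul1r subr0 normc1 mulr1.
- by rewrite subrr normc0 mulr0 mul0r.
Qed.

Let hdot_le x y : normc (hdot x y) <= hnorm x * hnorm y.
Proof.
rewrite -(@ler_pXn2r _ 2) ?nnegrE ?mulr_ge0 ?(ltW (hnorm_gt0 _))//.
rewrite exprMn !sqr_sqrtr ?addr_ge0 ?sqr_ge0// /hdot.
case: (hnum x) (hden x) (hnum y) (hden y) => [a b] [c d] [e f] [g h].
rewrite -subr_ge0; simpc; rewrite !normc_sqr.
set t := (X in 0 <= X).
have -> : t = (a * g - b * h - (e * c - f * d)) ^+ 2
   + (a * h + b * g - (e * d + f * c)) ^+ 2 by rewrite /t; ring.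
by rewrite addr_ge0 ?sqr_ge0.
Qed.

Let hdet_triangle x y z : hdet x z * hdot y y = hdet x y * hdot z y + hdet y z * hdot x y.
Proof. by rewrite /hdet /hdot; ring. Qed.

Let normc_hdot y : normc (hdot y y) = hnorm y ^+ 2.
Proof.
rewrite sqr_sqrtr ?addr_ge0 ?sqr_ge0// /hdot.
case: (hnum y) (hden y) => [a b] [c d]; simpc; rewrite !normc_sqr /normc.
rewrite (_ : Num.sqrt _ = `|a ^+ 2 + b ^+ 2 + (c ^+ 2 + d ^+ 2)|).
  by rewrite ger0_norm// !addr_ge0 ?sqr_ge0.
by rewrite -sqrtr_sqr; congr Num.sqrt; ring.
Qed.

Let chordalxx x : chordal x x = 0.
Proof. by rewrite chordalE /hdet subrr normc0 mulr0 mul0r. Qed.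

Let chordal_sym x y : chordal x y = chordal y x.
Proof. by rewrite !chordalE /hdet -normcN opprB (mulrC (hnorm y)). Qed.

Let chordal_eq0 x y : chordal x y = 0 -> x = y.
Proof.
move/eqP; rewrite chordalE !mulf_eq0 invr_eq0 mulf_eq0 pnatr_eq0 /=.
rewrite !(gt_eqF (hnorm_gt0 _)) !orbF => /eqP/eq0_normc.
rewrite /hdet; case: x y => [z|] [w|] //=; rewrite ?mulr1 ?mulr0 ?subr0 ?sub0r.
- by move/eqP; rewrite subr_eq0 => /eqP ->.
- by move/eqP; rewrite oppr_eq0 oner_eq0.
- by move/eqP; rewrite oner_eq0.
Qed.

Let chordal_triangle y x z : chordal x z <= chordal x y + chordal y z.
Proof.
rewrite !chordalE.
have hx := hnorm_gt0 x; have hy := hnorm_gt0 y; have hz := hnorm_gt0 z.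
have key : normc (hdet x z) * hnorm y ^+ 2 <=
    normc (hdet x y) * (hnorm z * hnorm y) + normc (hdet y z) * (hnorm x * hnorm y).
  rewrite -normc_hdot -normcM hdet_triangle (le_trans (le_normcD _ _))//.
  by rewrite !normcM lerD// ler_wpM2l// hdot_le.
rewrite -(@ler_pM2r _ (hnorm x * hnorm y ^+ 2 * hnorm z)) ?mulr_gt0 ?exprn_gt0//.
have -> : 2 * normc (hdet x z) / (hnorm x * hnorm z) * (hnorm x * hnorm y ^+ 2 * hnorm z)
  = 2 * (normc (hdet x z) * hnorm y ^+ 2) by field; rewrite !gt_eqF.
set t := (X in _ <= X).
have -> : t = 2 * (normc (hdet x y) * (hnorm z * hnorm y)
   + normc (hdet y z) * (hnorm x * hnorm y)) by rewrite /t; field; rewrite !gt_eqF.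
by rewrite ler_pM2l.
Qed.

HB.instance Definition _ := isMetric.Build R (riemann_sphere R)
  chordalxx chordal_eq0 chordal_sym chordal_triangle.

End chordal_metric.

Section julia.
Variable R : realType.
Local Notation S := (riemann_sphere R).

Definition quad_map (lambda : R[i]) (x : S) : S :=
  if x is Some z then Some (lambda * z + z ^+ 2) else None.

(* The limit [g] only matters on [U]. *)
Definition normal_family (U : set S) (F : set (S -> S)) : Prop :=
  forall h : nat -> S -> S, (forall k, F (h k)) ->
  exists s : nat -> nat, {homo s : m n / (m < n)%N} /\
  exists g : S -> S,
    {family [set K | compact K /\ K `<=` U], (h \o s) @ \oo --> g}.

Definition fatou_set (f : S -> S) : set S :=
  [set x | exists U : set S, [/\ open U, U x &
    normal_family U [set iter n f | n in [set: nat]]]].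

Definition julia_set (f : S -> S) : set S := ~` fatou_set f.

End julia.

Section hausdorff_distance.
Variables (R : realType) (T : metricType R).

Definition thickening (r : R) (A : set T) : set T := \bigcup_(a in A) ball a r.

Definition hausdorff_dist (A B : set T) : \bar R :=
  ereal_inf [set r%:E | r in [set r : R |
    [/\ 0 < r, A `<=` thickening r B & B `<=` thickening r A]]].

(* On the nonempty compact sets this is convergence for the Hausdorff
   topology. *)
Definition hausdorff_cvg (A : nat -> set T) (B : set T) : Prop :=
  hausdorff_dist (A n) B @[n --> \oo] --> 0%E.

End hausdorff_distance.

(* Main.v *)
(* For |lambda| <= 2 the Julia set of f_lambda is the boundary of the filled set
   K(lambda).  Boundary points persist under perturbation, so the Julia sets
   converge unless points of J(f_(lambda n)) accumulate at the interior of
   K(lambda0), which is the parabolic basin of 0.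

   Put mu = lambda^q.  A normal form U o f = mu U + b U^2 + ... with
   U = z^q + ... holds near 0, continuously in lambda, and w = - mu / (b U)
   satisfies w o f = (w + 1) / mu + g / w + O(|w|^-2).  With d = 1 - mu and
   zeta = 1 + d w, the potential ln |zeta| - Re (g d) ln |w| increases at each
   step by - ln |mu|, up to an error that is summable along an orbit, and
   - ln |mu| has the size of |d|^2 Re (1 / d).  If |Re (1 / d)| is large, this
   drift keeps the orbits entering the gate on the attracting side away from
   w = 0, so that compact parts of the basin remain in K(lambda).  If
   |Re (1 / d)| is bounded, zeta makes a full turn and the orbit comes back;
   applied to the backward orbit of a Julia point close to 0, this yields Julia
   points of f_lambda in a fixed compact part of the basin.

   Complex integration is avoided: the values at roots of unity give Cauchy
   estimates for polynomials, and inverse branches of the iterates are uniform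
   limits of polynomials.  Since the inverse branches must be obstructed, the
   critical orbit visits every petal, so there is one cycle of petals (b is not
   zero) and no recurrent point in the interior of K(lambda0). *)

Require Import Defs.
From mathcomp Require Import all_boot all_order all_algebra.
From mathcomp Require Import all_classical all_reals all_analysis.
From mathcomp Require Import complex ring lra.

Set Implicit Arguments.
Unset Strict Implicit.
Unset Printing Implicit Defensive.

Import Order.TTheory GRing.Theory Num.Theory.
Import numFieldNormedType.Exports.

Local Open Scope classical_set_scope.
Local Open Scope ring_scope.
Local Open Scope complex_scope.

(** Each step changes the potential by ln |1 / mu| up to an error of size |d| (1 + |Im w|) / |w|^2,
    plus O(|d|^2). This is summed without knowing the shape of the orbit: a bounded function of w
    gains at least (1 + |Im w|) / |w|^2, up to constants and O(|d|), at every step, so the sum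
    telescopes and k steps cost O(|d| + k |d|^2). Without the term in ln |w| the error would contain
    Re (d g / w), whose sum is of order |d| ln (1 / |d|) and too large: at both ends of a passage,
    near w = 0, the potential is only O(|d|). This scale decides the dichotomy. A passage takes at
    least a constant times 1 / |d| steps, so the drift it accumulates is at least of order |Re (1 /
    d)| |d|, to be compared with O(|d|). In the bounded case the backward orbit is followed because
    Julia points of the limit map near 0 lie on the repelling side, and preimages of Julia points
    are Julia points. In the coordinate - mu w the inverse map is again a gate map, with 1 / d
    replaced by 1 - 1 / d, so one analysis serves both directions. *)

Notation nm := ComplexField.Normc.normc.
Notation re := complex.Re.
Notation im := complex.Im.

(** * Modulus, real and imaginary parts of complex numbers *)

Section modulus.
Variable R : realType.
Implicit Types (x y z : R[i]) (a b : R).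

Lemma nm_ge0 z : 0 <= nm z.
Proof. by case: z => a b; rewrite /nm sqrtr_ge0. Qed.

Lemma nmM x y : nm (x * y) = nm x * nm y.
Proof. exact: ComplexField.Normc.normcM. Qed.

Lemma nmV x : nm x^-1 = (nm x)^-1.
Proof. exact: ComplexField.Normc.normcV. Qed.

Lemma nm_div x y : nm (x / y) = nm x / nm y.
Proof. by rewrite nmM nmV. Qed.

Lemma nm0 : nm (0 : R[i]) = 0.
Proof. exact: ComplexField.Normc.normc0. Qed.

Lemma nm1 : nm (1 : R[i]) = 1.
Proof. exact: ComplexField.Normc.normc1. Qed.

Lemma nmN x : nm (- x) = nm x.
Proof. exact: normcN. Qed.

Lemma nmD x y : nm (x + y) <= nm x + nm y.
Proof. exact: le_normcD. Qed.

Lemma nmB x y : nm (x - y) <= nm x + nm y.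
Proof. by rewrite -(nmN y); exact: nmD. Qed.

Lemma nmC x y : nm (x - y) = nm (y - x).
Proof. by rewrite -nmN opprB. Qed.

Lemma nm_tri y x z : nm (x - z) <= nm (x - y) + nm (y - z).
Proof. by rewrite (le_trans _ (nmD _ _))// addrA subrK. Qed.

Lemma nm_leB x y : nm x - nm y <= nm (x - y).
Proof. by have := nmD (x - y) y; rewrite subrK; lra. Qed.

Lemma nm_leD x y : nm x - nm y <= nm (x + y).
Proof. by have := nm_leB x (- y); rewrite opprK nmN. Qed.

Lemma nmX x n : nm (x ^+ n) = nm x ^+ n.
Proof. by elim: n => [|n IH]; rewrite ?expr0 ?nm1// !exprS nmM IH. Qed.

Lemma nm_eq0 x : (nm x == 0) = (x == 0).
Proof.
apply/eqP/eqP => [|->]; last exact: nm0.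
exact: ComplexField.Normc.eq0_normc.
Qed.

Lemma nm_gt0 x : (0 < nm x) = (x != 0).
Proof. by rewrite lt_neqAle nm_ge0 andbT eq_sym nm_eq0. Qed.

Lemma nm_real a : nm (a%:C) = `|a|.
Proof. by rewrite /nm /= expr0n /= addr0 sqrtr_sqr. Qed.

Lemma nm_nat n : nm (n%:R : R[i]) = n%:R.
Proof.
have -> : n%:R = (n%:R : R)%:C by rewrite rmorph_nat.
by rewrite nm_real ger0_norm ?ler0n.
Qed.

Lemma nm_sqr z : nm z ^+ 2 = re z ^+ 2 + im z ^+ 2.
Proof. by case: z => a b; rewrite /nm sqr_sqrtr// addr_ge0// sqr_ge0. Qed.

Lemma nm_sum (I : Type) (r : seq I) (P : pred I) (F : I -> R[i]) :
  nm (\sum_(i <- r | P i) F i) <= \sum_(i <- r | P i) nm (F i).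
Proof.
elim/big_ind2: _ => [|x u y v hx hy|//]; first by rewrite nm0.
by rewrite (le_trans (nmD _ _))// lerD.
Qed.

Lemma nm_prod (I : Type) (r : seq I) (P : pred I) (F : I -> R[i]) :
  nm (\prod_(i <- r | P i) F i) = \prod_(i <- r | P i) nm (F i).
Proof. by elim/big_ind2: _ => [|x u y v <- <-|//]; rewrite ?nm1 ?nmM. Qed.

Lemma re_nm z : `|re z| <= nm z.
Proof.
rewrite -(@ler_pXn2r _ 2) ?nnegrE ?nm_ge0// nm_sqr real_normK ?num_real//.
by rewrite lerDl sqr_ge0.
Qed.

Lemma im_nm z : `|im z| <= nm z.
Proof.
rewrite -(@ler_pXn2r _ 2) ?nnegrE ?nm_ge0// nm_sqr real_normK ?num_real//.
by rewrite lerDr sqr_ge0.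
Qed.

Lemma re_le z : re z <= nm z.
Proof. exact: le_trans (ler_norm _) (re_nm z). Qed.

Lemma re_ge z : - nm z <= re z.
Proof. by have := re_nm z; rewrite ler_norml => /andP[]. Qed.

Lemma nm_reim z : nm z <= `|re z| + `|im z|.
Proof.
rewrite -(@ler_pXn2r _ 2) ?nnegrE ?nm_ge0 ?addr_ge0// nm_sqr.
have := normr_ge0 (re z); have := normr_ge0 (im z).
by rewrite -(real_normK (num_real (re z))) -(real_normK (num_real (im z))); nra.
Qed.

Lemma reD x y : re (x + y) = re x + re y. Proof. by case: x y => [? ?] []. Qed.
Lemma imD x y : im (x + y) = im x + im y. Proof. by case: x y => [? ?] []. Qed.
Lemma reN x : re (- x) = - re x. Proof. by case: x. Qed.
Lemma imN x : im (- x) = - im x. Proof. by case: x. Qed.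
Lemma reB x y : re (x - y) = re x - re y. Proof. by rewrite reD reN. Qed.
Lemma imB x y : im (x - y) = im x - im y. Proof. by rewrite imD imN. Qed.
Lemma reM x y : re (x * y) = re x * re y - im x * im y.
Proof. by case: x y => [? ?] []. Qed.
Lemma imM x y : im (x * y) = re x * im y + im x * re y.
Proof. by case: x y => [? ?] []. Qed.
Lemma reV x : re x^-1 = re x / nm x ^+ 2.
Proof. by rewrite nm_sqr; case: x. Qed.
Lemma imV x : im x^-1 = - im x / nm x ^+ 2.
Proof. by rewrite nm_sqr; case: x => a b /=; rewrite mulNr. Qed.

Lemma nat_gt (a : R) : exists n : nat, a < n%:R.
Proof.
exists (Num.bound `|a|).
by apply: le_lt_trans (ler_norm a) _; exact: archi_boundP.
Qed.

Lemma expr_gt (a b : R) : 1 < a -> exists n, b < a ^+ n.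
Proof.
move=> a1; have [n hn] := nat_gt (b / (a - 1)).
exists n; rewrite ltr_pdivrMr ?subr_gt0// in hn.
suff : 1 + n%:R * (a - 1) <= a ^+ n by lra.
elim: n {hn} => [|n IH]; first by rewrite mul0r addr0 expr0.
rewrite exprS -natr1; have n0 := ler0n R n.
have h1 : a * (1 + n%:R * (a - 1)) <= a * a ^+ n by rewrite ler_wpM2l//; lra.
have h2 : 0 <= n%:R * (a - 1) ^+ 2 by rewrite mulr_ge0 ?sqr_ge0.
by lra.
Qed.

Lemma expr_lt (a b : R) : 0 <= a -> a < 1 -> 0 < b ->
  exists n, forall m, (n <= m)%N -> a ^+ m < b.
Proof.
rewrite le_eqVlt => /predU1P[<-|a0] a1 b0.
  by exists 1%N => -[//|m] _; rewrite expr0n.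
have [|n hn] := @expr_gt a^-1 b^-1; first by rewrite invf_gt1.
exists n => m nm; have : a ^+ m <= a ^+ n by rewrite ler_wiXn2l// ltW.
move=> /le_lt_trans; apply; rewrite exprVn ltf_pV2 ?posrE ?exprn_gt0// in hn.
Qed.

End modulus.

(** * Cauchy estimates for polynomials *)

Section discrete_cauchy.
Variable R : realType.
Implicit Types (p : {poly R[i]}) (z a : R[i]) (r M : R).

(** Iterated square roots of -1: if w^(2^l) = -1, the order of w divides 2^(l+1) but not 2^l. Orders
    that are powers of two suffice to average polynomials of any degree. *)
Lemma dyadic_prim_root l : exists z : R[i], (2 ^ l).-primitive_root z.
Proof.
case: l => [|l].
  exists 1; apply/andP; split => //; apply/forallP => i; rewrite ord1 /=.
  by rewrite unity_rootE expr1n eqxx.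
have [w hw] : exists w : R[i], w ^+ (2 ^ l) = -1.
  elim: l => [|l [w hw]]; first by exists (-1).
  by exists (sqrtc w); rewrite expnS exprM sqr_sqrtc.
have hw2 : w ^+ (2 ^ l.+1) = 1 by rewrite expnSr exprM hw expr2 mulrNN mulr1.
have [|m pm dm] := prim_order_exists _ hw2; first by rewrite expn_gt0.
exists w; suff -> : (2 ^ l.+1)%N = m by [].
have /(dvdn_pfactor _ _ (isT : prime 2))[k kl mE] := dm.
move: kl; rewrite leq_eqVlt => /predU1P[kE|]; first by rewrite mE kE.
rewrite ltnS => kl; exfalso.
have : w ^+ (2 ^ l) = 1.
  apply/eqP; rewrite -(prim_order_dvd pm) mE.
  by rewrite dvdn_exp2l.
rewrite hw => /eqP; rewrite -subr_eq0 -opprD oppr_eq0 -(natrD _ 1 1) pnatr_eq0.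
by [].
Qed.

Lemma root_sum (n : nat) z (i k : nat) : n.-primitive_root z -> (i < n)%N -> (k < n)%N ->
  \sum_(j < n) (z ^+ j) ^+ i * (z ^+ j) ^- k = n%:R *+ (i == k).
Proof.
move=> pz hi hk.
have z0 : z != 0.
  apply/eqP => z0; have := prim_expr_order pz.
  by rewrite z0 expr0n gtn_eqF ?(leq_ltn_trans _ hi)// => /eqP; rewrite eq_sym oner_eq0.
have [e|ik] := eqVneq i k.
  rewrite -e mulr1n -[n in RHS]card_ord -sumr_const; apply: eq_bigr => j _.
  by rewrite divff// !expf_neq0.
rewrite mulr0n; pose q := z ^+ i / z ^+ k.
rewrite (eq_bigr (fun j : 'I_n => q ^+ j)); last first.
  by move=> j _; rewrite /q exprMn exprVn -!exprM !(mulnC j).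
have q1 : q != 1.
  apply/eqP => /(congr1 (fun x => x * z ^+ k)).
  rewrite /q divfK ?expf_neq0// mul1r => /eqP.
  by rewrite (eq_prim_root_expr pz) !modn_small// (negPf ik).
have : (q - 1) * \sum_(j < n) q ^+ j = 0.
  rewrite -subrX1 /q exprMn exprVn -!exprM (mulnC i) (mulnC k) !exprM.
  by rewrite (prim_expr_order pz) !expr1n divr1 subrr.
by move/eqP; rewrite mulf_eq0 subr_eq0 (negPf q1) /= => /eqP.
Qed.

(** Averaging p(r w^j) w^(-jk) over the n-th roots of unity w^j isolates p_k r^k exactly once n is
    at least the size of p: a finite form of the Cauchy integral. *)
Lemma nm_coef_le p M r k : 0 < r -> (forall z, nm z <= r -> nm p.[z] <= M) ->
  nm p`_k * r ^+ k <= M.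
Proof.
move=> r0 H; have M0 : 0 <= M.
  by apply: le_trans (H 0 _); rewrite ?nm_ge0// nm0 ltW.
have [kp|kp] := ltnP k (size p); last first.
  by rewrite nth_default// nm0 mul0r.
pose n := (2 ^ size p)%N.
have sn : (size p <= n)%N by rewrite ltnW// ltn_expl.
have [w pw] := dyadic_prim_root (size p); rewrite -/n in pw.
have n0 : (0 < n)%N := prim_order_gt0 pw.
have w1 : nm w = 1.
  have : nm w ^+ n = 1 by rewrite -nmX (prim_expr_order pw) nm1.
  by move/eqP; rewrite pexpr_eq1 ?nm_ge0// => /eqP.
have e : n%:R * (p`_k * (r%:C) ^+ k) =
   \sum_(j < n) p.[r%:C * w ^+ j] * (w ^+ j) ^- k.
  under eq_bigr => j _ do rewrite (horner_coef_wide _ sn) mulr_suml.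
  rewrite exchange_big /=.
  under eq_bigr => i _.
    under eq_bigr => j _ do rewrite exprMn mulrA -mulrA.
    rewrite -mulr_sumr (root_sum pw (ltn_ord i) (leq_trans kp sn)); over.
  rewrite (bigD1 (Ordinal (leq_trans kp sn)))//= eqxx mulr1n big1 ?addr0; last first.
    by move=> i ik; rewrite (_ : (i == k :> nat) = false) ?mulr0n ?mulr0//; exact/negbTE.
  by rewrite mulrC.
have hn : 0 < n%:R :> R by rewrite ltr0n.
rewrite -(ler_pM2l hn).
have -> : n%:R * (nm p`_k * r ^+ k) = nm (n%:R * (p`_k * (r%:C) ^+ k)).
  by rewrite !nmM nmX nm_real gtr0_norm// nm_nat.
have -> : n%:R * M = \sum_(j < n) M by rewrite sumr_const card_ord mulr_natl.
rewrite e (le_trans (nm_sum _ _ _))//.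
apply: ler_sum => j _; rewrite nmM nmV !nmX w1 !expr1n invr1 mulr1.
by apply: H; rewrite nmM nmX w1 expr1n mulr1 nm_real gtr0_norm.
Qed.

Lemma nm_coef_le_div p M r k : 0 < r -> (forall z, nm z <= r -> nm p.[z] <= M) ->
  nm p`_k <= M / r ^+ k.
Proof. by move=> r0 H; rewrite ler_pdivlMr ?exprn_gt0// nm_coef_le. Qed.

Lemma geom_half (t : R) n : 0 <= t -> t <= 1/2 -> \sum_(i < n) t ^+ i <= 2.
Proof.
move=> t0 t1; suff : \sum_(i < n) t ^+ i <= 2 - 2 * t ^+ n.
  by have := exprn_ge0 n t0; lra.
elim: n => [|n IH]; first by rewrite big_ord0 expr0; lra.
rewrite big_ord_recr /= exprS.
by have := exprn_ge0 n t0; nra.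
Qed.

Definition shift_poly a p := p \Po ('X + a%:P).

Lemma shift_polyE a p z : (shift_poly a p).[z] = p.[z + a].
Proof. by rewrite horner_comp hornerD hornerX hornerC. Qed.

Lemma poly_lip0 p a r M z : 0 < r -> (forall z, nm (z - a) <= r -> nm p.[z] <= M) ->
  nm (z - a) <= r / 2 -> nm (p.[z] - p.[a]) <= 2 * M * nm (z - a) / r.
Proof.
move=> r0 H hz; set q := shift_poly a p.
have Hq h : nm h <= r -> nm q.[h] <= M.
  by move=> hh; rewrite shift_polyE H// addrK.
have -> : p.[z] = q.[z - a] by rewrite shift_polyE subrK.
have -> : p.[a] = q.[0] by rewrite shift_polyE add0r.
move: (z - a) hz => h hh {z}.
have M0 : 0 <= M.
  by apply: le_trans (Hq 0 _); rewrite ?nm_ge0// nm0 ltW.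
have h0 := nm_ge0 h.
have t0 : 0 <= nm h / r by rewrite divr_ge0// ltW.
have t1 : nm h / r <= 1/2 by rewrite ler_pdivrMr//; lra.
rewrite horner_coef0 (@horner_coef_wide _ (size q).+1 q)//.
rewrite big_ord_recl /= expr0 mulr1 addrC addKr.
apply: (le_trans (nm_sum _ _ _)).
apply: (@le_trans _ _ (\sum_(i < size q) M * (nm h / r) * (nm h / r) ^+ i)).
  apply: ler_sum => i _; rewrite /bump /= add1n nmM nmX.
  have c := nm_coef_le_div i.+1 r0 Hq.
  rewrite -mulrA -exprS expr_div_n mulrCA mulrC.
  by apply: ler_wpM2l => //; exact: exprn_ge0.
rewrite -mulr_sumr.
have := ler_wpM2l (mulr_ge0 M0 t0) (geom_half (size q) t0 t1); lra.
Qed.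

(** If z and z' are within r/4, the estimate at a centre applies on the disc of radius r/2 around
    z'; otherwise the trivial bound 2 M is already below 8 M |z - z'| / r. *)
Lemma poly_lip p a r M z z' : 0 < r -> (forall z, nm (z - a) <= r -> nm p.[z] <= M) ->
  nm (z - a) <= r / 2 -> nm (z' - a) <= r / 2 ->
  nm (p.[z] - p.[z']) <= 8 * M * nm (z - z') / r.
Proof.
move=> r0 H hz hz'.
have [near|far] := leP (nm (z - z')) (r / 4).
  have r2 : 0 < r / 2 by rewrite divr_gt0.
  have H' y : nm (y - z') <= r / 2 -> nm p.[y] <= M.
    by move=> hy; apply: H; have := nm_tri z' y a; lra.
  have M0 : 0 <= M.
    by apply: le_trans (H' z' _); rewrite ?nm_ge0// subrr nm0; lra.
  have := poly_lip0 r2 H' (ltac:(lra) : nm (z - z') <= r / 2 / 2).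
  have -> : 2 * M * nm (z - z') / (r / 2) = 4 * M * nm (z - z') / r by field; rewrite gt_eqF.
  move/le_trans; apply; rewrite ler_pM2r ?invr_gt0//.
  by have := mulr_ge0 M0 (nm_ge0 (z - z')); lra.
have h1 := H z (ltac:(lra)); have h2 := H z' (ltac:(lra)).
have M0 : 0 <= M := le_trans (nm_ge0 _) h1.
rewrite ler_pdivlMr// (@le_trans _ _ (2 * M * r))//.
  by rewrite ler_pM2r// (le_trans (nmB _ _))//; lra.
by nra.
Qed.

(* A crude form of Hadamard's three circles theorem. *)
Lemma poly_two_const M r s k : 0 < r -> 0 < s -> 0 < k -> exists2 e, 0 < e &
  forall p a, (forall z, nm (z - a) <= r -> nm p.[z] <= M) ->
    (forall z, nm (z - a) <= s -> nm p.[z] <= e) ->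
  forall z, nm (z - a) <= r / 2 -> nm p.[z] <= k.
Proof.
move=> r0 s0 k0.
have M1 : 0 < 4 * (1 + `|M|) by rewrite mulr_gt0//; have := normr_ge0 M; lra.
have h20 : 0 <= 1/2 :> R by lra.
have h21 : 1/2 < 1 :> R by lra.
have [n hn] := expr_lt h20 h21 (divr_gt0 k0 M1).
pose c := r / (2 * s).
have c0 : 0 < c by rewrite divr_gt0// mulr_gt0.
pose A := 1 + \sum_(i < n) c ^+ i.
have A0 : 1 <= A by rewrite lerDl sumr_ge0// => i _; rewrite exprn_ge0// ltW.
exists (k / (2 * A)); first by rewrite divr_gt0// mulr_gt0//; lra.
move=> p a H1 H2 z hz; set q := shift_poly a p.
have Hq h : nm h <= r -> nm q.[h] <= M.
  by move=> hh; rewrite shift_polyE H1// addrK.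
have Hs h : nm h <= s -> nm q.[h] <= k / (2 * A).
  by move=> hh; rewrite shift_polyE H2// addrK.
have -> : p.[z] = q.[z - a] by rewrite shift_polyE subrK.
move: (z - a) hz => h hh {z}.
have M0 : 0 <= M.
  by apply: le_trans (Hq 0 _); rewrite ?nm_ge0// nm0 ltW.
have h0 := nm_ge0 h.
rewrite (@horner_coef_wide _ (n + size q) q) ?leq_addl// big_split_ord /=.
rewrite (le_trans (nmD _ _))//.
have b1 : nm (\sum_(i < n) q`_i * h ^+ i) <= k / 2.
  apply: (le_trans (nm_sum _ _ _)).
  apply: (@le_trans _ _ (\sum_(i < n) (k / (2 * A)) * c ^+ i)).
    apply: ler_sum => i _; rewrite nmM nmX.
    have := nm_coef_le_div i s0 Hs => h1.
    have h2 : nm h ^+ i <= (r / 2) ^+ i by apply: lerXn2r => //; rewrite nnegrE; lra.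
    apply: (@le_trans _ _ (k / (2 * A) / s ^+ i * (r / 2) ^+ i)).
      by apply: ler_pM; rewrite ?nm_ge0 ?exprn_ge0.
    rewrite -!mulrA ler_pM2l// ler_pM2l; last by rewrite invr_gt0 mulr_gt0//; lra.
    by rewrite -exprVn -exprMn /c invfM mulrCA (mulrC s^-1).
  rewrite -mulr_sumr.
  have -> : k / 2 = k / (2 * A) * A by field; rewrite gt_eqF//; lra.
  rewrite ler_pM2l ?divr_gt0 ?mulr_gt0//; last by lra.
  by rewrite /A lerDr.
have b2 : nm (\sum_(i < size q) q`_(n + i) * h ^+ (n + i)) <= k / 2.
  apply: (le_trans (nm_sum _ _ _)).
  apply: (@le_trans _ _ (\sum_(i < size q) (M * (1/2) ^+ n) * (1/2) ^+ i)).
    apply: ler_sum => i _; rewrite nmM nmX.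
    have := nm_coef_le_div (n + i) r0 Hq => h1.
    have h2 : nm h ^+ (n + i) <= (r / 2) ^+ (n + i) by apply: lerXn2r => //; rewrite nnegrE; lra.
    apply: (@le_trans _ _ (M / r ^+ (n + i) * (r / 2) ^+ (n + i))).
      by apply: ler_pM; rewrite ?nm_ge0 ?exprn_ge0.
    rewrite -!mulrA ler_wpM2l// -exprD -exprVn -exprMn.
    by rewrite mulrA mulVf ?mul1r ?div1r// gt_eqF.
  rewrite -mulr_sumr.
  have g := @geom_half (1/2) (size q) (ltac:(lra)) (lexx _).
  have Mn : 0 <= M * (1/2) ^+ n by rewrite mulr_ge0 ?exprn_ge0//; lra.
  apply: (le_trans (ler_wpM2l Mn g)).
  have := hn n (leqnn _); rewrite ltr_pdivlMr//.
  rewrite (ger0_norm M0) => hk.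
  have : 0 <= (1/2 : R) ^+ n by rewrite exprn_ge0//; lra.
  by move: hk; clear; lra.
by move: b1 b2; clear; lra.
Qed.

End discrete_cauchy.

(** * Ultralimits, extraction of subsequences and Ascoli's theorem *)

Section ultralimits.
Variable R : realType.
Implicit Types (z a : R[i]) (r M : R).

(** A free ultrafilter makes all bounded sequences converge at once, so a limit function can be
    defined at every point before any subsequence is extracted. *)
Lemma nat_ultrafilter (P : nat -> Prop) : (forall N, exists2 n, (N <= n)%N & P n) ->
  exists F : set_system nat, [/\ UltraFilter F, F P & forall N, F [set n | (N <= n)%N]].
Proof.
move=> HP; pose B := fun N => [set n | (N <= n)%N /\ P n].
have PF : ProperFilter (filter_from [set: nat] B).
  apply: filter_from_proper; last by move=> N _; have [n nN Pn] := HP N; exists n.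
  apply: filter_from_filter; first by exists 0%N.
  move=> i j _ _; exists (maxn i j) => // n [] /=; rewrite geq_max => /andP[h1 h2] Pn.
  by split.
have [G [GU sG]] := ultraFilterLemma PF; exists G; split => //.
  by apply: sG; exists 0%N => // n [].
by move=> N; apply: sG; exists N => // n [].
Qed.

Variable F : set_system nat.
Context {FU : UltraFilter F}.

Lemma ultra_ex (A : set nat) : F A -> exists n, A n.
Proof. by move=> /filter_ex. Qed.

Lemma ultralim_real (u : nat -> R) M : (forall n, `|u n| <= M) ->
  exists l, forall e, 0 < e -> F [set n | `|u n - l| < e].
Proof.
move=> hu; pose A := [set t | F [set n | t <= u n]].
have A0 : A (- M).
  by apply: filterS filterT => n _ /=; have := hu n; rewrite ler_norml => /andP[].
have Ab : has_sup A.
  split; first by exists (- M).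
  exists M => t /ultra_ex[n /= tn]; apply: (le_trans tn).
  by have := hu n; rewrite ler_norml => /andP[].
exists (sup A) => e e0.
have [t At lt] := sup_adherent e0 Ab.
have nA : ~ A (sup A + e / 2).
  move=> h; have := ub_le_sup Ab.2 h; lra.
have [//|h] := in_ultra_setVsetC [set n | sup A + e / 2 <= u n] FU.
apply: filterS (filterI At h) => n [/= tn /negP]; rewrite -ltNge => h2.
by rewrite ltr_norml; apply/andP; split; lra.
Qed.

Lemma ultralim (u : nat -> R[i]) M : (forall n, nm (u n) <= M) ->
  exists l, forall e, 0 < e -> F [set n | nm (u n - l) < e].
Proof.
move=> hu.
have [x hx] := @ultralim_real (fun n => re (u n)) M (fun n => le_trans (re_nm _) (hu n)).
have [y hy] := @ultralim_real (fun n => im (u n)) M (fun n => le_trans (im_nm _) (hu n)).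
exists (x +i* y) => e e0; have e2 : 0 < e / 2 by rewrite divr_gt0.
apply: filterS (filterI (hx _ e2) (hy _ e2)) => n [/= h1 h2].
have := nm_reim (u n - (x +i* y)); rewrite reB imB /=; lra.
Qed.

End ultralimits.

Section extraction.
Variable R : realType.
Implicit Types (z a : R[i]) (r M : R).

Lemma extraction (P : R -> nat -> Prop) :
  (forall e, 0 < e -> forall N, exists2 n, (N <= n)%N & P e n) ->
  exists s : nat -> nat, {homo s : m n / (m < n)%N} /\ forall j, P (j.+1%:R^-1) (s j).
Proof.
move=> H.
have pos j : 0 < j.+1%:R^-1 :> R by rewrite invr_gt0.
have /(@choice _ _ _)[f hf] : forall x : nat * nat, exists n, (x.2 <= n)%N /\ P (x.1.+1%:R^-1) n.
  by move=> [j N]; have [n h1 h2] := H _ (pos j) N; exists n.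
pose fix s j := if j is j'.+1 then f (j, (s j').+1) else f (0%N, 0%N).
exists s; split; last by case=> [|j]; [exact: (hf (0%N, 0%N)).2|exact: (hf (j.+1, (s j).+1)).2].
apply: homo_ltn => // [|j]; first exact: ltn_trans.
by have [] := hf (j.+1, (s j).+1).
Qed.

Lemma bolzano (u : nat -> R[i]) M : (forall n, nm (u n) <= M) ->
  exists l, forall e, 0 < e -> forall N, exists2 n, (N <= n)%N & nm (u n - l) < e.
Proof.
move=> hu; have [F [FU _ FN]] := nat_ultrafilter (fun N => ex_intro2 (fun n => (N <= n)%N) (fun=> True) N (leqnn _) I).
have [l hl] := ultralim hu; exists l => e e0 N.
by have [n [h1 h2]] := ultra_ex (filterI (hl e e0) (FN N)); exists n.
Qed.

(** The ultralimit g exists at every point of the disc. If convergence failed to be uniform along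
    [F], most n would have a bad point y n; these accumulate at a point l of the disc, where the
    common Lipschitz constant carries the convergence at l over to y n. *)
Lemma ascoli_seq (h : nat -> R[i] -> R[i]) a r M L :
  (forall n z, nm (z - a) <= r -> nm (h n z) <= M) -> 0 <= r -> 0 <= L ->
  (forall n z z', nm (z - a) <= r -> nm (z' - a) <= r -> nm (h n z - h n z') <= L * nm (z - z')) ->
  exists (g : R[i] -> R[i]) (s : nat -> nat), {homo s : m n / (m < n)%N} /\
   forall j z, nm (z - a) <= r -> nm (h (s j) z - g z) <= j.+1%:R^-1.
Proof.
move=> hb r0 L0 hl.
have [F [FU _ FN]] := nat_ultrafilter (fun N => ex_intro2 (fun n => (N <= n)%N) (fun=> True) N (leqnn _) I).
have /(@choice _ _ _)[g hg] : forall z, exists l, nm (z - a) <= r ->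
    forall e, 0 < e -> F [set n | nm (h n z - l) < e].
  move=> z; have [hz|hz] := leP (nm (z - a)) r; last by exists 0 => hz'; lra.
  have [l] := ultralim (fun n => hb n z hz); by exists l.
exists g; apply: (@extraction (fun e n => forall z, nm (z - a) <= r -> nm (h n z - g z) <= e)).
move=> e e0 N.
have [good|bad] := in_ultra_setVsetC [set n | forall z, nm (z - a) <= r -> nm (h n z - g z) <= e] FU.
  by have [n [h1 h2]] := ultra_ex (filterI good (FN N)); exists n.
exfalso.
(* The centre serves as a default for the n without a bad point. *)
have /(@choice _ _ _)[y hy] : forall n, exists y, nm (y - a) <= r /\
   ((exists z, nm (z - a) <= r /\ e < nm (h n z - g z)) -> e < nm (h n y - g y)).
  move=> n; have [[z [h1 h2]]|nz] := pselect (exists z, nm (z - a) <= r /\ e < nm (h n z - g z)).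
    by exists z.
  by exists a; split => [|/nz//]; rewrite subrr nm0.
have by_ n : nm (y n) <= r + nm a.
  by have := nmD (y n - a) a; rewrite subrK; have := (hy n).1; lra.
have [l hl'] := ultralim by_.
have lr : nm (l - a) <= r.
  rewrite leNgt; apply/negP => lr.
  have [n /= hn] := ultra_ex (hl' _ (ltac:(by rewrite subr_gt0) : 0 < nm (l - a) - r)).
  by have := nm_tri (y n) l a; rewrite (nmC l (y n)); have := (hy n).1; lra.
have e1 : 0 < e / (8 * (L + 1)) by rewrite divr_gt0// mulr_gt0//; lra.
have e4 : 0 < e / 8 by rewrite divr_gt0.
have [n [[[/= n1 n2] n3] n4]] := ultra_ex (filterI (filterI (filterI (hl' _ e1) (hg l lr _ e4)) bad) (FN 0%N)).
have {n3} : e < nm (h n (y n) - g (y n)).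
  apply: (hy n).2; apply: contrapT => nz; apply: n3 => z hz.
  by rewrite leNgt; apply/negP => hz2; apply: nz; exists z.
apply/negP; rewrite -leNgt.
have yr := (hy n).1.
have gl : nm (g l - g (y n)) <= L * nm (l - y n) + e / 8 + e / 8.
  have [m [[/= m1 m2] _]] := ultra_ex (filterI (filterI (hg l lr _ e4) (hg _ yr _ e4)) (FN 0%N)).
  have := nm_tri (h m l) (g l) (g (y n)); have := nm_tri (h m (y n)) (h m l) (g (y n)).
  by rewrite (nmC (g l) (h m l)); have := hl m l (y n) lr yr; lra.
have Le : L * nm (y n - l) <= e / 8.
  apply: (@le_trans _ _ (L * (e / (8 * (L + 1))))); first by rewrite ler_wpM2l// ltW.
  by rewrite mulrA ler_pdivrMr ?mulr_gt0//; nra.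
have := nm_tri (h n l) (h n (y n)) (g (y n)); have := nm_tri (g l) (h n l) (g (y n)).
have := hl n (y n) l yr lr; rewrite (nmC l) in gl.
by move: Le gl n2 => /=; lra.
Qed.

End extraction.

(** * Filled Julia sets *)

Section quadratic.
Variable R : realType.
Implicit Types (l z x y : R[i]) (e d : R).

Definition quad l z : R[i] := l * z + z ^+ 2.

Definition iterpoly l n : {poly R[i]} := iter n (fun p => l *: p + p ^+ 2) 'X.

(* For [nm l <= 2] an orbit leaving the disc of radius 4 tends to infinity. *)
Definition filled l z := forall n, nm (iter n (quad l) z) <= 4.

Definition filled_bd l x := filled l x /\ forall e, 0 < e -> exists2 y, nm (y - x) < e & ~ filled l y.

Definition filled_int l x := exists2 e, 0 < e & forall y, nm (y - x) < e -> filled l y.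

Lemma iterpolyE l n z : (iterpoly l n).[z] = iter n (quad l) z.
Proof. by elim: n => [|n IH] /=; rewrite ?hornerX// hornerD hornerZ horner_exp IH. Qed.

Lemma size_iterpoly l n : (size (iterpoly l n) <= (2 ^ n).+1)%N.
Proof.
elim: n => [|n IH]; first by rewrite size_polyX.
rewrite /= -/(iterpoly l n) (leq_trans (size_polyD _ _))// geq_max; apply/andP; split.
  by rewrite (leq_trans (size_scale_leq _ _))// (leq_trans IH)// ltnS leq_exp2l.
rewrite expr2 (leq_trans (size_polyMleq _ _))// expnS mul2n -addnn.
have key s m : (s <= m.+1 -> (s + s).-1 <= (m + m).+1)%N.
  by case: s => // s; rewrite ltnS addSn /= addnS => h; rewrite ltnS leq_add.
exact: key.
Qed.

Lemma nm_quad_le l z : nm l <= 2 -> nm (quad l z) <= 2 * nm z + nm z ^+ 2.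
Proof.
move=> hl; rewrite (le_trans (nmD _ _))// nmM nmX lerD2r.
by rewrite ler_wpM2r ?nm_ge0.
Qed.

Lemma nm_quad_ge l z : nm l <= 2 -> nm z ^+ 2 - 2 * nm z <= nm (quad l z).
Proof.
move=> hl; have := nm_leD (z ^+ 2) (l * z); rewrite [z ^+ 2 + _]addrC nmX nmM.
by rewrite -/(quad l z); have := ler_wpM2r (nm_ge0 z) hl; lra.
Qed.

Lemma escape_iter l z n : nm l <= 2 -> 4 < nm z -> 2 ^+ n * nm z <= nm (iter n (quad l) z).
Proof.
move=> hl z4; elim: n => [|n IH]; first by rewrite mul1r.
have h1 : 1 <= 2 ^+ n :> R by rewrite exprn_ege1// ler1n.
have := nm_quad_ge (iter n (quad l) z) hl; rewrite [2 ^+ n.+1]exprS /=.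
move: IH; set b := nm (quad l _); set a := nm (iter n _ z); set c := 2 ^+ n in h1 *.
move=> h2 h3; have a4 : 4 <= a by move: h1 h2 z4; clear; nra.
by move: h2 h3 a4; clear; nra.
Qed.

Lemma escape_gt l z n m : nm l <= 2 -> (n <= m)%N -> 4 < nm (iter n (quad l) z) ->
  4 < nm (iter m (quad l) z).
Proof.
move=> hl nm_ h; rewrite -(subnK nm_) iterD.
apply: lt_le_trans (escape_iter (m - n) hl h).
have : 1 <= 2 ^+ (m - n) :> R by rewrite exprn_ege1// ler1n.
by nra.
Qed.

Lemma not_filled l z : ~ filled l z -> exists n, 4 < nm (iter n (quad l) z).
Proof.
move=> nF; apply: contrapT => h; apply: nF => n; rewrite leNgt.
by apply/negP => hn; apply: h; exists n.
Qed.

Lemma escape_large l z (B : R) : nm l <= 2 -> ~ filled l z ->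
  exists N, forall n, (N <= n)%N -> B < nm (iter n (quad l) z).
Proof.
move=> hl /not_filled[n hn].
have [m hm] := @expr_gt R 2 B (ltac:(lra)).
exists (m + n)%N => k mk; rewrite -(subnK mk) addnA iterD.
apply: lt_le_trans (escape_iter _ hl hn).
have h1 : 2 ^+ m <= 2 ^+ (k - (m + n) + m) :> R by rewrite ler_eXn2l ?leq_addl// ltr1n.
have : 0 < 2 ^+ (k - (m + n) + m) :> R by rewrite exprn_gt0.
by nra.
Qed.

Lemma filled_tail l z : nm l <= 2 ->
  (forall N, exists2 n, (N <= n)%N & nm (iter n (quad l) z) <= 4) -> filled l z.
Proof.
move=> hl H n; rewrite leNgt; apply/negP => h.
by have [m nm_] := H n; rewrite leNgt (escape_gt hl nm_ h).
Qed.

Lemma filled_quad l z : nm l <= 2 -> filled l (quad l z) <-> filled l z.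
Proof.
move=> hl; split => H n; last by rewrite -iterSr.
case: n => [|n]; last by rewrite iterSr.
rewrite leNgt; apply/negP => h; have := H 0%N; rewrite leNgt => /negP; apply.
exact: (escape_gt hl (leqnSn 0) h).
Qed.

Lemma filled_iter l z n : nm l <= 2 -> filled l (iter n (quad l) z) <-> filled l z.
Proof.
by move=> hl; elim: n => //= n IH; rewrite -IH; exact: filled_quad.
Qed.

Lemma quad0 l : quad l 0 = 0.
Proof. by rewrite /quad mulr0 expr0n addr0. Qed.

Lemma iter_quad0 l n : iter n (quad l) 0 = 0.
Proof. by elim: n => //= n ->; exact: quad0. Qed.

Lemma filled0 l : filled l 0.
Proof. by move=> n; rewrite iter_quad0 nm0. Qed.

Lemma filled_nm l z : filled l z -> nm z <= 4.
Proof. by move/(_ 0%N). Qed.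

Lemma quad_cont l0 z0 e : 0 < e -> exists2 d, 0 < d & forall l z,
  nm (l - l0) < d -> nm (z - z0) < d -> nm (quad l z - quad l0 z0) < e.
Proof.
move=> e0; pose Q := 2 + nm l0 + 2 * nm z0 + nm z0.
have l00 := nm_ge0 l0; have z00 := nm_ge0 z0.
have Q0 : 0 < Q by rewrite /Q; lra.
exists (Num.min 1 (e / Q)); first by rewrite lt_min ltr01 divr_gt0.
move=> l z; rewrite !lt_min => /andP[a1 a2] /andP[b1 b2].
rewrite ltr_pdivlMr// in a2; rewrite ltr_pdivlMr// in b2.
have -> : quad l z - quad l0 z0 = (l - l0) * (z - z0) + (l - l0) * z0 + l0 * (z - z0)
  + (z - z0) * (z - z0) + 2 * z0 * (z - z0) by rewrite /quad; ring.
set p := nm (l - l0) in a1 a2 *; set q := nm (z - z0) in b1 b2 *.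
have p0 : 0 <= p := nm_ge0 _; have q0 : 0 <= q := nm_ge0 _.
apply: (@le_lt_trans _ _ (p * q + p * nm z0 + nm l0 * q + q * q + 2 * nm z0 * q)).
  do 4! (apply: (le_trans (nmD _ _)); apply: lerD; last by rewrite !nmM ?nm_nat).
  by rewrite nmM.
have h : p * nm z0 <= p * Q / 3 by rewrite /Q; nra.
have h1 : q * (2 + nm l0 + 2 * nm z0) <= q * (Q - nm z0) by rewrite /Q; nra.
have pq : p * q <= q by nra.
have qq : q * q <= q by nra.
have : p * Q < e by [].
have : q * Q < e by [].
rewrite /Q => u1 u2.
have [pq2|pq2] := leP p q; nra.
Qed.

Lemma iter_quad_cont n l0 z0 e : 0 < e -> exists2 d, 0 < d & forall l z,
  nm (l - l0) < d -> nm (z - z0) < d ->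
  nm (iter n (quad l) z - iter n (quad l0) z0) < e.
Proof.
elim: n e => [|n IH] e e0; first by exists e.
have [d1 d10 h1] := quad_cont l0 (iter n (quad l0) z0) e0.
have [d2 d20 h2] := IH _ d10.
exists (Num.min d1 d2); first by rewrite lt_min d10.
by move=> l z; rewrite !lt_min => /andP[a1 a2] /andP[b1 b2]; apply: h1 => //; exact: h2.
Qed.

Lemma escape_open l0 z0 : ~ filled l0 z0 -> exists2 d, 0 < d &
  forall l z, nm (l - l0) < d -> nm (z - z0) < d -> ~ filled l z.
Proof.
move=> /not_filled[n hn].
have [d d0 h] := iter_quad_cont n l0 z0 (ltac:(by rewrite subr_gt0) : 0 < nm (iter n (quad l0) z0) - 4).
exists d => // l z hl hz /(_ n).
have := h l z hl hz; have := nm_leB (iter n (quad l0) z0) (iter n (quad l) z).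
by rewrite nmC; lra.
Qed.

Lemma filled_closed l x : (forall e, 0 < e -> exists2 y, nm (y - x) < e & filled l y) ->
  filled l x.
Proof.
move=> H; apply: contrapT => /escape_open[d d0 h].
by have [y yx Ky] := H d d0; apply: (h l y) => //; rewrite subrr nm0.
Qed.

Lemma filled_bdP l x : filled l x -> filled_bd l x \/ filled_int l x.
Proof.
move=> Kx; have [h|h] := pselect (filled_int l x); [by right|left; split=> // e e0].
apply: contrapT => nex; apply: h; exists e => // y hy.
by apply: contrapT => nK; apply: nex; exists y.
Qed.

Lemma filled_bd_int l x : filled_bd l x -> filled_int l x -> False.
Proof. by move=> [_ h] [e e0 h2]; have [y hy] := h e e0; apply; exact: h2. Qed.

Lemma filled_bd_closed l x : (forall e, 0 < e -> exists2 y, nm (y - x) < e & filled_bd l y) ->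
  filled_bd l x.
Proof.
move=> H; split.
  by apply: filled_closed => e /H[y h [Ky _]]; exists y.
move=> e e0; have e2 : 0 < e / 2 by rewrite divr_gt0.
have [y hy [_ /(_ _ e2)[z hz nz]]] := H _ e2.
by exists z => //; have := nm_tri y z x; lra.
Qed.

(* Among the two roots [h] of [h ^+ 2 + (2 z + l) h = d] one has modulus at most
   the square root of [|d|]. *)
Lemma quad_open l z u : exists2 y, quad l y = u & nm (y - z) ^+ 2 <= nm (u - quad l z).
Proof.
pose b := 2 * z + l; pose c := u - quad l z.
pose s := sqrtc (b ^+ 2 + 4 * c).
have s2 : s ^+ 2 = b ^+ 2 + 4 * c by rewrite sqr_sqrtc.
have n2 : (2 : R[i]) != 0 by rewrite pnatr_eq0.
pose h1 := (- b + s) / 2; pose h2 := (- b - s) / 2.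
have e1 : h1 * h2 = - c.
  have -> : h1 * h2 = (b ^+ 2 - s ^+ 2) / 4 by rewrite /h1 /h2; field.
  by rewrite s2; field.
have q h : h ^+ 2 + b * h = c -> quad l (z + h) = u.
  move=> e; have -> : quad l (z + h) = quad l z + (h ^+ 2 + b * h) by rewrite /quad /b; ring.
  by rewrite e /c; ring.
have n1 : nm h1 * nm h2 = nm c by rewrite -nmM e1 nmN.
have q1 : h1 ^+ 2 + b * h1 = c.
  have -> : h1 ^+ 2 + b * h1 = (s ^+ 2 - b ^+ 2) / 4 by rewrite /h1; field.
  by rewrite s2; field.
have q2 : h2 ^+ 2 + b * h2 = c.
  have -> : h2 ^+ 2 + b * h2 = (s ^+ 2 - b ^+ 2) / 4 by rewrite /h2; field.
  by rewrite s2; field.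
have := nm_ge0 h1; have := nm_ge0 h2.
have [le|le] := leP (nm h1) (nm h2) => g1 g2.
  by exists (z + h1); [exact: q|rewrite addrC addKr -/c -n1 expr2 ler_wpM2l].
by exists (z + h2); [exact: q|rewrite addrC addKr -/c -n1 expr2 ler_wpM2r// ltW].
Qed.

Lemma filled_int_quad l z : nm l <= 2 -> filled_int l z -> filled_int l (quad l z).
Proof.
move=> hl [e e0 he]; exists (e ^+ 2); first by rewrite exprn_gt0.
move=> u hu; have [y yE hy] := quad_open l z u; rewrite -yE.
apply/filled_quad => //; apply: he.
rewrite -(@ltr_pXn2r _ 2) ?nnegrE ?nm_ge0 ?(ltW e0)//.
exact: le_lt_trans hy hu.
Qed.

Lemma filled_int_iter l z n : nm l <= 2 -> filled_int l z -> filled_int l (iter n (quad l) z).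
Proof. by move=> hl h; elim: n => //= n IH; exact: filled_int_quad. Qed.

(** f is open, so interior points of the filled set have interior images; a preimage of a boundary
    point is filled and cannot be interior. *)
Lemma filled_bd_preim l z : nm l <= 2 -> filled_bd l (quad l z) -> filled_bd l z.
Proof.
move=> hl H; have Kz : filled l z by apply/filled_quad => //; exact: H.1.
case: (filled_bdP Kz) => // /(filled_int_quad hl) h.
by case: (filled_bd_int H h).
Qed.

(** The point sought is the last filled one on the segment: closedness makes the supremum of the
    filled parameters filled, and every larger parameter gives an escaping point. *)
Lemma bd_between l p y : filled l p -> ~ filled l y -> exists t : R,
  [/\ 0 <= t, t <= 1 & filled_bd l (p + t%:C * (y - p))].
Proof.
move=> Kp nKy; pose c t := p + t%:C * (y - p).
pose A := [set t : R | [/\ 0 <= t, t <= 1 & filled l (c t)]].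
have A0 : A 0 by split => //; rewrite /c mul0r addr0.
have Ab : has_sup A by split; [exists 0|exists 1 => t []].
have ubA t : A t -> t <= sup A by move=> At; exact: (ub_le_sup Ab.2 At).
have s0 : 0 <= sup A by exact: ubA.
have s1 : sup A <= 1 by apply: sup_le_ub; [exists 0|move=> t []].
have dc t t' : nm (c t - c t') = `|t - t'| * nm (y - p).
  have -> : c t - c t' = (t - t')%:C * (y - p) by rewrite /c rmorphB; ring.
  by rewrite nmM nm_real.
have yp : 0 < nm (y - p).
  by rewrite nm_gt0 subr_eq0; apply/eqP => e; apply: nKy; rewrite e.
have Ks : filled l (c (sup A)).
  apply: filled_closed => e e0.
  have [t [t0 t1 Kt] ht] := sup_adherent (divr_gt0 e0 yp) Ab.
  exists (c t) => //; rewrite dc -ltr_pdivlMr//.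
  have tA : t <= sup A by exact: ubA.
  by rewrite ltr_norml; apply/andP; split; have := divr_gt0 e0 yp; lra.
exists (sup A); split => //; split=> // e e0.
have ey := divr_gt0 e0 yp.
have sl1 : sup A < 1.
  rewrite lt_neqAle s1 andbT; apply/eqP => e1; apply: nKy.
  by move: Ks; rewrite e1 /c mul1r addrC subrK.
pose t := Num.min 1 (sup A + e / nm (y - p) / 2).
have t1 : t <= 1 by rewrite ge_min lexx.
have st : sup A < t by rewrite lt_min sl1 ltrDl divr_gt0.
have ts : t <= sup A + e / nm (y - p) / 2 by rewrite ge_min lexx orbT.
exists (c t).
  rewrite dc -ltr_pdivlMr// ltr_norml; apply/andP; split; lra.
move=> Kt; have /ubA : A t by split => //; lra.
by rewrite leNgt st.
Qed.

End quadratic.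

(** * Persistence of boundary points under perturbation *)

Section lower_semicontinuity.
Variable R : realType.
Implicit Types (l z x y : R[i]) (e d : R).

Lemma expr1D_le (t : R) n : 0 <= t -> n%:R * t <= 1/2 -> (1 + t) ^+ n <= 1 + 2 * (n%:R * t).
Proof.
move=> t0; elim: n => [|n IH] hn; first by rewrite expr0 mul0r mulr0 addr0.
have n0 : 0 <= n%:R * t by rewrite mulr_ge0.
rewrite -natr1 in hn *; have {}IH := IH (ltac:(lra)).
by rewrite exprS; nra.
Qed.

Lemma prod_root_shift (n : nat) (w u h : R[i]) : n.-primitive_root w -> h != 0 ->
  \prod_(j < n) (u - h * w ^+ j) = u ^+ n - h ^+ n.
Proof.
move=> pw h0.
have e : \prod_(j < n) (u / h - w ^+ j) = (u / h) ^+ n - 1.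
  transitivity ('X^n - 1 : {poly R[i]}).[u / h]; last first.
    by rewrite hornerD hornerN hornerXn hornerC.
  rewrite -(factor_Xn_sub_1 pw) big_mkord horner_prod.
  by apply: eq_bigr => j _; rewrite hornerXsubC.
have -> : u ^+ n - h ^+ n = ((u / h) ^+ n - 1) * h ^+ n.
  by rewrite mulrBl mul1r -exprMn divfK.
rewrite -e -[X in _ * h ^+ X]card_ord -prodr_const -big_split /=.
by apply: eq_bigr => j _; rewrite mulrBl divfK// (mulrC h).
Qed.

Lemma prod_nm_ge (n : nat) (f : 'I_n -> R) (j : 'I_n) : (forall i, 1 <= f i) ->
  f j <= \prod_i f i.
Proof.
move=> h; rewrite (bigD1 j)//= ler_peMr//; first by rewrite (le_trans ler01).
by elim/big_rec: _ => // i z _ hz; exact: mulr_ege1.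
Qed.

(* Replaces Harnack's inequality for the Green function: compare the values of
   a zero-free polynomial at the vertices of a regular polygon centred at x. *)
Lemma poly_polygon (p : {poly R[i]}) x y (n m : nat) e (w : R[i]) :
  n.-primitive_root w -> y != x -> nm (y - x) <= e / 2 -> 0 < e ->
  (size p <= m.+1)%N ->
  (forall z, nm (z - x) <= e -> p.[z] != 0) ->
  (forall j, (j < n)%N -> 1 <= nm p.[x + (y - x) * w ^+ j]) ->
  nm p.[y] <= nm p.[x] ^+ n * (1 + (1/2) ^+ n) ^+ m.
Proof.
move=> pw yx he e0 sp nz big; pose h := y - x.
have h0 : h != 0 by rewrite subr_eq0.
have n0 : (0 < n)%N := prim_order_gt0 pw.
have [rs pE] := closed_field_poly_normal p.
set c := lead_coef p in pE.
have c0 : c != 0.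
  apply/eqP => c0; have := nz x; rewrite pE c0 scale0r horner0 eqxx subrr nm0.
  by move=> /(_ (ltW e0)).
have ev z : nm p.[z] = nm c * \prod_(a <- rs) nm (z - a).
  rewrite pE hornerZ nmM horner_prod nm_prod; congr (_ * _).
  by apply: eq_bigr => a _; rewrite hornerD hornerN hornerX hornerC.
have srs : (size rs <= m)%N.
  move: sp; rewrite pE size_scale// size_prod_XsubC ltnS; exact.
have far a : a \in rs -> e < nm (x - a).
  move=> ars; rewrite ltNge; apply/negP => h1; have := nz a; rewrite nmC => /(_ h1).
  have /eqP E : (\prod_(z <- rs) ('X - z%:P)).[a] == 0 by rewrite -rootE root_prod_XsubC.
  by rewrite pE hornerZ E mulr0 eqxx.
have q0 : 0 <= (1/2 : R) ^+ n by rewrite exprn_ge0//; lra.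
apply: (@le_trans _ _ (\prod_(j < n) nm p.[x + h * w ^+ j])).
  have := @prod_nm_ge n (fun j => nm p.[x + h * w ^+ j]) (Ordinal n0) (fun j => big j (ltn_ord j)).
  by rewrite /= expr0 mulr1 /h addrC subrK.
have -> : \prod_(j < n) nm p.[x + h * w ^+ j] =
    nm c ^+ n * \prod_(a <- rs) nm ((x - a) ^+ n - (- h) ^+ n).
  rewrite (eq_bigr _ (fun j _ => ev _)) big_split /= prodr_const card_ord; congr (_ * _).
  rewrite exchange_big /=; apply: eq_bigr => a _.
  rewrite -(prod_root_shift (x - a) pw) ?oppr_eq0// nm_prod; apply: eq_bigr => j _.
  by congr nm; ring.
rewrite ev exprMn -mulrA ler_wpM2l ?exprn_ge0 ?nm_ge0//.
apply: (@le_trans _ _ (\prod_(a <- rs) (nm (x - a) ^+ n * (1 + (1/2) ^+ n)))).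
  rewrite [X in X <= _]big_seq [X in _ <= X]big_seq; apply: ler_prod => a ars; rewrite nm_ge0 /=.
  rewrite (le_trans (nmB _ _))// !nmX nmN mulrDr mulr1 lerD2l -exprMn.
  have hx : nm h <= nm (x - a) * (1/2) by have := far a ars; rewrite /h; lra.
  have hp : 0 <= nm (x - a) * (1/2) := le_trans (nm_ge0 h) hx.
  by apply: lerXn2r => //; rewrite nnegrE nm_ge0.
rewrite big_split /= -prodrXl; apply: ler_wpM2l.
  by apply: prodr_ge0 => a _; rewrite exprn_ge0 ?nm_ge0.
rewrite big_const_seq count_predT iter_mulr_1.
by apply: ler_weXn2l => //; lra.
Qed.

Lemma iter_quad_lower l z n : nm l <= 2 -> 3 <= nm z ->
  (nm z - 2) ^+ (2 ^ n) <= nm (iter n (quad l) z) - 2.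
Proof.
move=> hl z3; elim: n => [|n IH]; first by rewrite expr1.
rewrite expnSr exprM; have := nm_quad_ge (iter n (quad l) z) hl => /=.
have : 1 <= (nm z - 2) ^+ (2 ^ n) by rewrite exprn_ege1//; lra.
move: IH; set a := nm (iter n _ _); set b := nm (quad _ _); set c := _ ^+ _.
by move: b a c => b a c; clear; nra.
Qed.

Lemma iter_quad_upper l z n : nm l <= 2 ->
  nm (iter n (quad l) z) + 1 <= (nm z + 1) ^+ (2 ^ n).
Proof.
move=> hl; elim: n => [|n IH]; first by rewrite expr1.
rewrite expnSr exprM; have := nm_quad_le (iter n (quad l) z) hl => /=.
have := nm_ge0 (iter n (quad l) z).
move: IH; set a := nm (iter n _ _); set b := nm (quad _ _); set c := _ ^+ _.
by move: b a c => b a c; clear; nra.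
Qed.

(** If the whole disc around x escaped for l, the iterates would be zero-free on it, as 0 is filled,
    and a high iterate would be large at the vertices of a polygon around x; the polygon estimate
    would then bound |f^k y| by |f^k x|^n (1 + 2^-n)^(2^k). But y escapes at a rate fixed by l0,
    while the orbit of x, filled for l0, stays bounded for m steps and afterwards grows at most like
    6^(2^j). Taking 2^j-th roots leaves 3^(2^i) <= 6^n 2^(2^i), which the choice of i excludes. *)
Lemma filled_near l0 x y e : nm l0 < 2 -> 0 < e -> filled l0 x -> ~ filled l0 y ->
  nm (y - x) <= e / 2 -> exists2 d, 0 < d & forall l, nm (l - l0) < d ->
  exists2 z, filled l z & nm (z - x) <= e.
Proof.
move=> hl0 e0 Kx nKy yx.
have yx0 : y != x by apply/eqP => E; apply: nKy; rewrite E.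
have [m0 hm0] := escape_large 5 (ltW hl0) nKy.
have {}hm0 := hm0 m0 (leqnn _).
(* With this n the factor (1 + 2^-n)^(2^m0) is at most 2. *)
pose n := (2 ^ (m0 + 2))%N.
have [w pw] := dyadic_prim_root R (m0 + 2).
rewrite -/n in pw.
have nm2 : (m0 + 2 <= n)%N by rewrite ltnW// ltn_expl.
pose t : R := (1/2) ^+ n.
have t0 : 0 <= t by rewrite exprn_ge0//; lra.
have ht : (1 + t) ^+ (2 ^ m0) <= 2.
  have tm : (2 ^ m0)%:R * t <= 1/4.
    apply: (@le_trans _ _ ((2 ^ m0)%:R * (1/2) ^+ (m0 + 2))).
      by rewrite ler_wpM2l// ler_wiXn2l//; lra.
    rewrite natrX exprD mulrA -exprMn.
    have -> : 2 * (1/2) = 1 :> R by lra.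
    by rewrite expr1n expr2; lra.
  have := expr1D_le t0 (ltac:(lra) : (2 ^ m0)%:R * t <= 1/2); lra.
have [i hi] := @expr_gt R (3/2) (6 ^+ n) (ltac:(lra)).
have hi2 : 6 ^+ n < (3/2 : R) ^+ (2 ^ i).
  apply: (lt_le_trans hi); rewrite ler_eXn2l; [exact/ltnW/ltn_expl|lra].
pose m := (i + m0)%N.
(* Only m0 steps from y and m steps from x are compared with l0. The j further steps, whose number
   depends on l, are estimated for l itself. *)
have [d1 d10 c1] := iter_quad_cont m0 l0 y (ltac:(by rewrite subr_gt0) : 0 < nm (iter m0 (quad l0) y) - 5).
have [d2 d20 c2] := @iter_quad_cont R m l0 x 1 ltr01.
exists (Num.min (2 - nm l0) (Num.min d1 d2)); first by rewrite !lt_min subr_gt0 hl0 d10.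
move=> l; rewrite !lt_min => /andP[l2 /andP[ld1 ld2]].
have hl : nm l <= 2 by have := nm_leB l l0; lra.
apply: contrapT => none.
have out z : nm (z - x) <= e -> ~ filled l z by move=> hz Kz; apply: none; exists z.
have /(@choice _ _ _)[N hN] : forall j, exists N, forall k, (N <= k)%N ->
    4 < nm (iter k (quad l) (x + (y - x) * w ^+ j)).
  move=> j; apply: escape_large => //; apply: out.
  rewrite addrC addKr nmM nmX.
  have -> : nm w = 1.
    have n0 : (0 < n)%N := prim_order_gt0 pw.
    have : nm w ^+ n = 1 by rewrite -nmX (prim_expr_order pw) nm1.
    by move/eqP; rewrite pexpr_eq1 ?nm_ge0// => /eqP.
  by rewrite expr1n mulr1; lra.
pose j := (\max_(i < n) N i)%N; pose k := (j + m)%N.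
have big a : (a < n)%N -> 1 <= nm (iterpoly l k).[x + (y - x) * w ^+ a].
  move=> an; rewrite iterpolyE; apply: le_trans (ltW (hN a k _)); first by lra.
  apply: leq_trans (leq_addr m _).
  exact: (@leq_bigmax _ (fun i : 'I_n => N i) (Ordinal an)).
have nz z : nm (z - x) <= e -> (iterpoly l k).[z] != 0.
  move=> hz; apply/eqP => E; apply: (out z hz); apply/(filled_iter _ k hl).
  by rewrite -iterpolyE E; exact: filled0.
have main := poly_polygon pw yx0 yx e0 (size_iterpoly l k) nz big.
rewrite -/t !iterpolyE in main.
have lower : (3 ^+ (2 ^ i)) ^+ (2 ^ j) <= nm (iter k (quad l) y).
  have h5 : 5 <= nm (iter m0 (quad l) y).
    have := c1 l y ld1; rewrite subrr nm0 => /(_ d10).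
    by have := nm_leB (iter m0 (quad l0) y) (iter m0 (quad l) y); rewrite nmC; lra.
  rewrite /k /m addnA iterD -exprM -expnD addnC.
  have h6 := iter_quad_lower (i + j) hl (ltac:(lra) : 3 <= nm (iter m0 (quad l) y)).
  have h7 : 3 ^+ (2 ^ (i + j)) <= (nm (iter m0 (quad l) y) - 2) ^+ (2 ^ (i + j)).
    by apply: lerXn2r; rewrite ?nnegrE; lra.
  by rewrite addnC; move: h6 h7; clear; lra.
have upper : nm (iter k (quad l) x) <= 6 ^+ (2 ^ j).
  have h5 : nm (iter m (quad l) x) <= 5.
    have := c2 l x ld2; rewrite subrr nm0 => /(_ d20).
    by have := Kx m; have := nm_leB (iter m (quad l) x) (iter m (quad l0) x); lra.
  rewrite /k iterD; have := iter_quad_upper (iter m (quad l) x) j hl.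
  have : (nm (iter m (quad l) x) + 1) ^+ (2 ^ j) <= 6 ^+ (2 ^ j).
    have x0 := nm_ge0 (iter m (quad l) x).
    by apply: lerXn2r; rewrite ?nnegrE; move: h5 x0; clear; lra.
  lra.
have fin : (3 ^+ (2 ^ i)) ^+ (2 ^ j) <= (6 ^+ n * 2 ^+ (2 ^ i)) ^+ (2 ^ j) :> R.
  apply: (le_trans lower); apply: (le_trans main).
  rewrite exprMn -exprM mulnC exprM; apply: ler_pM; rewrite ?exprn_ge0 ?nm_ge0//; first by lra.
    by apply: lerXn2r => //; rewrite nnegrE ?nm_ge0 ?exprn_ge0.
  have -> : (2 ^ k = 2 ^ m0 * 2 ^ (i + j))%N.
    by rewrite /k /m -expnD; congr expn; rewrite [RHS]addnC addnC -!addnA; congr addn; rewrite addnC -?addnA.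
  rewrite exprM -[X in _ <= X]exprM -expnD.
  by apply: lerXn2r; rewrite ?nnegrE ?exprn_ge0//; lra.
have : 3 ^+ (2 ^ i) <= 6 ^+ n * 2 ^+ (2 ^ i) :> R.
  by rewrite -(@ler_pXn2r _ (2 ^ j)) ?nnegrE ?mulr_ge0 ?exprn_ge0 ?expn_gt0.
apply/negP; rewrite -ltNge -ltr_pdivlMr ?exprn_gt0// -expr_div_n.
exact: hi2.
Qed.

(** A filled point and an escaping point close to x both persist for l near l0, and the segment
    between them meets the boundary. *)
Lemma bd_lower_semicont l0 x e : nm l0 < 2 -> filled_bd l0 x -> 0 < e ->
  exists2 d, 0 < d & forall l, nm (l - l0) < d -> exists2 z, filled_bd l z & nm (z - x) < e.
Proof.
move=> hl0 [Kx bx] e0.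
have [y yx nKy] := bx (e / 4) (ltac:(by rewrite divr_gt0)).
have [d1 d10 h1] := filled_near hl0 (ltac:(lra) : 0 < e / 2) Kx nKy (ltac:(lra)).
have [d2 d20 h2] := escape_open nKy.
exists (Num.min d1 d2); first by rewrite lt_min d10.
move=> l; rewrite lt_min => /andP[ld1 ld2].
have [p Kp px] := h1 l ld1.
have nKy' : ~ filled l y by apply: h2 => //; rewrite subrr nm0.
have [t [t0 t1 bt]] := bd_between Kp nKy'.
exists (p + t%:C * (y - p)) => //.
have -> : p + t%:C * (y - p) - x = (1 - t)%:C * (p - x) + t%:C * (y - x).
  by rewrite rmorphB rmorph1; ring.
rewrite (le_lt_trans (nmD _ _))// !nmM !nm_real !ger0_norm; [|lra..].
by have := nm_ge0 (p - x); have := nm_ge0 (y - x); nra.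
Qed.

End lower_semicontinuity.

(** * Julia sets and chordal convergence *)

Section sphere.
Variable R : realType.
Implicit Types (z w : R[i]) (x y : riemann_sphere R) (d e : R).

Lemma sphere_ballE x y e : ball x e y = (chordal x y < e) :> Prop.
Proof. by rewrite ballEmdist. Qed.

Lemma chordalC x y : chordal x y = chordal y x.
Proof. exact: (@metric_sym _ (riemann_sphere R : metricType R)). Qed.

Lemma chordal_tri y x (x' : riemann_sphere R) d e :
  chordal x y < d -> chordal y x' < e -> chordal x x' < d + e.
Proof. by rewrite -!sphere_ballE; exact: ball_triangle. Qed.

Lemma root_gt0 z : 0 < Num.sqrt (1 + nm z ^+ 2) :> R.
Proof. by rewrite sqrtr_gt0 ltr_pwDl// sqr_ge0. Qed.

Lemma root_le z : Num.sqrt (1 + nm z ^+ 2) <= 1 + nm z :> R.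
Proof.
have h : 0 <= 1 + nm z by rewrite addr_ge0// nm_ge0.
rewrite -[leRHS]ger0_norm// -sqrtr_sqr ler_wsqrtr//; have := nm_ge0 z; nra.
Qed.

Lemma root_ge z : 1 <= Num.sqrt (1 + nm z ^+ 2) :> R.
Proof. by rewrite -[leLHS]sqrtr1 ler_wsqrtr// lerDl sqr_ge0. Qed.

Lemma root_ge_nm z : nm z <= Num.sqrt (1 + nm z ^+ 2) :> R.
Proof. by rewrite -[leLHS]ger0_norm ?nm_ge0// -sqrtr_sqr ler_wsqrtr// lerDr. Qed.

Lemma chordal_le z w : chordal (Some z) (Some w) <= 2 * nm (z - w).
Proof.
rewrite /chordal ler_pdivrMr ?mulr_gt0 ?root_gt0// ler_peMr ?mulr_ge0 ?nm_ge0//.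
exact: mulr_ege1 (root_ge z) (root_ge w).
Qed.

(** The condition on d keeps y away from infinity. Then 2 |w - z| < d (1 + |z|) (1 + |w|) with |w|
    <= |z| + |w - z| is solved for |w - z|, the condition absorbing the term on the right. *)
Lemma chordal_near z y d : d * (1 + nm z) <= 1 -> chordal (Some z) y < d ->
  exists2 w, y = Some w & nm (w - z) < (1 + nm z) ^+ 2 * d.
Proof.
move=> hd; case: y => [w|] /=; last first.
  have n0 := nm_ge0 z; rewrite ltr_pdivrMr ?root_gt0// => h.
  have d0 : 0 < d by rewrite -(pmulr_lgt0 _ (root_gt0 z)); lra.
  by have := ler_wpM2l (ltW d0) (root_le z); lra.
rewrite ltr_pdivrMr ?mulr_gt0 ?root_gt0// => h; exists w => //.
have d0 : 0 < d.
  rewrite -(pmulr_lgt0 _ (root_gt0 z)) -(pmulr_lgt0 _ (root_gt0 w)) -mulrA.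
  by apply: le_lt_trans h; rewrite mulr_ge0 ?nm_ge0.
have h1 : Num.sqrt (1 + nm z ^+ 2) * Num.sqrt (1 + nm w ^+ 2) <= (1 + nm z) * (1 + nm w).
  by apply: ler_pM; rewrite ?root_le// sqrtr_ge0.
have := lt_le_trans h (ler_wpM2l (ltW d0) h1); have := nm_leB w z; rewrite (nmC z w).
move: hd d0 (nm_ge0 z) (nm_ge0 (w - z)) => hd d0 z0 t0.
have : 0 <= (1 - d * (1 + nm z)) * nm (w - z) by rewrite mulr_ge0// subr_ge0.
have k1 : 0 <= 1 + nm z by rewrite addr_ge0.
move: (mulr_ge0 (ltW d0) k1); move: (nm (w - z)) (nm z) (nm w) => t a b; clear => h1 h2 h3 h4.
have : 0 <= d * (1 + a) * (t - (b - a)) by rewrite mulr_ge0// subr_ge0.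
by move: h2 h4; lra.
Qed.

Lemma chordal_infty z e : 0 < e -> 2 / e < nm z -> chordal None (Some z) < e.
Proof.
move=> e0; rewrite ltr_pdivrMr// => h; rewrite /= ltr_pdivrMr ?root_gt0//.
by rewrite mulrC; apply: (lt_le_trans h); rewrite ler_wpM2r ?root_ge_nm// ltW.
Qed.

Lemma chordal_infty_near z (M : R) : 0 <= M -> chordal None (Some z) < 2 / (1 + M) -> M < nm z.
Proof.
move=> M0 /=; rewrite ltr_pdivrMr ?root_gt0// mulrAC ltr_pdivlMr ?ltr_wpDr//.
by have := root_le z; lra.
Qed.

Lemma iter_quad_map l k z : iter k (quad_map l) (Some z) = Some (iter k (quad l) z).
Proof. by elim: k => //= k ->. Qed.

Lemma iter_quad_map_infty (l : R[i]) k : iter k (quad_map l) None = None :> riemann_sphere R.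
Proof. by elim: k => //= k ->. Qed.

(** Reduces normality of the iterates to exponents tending to infinity: a subsequence with constant
    exponent converges trivially. *)
Lemma nat_subseq (m : nat -> nat) : exists2 s : nat -> nat, {homo s : i j / (i < j)%N} &
  (exists c, forall k, m (s k) = c) \/ forall k, (k <= m (s k))%N.
Proof.
have [h|h] := pselect (forall B N, exists2 n, (N <= n)%N & (B <= m n)%N).
  have /(@choice _ _ _)[f hf] : forall BN : nat * nat, exists n, (BN.2 <= n)%N /\ (BN.1 <= m n)%N.
    by move=> [B N]; have [n h1 h2] := h B N; exists n.
  pose fix s k := if k is k'.+1 then f (k, (s k').+1) else f (0, 0)%N.
  exists s; last by right; case=> [|k] //=; exact: (hf (k.+1, _)).2.
  by apply: homo_ltn => [|k]; [exact: ltn_trans|exact: (hf (k.+1, _)).1].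
have [B [N hBN]] : exists B N, forall n, (N <= n)%N -> (m n < B)%N.
  apply: contrapT => nh; apply: h => B N; apply: contrapT => nex; apply: nh; exists B, N => n Nn.
  by rewrite ltnNge; apply/negP => Bn; apply: nex; exists n.
have [c hc] : exists c, forall M, exists2 n, (M <= n)%N & m n = c.
  apply: contrapT => nh.
  suff : forall b, exists M, forall n, (M <= n)%N -> (b <= m n)%N.
    by move=> /(_ B)[M hM]; have := hBN (maxn M N) (leq_maxr _ _); rewrite ltnNge hM// leq_maxl.
  elim=> [|b [M hM]]; first by exists 0%N.
  apply: contrapT => nh2; apply: nh; exists b => M'; apply: contrapT => nex.
  apply: nh2; exists (maxn M M') => n; rewrite geq_max => /andP[h1 h2].
  rewrite ltn_neqAle hM// andbT; apply/eqP => E; apply: nex; by exists n.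
have /(@choice _ _ _)[f hf] : forall M, exists n, (M <= n)%N /\ m n = c.
  by move=> M; have [n h1 h2] := hc M; exists n.
pose fix s k := if k is k'.+1 then f (s k').+1 else f 0%N.
exists s; last by left; exists c; case=> [|k] /=; exact: (hf _).2.
by apply: homo_ltn => [|k]; [exact: ltn_trans|exact: (hf _).1].
Qed.

Lemma fatou_ball (f : riemann_sphere R -> riemann_sphere R) x e : 0 < e ->
  (forall m : nat -> nat, (forall k, (k <= m k)%N) -> exists (s : nat -> nat) g,
     {homo s : i j / (i < j)%N} /\ forall d, 0 < d -> exists N, forall k, (N <= k)%N ->
       forall y, ball x e y -> chordal (g y) (iter (m (s k)) f y) < d) ->
  fatou_set f x.
Proof.
move=> e0 H; exists (ball x e)°; split.
- exact: open_interior.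
- exact: nbhsx_ballx.
move=> h hF.
have /(@choice _ _ _)[m hm] : forall k, exists n, h k = iter n f.
  by move=> k; have [n _ <-] := hF k; exists n.
suff [s [g [hs hg]]] : exists (s : nat -> nat) g, {homo s : i j / (i < j)%N} /\ forall d, 0 < d ->
    exists N, forall k, (N <= k)%N -> forall y, ball x e y -> chordal (g y) (iter (m (s k)) f y) < d.
  exists s; split => //; exists g; apply/fam_cvgP => K [_ KU] P /uniform_nbhs[E [/= entE EP]].
  move: entE; rewrite -entourage_ballE => -[d /= d0 dE].
  have [N hN] := hg d d0; exists N => // k Nk; apply: EP => y Ky; apply: dE => /=.
  by rewrite sphere_ballE hm; apply: hN => //; exact: (@interior_subset _ (ball x e) _ (KU _ Ky)).
have [s hs [[c hc]|sm]] := nat_subseq m.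
  exists s, (iter c f); split=> // d d0; exists 0%N => k _ y _.
  by rewrite hc; have : ball (iter c f y) d (iter c f y) by exact: ballxx; rewrite sphere_ballE.
have [t [g [ht hg]]] := H (m \o s) sm; exists (s \o t), g; split => //.
by move=> i j ij; exact/hs/ht.
Qed.

Lemma fatou_escape l x e n : nm l <= 2 -> 0 < e ->
  (forall y z, ball x e y -> y = Some z -> 4 < nm (iter n (quad l) z)) ->
  fatou_set (quad_map l) x.
Proof.
move=> hl e0 H; apply: (fatou_ball e0) => m hm.
exists id, (fun=> None); split=> // d d0.
have [N hN] := @expr_gt R 2 (2 / d) (ltac:(lra)).
exists (N + n)%N => k Nk [z|] hy; last by rewrite iter_quad_map_infty.
rewrite iter_quad_map; apply: chordal_infty => //; apply: (lt_trans hN).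
have nk : (N + n <= m k)%N := leq_trans Nk (hm k).
rewrite -(subnK nk) addnA iterD.
have h4 := H _ z hy erefl; apply: lt_le_trans (escape_iter _ hl h4).
have : 2 ^+ N <= 2 ^+ (m k - (N + n) + N) :> R by rewrite ler_eXn2l ?leq_addl// ltr1n.
have : 0 < 2 ^+ N :> R by rewrite exprn_gt0.
by move: h4; clear; nra.
Qed.

Lemma julia_filled l x : nm l <= 2 -> julia_set (quad_map l) x -> exists2 z, x = Some z & filled l z.
Proof.
move=> hl Jx; apply: contrapT => nex; apply: Jx; case: x nex => [z|] nex.
  have nK : ~ filled l z by move=> Kz; apply: nex; exists z.
  have [n hn] := not_filled nK.
  have [d d0 hd] := iter_quad_cont n l z (ltac:(by rewrite subr_gt0) : 0 < nm (iter n (quad l) z) - 4).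
  have nz : 0 < 1 + nm z by rewrite ltr_wpDr ?nm_ge0.
  pose e := Num.min (1 + nm z)^-1 (d / (1 + nm z) ^+ 2).
  apply: (@fatou_escape _ _ e n) => //; first by rewrite lt_min invr_gt0 nz divr_gt0 ?exprn_gt0.
  move=> y w; rewrite sphere_ballE => h E.
  have [|v] := chordal_near _ h; first by rewrite -ler_pdivlMr// mul1r ge_min lexx.
  rewrite E => -[<-] hv.
  have : nm (w - z) < d.
    apply: (lt_le_trans hv); rewrite mulrC -ler_pdivlMr ?exprn_gt0//; rewrite ge_min lexx orbT.
    by [].
  move=> /(hd l w); rewrite subrr nm0 => /(_ d0).
  have := nm_leB (iter n (quad l) z) (iter n (quad l) w); rewrite nmC; lra.
apply: (@fatou_escape _ _ (2 / (1 + 4)) 0%N) => // y w; rewrite sphere_ballE => h E; move: h.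
by rewrite E => /chordal_infty_near; apply.
Qed.

(** All iterates are bounded by 4 on a disc, hence equi-Lipschitz on a smaller one by the Cauchy
    estimates, and Ascoli's theorem yields normality. *)
Lemma julia_not_int l z : nm l <= 2 -> filled_int l z -> ~ julia_set (quad_map l) (Some z).
Proof.
move=> hl [r r0 hr]; apply; pose r2 := r / 2.
have r20 : 0 < r2 by rewrite divr_gt0.
have hK n w : nm (w - z) <= r2 -> nm (iter n (quad l) w) <= 4.
  by move=> h; apply: hr; move: h r0; rewrite /r2; lra.
have nz : 0 < 1 + nm z by rewrite ltr_wpDr ?nm_ge0.
pose e := Num.min (1 + nm z)^-1 (r2 / 2 / (1 + nm z) ^+ 2).
have e0 : 0 < e by rewrite lt_min invr_gt0 nz !divr_gt0 ?exprn_gt0.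
apply: (fatou_ball e0) => m hm.
have lip n w w' : nm (w - z) <= r2 / 2 -> nm (w' - z) <= r2 / 2 ->
    nm (iter (m n) (quad l) w - iter (m n) (quad l) w') <= 32 / r2 * nm (w - w').
  move=> h h'; rewrite -!iterpolyE; apply: (le_trans (poly_lip r20 _ h h')).
    by move=> v hv; rewrite iterpolyE; exact: hK hv.
  by rewrite [leRHS]mulrAC -natrM.
have [|||g [s [hs hg]]] := @ascoli_seq R (fun n => iter (m n) (quad l)) z (r2 / 2) 4 (32 / r2) _ _ _ lip.
- by move=> n w hw; apply: hK; move: hw r20; lra.
- by rewrite divr_ge0// ltW.
- by rewrite divr_ge0// ltW.
exists s, (fun y => if y is Some w then Some (g w) else None); split=> // d d0.
have [N hN] := nat_gt (2 / d); exists N => k Nk y; rewrite sphere_ballE => hy.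
have [|w -> hw] := chordal_near _ hy; first by rewrite -ler_pdivlMr// mul1r ge_min lexx.
have wr : nm (w - z) <= r2 / 2.
  apply: (le_trans (ltW hw)); rewrite mulrC -ler_pdivlMr ?exprn_gt0//; rewrite ge_min lexx orbT.
  by [].
rewrite iter_quad_map; apply: (le_lt_trans (chordal_le _ _)); rewrite nmC.
rewrite mulrC -ltr_pdivlMr//; apply: (le_lt_trans (hg k w wr)).
have : k.+1%:R^-1 < d / 2.
  rewrite -[d / 2]invrK ltf_pV2 ?posrE ?invr_gt0 ?divr_gt0// invfM invrK mulrC.
  by apply: (lt_le_trans hN); rewrite ler_nat ltnW.
by [].
Qed.

Lemma seq_compact (u : nat -> riemann_sphere R) x :
  (forall e, 0 < e -> exists N, forall n, (N <= n)%N -> chordal x (u n) < e) ->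
  compact (x |` range u).
Proof.
move=> ux F PF FK; have [xF|] := pselect (cluster F x); first by exists x; split => //; left.
move=> /existsNP[A /existsNP[B /not_implyP[FA /not_implyP[/nbhs_ballP[e /= e0 eB] AB]]]].
have [N hN] := ux e e0; pose K := u @` `I_N.
have FK' : F K.
  apply: filterS (filterI FA FK) => y [Ay [yx|[n _ ny]]].
    by exfalso; apply: AB; exists y; split => //; apply: eB; rewrite yx; exact: ballxx.
  exists n => //=; rewrite ltnNge; apply/negP => Nn; apply: AB; exists y; split => //.
  by apply: eB; rewrite sphere_ballE -ny; exact: hN.
have [y [[n _ ny] cy]] : K `&` cluster F !=set0.
  by apply: (finite_compact (finite_image _ (finite_II N))).
by exists y; split => //; right; exists n.
Qed.

(** Normality is tested on the compact set formed by z and escaping points u n tending to z. The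
    limit g must be infinity at every u n, while the iterate s N, uniformly close to g there, is
    bounded at u n once u n is near z. *)
Lemma julia_bd l z : nm l <= 2 -> filled_bd l z -> julia_set (quad_map l) (Some z).
Proof.
move=> hl [Kz bz] [U [oU Uz nU]].
have [s [hs [g /fam_cvgP hg]]] := nU (fun k => iter k (quad_map l)) (fun k => ex_intro2 _ _ k I erefl).
have /nbhs_ballP[e /= e0 eU] : nbhs (Some z : riemann_sphere R) U by exact: open_nbhs_nbhs.
have /(@choice _ _ _)[u hu] : forall n : nat, exists y : R[i], nm (y - z) < Num.min (e / 2) (n.+1%:R^-1 / 2) /\ ~ filled l y.
  move=> n; have [|y h1 h2] := bz (Num.min (e / 2) (n.+1%:R^-1 / 2)); last by exists y.
  by rewrite lt_min !divr_gt0.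
pose v n : riemann_sphere R := Some (u n).
have near n : chordal (Some z) (v n) < e /\ chordal (Some z) (v n) < n.+1%:R^-1.
  have := (hu n).1; rewrite lt_min => /andP[h1 h2]; rewrite nmC in h1 h2.
  by split; apply: (le_lt_trans (chordal_le _ _)); rewrite mulrC -ltr_pdivlMr.
pose K : set (riemann_sphere R) := Some z |` range v.
have cK : compact K.
  apply: seq_compact => d d0; have [N hN] := nat_gt d^-1; exists N => n Nn.
  apply: (lt_trans (near n).2); rewrite -[d]invrK ltf_pV2 ?posrE ?invr_gt0//; apply: (lt_le_trans hN).
  by rewrite ler_nat ltnW.
have KU : K `<=` U.
  by move=> y [->//|[n _ <-]]; apply: eU; rewrite sphere_ballE; exact: (near n).1.
have unif d : 0 < d -> exists N, forall n, (N <= n)%N -> forall y, K y -> chordal (g y) (iter (s n) (quad_map l) y) < d.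
  move=> d0; have [|N _ hN] := hg K (conj cK KU) [set h | forall y, K y -> ball (g y) d (h y)].
    apply/uniform_nbhs; exists [set p | ball p.1 d p.2]; split => //.
    by rewrite -entourage_ballE; exists d.
  by exists N => n Nn y Ky; rewrite -sphere_ballE; exact: hN.
(* Two errors of 1/12 stay below 2 / (1 + 5), a chordal distance from infinity that forces a modulus
   larger than 5. *)
have [N hN] := unif (1 / 12) (ltac:(by rewrite divr_gt0)).
have gv n : chordal None (g (v n)) < 1 / 12.
  have Kv : K (v n) by right; exists n.
  have [M hM] := unif (1 / 24) (ltac:(by rewrite divr_gt0)).
  have [M' hM'] := escape_large (2 / (1 / 24)) hl (hu n).2.
  pose k := maxn M M'; have h1 := hM k (leq_maxl _ _) _ Kv.
  have ks : (M' <= s k)%N.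
    apply: leq_trans (leq_maxr M M') _; rewrite -/k.
    by clear -hs; elim: k => // k IH; apply: leq_ltn_trans IH _; exact: hs.
  move: h1; rewrite iter_quad_map => h1.
  have h2 := @chordal_infty (iter (s k) (quad l) (u n)) (1 / 24) (ltac:(by rewrite divr_gt0)) (hM' _ ks).
  rewrite chordalC in h1.
  have := chordal_tri h2 h1; suff -> : 1 / 24 + 1 / 24 = 1 / 12 :> R by [].
  by lra.
have [d d0 hd] := iter_quad_cont (s N) l z ltr01.
have [n hn] := nat_gt (d^-1).
have un : nm (u n - z) < d.
  have := (hu n).1; rewrite lt_min => /andP[_ h2]; apply: (lt_trans h2).
  apply: (@lt_trans _ _ n.+1%:R^-1); first by rewrite ltr_pdivrMr// ltr_pMr ?invr_gt0// ltr1n.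
  rewrite -[d]invrK ltf_pV2 ?posrE ?invr_gt0//; apply: (lt_trans hn).
  by rewrite ltr_nat.
have hv := hd l (u n) (ltac:(by rewrite subrr nm0)) un.
have h5 : nm (iter (s N) (quad l) (u n)) <= 5.
  have := nm_leB (iter (s N) (quad l) (u n)) (iter (s N) (quad l) z); have := Kz (s N).
  by move: hv; clear; lra.
have Kv : K (v n) by right; exists n.
have h1 := hN N (leqnn _) _ Kv; rewrite iter_quad_map in h1.
have h2 := chordal_tri (gv n) h1.
have h6 : chordal None (Some (iter (s N) (quad l) (u n))) < 2 / (1 + 5).
  have E : 1 / 12 + 1 / 12 <= 2 / (1 + 5) :> R by have -> : (1 + 5 = 6 :> R); lra.
  exact: lt_le_trans h2 E.
have := chordal_infty_near (ltac:(lra) : 0 <= 5 :> R) h6; move: h5; clear; lra.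
Qed.

Lemma julia_quad (l : R[i]) : nm l <= 2 -> julia_set (quad_map l) = Some @` [set z | filled_bd l z].
Proof.
move=> hl; apply/seteqP; split=> [x Jx|x [z bz <-]]; last exact: julia_bd.
have [z xE Kz] := julia_filled hl Jx; exists z => //=.
by case: (filled_bdP Kz) => // /(julia_not_int hl); rewrite -xE.
Qed.

Lemma hausdorff_cvgP (T : metricType R) (A : nat -> set T) B : hausdorff_cvg A B <->
  forall e, 0 < e -> exists N, forall n, (N <= n)%N ->
    (forall a, A n a -> exists2 b, B b & ball b e a) /\ (forall b, B b -> exists2 a, A n a & ball a e b).
Proof.
rewrite /hausdorff_cvg; have h0 n : (0 <= hausdorff_dist (A n) B)%E.
  by apply: le_ereal_inf_tmp => _ [r [r0 _ _] <-]; rewrite lee_fin ltW.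
split=> [H e e0|H].
  have /(H _)[N _ hN] : nbhs (0%E : \bar R) [set u | (u < e%:E)%E].
    by apply: open_ereal_lt'; rewrite lte_fin.
  exists N => n Nn; have /ereal_inf_lt[_ [r [r0 AB BA] <-]] := hN n Nn.
  rewrite lte_fin => /ltW re.
  by split=> [x /AB|y /BA] [a ha hx]; exists a => //; exact: le_ball hx.
have hle e : 0 < e -> exists N, forall n, (N <= n)%N -> (hausdorff_dist (A n) B <= e%:E)%E.
  move=> /[dup] e0 /H[N hN]; exists N => n Nn; have [h1 h2] := hN n Nn.
  apply: ereal_inf_lbound; exists e => //; split => // [x /h1[y By hy]|y /h2[x Ax hx]].
apply/fine_cvgP; split.
  have [N hN] := hle 1 ltr01; exists N => // n Nn; rewrite ge0_fin_numE//.
  by apply: (le_lt_trans (hN n Nn)); rewrite ltry.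
apply/cvgrPdist_le => e /= e0; have [N hN] := hle e e0; exists N => // n Nn.
rewrite sub0r normrN ger0_norm ?fine_ge0//.
by rewrite -lee_fin fineK ?hN// ge0_fin_numE// (le_lt_trans (hN n Nn))// ltry.
Qed.

End sphere.

(** * Passage through the gate *)

Section gate_functions.
Variable R : realType.
Implicit Types (x y r : R) (w : R[i]).

(** Increasing and bounded, with derivative 1 / (1 + |x|)^2: along an orbit moving to the right its
    increments have a bounded sum, yet pay for errors of size 1 / |w|^2. *)
Definition squash x : R := x / (1 + `|x|).

Lemma squash_bound x : `|squash x| <= 1.
Proof.
have h : 0 < 1 + `|x| by have := normr_ge0 x; lra.
rewrite /squash normrM normfV (gtr0_norm h) ler_pdivrMr//; lra.
Qed.

Lemma squash_step x y : x + 1/2 <= y ->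
  1 / (8 * (1 + `|x|) ^+ 2) <= squash y - squash x.
Proof.
move=> xy; have hx : 0 < 1 + `|x| by have := normr_ge0 x; lra.
have hy : 0 < 1 + `|y| by have := normr_ge0 y; lra.
have -> : squash y - squash x =
   ((y * (1 + `|x|) - x * (1 + `|y|)) * (8 * (1 + `|x|)) / (1 + `|y|)) / (8 * (1 + `|x|) ^+ 2).
  by rewrite /squash; field; rewrite !gt_eqF.
rewrite ler_pM2r ?invr_gt0 ?mulr_gt0 ?exprn_gt0// ler_pdivlMr// mul1r.
have [x0|x0] := leP 0 x.
  have y0 : 0 <= y by lra.
  rewrite !ger0_norm//.
  have -> : (y * (1 + x) - x * (1 + y)) * (8 * (1 + x)) = 8 * (y - x) * (1 + x) by ring.
  have := mulr_ge0 x0 (_ : 0 <= y - x - 1 / 2); nra.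
have [y0|y0] := leP 0 y.
  by rewrite (ltr0_norm x0) (ger0_norm y0); nra.
rewrite (ltr0_norm x0) (ltr0_norm y0).
have -> : (y * (1 + - x) - x * (1 + - y)) * (8 * (1 + - x)) = 8 * (y - x) * (1 - x) by ring.
nra.
Qed.

(* The tangent of half the angle between [w] and the vertical axis. *)
Definition half_tan w : R := re w / (nm w + `|im w|).

Lemma half_tan_bound w : `|half_tan w| <= 1.
Proof.
have [->|w0] := eqVneq w 0.
  by rewrite /half_tan nm0 /= normr0 addr0 invr0 mulr0 normr0 ler01.
have r0 : 0 < nm w by rewrite nm_gt0.
have h : 0 < nm w + `|im w| by have := normr_ge0 (im w); lra.
rewrite /half_tan normrM normfV (gtr0_norm h) ler_pdivrMr//.
have := re_nm w; have := normr_ge0 (im w); lra.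
Qed.

Lemma half_tan_lip w w' : 1 <= nm w -> 1 <= nm w' ->
  `|half_tan w - half_tan w'| <= 4 * nm (w' - w) / nm w.
Proof.
move=> r1 r1'.
have a0 := normr_ge0 (im w); have a0' := normr_ge0 (im w').
have h : 0 < nm w + `|im w| by lra.
have h' : 0 < nm w' + `|im w'| by lra.
have -> : half_tan w - half_tan w' =
  ((re w - re w') * (nm w' + `|im w'|) + re w' * ((nm w' - nm w) + (`|im w'| - `|im w|)))
  / ((nm w + `|im w|) * (nm w' + `|im w'|)).
  by rewrite /half_tan; field; rewrite !gt_eqF.
rewrite normrM normfV (gtr0_norm (mulr_gt0 h h')).
set d := nm (w' - w).
have d0 : 0 <= d by exact: nm_ge0.
have e1 : `|re w - re w'| <= d by rewrite -reB /d nmC re_nm.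
have e2 : `|nm w' - nm w| <= d.
  by rewrite ler_norml; have := nm_leB w' w; have := nm_leB w w'; rewrite nmC -/d; lra.
have e3 : `|(`|im w'| - `|im w|)| <= d.
  by rewrite (le_trans (ler_dist_dist _ _))// -imB im_nm.
have e4 := re_nm w'; have e5 := im_nm w'.
rewrite ler_pdivrMr ?mulr_gt0//.
apply: (@le_trans _ _ (4 * d * nm w')).
  apply: le_trans (ler_normD _ _) _; rewrite !normrM (gtr0_norm h').
  have f1 : `|re w - re w'| * (nm w' + `|im w'|) <= d * (2 * nm w').
    by apply: ler_pM => //; lra.
  have f2 : `|re w'| * `|nm w' - nm w + (`|im w'| - `|im w|)| <= nm w' * (2 * d).
    apply: ler_pM => //.
    by apply: le_trans (ler_normD _ _) _; lra.
  lra.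
have -> : 4 * d / nm w * ((nm w + `|im w|) * (nm w' + `|im w'|)) =
   4 * d * ((1 + `|im w| / nm w) * (nm w' + `|im w'|)) by field; rewrite gt_eqF//; lra.
rewrite ler_wpM2l ?mulr_ge0//.
have : 0 <= `|im w| / nm w by rewrite divr_ge0//; lra.
by move=> q0; nra.
Qed.

(** A translation by 1 turns w by an angle of about |Im w| / |w|^2. The other part of the difference
    is nonnegative because Re w / |w| increases under the translation ([key]). *)
Lemma half_tan_shift w : 2 <= nm w ->
  `|im w| / (6 * nm w ^+ 2) <= half_tan (w + 1) - half_tan w.
Proof.
move=> r2; set w' := w + 1.
have ei : im w' = im w by rewrite imD /= addr0.
have er : re w' = re w + 1 by rewrite reD.
have a0 := normr_ge0 (im w).
have r1' : nm w' <= nm w + 1 by rewrite -(nm1 R) nmD.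
have r0' : nm w - 1 <= nm w' by have := nm_leD w 1; rewrite nm1.
have h : 0 < nm w + `|im w| by lra.
have h' : 0 < nm w' + `|im w| by lra.
have key : 0 <= (re w + 1) * nm w - re w * nm w'.
  have s1 := nm_sqr w; have s2 := nm_sqr w'; rewrite ei er in s2.
  have i2 := sqr_ge0 (im w).
  have [x0|x0] := leP 0 (re w).
    suff : re w * nm w' <= (re w + 1) * nm w by lra.
    rewrite -(@ler_pXn2r _ 2) ?nnegrE ?mulr_ge0 ?nm_ge0 ?addr_ge0//.
    rewrite !exprMn s1 s2; nra.
  have [x1|x1] := leP 0 (re w + 1).
    have : 0 <= - re w * nm w' by rewrite mulr_ge0 ?nm_ge0//; lra.
    have : 0 <= (re w + 1) * nm w by rewrite mulr_ge0 ?nm_ge0//; lra.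
    lra.
  suff : - (re w + 1) * nm w <= - re w * nm w' by lra.
  rewrite -(@ler_pXn2r _ 2) ?nnegrE ?mulr_ge0 ?nm_ge0//; [|lra..].
  rewrite !exprMn !sqrrN s1 s2; nra.
have -> : half_tan w' - half_tan w =
   (((re w + 1) * nm w - re w * nm w') + `|im w|)
  / ((nm w + `|im w|) * (nm w' + `|im w|)).
  by rewrite /half_tan ei er; field; rewrite !gt_eqF.
rewrite ler_pdivlMr ?mulr_gt0//.
have e5 := im_nm w.
have -> : `|im w| / (6 * nm w ^+ 2) * ((nm w + `|im w|) * (nm w' + `|im w|)) =
   `|im w| * (((nm w + `|im w|) * (nm w' + `|im w|)) / (6 * nm w ^+ 2)).
  by field; rewrite gt_eqF//; lra.
suff : ((nm w + `|im w|) * (nm w' + `|im w|)) / (6 * nm w ^+ 2) <= 1 by nra.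
rewrite ler_pdivrMr ?mul1r; last by rewrite mulr_gt0// exprn_gt0//; lra.
have -> : 6 * nm w ^+ 2 = (2 * nm w) * (3 * nm w) by ring.
by apply: ler_pM; lra.
Qed.

(* This weight makes the gain of [squash] absorb the error of
   [half_tan]; beyond modulus [1 / (32 D)] the function vanishes. *)
Definition gate_weight (G : R) : R := 32 * (16 * G + 1).

Definition gate_core G w : R := gate_weight G * squash (re w) + half_tan w.

Definition gate_fn G D w : R := Num.max 0 (1 - 32 * D * nm w) * gate_core G w.

Lemma gate_core_bound G w : 1 <= G -> `|gate_core G w| <= gate_weight G + 1.
Proof.
move=> G1; rewrite /gate_core (le_trans (ler_normD _ _))// lerD ?half_tan_bound//.
have K0 : 0 <= gate_weight G by rewrite /gate_weight; lra.
by rewrite normrM (ger0_norm K0); have := squash_bound (re w); nra.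
Qed.

Lemma gate_fn_bound G D w : 1 <= G -> 0 <= D -> `|gate_fn G D w| <= gate_weight G + 1.
Proof.
move=> G1 D0; rewrite /gate_fn normrM.
have K0 : 0 <= gate_weight G + 1 by rewrite /gate_weight; lra.
have h0 : 0 <= Num.max 0 (1 - 32 * D * nm w) by rewrite le_max lexx.
have h1 : Num.max 0 (1 - 32 * D * nm w) <= 1.
  by rewrite ge_max ler01 /= gerBl !mulr_ge0 ?nm_ge0.
have := gate_core_bound w G1; have := normr_ge0 (gate_core G w).
by rewrite (ger0_norm h0); nra.
Qed.

(** The true step differs from the translation by e, which disturbs [half_tan] by at most 8 e / |w|,
    that is by 32 D + 16 G / |w|^2. The weighted increment of [squash], at least (16 G + 1) / |w|^2,
    covers the second term and leaves the 1 in 1 + |Im w|. *)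
Lemma gate_core_step G D w w' : 1 <= G -> 0 < D -> D <= 1/32 -> 32 * G <= nm w ->
  D * nm w <= 1/16 -> nm (w' - w - 1) <= 2 * D * nm w + 2 * D + 2 * G / nm w ->
  (1 + `|im w|) / (6 * nm w ^+ 2) - 32 * D <= gate_core G w' - gate_core G w.
Proof.
move=> G1 D0 D1 hr hDr he.
set r := nm w in hr hDr he *; set e := nm (w' - w - 1) in he.
have r0 : 0 < r by lra.
have e0 : 0 <= e by exact: nm_ge0.
have Gr : G / r <= 1 / 32 by rewrite ler_pdivrMr//; lra.
have eq4 : e <= 1/4 by lra.
have re1 : re w + 1/2 <= re w'.
  have := re_ge (w' - w - 1); rewrite !reB /= -/e; lra.
have st1 := squash_step re1.
have r1 : r - 1 <= nm (w + 1) by have := nm_leD w 1; rewrite nm1.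
have r2 : r - 2 <= nm w'.
  have -> : w' = (w + 1) + (w' - w - 1) by ring.
  by have := nm_leD (w + 1) (w' - w - 1); rewrite -/e; lra.
have st2 : `|im w| / (6 * r ^+ 2) <= half_tan (w + 1) - half_tan w.
  by apply: half_tan_shift; rewrite -/r; lra.
have : `|half_tan (w + 1) - half_tan w'| <= 4 * nm (w' - (w + 1)) / nm (w + 1).
  by apply: half_tan_lip; lra.
have -> : w' - (w + 1) = w' - w - 1 by ring.
rewrite -/e ler_norml => /andP[_ st3].
have st4 : 4 * e / nm (w + 1) <= 8 * e / r.
  rewrite ler_pdivrMr; last by lra.
  rewrite mulrAC ler_pdivlMr//; nra.
have st5 : 8 * e / r <= 32 * D + 16 * G / r ^+ 2.
  have -> : 32 * D + 16 * G / r ^+ 2 = (32 * D * r + 16 * (G / r)) / r.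
    by field; rewrite gt_eqF.
  by rewrite ler_pM2r ?invr_gt0//; nra.
have st6 : (16 * G + 1) / r ^+ 2 <= gate_weight G * (1 / (8 * (1 + `|re w|) ^+ 2)).
  have -> : gate_weight G * (1 / (8 * (1 + `|re w|) ^+ 2)) =
     (16 * G + 1) / (((1 + `|re w|) / 2) ^+ 2).
    rewrite /gate_weight; field.
    by rewrite gt_eqF//; have := normr_ge0 (re w); lra.
  rewrite ler_wpM2l//; first by lra.
  have a0 := normr_ge0 (re w); have a1 := re_nm w.
  rewrite -/r in a1; have p : 0 < (1 + `|re w|) / 2 by lra.
  by rewrite lef_pV2 ?posrE ?exprn_gt0// ler_pXn2r ?nnegrE ?(ltW p) ?(ltW r0)//; lra.
have st7 : gate_weight G * (1 / (8 * (1 + `|re w|) ^+ 2)) <=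
           gate_weight G * (squash (re w') - squash (re w)).
  by rewrite ler_wpM2l// /gate_weight; lra.
have -> : (1 + `|im w|) / (6 * r ^+ 2) = (1/6) / r ^+ 2 + `|im w| / (6 * r ^+ 2).
  by field; rewrite gt_eqF.
have st8 : (1/6) / r ^+ 2 + 16 * G / r ^+ 2 <= (16 * G + 1) / r ^+ 2.
  by rewrite -mulrDl ler_wpM2r ?invr_ge0 ?sqr_ge0//; lra.
by rewrite /gate_core; lra.
Qed.

Lemma max0_lip x y : `|Num.max 0 x - Num.max 0 y| <= `|x - y|.
Proof.
have := ler_norm (x - y); have := ler_norm (y - x).
rewrite (distrC y) => h1 h2; rewrite ler_norml.
by case: (leP 0 x) => hx; case: (leP 0 y) => hy; apply/andP; split; lra.
Qed.

(** Where the cut-off is below 1/2, |w| is at least of order 1 / D and the gain claimed, at most 1 /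
    (6 |w|), is absorbed in a multiple of D. The cut-off itself varies by at most 40 D per step,
    against a core bounded by [gate_weight G + 1]. *)
Lemma gate_fn_step G D w w' : 1 <= G -> 0 < D -> D <= 1/32 -> 32 * G <= nm w ->
  nm (w' - w - 1) <= 2 * D * nm w + 2 * D + 2 * G / nm w ->
  (1 + `|im w|) / (12 * nm w ^+ 2) - (40 * gate_weight G + 100) * D
    <= gate_fn G D w' - gate_fn G D w.
Proof.
move=> G1 D0 D1 hr he.
set r := nm w in hr he *; set e := nm (w' - w - 1) in he.
have r0 : 0 < r by lra.
have K0 : 1 <= gate_weight G by rewrite /gate_weight; lra.
set K := gate_weight G in K0 *.
have e0 : 0 <= e by exact: nm_ge0.
have Gr : G / r <= 1 / 32 by rewrite ler_pdivrMr//; lra.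
have DK : 0 <= D * K by rewrite mulr_ge0//; lra.
have iw := im_nm w; rewrite -/r in iw.
have a0 := normr_ge0 (im w).
have rr1 : nm w' <= r + 1 + e.
  have -> : w' = (w + 1) + (w' - w - 1) by ring.
  by rewrite (le_trans (nmD _ _))// lerD2r (le_trans (nmD _ _))// nm1.
have rr2 : r - 1 - e <= nm w'.
  have -> : w' = (w + 1) + (w' - w - 1) by ring.
  have := nm_leD (w + 1) (w' - w - 1); have := nm_leD w 1; rewrite nm1 -/e -/r; lra.
have up : (1 + `|im w|) / (12 * r ^+ 2) <= 1 / (6 * r).
  rewrite ler_pdivrMr ?mulr_gt0 ?exprn_gt0//.
  have -> : 1 / (6 * r) * (12 * r ^+ 2) = 2 * r by field; rewrite gt_eqF.
  by lra.
rewrite /gate_fn -/r.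
have [far|near] := ltP (1/16) (D * r).
  have -> : Num.max 0 (1 - 32 * D * r) = 0 by apply/max_idPl; lra.
  have -> : Num.max 0 (1 - 32 * D * nm w') = 0.
    apply/max_idPl.
    have : D * (r / 2) <= D * nm w' by rewrite ler_pM2l//; nra.
    by lra.
  rewrite !mul0r subr0.
  have : 1 / (6 * r) <= 3 * D by rewrite ler_pdivrMr ?mulr_gt0//; nra.
  by lra.
have core := gate_core_step G1 D0 D1 hr near he.
rewrite -/r in core.
set x := gate_core G w in core *; set x' := gate_core G w' in core *.
have eq4 : e <= 1/4 by lra.
set c' := Num.max 0 _; set c := Num.max 0 _.
have c0' : 0 <= c' by rewrite le_max lexx.
have c1' : c' <= 1 by rewrite ge_max ler01 /= gerBl !mulr_ge0 ?nm_ge0//; lra.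
have xb : `|x| <= K + 1 by exact: gate_core_bound.
have dr : `|nm w' - r| <= 5/4 by rewrite ler_norml; apply/andP; split; lra.
have dc : `|c' - c| <= 40 * D.
  apply: (@le_trans _ _ (`|(1 - 32 * D * nm w') - (1 - 32 * D * r)|)).
    exact: max0_lip.
  have -> : 1 - 32 * D * nm w' - (1 - 32 * D * r) = - (32 * D * (nm w' - r)) by ring.
  by rewrite normrN !normrM (gtr0_norm D0) (@ger0_norm _ 32)//; nra.
have -> : c' * x' - c * x = c' * (x' - x) + x * (c' - c) by ring.
have p1 : - (40 * K * D + 40 * D) <= x * (c' - c).
  have : `|x * (c' - c)| <= (K + 1) * (40 * D) by rewrite normrM ler_pM.
  by rewrite ler_norml => /andP[h _]; lra.
have p2 : c' * ((1 + `|im w|) / (6 * r ^+ 2)) - 32 * D <= c' * (x' - x).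
  have := ler_wpM2l c0' core; rewrite mulrBr; nra.
have q0 : 0 <= (1 + `|im w|) / (6 * r ^+ 2).
  by rewrite divr_ge0 ?mulr_ge0 ?exprn_ge0//; lra.
have q1 : (1 + `|im w|) / (12 * r ^+ 2) = 1/2 * ((1 + `|im w|) / (6 * r ^+ 2)).
  by field; rewrite gt_eqF.
have [big|small] := leP (1/2) c'.
  have := ler_wpM2r q0 big; lra.
have big : 1/2 < 32 * D * nm w'.
  by move: small; rewrite gt_max => /andP[_]; lra.
have : 1 / (6 * r) <= 22 * D.
  rewrite ler_pdivrMr ?mulr_gt0//.
  have : D * nm w' <= D * (2 * r) by rewrite ler_pM2l//; lra.
  by lra.
have := mulr_ge0 c0' q0; lra.
Qed.

End gate_functions.

(** * The gate relation and the increment of the potential *)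

Section gate_potential.
Variable R : realType.
Implicit Types (G : R) (w d g t : R[i]).

Lemma ln_nm1D t : nm t <= 1/8 -> `|ln (nm (1 + t)) - re t| <= 3 * nm t ^+ 2.
Proof.
move=> ht; have t0 := nm_ge0 t.
have := re_nm t; rewrite ler_norml => /andP[r1 r2].
set s := 2 * re t + nm t ^+ 2.
have e : nm (1 + t) ^+ 2 = 1 + s.
  by rewrite /s !nm_sqr reD imD /=; ring.
have s1 : - (17/8 * nm t) <= s by rewrite /s; nra.
have s2 : s <= 17/8 * nm t by rewrite /s; nra.
have p : 0 < nm (1 + t).
  by have := nm_leD 1 t; rewrite nm1; lra.
have l2 : ln (1 + s) = 2 * ln (nm (1 + t)) by rewrite -e lnXn// mulr2n; ring.
have u : ln (1 + s) <= s by apply: le_ln1Dx; lra.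
have v : - ln (1 + s) <= - s + 7 * nm t ^+ 2.
  have q : 0 < 1 + s by lra.
  rewrite -lnV ?posrE//.
  have -> : (1 + s)^-1 = 1 + (- s / (1 + s)) by field; rewrite gt_eqF.
  apply: le_trans (le_ln1Dx _) _.
    by rewrite ltr_pdivlMr//; lra.
  by rewrite ler_pdivrMr//; nra.
by rewrite ler_norml; apply/andP; split; rewrite /s in u v; lra.
Qed.

(** The multiplier 1 / mu of the gate relation, written through d = 1 - mu. *)
Definition gate_mult d : R[i] := (1 - d)^-1.

Definition gate_rel (G : R) d g w w' :=
  nm (w' - (gate_mult d * w + gate_mult d + g / w)) <= G / nm w ^+ 2.

(* Increases by [ln (nm (gate_mult d))] at each step, up to a summable error. *)
Definition gate_pot d g w : R := ln (nm (1 + d * w)) - re (g * d) * ln (nm w).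

Lemma nm_1B d : nm d <= 1/32 -> 31/32 <= nm (1 - d) <= 33/32.
Proof.
move=> hd; have := nm_leB 1 d; have := nmB 1 d; rewrite nm1 => ? ?.
by apply/andP; split; lra.
Qed.

Lemma gate_1B_neq0 d : nm d <= 1/32 -> 1 - d != 0.
Proof. by move=> /nm_1B/andP[h _]; rewrite -nm_gt0; lra. Qed.

Lemma gate_mult_neq0 d : nm d <= 1/32 -> gate_mult d != 0.
Proof. by move=> hd; rewrite invr_eq0 gate_1B_neq0. Qed.

Lemma nm_gate_mult d : nm d <= 1/32 -> nm (gate_mult d) <= 32/31.
Proof.
move=> /nm_1B/andP[h _].
by rewrite /gate_mult nmV -div1r ler_pdivrMr; lra.
Qed.

Lemma nm_gate_mult1 d : nm d <= 1/32 -> nm (gate_mult d - 1) <= 2 * nm d.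
Proof.
move=> hd; have -> : gate_mult d - 1 = gate_mult d * d.
  by rewrite /gate_mult; field; exact: gate_1B_neq0.
by rewrite nmM; have := nm_gate_mult hd; have := nm_ge0 d; nra.
Qed.

Lemma ln_gate_mult d : nm d <= 1/32 -> `|ln (nm (gate_mult d)) - re d| <= 3 * nm d ^+ 2.
Proof.
move=> hd; have /andP[h _] := nm_1B hd.
rewrite /gate_mult nmV lnV ?posrE; last by lra.
have := @ln_nm1D (- d); rewrite nmN reN opprK => h2.
have -> : - ln (nm (1 - d)) - re d = - (ln (nm (1 - d)) + re d) by ring.
by rewrite normrN; apply: h2; lra.
Qed.

Lemma gate_relE G d g w w' : gate_rel G d g w w' ->
  exists2 e, w' = gate_mult d * w + gate_mult d + g / w + e & nm e <= G / nm w ^+ 2.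
Proof.
move=> h; exists (w' - (gate_mult d * w + gate_mult d + g / w)); last exact: h.
by ring.
Qed.

Lemma gate_rel_near G d g w w' : 1 <= G -> nm g <= G -> nm d <= 1/32 ->
  32 * G <= nm w -> gate_rel G d g w w' ->
  nm (w' - w - 1) <= 2 * nm d * nm w + 2 * nm d + 2 * G / nm w.
Proof.
move=> hG hg hd hr step.
have hr0 : 0 < nm w by lra.
have w0 : w != 0 by rewrite -nm_gt0.
have hGr : G / nm w <= 1/32 by rewrite ler_pdivrMr//; lra.
have hGr0 : 0 < G / nm w by rewrite divr_gt0//; lra.
have hr1 : (nm w)^-1 <= 1/32 by rewrite -div1r ler_pdivrMr//; lra.
have hri : 0 < (nm w)^-1 by rewrite invr_gt0.
have [e -> he] := gate_relE step.
have -> : gate_mult d * w + gate_mult d + g / w + e - w - 1 =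
  (gate_mult d - 1) * w + (gate_mult d - 1) + g / w + e by ring.
rewrite (le_trans (nmD _ _))//.
have h1 : nm e <= G / nm w.
  apply: (le_trans he); rewrite expr2 invfM mulrA ler_piMr ?(ltW hGr0)//; lra.
have h2 : nm (g / w) <= G / nm w by rewrite nm_div ler_pM2r.
have h3 : nm ((gate_mult d - 1) * w + (gate_mult d - 1) + g / w) <=
    nm (gate_mult d - 1) * nm w + nm (gate_mult d - 1) + nm (g / w).
  by rewrite -nmM (le_trans (nmD _ _))// lerD2r nmD.
have := nm_gate_mult1 hd; have := nm_ge0 d; nra.
Qed.

(** Two factorisations are exact: zeta' = M zeta (1 + t) and w' = M w (1 + t2), where M is
    [gate_mult d]. To first order t is d g / w and t2 is 1 / w, and Re (d g / w) - Re (g d) Re (1 /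
    w) is a product of imaginary parts, of size |d| |Im w| / |w|^2. This cancellation is the purpose
    of the logarithmic term; all other errors are O(|d|^2) or O(|d| / |w|^2). *)
Lemma gate_pot_step G d g w w' : 1 <= G -> nm g <= G -> d != 0 -> nm d <= 1/32 ->
  32 * G <= nm w -> gate_rel G d g w w' -> 1/4 <= nm (1 + d * w) ->
  `|gate_pot d g w' - gate_pot d g w - ln (nm (gate_mult d))| <=
  24 * G ^+ 2 * (nm d ^+ 2 + nm d * ((1 + `|im w|) / nm w ^+ 2)).
Proof.
move=> hG hg d0 hd hr step hz.
have hD : 0 < nm d by rewrite nm_gt0.
have hr0 : 0 < nm w by lra.
have w0 : w != 0 by rewrite -nm_gt0.
have hGr : G / nm w <= 1/32 by rewrite ler_pdivrMr//; lra.
have hGr0 : 0 < G / nm w by rewrite divr_gt0//; lra.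
have hr1 : (nm w)^-1 <= 1/32 by rewrite -div1r ler_pdivrMr//; lra.
have hri : 0 < (nm w)^-1 by rewrite invr_gt0.
have [e w'E he] := gate_relE step.
set z := 1 + d * w in hz.
have z0 : z != 0 by rewrite -nm_gt0; lra.
have M0 := gate_mult_neq0 hd.
have h1B := gate_1B_neq0 hd.
have /andP[b1 b2] := nm_1B hd.
set s := (nm w)^-1 in hr1 hri *.
have es : nm w ^- 2 = s ^+ 2 by rewrite exprVn.
have Gs : G * s <= 1/32 := hGr.
have {}he : nm e <= G * s ^+ 2 by rewrite -es.
have hes : nm e <= G * s by apply: (le_trans he); nra.
have zi : nm z^-1 <= 4.
  by rewrite nmV -div1r ler_pdivrMr; lra.
have zi0 := nm_ge0 z^-1.
have Gs0 : 0 <= G * s := ltW hGr0.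
have G0' : 0 <= G := le_trans ler01 hG.
have gs0 := nm_ge0 g; have e0 := nm_ge0 e.
pose t := d * (g / w + e) * (1 - d) * z^-1.
have z'E : 1 + d * w' = gate_mult d * z * (1 + t).
  by rewrite w'E /t /z /gate_mult; field; rewrite h1B w0 -/z z0.
have ht : nm t <= 16 * (nm d * (G * s)).
  rewrite /t !nmM.
  have hA : nm (g / w + e) <= 2 * (G * s).
    by rewrite (le_trans (nmD _ _))// nm_div -/s; nra.
  have hB : nm d * nm (g / w + e) <= nm d * (2 * (G * s)) by rewrite ler_pM2l.
  have hC : nm d * nm (g / w + e) * nm (1 - d) <= nm d * (2 * (G * s)) * 2.
    by apply: ler_pM; rewrite ?mulr_ge0 ?nm_ge0//; lra.
  have hDD : nm d * nm (g / w + e) * nm (1 - d) * nm z^-1 <=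
       nm d * (2 * (G * s)) * 2 * 4.
    by apply: ler_pM; rewrite ?mulr_ge0 ?nm_ge0//; lra.
  by lra.
have dG : nm d * (G * s) <= 1/32 * (1/32) by apply: ler_pM => //; rewrite ?mulr_ge0 ?nm_ge0//; lra.
have ht8 : nm t <= 1/8 by lra.
pose t2 := w^-1 + (1 - d) * (g / w ^+ 2 + e / w).
have w'2 : w' = gate_mult d * w * (1 + t2).
  by rewrite w'E /t2 /gate_mult; field; rewrite h1B w0.
have ht2' : nm (t2 - w^-1) <= 4 * (G * s ^+ 2).
  have -> : t2 - w^-1 = (1 - d) * (g / w ^+ 2 + e / w) by rewrite /t2; ring.
  rewrite nmM.
  have hA : nm (g / w ^+ 2 + e / w) <= 2 * (G * s ^+ 2).
    rewrite (le_trans (nmD _ _))// !nm_div nmX -/s es; nra.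
  have : nm (1 - d) * nm (g / w ^+ 2 + e / w) <= 2 * (2 * (G * s ^+ 2)).
    by apply: ler_pM; rewrite ?nm_ge0//; lra.
  by lra.
have ht2 : nm t2 <= 2 * s.
  have := nmD (t2 - w^-1) w^-1; rewrite subrK nmV -/s; nra.
have l1 := ln_nm1D ht8.
have l2 : `|ln (nm (1 + t2)) - re t2| <= 3 * nm t2 ^+ 2 by apply: ln_nm1D; move: ht2 hr1; clear; lra.
have l3 := ln_gate_mult hd.
have p1 : 0 < nm (1 + t) by move: (nm_leD 1 t) ht8; rewrite nm1; clear; lra.
have p2 : 0 < nm (1 + t2) by move: (nm_leD 1 t2) ht2 hr1; rewrite nm1; clear; lra.
have pM : 0 < nm (gate_mult d) by rewrite nm_gt0.
have pz : 0 < nm z by rewrite nm_gt0.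
set L := ln (nm (gate_mult d)) in l3 *.
have V'E : gate_pot d g w' = L + ln (nm z) + ln (nm (1 + t)) -
   re (g * d) * (L + ln (nm w) + ln (nm (1 + t2))).
  rewrite /gate_pot z'E {1}w'2 !nmM !lnM ?posrE ?mulr_gt0//.
rewrite V'E /gate_pot -/z.
set A := ln (nm (1 + t)) in l1 *; set B := ln (nm (1 + t2)) in l2 *.
have -> : L + ln (nm z) + A - re (g * d) * (L + ln (nm w) + B) -
    (ln (nm z) - re (g * d) * ln (nm w)) - L =
  (A - re t) + re (t - d * g / w) + (re (d * g / w) - re (g * d) * re w^-1)
   - re (g * d) * L - re (g * d) * (B - re t2) - re (g * d) * (re (t2 - w^-1)).
  rewrite !reB; ring.
have a1 : `|A - re t| <= nm d ^+ 2.
  apply: (le_trans l1).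
  have : nm t ^+ 2 <= (16 * (nm d * (G * s))) ^+ 2.
    have X0 : 0 <= nm d * (G * s) by rewrite mulr_ge0// nm_ge0.
    by rewrite ler_pXn2r ?nnegrE ?nm_ge0// mulr_ge0.
  have : (G * s) ^+ 2 <= (1/32) ^+ 2.
    have h32 : 0 <= 1/32 :> R by clear; lra.
    by apply: lerXn2r.
  by have := sqr_ge0 (nm d); rewrite !exprMn; clear; nra.
have a2 : `|re (t - d * g / w)| <= 8 * G * nm d ^+ 2 + 8 * (nm d * (G * s ^+ 2)).
  apply: le_trans (re_nm _) _.
  have -> : t - d * g / w = - (d ^+ 2 * g * (w^-1 + 1) * z^-1) + d * e * (1 - d) * z^-1.
    by rewrite /t /z; field; rewrite w0 -/z z0.
  rewrite (le_trans (nmD _ _))// nmN !nmM -expr2.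
  have hA : nm (w^-1 + 1) <= 2.
    by rewrite (le_trans (nmD _ _))// nm1 nmV -/s; move: hr1; clear; lra.
  have hB : nm d ^+ 2 * nm g * nm (w^-1 + 1) * nm z^-1 <= nm d ^+ 2 * G * 2 * 4.
    have D2 := sqr_ge0 (nm d).
    apply: ler_pM => //; first by rewrite !mulr_ge0 ?nm_ge0.
    apply: ler_pM => //; rewrite ?mulr_ge0 ?nm_ge0//.
    by rewrite ler_wpM2l.
  have hC : nm d * nm e * nm (1 - d) * nm z^-1 <= nm d * (G * s ^+ 2) * 2 * 4.
    apply: ler_pM => //; first by rewrite !mulr_ge0 ?nm_ge0.
    apply: ler_pM => //; rewrite ?mulr_ge0 ?nm_ge0//; last by move: b2; clear; lra.
    by rewrite ler_pM2l.
  by move: hB hC; clear; lra.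
have hgd : `|re (g * d)| <= G * nm d.
  by rewrite (le_trans (re_nm _))// nmM ler_pM2r.
have a3 : `|re (d * g / w) - re (g * d) * re w^-1| <= G * nm d * (`|im w| * s ^+ 2).
  have -> : re (d * g / w) - re (g * d) * re w^-1 = - (im (g * d) * im w^-1).
    by rewrite reM (mulrC g d); ring.
  rewrite normrN normrM imV es normrM normrN (ger0_norm (sqr_ge0 s)).
  have q : `|im (g * d)| <= G * nm d by rewrite (le_trans (im_nm _))// nmM ler_pM2r.
  by apply: ler_wpM2r => //; apply: mulr_ge0 => //; exact: sqr_ge0.
have rd := re_nm d.
have hL : `|L| <= 2 * nm d.
  have -> : L = (L - re d) + re d by ring.
  rewrite (le_trans (ler_normD _ _))//; move: l3 rd hd hD.
  by clear; nra.
have mulb (x y X Y : R) : `|x| <= X -> `|y| <= Y -> `|x * y| <= X * Y.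
  by move=> *; rewrite normrM ler_pM.
have a4 : `|re (g * d) * L| <= G * nm d * (2 * nm d) by exact: mulb.
have a5 : `|re (g * d) * (B - re t2)| <= G * nm d * (12 * s ^+ 2).
  apply: mulb => //; apply: (le_trans l2).
  have : nm t2 ^+ 2 <= (2 * s) ^+ 2.
    by rewrite ler_pXn2r ?nnegrE ?nm_ge0//; apply: le_trans ht2; exact: nm_ge0.
  by rewrite exprMn; clear; lra.
have a6 : `|re (g * d) * re (t2 - w^-1)| <= G * nm d * (4 * (G * s ^+ 2)).
  by apply: mulb => //; apply: le_trans (re_nm _) _.
apply: (@le_trans _ _ (nm d ^+ 2 + (8 * G * nm d ^+ 2 + 8 * (nm d * (G * s ^+ 2)))
  + G * nm d * (`|im w| * s ^+ 2) + G * nm d * (2 * nm d) + G * nm d * (12 * s ^+ 2)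
  + G * nm d * (4 * (G * s ^+ 2)))).
  rewrite (le_trans (ler_normB _ _))// lerD//.
  rewrite (le_trans (ler_normB _ _))// lerD//.
  rewrite (le_trans (ler_normB _ _))// lerD//.
  rewrite (le_trans (ler_normD _ _))// lerD//.
  by rewrite (le_trans (ler_normD _ _))// lerD.
rewrite es; set D := nm d in hD *.
have i0 := normr_ge0 (im w).
have GG : G <= G ^+ 2 by rewrite expr2 ler_peMl//; lra.
have q1 : D ^+ 2 + 8 * G * D ^+ 2 + G * D * (2 * D) <= 24 * G ^+ 2 * D ^+ 2.
  have -> : D ^+ 2 + 8 * G * D ^+ 2 + G * D * (2 * D) = (1 + 10 * G) * D ^+ 2 by ring.
  by apply: ler_wpM2r; [exact: sqr_ge0|move: GG hG; clear; lra].
have q2 : 8 * (D * (G * s ^+ 2)) + G * D * (`|im w| * s ^+ 2) + G * D * (12 * s ^+ 2)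
   + G * D * (4 * (G * s ^+ 2)) <= 24 * G ^+ 2 * (D * ((1 + `|im w|) * s ^+ 2)).
  have -> : 8 * (D * (G * s ^+ 2)) + G * D * (`|im w| * s ^+ 2) + G * D * (12 * s ^+ 2)
   + G * D * (4 * (G * s ^+ 2)) =
    (20 * G + 4 * G ^+ 2 + G * `|im w|) * (D * s ^+ 2) by ring.
  have -> : 24 * G ^+ 2 * (D * ((1 + `|im w|) * s ^+ 2)) =
    (24 * G ^+ 2 * (1 + `|im w|)) * (D * s ^+ 2) by ring.
  apply: ler_wpM2r; first by apply: mulr_ge0; [exact: ltW|exact: sqr_ge0].
  by move: (ler_wpM2r i0 GG) (mulr_ge0 (sqr_ge0 G) i0) (GG) (hG) (sqr_ge0 G); clear; lra.
by move: q1 q2; clear; lra.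
Qed.

End gate_potential.

(** * Drift of the potential along an orbit; orbits that never return *)

Section gate_orbits.
Variable R : realType.
Implicit Types (G A : R) (d g : R[i]) (w : nat -> R[i]).

(** Each term (1 + |Im w|) / |w|^2 of the error is at most 12 times an increment of the bounded
    function [gate_fn], up to O(|d|). Multiplied by |d| and summed, it gives O(|d|) from telescoping
    and O(k |d|^2) from the rest. *)
Lemma gate_drift G : 1 <= G -> exists2 C : R, 0 <= C & forall d g w k,
  nm g <= G -> d != 0 -> nm d <= 1/32 ->
  (forall j, (j < k)%N -> [/\ 32 * G <= nm (w j), 1/4 <= nm (1 + d * w j) &
     gate_rel G d g (w j) (w j.+1)]) ->
  `|gate_pot d g (w k) - gate_pot d g (w 0%N) - k%:R * ln (nm (gate_mult d))|
    <= C * (nm d + k%:R * nm d ^+ 2).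
Proof.
move=> G1; pose K := gate_weight G.
have K0 : 1 <= K by rewrite /K /gate_weight; lra.
pose C0 := 40 * K + 100.
pose B := 24 * G ^+ 2; have B0 : 0 <= B by rewrite mulr_ge0// sqr_ge0.
exists (B * (1 + 12 * C0 + 24 * (K + 1))).
  by rewrite mulr_ge0// /C0; lra.
move=> d g w k gG d0 d1 H; set L := ln _; set D := nm d.
have D0 : 0 < D by rewrite nm_gt0.
suff main : `|gate_pot d g (w k) - gate_pot d g (w 0%N) - k%:R * L| <=
    B * (k%:R * D ^+ 2 + D * (12 * (gate_fn G D (w k) - gate_fn G D (w 0%N) + k%:R * (C0 * D)))).
  apply: (le_trans main).
  have := gate_fn_bound (w k) G1 (ltW D0); have := gate_fn_bound (w 0%N) G1 (ltW D0).
  rewrite -/K !ler_norml => /andP[b1 b2] /andP[b3 b4].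
  rewrite -mulrA ler_wpM2l//.
  have k0 : 0 <= k%:R :> R by rewrite ler0n.
  have q : D * (gate_fn G D (w k) - gate_fn G D (w 0%N)) <= D * (2 * (K + 1)).
    by rewrite ler_pM2l//; lra.
  have z1 : 0 <= k%:R * D ^+ 2 * (K + 1) by rewrite !mulr_ge0 ?sqr_ge0//; lra.
  have z2 : 0 <= D * C0 by rewrite mulr_ge0 ?(ltW D0)// /C0; lra.
  by move: q z1 z2 D0; rewrite /C0; clear; nra.
elim: k H => [|k IH] H.
  by rewrite !subrr !mul0r !subrr normr0 addr0 !mulr0 addr0 mulr0.
have {}IH := IH (fun j hj => H j (ltnW hj)).
have [h1 h2 h3] := H k (leqnn _).
have st := gate_pot_step G1 gG d0 d1 h1 h3 h2.
have ly := gate_fn_step G1 D0 d1 h1 (gate_rel_near G1 gG d1 h1 h3).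
rewrite -/K -/C0 -/D -/L -/B in st ly.
have y : D * ((1 + `|im (w k)|) / nm (w k) ^+ 2) <=
  D * (12 * (gate_fn G D (w k.+1) - gate_fn G D (w k) + C0 * D)).
  rewrite ler_pM2l//.
  have e : (1 + `|im (w k)|) / (12 * nm (w k) ^+ 2) = (1 + `|im (w k)|) / nm (w k) ^+ 2 / 12.
    by rewrite invfM mulrCA mulrC.
  by move: ly; rewrite e; clear; lra.
have := le_trans st (ler_wpM2l B0 (lerD (lexx (D ^+ 2)) y)).
move: IH; rewrite -[k.+1%:R]natr1 !ler_norml => /andP[i1 i2] /andP[s1 s2].
by apply/andP; split; move: i1 i2 s1 s2; clear; lra.
Qed.

Lemma gate_pot_small G A d g (z : R[i]) : nm g <= G -> d != 0 ->
  1 <= nm z -> nm z <= A -> nm d * A <= 1/8 ->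
  `|gate_pot d g z| <= (2 * A + G * A) * nm d.
Proof.
move=> gG d0 z1 zA dA.
have D0 : 0 < nm d by rewrite nm_gt0.
have dz : nm (d * z) <= nm d * A by rewrite nmM ler_pM2l.
have h := ln_nm1D (le_trans dz dA).
have l0 : 0 <= ln (nm z) by exact: ln_ge0.
have l1 : ln (nm z) <= A by apply: le_trans zA; apply/ltW/ln_sublinear; lra.
have hgd : `|re (g * d)| <= G * nm d.
  by rewrite (le_trans (re_nm _))// nmM ler_pM2r.
have p1 : `|re (g * d) * ln (nm z)| <= G * nm d * A.
  by rewrite normrM ler_pM// ger0_norm.
have p2 : `|ln (nm (1 + d * z))| <= 2 * (nm d * A).
  have r := re_nm (d * z); have n0 := nm_ge0 (d * z).
  move: h r dz dA n0; rewrite !ler_norml => /andP[? ?] /andP[? ?] ? ? ?.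
  by apply/andP; split; nra.
rewrite /gate_pot (le_trans (ler_normB _ _))//.
by move: p1 p2; clear; lra.
Qed.

(* [re w0 >= -|w0|/4] guarantees that a drift by +1 at each step does not
   bring the orbit back towards the origin. *)
Definition wide_start G A (z : R[i]) :=
  [/\ 80 * G <= nm z, nm z <= A & - (nm z / 4) <= re z].

(** The relation is asked only while the orbit has stayed outside the disc of radius 40 G, because w
    comes from a chart that is valid only near z = 0. *)
Definition gate_orbit G d g w := forall j,
  (forall i, (i <= j)%N -> 40 * G <= nm (w i)) -> gate_rel G d g (w j) (w j.+1).

Lemma wide_translate (z : R[i]) (t : R) : 0 <= t -> - (nm z / 4) <= re z ->
  6/10 * (nm z + t) <= nm (z + t%:C).
Proof.
move=> t0 hz; have z0 := nm_ge0 z.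
rewrite -(@ler_pXn2r _ 2) ?nnegrE ?nm_ge0 ?mulr_ge0 ?addr_ge0//.
rewrite nm_sqr reD imD /= addr0.
have s := nm_sqr z; have h1 := mulr_ge0 t0 z0.
have h2 : 0 <= re z + nm z / 4 by lra.
have h3 := mulr_ge0 t0 h2; have h4 := sqr_ge0 (nm z - t).
have -> : (re z + t) ^+ 2 + im z ^+ 2 = nm z ^+ 2 + 2 * (t * re z) + t ^+ 2.
  by rewrite s; ring.
by move: h1 h3 h4; clear; lra.
Qed.

(** While k |d| <= 1/100 each step is a translation by 1 up to 1/10, and from a wide start such
    steps cannot bring the orbit back. *)
Lemma gate_start G A d g w k : 1 <= G -> nm g <= G -> d != 0 ->
  wide_start G A (w 0%N) -> gate_orbit G d g w ->
  nm d * (A + 1) <= 1/100 -> k%:R * nm d <= 1/100 ->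
  (nm (w 0%N) + k%:R) / 2 <= nm (w k) /\ nm (w k) <= nm (w 0%N) + 2 * k%:R.
Proof.
move=> G1 gG d0 [a1 a2 a3] orb dA.
set D := nm d in dA *; set a := nm (w 0%N) in a1 a2 a3 *.
have D0 : 0 < D by rewrite nm_gt0.
have d1 : D <= 1/32 by move: D0 dA a1 a2 G1; clear; nra.
suff H : k%:R * D <= 1/100 -> nm (w k - (w 0%N + k%:R%:C)) <= k%:R / 10 /\
   forall i, (i <= k)%N -> (a + i%:R) / 2 <= nm (w i).
  move=> /H[h1 h2]; split; first exact: h2.
  have -> : w k = (w k - (w 0%N + k%:R%:C)) + (w 0%N + k%:R%:C) by ring.
  rewrite (le_trans (nmD _ _))//.
  have := nmD (w 0%N) k%:R%:C; rewrite nm_real ger0_norm ?ler0n//.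
  by have := ler0n R k; rewrite -/a; move: h1; clear; lra.
elim: k => [_|k IH hk].
  split; first by rewrite /= addr0 subrr nm0 mul0r.
  by move=> i; rewrite leqn0 => /eqP->; rewrite addr0 -/a; move: a1 G1; clear; lra.
have kk : k%:R * D <= 1/100.
  by apply: le_trans hk; rewrite ler_pM2r// ler_nat.
have [h1 h2] := IH kk.
have k0 : 0 <= k%:R :> R by rewrite ler0n.
have big i : (i <= k)%N -> 40 * G <= nm (w i).
  by move=> /h2; have := ler0n R i; move: a1; clear; lra.
have rel := orb k big.
have rk : 32 * G <= nm (w k) by have := big k (leqnn _); move: G1; clear; lra.
have near := gate_rel_near G1 gG d1 rk rel.
have up : nm (w k) <= a + k%:R * (11/10).
  have -> : w k = (w k - (w 0%N + k%:R%:C)) + (w 0%N + k%:R%:C) by ring.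
  rewrite (le_trans (nmD _ _))//.
  have := nmD (w 0%N) k%:R%:C; rewrite nm_real ger0_norm ?ler0n//.
  by rewrite -/a; move: h1; clear; lra.
have e1 : 2 * G / nm (w k) <= 1/20.
  have := big k (leqnn _) => bk.
  by rewrite ler_pdivrMr; move: bk G1; clear; lra.
have e2 : 2 * D * nm (w k) + 2 * D <= 1/20.
  have : D * nm (w k) <= D * (a + k%:R * (11/10)) by rewrite ler_pM2l.
  have : D * a <= D * A by rewrite ler_pM2l.
  by move: kk dA; clear; lra.
have new : nm (w k.+1 - (w 0%N + k.+1%:R%:C)) <= k.+1%:R / 10.
  have -> : w k.+1 - (w 0%N + k.+1%:R%:C) =
     (w k.+1 - w k - 1) + (w k - (w 0%N + k%:R%:C)).
    by rewrite -natr1 rmorphD rmorph1; ring.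
  rewrite (le_trans (nmD _ _))// -natr1.
  by move: near e1 e2 h1; rewrite -/D; clear; lra.
split=> // i; rewrite leq_eqVlt => /predU1P[->|]; last exact: h2.
have -> : w k.+1 = (w 0%N + k.+1%:R%:C) + (w k.+1 - (w 0%N + k.+1%:R%:C)) by ring.
have wd := wide_translate (ler0n R k.+1) a3.
have := nm_leD (w 0%N + k.+1%:R%:C) (w k.+1 - (w 0%N + k.+1%:R%:C)).
by rewrite -/a in wd; have := nm_ge0 (w 0%N); rewrite -/a; move: wd new; clear; lra.
Qed.

Lemma mul_ln_small (e : R) : 0 < e -> exists2 s : R, 0 < s &
  forall D : R, 0 < D -> D < s -> D * ln (2 / D) <= e.
Proof.
move=> e0; exists (e ^+ 2 / 8); first by rewrite divr_gt0// exprn_gt0.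
move=> D D0 De; set y := Num.sqrt (2 / D).
have q0 : 0 < 2 / D by rewrite divr_gt0.
have y0 : 0 < y by rewrite sqrtr_gt0.
have y2 : y ^+ 2 = 2 / D by rewrite sqr_sqrtr// ltW.
have l : ln (2 / D) <= 2 * y.
  by rewrite -y2 lnXn// mulr2n; have := ln_sublinear y0; lra.
have Dy : D * y ^+ 2 = 2 by rewrite y2; field; rewrite gt_eqF.
have : 4 <= e * y.
  rewrite -(@ler_pXn2r _ 2) ?nnegrE ?mulr_ge0 ?(ltW e0) ?(ltW y0)//.
  rewrite exprMn.
  have : D * y ^+ 2 < e ^+ 2 / 8 * y ^+ 2 by rewrite ltr_pM2r// exprn_gt0.
  by rewrite Dy; lra.
move=> h; rewrite -(@ler_pM2r _ y)//.
have h2 : D * ln (2 / D) * y <= D * (2 * y) * y.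
  by rewrite ler_pM2r// ler_pM2l.
by move: h2 Dy h; clear; nra.
Qed.

Lemma re_inv d : d != 0 -> re d = re d^-1 * nm d ^+ 2.
Proof.
move=> d0; rewrite reV -mulrA mulVf ?mulr1// expf_neq0//.
by rewrite nm_eq0.
Qed.

(* With large negative [re d^-1] the disc [|zeta| <= 1/2] is a trap. *)
Lemma gate_trap G d g (z z' : R[i]) : 1 <= G -> nm g <= G -> d != 0 -> nm d <= 1/32 ->
  128 * G * nm d <= 1 -> re d^-1 <= - (24 * G) ->
  gate_rel G d g z z' -> nm (1 + d * z) <= 1/2 -> nm (1 + d * z') <= 1/2.
Proof.
move=> G1 gG d0 d1 dG X rel hz.
have D0 : 0 < nm d by rewrite nm_gt0.
have rd := re_inv d0.
have z2 : 1/2 <= nm d * nm z.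
  rewrite -nmM; have := nm_leB (1 + d * z) 1; have := nm_leB 1 (1 + d * z).
  have -> : 1 - (1 + d * z) = - (d * z) by ring.
  by rewrite nm1 nmN; move: hz; clear; lra.
have nz0 : 0 < nm z.
  by rewrite ltNge; apply/negP => h; move: z2 (nm_ge0 z) D0; nra.
have iz : (nm z)^-1 <= 2 * nm d.
  by rewrite -div1r ler_pdivrMr//; move: z2; clear; lra.
have iz0 : 0 < (nm z)^-1 by rewrite invr_gt0.
have z0 : z != 0 by rewrite -nm_gt0.
have [e z'E he] := gate_relE rel.
have h1B := gate_1B_neq0 d1.
have -> : 1 + d * z' = gate_mult d * (1 + d * z) + d * (g / z + e).
  by rewrite z'E /gate_mult; field; rewrite h1B z0.
have hM : nm (gate_mult d) * (1 + 10 * G * nm d ^+ 2) <= 1.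
  rewrite /gate_mult nmV mulrC ler_pdivrMr ?mul1r ?nm_gt0//.
  rewrite -(@ler_pXn2r _ 2) ?nnegrE ?nm_ge0//; last first.
    by rewrite addr_ge0// !mulr_ge0 ?sqr_ge0//; lra.
  rewrite [X in _ <= X]nm_sqr reB imB /= sub0r sqrrN.
  have s := nm_sqr d; have D2 : 0 < nm d ^+ 2 by rewrite exprn_gt0.
  have q : G * nm d ^+ 2 <= 1/128 * (1/32).
    have -> : G * nm d ^+ 2 = (G * nm d) * nm d by ring.
    by apply: ler_pM; rewrite ?mulr_ge0 ?nm_ge0//; move: dG d1 G1; clear; lra.
  have rd2 : re d <= - (24 * G) * nm d ^+ 2 by rewrite rd ler_pM2r.
  have q2 : (G * nm d ^+ 2) * (G * nm d ^+ 2) <= (G * nm d ^+ 2) * (1/128 * (1/32)).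
    by rewrite ler_wpM2l// mulr_ge0 ?ltW//; lra.
  have -> : (1 - re d) ^+ 2 + im d ^+ 2 = 1 - 2 * re d + nm d ^+ 2 by rewrite s; ring.
  have q0 : 0 <= G * nm d ^+ 2 by rewrite mulr_ge0 ?ltW//; lra.
  by move: rd2 q2 q D2 q0; clear; nra.
have he2 : nm (d * (g / z + e)) <= nm d ^+ 2 * (3 * G).
  rewrite nmM expr2 -mulrA ler_pM2l// (le_trans (nmD _ _))//.
  have a1 : nm (g / z) <= G * (2 * nm d).
    rewrite nm_div; apply: ler_pM; rewrite ?nm_ge0//; exact: ltW.
  have a2 : nm e <= G * nm d.
    apply: (le_trans he); rewrite ler_wpM2l//; first by lra.
    rewrite -exprVn expr2.
    have : (nm z)^-1 * (nm z)^-1 <= (2 * nm d) * (2 * nm d) by apply: ler_pM => //; exact: ltW.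
    by move: d1 D0; clear; nra.
  by move: a1 a2; clear; lra.
rewrite (le_trans (nmD _ _))// nmM.
have D2 : 0 < nm d ^+ 2 by rewrite exprn_gt0.
have GD : 0 < G * nm d ^+ 2 by rewrite mulr_gt0//; lra.
have m0 := nm_ge0 (gate_mult d).
have p : nm (gate_mult d) * nm (1 + d * z) <= nm (gate_mult d) * (1/2) by rewrite ler_wpM2l.
have q : G * nm d ^+ 2 <= 1/128 * (1/32).
  have -> : G * nm d ^+ 2 = (G * nm d) * nm d by ring.
  by apply: ler_pM; rewrite ?mulr_ge0 ?nm_ge0//; move: dG d1 G1; clear; lra.
have mm : nm (gate_mult d) <= 1 - 10 * (G * nm d ^+ 2) + 100 * (G * nm d ^+ 2) * (1/128).
  have t0 : 0 < 1 + 10 * G * nm d ^+ 2 by rewrite -mulrA; lra.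
  rewrite -(ler_pM2r t0) (le_trans hM)//.
  by move: GD q; clear; nra.
by move: p mm he2 GD; clear; lra.
Qed.

(** Let k be the first index inside the disc of radius 40 G; the start forces k |d| > 1/100. Before
    k, zeta cannot become small: if Re (1 / d) > 0 the potential would have to drop although it
    drifts upwards, and if Re (1 / d) < 0 the orbit would be caught in the trap, where w is large.
    So the drift estimate holds up to k. The potential is O(|d|) at both ends, and k |ln |M|| <=
    O(|d|) + C k |d|^2 contradicts |ln |M|| >= (T - 3) |d|^2. *)
Lemma gate_stay G A : 1 <= G -> exists T s : R, 0 < s /\ forall d g w,
  nm g <= G -> d != 0 -> nm d < s -> T <= `|re d^-1| ->
  wide_start G A (w 0%N) -> gate_orbit G d g w -> forall j, 40 * G <= nm (w j).
Proof.
move=> G1; have [C C0 drift] := gate_drift G1.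
have [|s1 s10 hs1] := @mul_ln_small (1 / (4 * G)); first by rewrite divr_gt0//; lra.
pose E := 2 * `|A| + G * `|A|; pose E' := 2 * (40 * G) + G * (40 * G).
have A0 := normr_ge0 A.
have GA0 : 0 <= G * `|A| by rewrite mulr_ge0//; lra.
have GG0 : 0 <= G * (40 * G) by nra.
(* The factor 100 inverts the bound 1/100 < k |d|; 24 G is the threshold of [gate_trap], and 3 the
   constant of [ln_gate_mult]. *)
pose T := 3 + C + 24 * G + 100 * (C + E + E' + 1).
pose s2 := 1 / (1000 * (1 + `|A| + G + C + E)).
have E0 : 0 <= E by move: A0 GA0; rewrite /E; clear; lra.
have E0' : 0 <= E' by move: GG0 G1; rewrite /E'; clear; lra.
have p0 : 0 < 1000 * (1 + `|A| + G + C + E) by move: A0 C0 E0 G1; clear; lra.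
have s20 : 0 < s2 by rewrite divr_gt0.
exists T, (Num.min s1 s2); split; first by rewrite lt_min s10.
move=> d g w gG d0; rewrite lt_min => /andP[ds1 ds2] XT wide orb.
have D0 : 0 < nm d by rewrite nm_gt0.
have [a1 a2 a3] := wide.
have aA : A <= `|A| := ler_norm A.
have DD : nm d * (1 + `|A| + G + C + E) <= 1/1000.
  by move: ds2; rewrite /s2 ltr_pdivlMr//; clear; lra.
have DA : nm d * `|A| <= 1/1000 by move: DD D0 A0 C0 E0 G1; clear; nra.
have DG : nm d * G <= 1/1000 by move: DD D0 A0 C0 E0 G1; clear; nra.
have DC : nm d * C <= 1/1000 by move: DD D0 A0 C0 E0 G1; clear; nra.
have DE : nm d * E <= 1/1000 by move: DD D0 A0 C0 E0 G1; clear; nra.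
have d1 : nm d <= 1/1000 by move: DG D0 G1; clear; nra.
have d32 : nm d <= 1/32 by move: d1; clear; lra.
have small : nm d * (A + 1) <= 1/100.
  have : nm d * A <= nm d * `|A| by rewrite ler_pM2l.
  by move: DA d1; clear; lra.
pose bad k := nm (w k) < 40 * G.
move=> j0; rewrite leNgt; apply/negP => hj0.
have ex : exists k, bad k by exists j0.
case: (ex_minnP ex) => k bk kmin {j0 hj0 ex}; rewrite /bad in bk kmin.
have good i : (i < k)%N -> 40 * G <= nm (w i).
  by move=> ik; rewrite leNgt; apply/negP => /kmin; rewrite leqNgt ik.
have rel i : (i < k)%N -> gate_rel G d g (w i) (w i.+1).
  by move=> ik; apply: orb => l li; apply: good; exact: leq_ltn_trans li ik.
have good32 i : (i < k)%N -> 32 * G <= nm (w i).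
  by move=> /good; move: G1; clear; lra.
have kD : 1/100 < k%:R * nm d.
  rewrite ltNge; apply/negP => h.
  have [h1 _] := gate_start G1 gG d0 wide orb small h.
  by have := ler0n R k; move: h1 a1 bk G1; clear; lra.
have k0 : (0 < k)%N.
  by rewrite lt0n; apply/eqP => k0; move: kD; rewrite k0 mul0r; clear; lra.
have low : 30 * G <= nm (w k).
  have k1 : (k.-1 < k)%N by rewrite prednK.
  have g1 := good _ k1; have g3 := good32 _ k1; have r1 := rel _ k1.
  have nr := gate_rel_near G1 gG d32 g3 r1; rewrite prednK// in nr.
  have e : 2 * G / nm (w k.-1) <= 1 / 20.
    by rewrite ler_pdivrMr; move: g1 G1; clear; lra.
  have -> : w k = w k.-1 + (1 + (w k - w k.-1 - 1)) by ring.
  have h1 := nm_leD (w k.-1) (1 + (w k - w k.-1 - 1)).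
  have h2 := nmD 1 (w k - w k.-1 - 1); rewrite nm1 in h2.
  have h3 : nm d * nm (w k.-1) <= 1/1000 * nm (w k.-1) by rewrite ler_wpM2r// nm_ge0.
  by move: h1 h2 h3 nr e g1 d1 G1; clear; lra.
have pot0 : `|gate_pot d g (w 0%N)| <= E * nm d.
  apply: gate_pot_small => //; first by move: a1 G1; clear; lra.
  - exact: le_trans a2 aA.
  - by move: DA; clear; lra.
have potk : `|gate_pot d g (w k)| <= E' * nm d.
  apply: gate_pot_small => //; first by move: low G1; clear; lra.
  - exact: ltW.
  - by move: DG; clear; lra.
have rd := re_inv d0.
have lM := ln_gate_mult d32.
set L := ln _ in lM; set X := re d^-1 in XT rd.
have D2 : 0 < nm d ^+ 2 by rewrite exprn_gt0.
have zeta i : (i < k)%N -> 1/4 <= nm (1 + d * w i).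
  rewrite leNgt => ik; apply/negP => hi.
  have ex : exists j, (j < k)%N && (nm (1 + d * w j) < 1/4) by exists i; rewrite ik.
  case: (ex_minnP ex) => j /andP[jk hj] jmin {i ik hi ex}.
  have zi i : (i < j)%N -> 1/4 <= nm (1 + d * w i).
    move=> ij; rewrite leNgt; apply/negP => h; have := jmin i.
    by rewrite (ltn_trans ij jk) h => /(_ isT); rewrite leqNgt ij.
  have [Xn|Xp] := leP X 0.
    have Xn' : X <= - (24 * G).
      by move: XT; rewrite (ler0_norm Xn) /T; move: C0 E0 E0' G1; clear; lra.
    have hj2 : nm (1 + d * w j) <= 1/2 by move: hj; clear; lra.
    have trap i : (j <= i)%N -> (i <= k)%N -> nm (1 + d * w i) <= 1/2.
      elim: i => [|i IH]; first by rewrite leqn0 => /eqP e0 _; move: hj2; rewrite e0.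
      rewrite leq_eqVlt => /predU1P[<- _//|ji ik].
      have dG : 128 * G * nm d <= 1 by move: DG; clear; lra.
      by apply: (gate_trap G1 gG d0 d32 dG Xn' (rel _ ik)); apply: IH => //; exact: ltnW.
    have := trap k (ltnW jk) (leqnn k).
    have := nm_leB 1 (1 + d * w k).
    have -> : 1 - (1 + d * w k) = - (d * w k) by ring.
    have : nm d * nm (w k) <= nm d * (40 * G) by rewrite ler_pM2l// ltW.
    by rewrite nm1 nmN nmM; move: DG; clear; lra.
  have Xp' : 3 + C <= X.
    by move: XT; rewrite (gtr0_norm Xp) /T; move: C0 E0 E0' G1; clear; lra.
  have := drift d g w j gG d0 d32 (fun i ij =>
    And3 (good32 i (ltn_trans ij jk)) (zi i ij) (rel i (ltn_trans ij jk))).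
  rewrite -/L; move: pot0 lM; rewrite !ler_norml => /andP[p1 p2] /andP[l1 l2] /andP[q1 q2].
  have Lp : C * nm d ^+ 2 <= L.
    have : (3 + C) * nm d ^+ 2 <= X * nm d ^+ 2 by rewrite ler_pM2r.
    by rewrite rd in l1 l2; move: l1; clear; lra.
  have jL : j%:R * (C * nm d ^+ 2) <= j%:R * L by rewrite ler_wpM2l.
  have potj : - (1/100) <= gate_pot d g (w j).
    by move: jL q1 p1 DC DE; clear; lra.
  move: potj; apply/negP; rewrite -ltNge /gate_pot.
  have gj := good _ jk.
  have wj0 : 1 <= nm (w j) by move: gj G1; clear; lra.
  have wj : nm (w j) <= 2 / nm d.
    rewrite ler_pdivlMr// mulrC -nmM.
    have := nmB (1 + d * w j) 1; have -> : 1 + d * w j - 1 = d * w j by ring.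
    by rewrite nm1; move: hj; clear; lra.
  have l1' : `|re (g * d) * ln (nm (w j))| <= 1/4.
    rewrite normrM (@ger0_norm _ (ln _)); last by exact: ln_ge0.
    have h1 : `|re (g * d)| <= G * nm d.
      by rewrite (le_trans (re_nm _))// nmM ler_pM2r.
    have h2 : ln (nm (w j)) <= ln (2 / nm d).
      by rewrite ler_ln ?posrE ?divr_gt0//; apply: lt_le_trans wj0.
    have h3 := hs1 _ D0 ds1.
    apply: (@le_trans _ _ (G * (nm d * ln (2 / nm d)))).
      by rewrite mulrA; apply: ler_pM => //; exact: ln_ge0.
    have G0 : 0 < G by move: G1; clear; lra.
    have := ler_wpM2l (ltW G0) h3.
    by have -> : G * (1 / (4 * G)) = 1/4 by field; rewrite gt_eqF.
  have lz : ln (nm (1 + d * w j)) <= - (3/4).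
    have [z0|z0] := ltP 0 (nm (1 + d * w j)).
      have -> : nm (1 + d * w j) = 1 + (nm (1 + d * w j) - 1) by ring.
      by rewrite (le_trans (le_ln1Dx _))//; move: hj z0; clear; lra.
    (* The logarithm estimate needs zeta nonzero. At j = 0 zeta is close to 1; later, |zeta| was at
       least 1/4 one step before, and a single step moves zeta by much less than that modulus. *)
    exfalso; have [j0|j0] := posnP j.
      move: hj; rewrite j0 => hj.
      have := nm_leB 1 (- (d * w 0%N)); rewrite opprK nmN nmM nm1.
      have : nm d * nm (w 0%N) <= nm d * A by rewrite ler_pM2l.
      by move: small D0 hj; clear; nra.
    have j1 : (j.-1 < j)%N by rewrite prednK.
    have j1k : (j.-1 < k)%N := ltn_trans j1 jk.
    have nr := gate_rel_near G1 gG d32 (good32 _ j1k) (rel _ j1k).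
    rewrite prednK// in nr; have zz := zi _ j1.
    have e : 2 * G / nm (w j.-1) <= 1 / 20.
      have g1 := good _ j1k.
      by rewrite ler_pdivrMr; move: g1 G1; clear; lra.
    have up : nm d * nm (w j.-1) <= nm (1 + d * w j.-1) + 1.
      have := nmB (1 + d * w j.-1) 1; rewrite nm1 -nmM.
      by have -> : 1 + d * w j.-1 - 1 = d * w j.-1 by ring.
    have h1 : nm (d * (w j - w j.-1)) <=
        nm d * (2 * nm d * nm (w j.-1) + 2 * nm d + 1/20 + 1).
      rewrite nmM ler_pM2l//.
      have -> : w j - w j.-1 = (w j - w j.-1 - 1) + 1 by ring.
      by rewrite (le_trans (nmD _ _))// nm1; move: nr e; clear; lra.
    have h2 : nm d * (nm d * nm (w j.-1)) <= 1/1000 * (nm (1 + d * w j.-1) + 1).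
      by apply: ler_pM; rewrite ?mulr_ge0 ?nm_ge0.
    have h3 : nm d * nm d <= 1/1000 * (1/1000) by apply: ler_pM; rewrite ?nm_ge0.
    have := nm_leB (1 + d * w j.-1) (- (d * (w j - w j.-1))).
    rewrite opprK nmN; have -> : 1 + d * w j.-1 + d * (w j - w j.-1) = 1 + d * w j by ring.
    by move: z0 zz h1 h2 h3 d1; clear; lra.
  by move: l1' lz; rewrite ler_norml => /andP[u v]; move: u v; clear; lra.
have := drift d g w k gG d0 d32 (fun i ij => And3 (good32 i ij) (zeta i ij) (rel i ij)).
rewrite -/L => fin.
have kL : `|k%:R * L| <= (E + E' + C) * nm d + C * k%:R * nm d ^+ 2.
  have -> : k%:R * L = - (gate_pot d g (w k) - gate_pot d g (w 0%N) - k%:R * L)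
      + gate_pot d g (w k) - gate_pot d g (w 0%N) by ring.
  rewrite (le_trans (ler_normB _ _))// (le_trans (lerD (ler_normD _ _) (lexx _)))//.
  by rewrite normrN; move: fin pot0 potk; clear; lra.
have LX : (T - 3) * nm d ^+ 2 <= `|L|.
  have h : `|X| * nm d ^+ 2 <= `|L| + 3 * nm d ^+ 2.
    rewrite -[nm d ^+ 2]ger0_norm ?sqr_ge0// -normrM -rd (ger0_norm (sqr_ge0 _)).
    have -> : re d = L - (L - re d) by ring.
    by rewrite (le_trans (ler_normB _ _))// lerD2l.
  have := ler_wpM2r (ltW D2) XT; move: h; clear; lra.
rewrite normrM ger0_norm ?ler0n// in kL.
have kp : 0 < k%:R :> R by rewrite ltr0n.
have m1 : k%:R * ((T - 3) * nm d ^+ 2) <= k%:R * `|L| by rewrite ler_pM2l.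
have m2 : (k%:R * nm d) * (100 * (C + E + E' + 1)) <= E + E' + C.
  rewrite -(ler_pM2r D0).
  have g24 : 0 <= 24 * G by move: G1; clear; lra.
  have := mulr_ge0 (mulr_ge0 (ltW kp) (ltW D2)) g24.
  by move: m1 kL; rewrite /T; clear; lra.
have m3 : 1/100 * (100 * (C + E + E' + 1)) <= (k%:R * nm d) * (100 * (C + E + E' + 1)).
  rewrite ler_wpM2r//; last exact: ltW.
  by move: C0 E0 E0' G1; clear; lra.
by move: m2 m3; clear; lra.
Qed.

End gate_orbits.

(** * One full turn of a rotation by a small angle *)

Section rotation.
Variable R : realType.
Implicit Types (x y : R) (u : R[i]).

Lemma sin_mvt x : 0 <= x -> exists2 c, 0 <= c <= x & sin x = cos c * x.
Proof.
move=> x0.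
have [|c] := @MVT_segment R (@sin R) (@cos R) 0 x x0 (fun y _ => is_derive_sin y).
  by apply: continuous_subspaceT => y; exact: continuous_sin.
by rewrite in_itv /= => cx; rewrite sin0 !subr0 => e; exists c.
Qed.

Lemma sin_le x : 0 <= x -> sin x <= x.
Proof. by move=> x0; have [c _ ->] := sin_mvt x0; have := cos_le1 c; nra. Qed.

Lemma cos_ge x : 0 <= x -> x <= 1 -> 1 - x ^+ 2 / 2 <= cos x.
Proof.
move=> x0 x1.
have e : cos x = 1 - 2 * sin (x / 2) ^+ 2.
  have -> : cos x = cos ((x / 2) *+ 2) by congr cos; rewrite mulr2n; lra.
  by rewrite cos_mulr2n cos2sin2 !mulr2n; lra.
have h0 : 0 <= sin (x / 2) by apply: sin_ge0_pi; have := @pi_ge2 R; lra.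
have h1 : sin (x / 2) <= x / 2 by apply: sin_le; lra.
by rewrite e; nra.
Qed.

Lemma sin_ge x : 0 <= x -> x <= 1 -> x / 2 <= sin x.
Proof.
move=> x0 x1; have [c /andP[c0 cx] ->] := sin_mvt x0.
have := cos_ge c0 (le_trans cx x1); nra.
Qed.

Lemma cis0 : cis 0 = 1 :> R[i].
Proof. by rewrite /cis cos0 sin0. Qed.

Lemma cisD x y : cis (x + y) = cis x * cis y.
Proof. by rewrite /cis cosD sinD; simpc; congr (_ +i* _); ring. Qed.

Lemma cisMn x n : cis (n%:R * x) = cis x ^+ n.
Proof.
by elim: n => [|n IH]; rewrite ?mul0r ?cis0// exprS -natr1 mulrDl mul1r cisD IH mulrC.
Qed.

Lemma nm_cis x : nm (cis x) = 1.
Proof. by rewrite /cis /nm cos2Dsin2 sqrtr1. Qed.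

Lemma nm_cisB1 x : `|x| <= 1 -> nm (cis x - 1) <= 2 * `|x|.
Proof.
have main y : 0 <= y -> y <= 1 -> nm (cis y - 1) <= 2 * y.
  move=> y0 y1; apply: le_trans (nm_reim _) _.
  rewrite reB imB /= subr0.
  have := cos_ge y0 y1; have := cos_le1 y; have := sin_le y0.
  have h : 0 <= sin y by apply: sin_ge0_pi; have := @pi_ge2 R; lra.
  rewrite (ger0_norm h) => h1 h2 h3; rewrite ler0_norm; nra.
move=> x1; have [x0|x0] := leP 0 x; first by rewrite ger0_norm// main// -[x]ger0_norm.
have -> : nm (cis x - 1) = nm (cis (- x) - 1).
  have e v : nm v = Num.sqrt (re v ^+ 2 + im v ^+ 2) by case: v.
  by rewrite !e !reB !imB /= cosN sinN !subr0 sqrrN.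
by rewrite ltr0_norm// main; [|lra|rewrite -ltr0_norm].
Qed.

Lemma unit_angle u : nm u = 1 -> 0 < re u -> im u != 0 -> `|im u| <= 1/4 ->
  exists s a : R, [/\ (s = 1 \/ s = -1), `|im u| <= a, a <= 2 * `|im u|,
    im u = s * `|im u| & forall n, u ^+ n = cos (n%:R * a) +i* (s * sin (n%:R * a))].
Proof.
move=> u1 ru iu0; have [y ey] : exists y, y = `|im u| by exists `|im u|.
have : 0 < `|im u| by rewrite normr_gt0.
rewrite -ey => y0 y4.
have y1 : -1 <= y <= 1 by apply/andP; split; lra.
have pi2 := @pi_ge2 R.
have h1 : asin y \in `[- (pi / 2), pi / 2].
  by rewrite in_itv /= asin_geNpi2// asin_lepi2.
have ea : sin (asin y) = y by apply: asinK; rewrite in_itv.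
have cy := cos_asin y1.
move: (asin y) h1 ea cy => a h1 ea cy.
have b1 : a < 1.
  have h2 : 1 \in `[- (pi / 2), (pi : R) / 2] by rewrite in_itv /=; apply/andP; split; lra.
  rewrite -(ltr_sin h1 h2) ea.
  have := @sin_ge 1 ler01 (lexx _); lra.
have b0 : 0 < a.
  have h2 : 0 \in `[- (pi / 2), (pi : R) / 2] by rewrite in_itv /=; apply/andP; split; lra.
  by rewrite -(ltr_sin h2 h1) ea sin0.
have re2 : re u = cos a.
  have : nm u ^+ 2 = 1 by rewrite u1 expr1n.
  rewrite nm_sqr -[im u ^+ 2]real_normK ?num_real// -ey => h.
  by rewrite cy -[LHS]gtr0_norm// -sqrtr_sqr; congr Num.sqrt; lra.
have [s [hs e]] : exists s : R, (s = 1 \/ s = -1) /\ im u = s * y.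
  have [i0|i0] := leP 0 (im u).
    by exists 1; split; [left|rewrite mul1r ey ger0_norm].
  by exists (-1); split; [right|rewrite mulN1r ey ltr0_norm// opprK].
exists s, a; split=> //.
- by rewrite -ea; apply: sin_le; exact: ltW.
- have := sin_ge (ltW b0) (ltW b1); lra.
have uE : u = re u +i* im u by case: (u).
move=> n; rewrite uE e re2 -ea.
case: hs => ->; first by rewrite !mul1r -[_ +i* _]/(cis a) -cisMn.
rewrite !mulN1r -sinN -cosN -[_ +i* _]/(cis (- a)) -cisMn /cis mulrN.
by rewrite cosN sinN.
Qed.

(* A rotation by a small angle of sign [s] comes back near 1 after one full
   turn: at time [j1] from one side, at time [j2] it has passed to the other. *)
Lemma rotation_turn u h : nm u = 1 -> 0 < re u -> h = `|im u| -> 0 < h -> h <= 1/2000 ->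
  exists (s : R) (j1 j2 : nat), [/\ s = 1 \/ s = -1, im u = s * h,
   (j1 < j2)%N, 1 <= j1%:R * h & [/\ j2%:R * h <= 9, s * im (u ^+ j1) <= - (7/1000),
    7/1000 <= s * im (u ^+ j2) &
    forall j, (j1 <= j)%N -> (j <= j2)%N -> nm (u ^+ j - 1) <= 36/1000]].
Proof.
move=> u1 ru hE h0 h1.
have iu0 : im u != 0 by rewrite -normr_gt0 -hE.
have [|s [a [hs]]] := unit_angle u1 ru iu0; first by rewrite -hE; lra.
rewrite -hE => ha1 ha2 iu pw.
have a0 : 0 < a by lra.
have pi2 := @pi_ge2 R; have pi4 : pi < 4 :> R by have := @pihalf_lt2 R; lra.
have nat_near (x : R) : 0 <= x -> exists j : nat, x <= j%:R * a /\ j%:R * a <= x + a.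
  move=> x0; have [n hn] := nat_gt (x / a).
  have ex : exists n, x <= n%:R * a.
    by exists n; rewrite -ler_pdivrMr// ltW.
  case: (ex_minnP ex) => -[|j] hj jm; first by exists 0%N; split=> //; lra.
  exists j.+1; split=> //; have := jm j; rewrite ltnn => hh.
  rewrite -natr1 mulrDl mul1r lerD2r leNgt; apply/negP => lt.
  by have := hh (ltW lt).
(* The angle a is at most 2 h <= 1/1000, so the two times fall within 1/1000 after the angles 2 pi -
   17/1000 and 2 pi + 15/1000, on either side of the full turn; sin x >= x / 2 then gives 7/1000. *)
have [j1 [j1a j1b]] := nat_near (2 * pi - 17/1000) (ltac:(lra)).
have [j2 [j2a j2b]] := nat_near (2 * pi + 15/1000) (ltac:(lra)).
have cisE n x : n%:R * a = x + 2 * pi ->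
    u ^+ n = cos x +i* (s * sin x).
  move=> e; rewrite pw e; have -> : 2 * pi = pi *+ 2 :> R by rewrite mulr_natl.
  by rewrite cosD2pi sinD2pi.
have ss : s * s = 1 by case: hs => ->; rewrite ?mulrNN mulr1.
have j12 : (j1 < j2)%N.
  rewrite -(ltr_nat R) -(ltr_pM2r a0); move: j1b j2a ha1 ha2 h1; clear; lra.
exists s, j1, j2; split => //.
  have : j1%:R * a <= j1%:R * (2 * h) by rewrite ler_wpM2l.
  by move: j1a pi2; clear; lra.
split.
- have : j2%:R * h <= j2%:R * a by rewrite ler_wpM2l.
  by move: j2b pi4 ha1 ha2 h1; clear; lra.
- rewrite (cisE j1 (- (2 * pi - j1%:R * a))); last by ring.
  rewrite /= mulrA ss mul1r sinN lerN2.
  apply: (@le_trans _ _ ((2 * pi - j1%:R * a) / 2)); first by move: j1b ha1 ha2 h1; clear; lra.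
  by apply: sin_ge; move: j1a j1b ha1 ha2 h1; clear; lra.
- rewrite (cisE j2 (j2%:R * a - 2 * pi)); last by ring.
  rewrite /= mulrA ss mul1r.
  apply: (@le_trans _ _ ((j2%:R * a - 2 * pi) / 2)); first by move: j2a; clear; lra.
  by apply: sin_ge; move: j2a j2b ha1 ha2 h1; clear; lra.
move=> j; rewrite -(ler_nat R) -(ler_pM2r a0) => g1.
rewrite -(ler_nat R) -(ler_pM2r a0) => g2.
have x1 : `|j%:R * a - 2 * pi| <= 18/1000.
  by rewrite ler_norml; apply/andP; split; move: g1 g2 j1a j2b ha1 ha2 h1; clear; lra.
have := @nm_cisB1 (j%:R * a - 2 * pi) (ltac:(by move: x1; clear; lra)).
rewrite (cisE j (j%:R * a - 2 * pi)); last by ring.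
have e v : nm v = Num.sqrt (re v ^+ 2 + im v ^+ 2) by case: v.
rewrite !e !reB !imB /= !subr0.
have -> : (s * sin (j%:R * a - 2 * pi)) ^+ 2 = sin (j%:R * a - 2 * pi) ^+ 2.
  by rewrite exprMn expr2 ss mul1r.
by move: x1; clear; lra.
Qed.

End rotation.

(** * Rotation of zeta when |Re (1 / d)| is bounded *)

Section gate_crossing.
Variable R : realType.
Implicit Types (G A B : R) (d g : R[i]) (w : nat -> R[i]).

Lemma expr_near1 (x e : R) n : `|x - 1| <= e -> n%:R * e <= 1/2 ->
  `|x ^+ n - 1| <= 2 * (n%:R * e).
Proof.
move=> hx hn; have e0 : 0 <= e := le_trans (normr_ge0 _) hx.
elim: n hn => [|n IH] hn; first by rewrite expr0 subrr normr0 mul0r mulr0.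
have n0 : 0 <= n%:R * e by rewrite mulr_ge0.
rewrite -natr1 in hn *.
have {}IH := IH (ltac:(lra)).
have -> : x ^+ n.+1 - 1 = (x ^+ n - 1) * (x - 1) + (x ^+ n - 1) + (x - 1).
  by rewrite exprS; ring.
have p : `|(x ^+ n - 1) * (x - 1)| <= 1 * e.
  by rewrite normrM; apply: ler_pM => //; lra.
rewrite (le_trans (ler_normD _ _))// (le_trans (lerD (ler_normD _ _) hx))//.
by move: p IH n0; clear; lra.
Qed.

(** Since Re d = Re (1 / d) |d|^2, a bounded Re (1 / d) makes a small d almost purely imaginary. *)
Lemma im_small_re d B : d != 0 -> `|re d^-1| <= B -> nm d * B <= 1/10 ->
  `|re d| <= B * nm d ^+ 2 /\ 9/10 * nm d <= `|im d|.
Proof.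
move=> d0 X dB; have D0 : 0 < nm d by rewrite nm_gt0.
have h1 : `|re d| <= B * nm d ^+ 2.
  by rewrite re_inv// normrM (ger0_norm (sqr_ge0 _)) ler_wpM2r ?sqr_ge0.
split => //; rewrite -(@ler_pXn2r _ 2) ?nnegrE ?mulr_ge0 ?(ltW D0)//.
rewrite real_normK ?num_real// exprMn.
have s := nm_sqr d; have h2 : `|re d| <= 1/10 * nm d.
  by apply: (le_trans h1); rewrite expr2 mulrA (mulrC B) ler_pM2r.
have : `|re d| ^+ 2 <= (1/10 * nm d) ^+ 2.
  by rewrite ler_pXn2r ?nnegrE ?mulr_ge0 ?(ltW D0)//; apply: le_trans h2.
by rewrite real_normK ?num_real// exprMn; move: s (sqr_ge0 (nm d)); clear; lra.
Qed.

(** The modulus of [gate_mult d] is 1 + O(|d|^2), so over O(1 / |d|) steps its powers stay close to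
    those of the unit number u, a rotation by about Im d. *)
Lemma gate_mult_unit d B : d != 0 -> nm d <= 1/32 -> `|re d^-1| <= B -> nm d * B <= 1/10 ->
  exists u, [/\ nm u = 1, 0 < re u, im u = im d / nm (1 - d),
    `|nm (gate_mult d) - 1| <= (4 * B + 2) * nm d ^+ 2 &
    forall n, gate_mult d ^+ n = (nm (gate_mult d) ^+ n)%:C * u ^+ n].
Proof.
move=> d0 d1 X dB; have /andP[b1 b2] := nm_1B d1.
have n0 : 0 < nm (1 - d) by lra.
have h1B := gate_1B_neq0 d1.
exists (gate_mult d * (nm (1 - d))%:C).
have nM : nm (gate_mult d) = (nm (1 - d))^-1 by rewrite /gate_mult nmV.
have rd := re_nm d; have Dn := nm_ge0 d.
split.
- by rewrite nmM nm_real gtr0_norm// nM mulVf// gt_eqF.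
- rewrite reM /= mulr0 subr0 /gate_mult reV reB /=.
  rewrite mulr_gt0// divr_gt0 ?exprn_gt0// subr_gt0.
  by have := re_le d; lra.
- rewrite imM /= mulr0 add0r /gate_mult imV imB /= sub0r opprK.
  by field; rewrite gt_eqF.
- have [h1 _] := im_small_re d0 X dB.
  have B0 : 0 <= B := le_trans (normr_ge0 _) X.
  have q : nm (1 - d) ^+ 2 = 1 - 2 * re d + nm d ^+ 2.
    by rewrite !nm_sqr reB imB /=; ring.
  have h2 : `|nm (1 - d) ^+ 2 - 1| <= (2 * B + 1) * nm d ^+ 2.
    have -> : nm (1 - d) ^+ 2 - 1 = - (2 * re d) + nm d ^+ 2 by rewrite q; ring.
    rewrite (le_trans (ler_normD _ _))// normrN normrM (ger0_norm (sqr_ge0 _)).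
    by rewrite (@ger0_norm _ 2)//; move: h1; clear; lra.
  have h3 : `|nm (1 - d) - 1| <= (2 * B + 1) * nm d ^+ 2.
    apply: le_trans h2.
    have -> : nm (1 - d) ^+ 2 - 1 = (nm (1 - d) - 1) * (nm (1 - d) + 1) by ring.
    rewrite normrM (@ger0_norm _ (_ + 1)); last by lra.
    by rewrite ler_peMr//; lra.
  have -> : nm (gate_mult d) - 1 = - (nm (1 - d) - 1) * nm (gate_mult d).
    by rewrite nM; field; rewrite gt_eqF.
  rewrite normrM normrN (ger0_norm (nm_ge0 _)).
  have := nm_gate_mult d1; have := nm_ge0 (gate_mult d).
  have := normr_ge0 (nm (1 - d) - 1).
  by move: h3; clear; nra.
move=> n; rewrite exprMn -rmorphXn mulrCA -rmorphM -exprMn nM mulVf ?gt_eqF//.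
by rewrite expr1n mulr1.
Qed.

(* Tracking of [zeta_j = 1 + d w_j] by the pure rotation [M ^ j]. *)
Lemma zeta_track G d g w (m S : R) k : 1 <= G -> nm g <= G -> nm d <= 1/32 ->
  1 <= m -> nm (gate_mult d) <= m ->
  (forall j, (j < k)%N -> 1 <= nm (w j) /\ gate_rel G d g (w j) (w j.+1)) ->
  \sum_(j < k) (nm (w j))^-1 <= S ->
  nm (1 + d * w k - gate_mult d ^+ k) <= m ^+ k * (nm d * nm (w 0%N) + 2 * G * nm d * S).
Proof.
move=> G1 gG d1 m1 Mm H hS.
have Dn := nm_ge0 d.
apply: (@le_trans _ _ (m ^+ k * (nm d * nm (w 0%N) + 2 * G * nm d * \sum_(j < k) (nm (w j))^-1))).
  elim: k H {hS} => [|k IH] H.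
    have -> : 1 + d * w 0%N - gate_mult d ^+ 0 = d * w 0%N by rewrite expr0; ring.
    by rewrite expr0 mul1r big_ord0 mulr0 addr0 nmM.
  have {}IH := IH (fun j hj => H j (ltnW hj)).
  have [w1 rel] := H k (leqnn _).
  have w0 : w k != 0 by rewrite -nm_gt0; lra.
  have [e wE he] := gate_relE rel.
  have -> : 1 + d * w k.+1 - gate_mult d ^+ k.+1 =
     gate_mult d * (1 + d * w k - gate_mult d ^+ k) + d * (g / w k + e).
    rewrite wE exprS; set M := gate_mult d; set x := g / w k.
    have -> : 1 + d * (M * w k + M + x + e) - M * M ^+ k =
      (1 + d * M - M) + (M * (1 + d * w k - M ^+ k) + d * (x + e)) by ring.
    have -> : 1 + d * M - M = 0 by rewrite /M /gate_mult; field; exact: gate_1B_neq0.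
    by rewrite add0r.
  rewrite big_ord_recr /= exprS.
  set Sk := \sum_(j < k) _ in IH *.
  have e1 : nm (d * (g / w k + e)) <= nm d * (2 * G * (nm (w k))^-1).
    rewrite nmM ler_wpM2l// (le_trans (nmD _ _))// nm_div.
    have i1 : (nm (w k))^-1 <= 1 by rewrite -div1r ler_pdivrMr; lra.
    have i0 : 0 < (nm (w k))^-1 by rewrite invr_gt0; lra.
    have a1 : nm g / nm (w k) <= G / nm (w k) by rewrite ler_pM2r.
    have a2 : nm e <= G / nm (w k).
      apply: (le_trans he); rewrite -exprVn expr2 mulrA ler_piMr// mulr_ge0//; lra.
    by move: a1 a2; clear; lra.
  rewrite (le_trans (nmD _ _))// nmM.
  have mk : 1 <= m * m ^+ k by rewrite -exprS exprn_ege1.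
  have e2 : nm (gate_mult d) * nm (1 + d * w k - gate_mult d ^+ k) <=
     m * (m ^+ k * (nm d * nm (w 0%N) + 2 * G * nm d * Sk)).
    by apply: ler_pM; rewrite ?nm_ge0.
  have e3 : nm d * (2 * G * (nm (w k))^-1) <= m * m ^+ k * (nm d * (2 * G * (nm (w k))^-1)).
    rewrite ler_peMl// !mulr_ge0 ?invr_ge0 ?nm_ge0//; lra.
  by move: e1 e2 e3; clear; lra.
apply: ler_wpM2l; first by apply: exprn_ge0; lra.
rewrite lerD2l ler_wpM2l// !mulr_ge0//; lra.
Qed.

(* On the imaginary axis the potential controls the modulus. *)
Lemma crossing_bound G B C d g (z : R[i]) : 1 <= G -> nm g <= G -> d != 0 ->
  `|re d^-1| <= B -> nm d * B <= 1/10 -> 0 <= re z -> re z <= 2 -> 1 <= nm z ->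
  nm d * nm z <= 1/20 -> `|gate_pot d g z| <= C * nm d ->
  nm z <= 2 * (C + 2 + B + 8 * G ^+ 2).
Proof.
move=> G1 gG d0 X dB z0 z2 z1 dz pot.
have D0 : 0 < nm d by rewrite nm_gt0.
have B0 : 0 <= B := le_trans (normr_ge0 _) X.
have [h1 h2] := im_small_re d0 X dB.
have l := @ln_nm1D R (d * z) (ltac:(rewrite nmM; lra)).
rewrite nmM in l.
have G0 : 0 < G by lra.
have ls : G * ln (nm z) <= nm z / 8 + 8 * G ^+ 2.
  have -> : nm z = (nm z / (8 * G)) * (8 * G) by field; rewrite gt_eqF.
  have p1 : 0 < nm z / (8 * G) by rewrite divr_gt0 ?mulr_gt0//; lra.
  have p2 : 0 < 8 * G by rewrite mulr_gt0.
  rewrite lnM ?posrE//.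
  have := ln_sublinear p1; have := ln_sublinear p2.
  set a := nm z / (8 * G) => u v.
  by have := ler_wpM2l (ltW G0) (ltW u); have := ler_wpM2l (ltW G0) (ltW v); lra.
have l0 : 0 <= ln (nm z) by exact: ln_ge0.
have a1 : `|re (g * d) * ln (nm z)| <= nm d * (nm z / 8 + 8 * G ^+ 2).
  rewrite normrM (ger0_norm l0).
  apply: (@le_trans _ _ (nm d * (G * ln (nm z)))); last by rewrite ler_pM2l.
  rewrite mulrA ler_wpM2r// (le_trans (re_nm _))// nmM mulrC ler_pM2l//.
have a2 : `|re (d * z)| <= C * nm d + nm d * (nm z / 8 + 8 * G ^+ 2) + 15/100 * nm d * nm z.
  have -> : re (d * z) = gate_pot d g z + re (g * d) * ln (nm z) -
     (ln (nm (1 + d * z)) - re (d * z)) by rewrite /gate_pot; ring.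
  apply: (le_trans (ler_normB _ _)); apply: lerD.
    by apply: (le_trans (ler_normD _ _)); apply: lerD.
  apply: (le_trans l); rewrite expr2.
  have q : 0 <= nm d * nm z by rewrite mulr_ge0 ?nm_ge0.
  by move: dz q; clear; nra.
have a3 : 9/10 * nm d * (nm z - 2) <= `|re (d * z)| + nm d * (B * nm d * 2).
  have e : im d * im z = re d * re z - re (d * z) by rewrite reM; ring.
  have : `|im d| * `|im z| <= `|re (d * z)| + B * nm d ^+ 2 * 2.
    rewrite -normrM e (le_trans (ler_normB _ _))// addrC lerD2l normrM ler_pM//.
    by rewrite ger0_norm.
  have iz : nm z - 2 <= `|im z|.
    by have := nm_reim z; rewrite (ger0_norm z0); move: z2; clear; lra.
  have : 9/10 * nm d * `|im z| <= `|im d| * `|im z| by rewrite ler_wpM2r.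
  have : 9/10 * nm d * (nm z - 2) <= 9/10 * nm d * `|im z|.
    by rewrite ler_wpM2l// mulr_ge0// ltW.
  by clear; lra.
rewrite -(ler_pM2l D0).
have q : nm d * (nm d * B) <= nm d * (1/10) by rewrite ler_pM2l.
by move: a2 a3 q D0 B0 (mulr_ge0 (ltW D0) B0) (mulr_ge0 (ltW D0) (sqr_ge0 G)) (mulr_ge0 (ltW D0) (nm_ge0 z)); clear; lra.
Qed.

(** Used with k of order 1 / |d|, r large and m fixed: multiplied by G |d| both terms become small,
    which controls the tracking error of zeta. *)
Lemma inv_sum_bound (w : nat -> R[i]) (r : R) (m k : nat) : 0 < r ->
  (forall j, (j < k)%N -> 1 <= nm (w j)) ->
  (forall j, (j < k)%N -> (m <= j)%N -> r <= nm (w j)) ->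
  \sum_(j < k) (nm (w j))^-1 <= m%:R + k%:R / r.
Proof.
move=> r0; have ir : 0 < r^-1 by rewrite invr_gt0.
suff main : (forall j, (j < k)%N -> 1 <= nm (w j)) ->
  (forall j, (j < k)%N -> (m <= j)%N -> r <= nm (w j)) ->
  \sum_(j < k) (nm (w j))^-1 <= (minn m k)%:R + k%:R / r.
  move=> h1 h2; apply: (le_trans (main h1 h2)).
  by rewrite lerD2r ler_nat geq_minl.
elim: k => [|k IH] h1 h2; first by rewrite big_ord0 minn0 mul0r addr0.
have {}IH := IH (fun j hj => h1 j (ltnW hj)) (fun j hj => h2 j (ltnW hj)).
rewrite big_ord_recr /= -[k.+1%:R]natr1 mulrDl.
have w1 := h1 k (leqnn _).
have [mk|km] := leqP m k.
  have h := h2 k (leqnn _) mk.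
  have : (nm (w k))^-1 <= 1 / r by rewrite div1r lef_pV2 ?posrE//; lra.
  have e : minn m k.+1 = minn m k.
    by rewrite (minn_idPl mk) (minn_idPl (leqW mk)).
  by rewrite e; move: IH; clear; lra.
have e1 : minn m k.+1 = k.+1 by apply/minn_idPr.
have e2 : minn m k = k by apply/minn_idPr; exact: ltnW.
rewrite e2 in IH; rewrite e1 -natr1.
have : (nm (w k))^-1 <= 1 by rewrite -div1r ler_pdivrMr; lra.
by move: IH ir; clear; lra.
Qed.

End gate_crossing.

(** * Return of the orbit after one turn *)

Section gate_passage.
Variable R : realType.
Implicit Types (G A B : R) (d g : R[i]) (w : nat -> R[i]).

(* As long as the orbit stays away from the origin, [zeta] follows the
   rotation [u]. *)
Lemma zeta_rotation G A B d g w u (r D : R) (m k : nat) : 1 <= G -> nm g <= G -> D = nm d ->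
  0 < D -> D <= 1/32 -> nm (w 0%N) <= A -> 0 <= B -> 0 < r ->
  `|nm (gate_mult d) - 1| <= (4 * B + 2) * D ^+ 2 -> nm u = 1 ->
  (forall n, gate_mult d ^+ n = (nm (gate_mult d) ^+ n)%:C * u ^+ n) ->
  k%:R * D <= 12 ->
  D * A <= 1/4/1000 -> G * D * m%:R <= 1/8/1000 -> 96 * 1000 * G <= r -> (4 * B + 2) * D <= 1/24/1000 ->
  (forall j, (j < k)%N -> 1 <= nm (w j) /\ gate_rel G d g (w j) (w j.+1)) ->
  (forall j, (j < k)%N -> (m <= j)%N -> r <= nm (w j)) ->
  nm (1 + d * w k - u ^+ k) <= 4/1000.
Proof.
move=> G1 gG DE D0 D1 wA B0 r0 hM u1 powM kD s1 s2 s3 s4 H1 H2.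
have d1 : nm d <= 1/32 by rewrite -DE.
pose e := (4 * B + 2) * D ^+ 2.
have e0 : 0 <= e by rewrite /e mulr_ge0 ?sqr_ge0//; lra.
have ke : k%:R * e <= 1/2000.
  have -> : k%:R * e = (k%:R * D) * ((4 * B + 2) * D) by rewrite /e; ring.
  have p0 : 0 <= (4 * B + 2) * D by rewrite mulr_ge0 ?(ltW D0)//; lra.
  have := ler_wpM2r p0 kD; move: s4; clear; lra.
have hM' : nm (gate_mult d) <= 1 + e.
  by move: hM; rewrite -/e ler_norml => /andP[_]; clear; lra.
have mk : (1 + e) ^+ k <= 2.
  have := @expr_near1 R (1 + e) e k; rewrite addrAC subrr add0r ger0_norm// => /(_ (lexx _)).
  move=> /(_ (ltac:(move: ke; clear; lra))); rewrite ler_norml => /andP[_].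
  by move: ke; clear; lra.
have Mk : `|nm (gate_mult d) ^+ k - 1| <= 1/1000.
  have := expr_near1 hM; rewrite -/e => /(_ k (ltac:(move: ke; clear; lra))).
  by move: ke; clear; lra.
have sum := inv_sum_bound r0 (fun j jk => (H1 j jk).1) H2.
have e1 : 1 <= 1 + e by move: e0; clear; lra.
have track := zeta_track G1 gG d1 e1 hM' H1 sum.
have -> : 1 + d * w k - u ^+ k = (1 + d * w k - gate_mult d ^+ k) +
  ((nm (gate_mult d) ^+ k - 1)%:C * u ^+ k).
  by rewrite powM rmorphB rmorph1; ring.
rewrite (le_trans (nmD _ _))// nmM nm_real nmX u1 expr1n mulr1.
rewrite -DE in track.
have q : D * nm (w 0%N) + 2 * G * D * (m%:R + k%:R / r) <= 15/10 * (1/1000).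
  have a1 : D * nm (w 0%N) <= D * A by rewrite ler_pM2l.
  have a2 : G * D * (k%:R / r) <= 12/96/1000.
    have -> : G * D * (k%:R / r) = (k%:R * D) * (G / r) by ring.
    have Gr : G / r <= 1/96/1000 by rewrite ler_pdivrMr//; move: s3; clear; lra.
    have Gr0 : 0 <= G / r by rewrite divr_ge0 ?(ltW r0)//; move: G1; clear; lra.
    have -> : 12 / 96 / 1000 = 12 * (1 / 96 / 1000) :> R by clear; lra.
    by apply: ler_pM => //; rewrite mulr_ge0 ?(ltW D0).
  by move: a1 a2 s1 s2; clear; lra.
have q0 : 0 <= D * nm (w 0%N) + 2 * G * D * (m%:R + k%:R / r).
  have p1 : 0 <= m%:R + k%:R / r :> R by rewrite addr_ge0 ?divr_ge0 ?(ltW r0).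
  have p2 : 0 <= 2 * G * D by rewrite !mulr_ge0 ?(ltW D0)//; move: G1; clear; lra.
  exact: addr_ge0 (mulr_ge0 (ltW D0) (nm_ge0 _)) (mulr_ge0 p2 p1).
have : (1 + e) ^+ k * (D * nm (w 0%N) + 2 * G * D * (m%:R + k%:R / r)) <=
   2 * (15/10 * (1/1000)) by apply: ler_pM => //; apply: exprn_ge0; move: e0; clear; lra.
by move: track Mk; clear; lra.
Qed.

(** As w = (zeta - 1) / d, for an almost imaginary d the sign of Re w is governed by Im d Im
    zeta. *)
Lemma re_of_zeta d (z : R[i]) : d != 0 ->
  re z * nm d ^+ 2 = re d * (re (1 + d * z) - 1) + im d * im (1 + d * z).
Proof.
by move=> d0; rewrite nm_sqr !reD !imD reM imM /=; ring.
Qed.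

(* If the orbit never came back to [|w| <= r] it would cross the imaginary
   axis after one full turn; there the potential, which changes by [O(|d|)]
   only, bounds [|w|]. *)
Lemma gate_no_escape G A B : 1 <= G -> 0 <= B -> exists C : R, forall r, C <= r ->
  exists2 s : R, 0 < s & forall d g w, nm g <= G -> d != 0 -> nm d < s ->
  `|re d^-1| <= B -> wide_start G A (w 0%N) -> gate_orbit G d g w ->
  ~ (forall k, k%:R * nm d <= 12 -> 1/100 < k%:R * nm d -> r < nm (w k)).
Proof.
move=> G1 B0; have [C C0 drift] := gate_drift G1.
pose E := 2 * `|A| + G * `|A|.
have A0 := normr_ge0 A.
have GA0 : 0 <= G * `|A| by rewrite mulr_ge0//; lra.
have E0 : 0 <= E by move: A0 GA0; rewrite /E; clear; lra.
pose C' := E + 12 * (B + 3) + 13 * C.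
have C0' : 0 <= C' by move: E0 C0 B0; rewrite /C'; clear; lra.
(* The first summand is the bound of [crossing_bound], to be contradicted; the second makes it
   strict and makes r / 2 large enough for [zeta_rotation]. *)
pose K := 2 * (C' + 2 + B + 8 * G ^+ 2) + 200 * 1000 * G.
exists K => r Kr.
have G20 := sqr_ge0 G.
have r1 : 200 * 1000 * G <= r by move: Kr G20 C0' B0; rewrite /K; clear; lra.
have r2 : 2 * (C' + 2 + B + 8 * G ^+ 2) < r by move: Kr G1; rewrite /K; clear; lra.
(* From step m on, the start phase alone gives |w| >= r / 2. *)
have [m rm] := nat_gt r.
have m0 : 0 <= m%:R :> R by rewrite ler0n.
have Gm0 : 0 <= G * m%:R by rewrite mulr_ge0//; lra.
pose Q := 1000 * 1000 * (1 + `|A| + G * m%:R + B).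
have Q0 : 0 < Q by move: A0 Gm0 B0; rewrite /Q; clear; lra.
exists (1 / Q); first by rewrite divr_gt0.
move=> d g w gG d0; rewrite ltr_pdivlMr// => dQ X wide orb far.
have [D DE] : exists D, D = nm d by exists (nm d).
have D0 : 0 < D by rewrite DE nm_gt0.
rewrite -DE in dQ.
have [DA DGm [DB D1]] : [/\ D * `|A| <= 1/1000/1000, G * D * m%:R <= 1/1000/1000 &
    D * B <= 1/1000/1000 /\ D <= 1/1000/1000].
  move: dQ (mulr_ge0 (ltW D0) A0) (mulr_ge0 (ltW D0) Gm0) (mulr_ge0 (ltW D0) B0) (D0).
  rewrite /Q; clear => y1 y2 y3 y4 y5.
  by split; [lra|lra|split; lra].
have [a1 a2 a3] := wide.
have aA := ler_norm A.
have d32 : nm d <= 1/32 by rewrite -DE; move: D1; clear; lra.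
have small : nm d * (A + 1) <= 1/100.
  rewrite -DE; have : D * A <= D * `|A| by rewrite ler_pM2l.
  by move: DA D1; clear; lra.
have start k : k%:R * D <= 1/100 -> (nm (w 0%N) + k%:R) / 2 <= nm (w k).
  by rewrite DE => h; have [] := gate_start G1 gG d0 wide orb small h.
have big k : k%:R * D <= 12 -> 40 * G <= nm (w k).
  move=> h; have [e|l] := leP (k%:R * D) (1/100).
    by have := start k e; have := ler0n R k; move: a1; clear; lra.
  have := far k; rewrite -DE => /(_ h l); move: r1 G1; clear; lra.
have early i k : (i <= k)%N -> k%:R * D <= 12 -> i%:R * D <= 12.
  by move=> ik; apply: le_trans; rewrite ler_pM2r// ler_nat.
have rel k : k%:R * D <= 12 -> gate_rel G d g (w k) (w k.+1).
  by move=> h; apply: orb => i ik; apply: big; exact: early h.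
have dB : nm d * B <= 1/10 by rewrite -DE; move: DB; clear; lra.
have [u [u1 ru iu hM powM]] := gate_mult_unit d0 d32 X dB.
have /andP[b1 b2] := nm_1B d32.
have n0 : 0 < nm (1 - d) by move: b1; clear; lra.
have [h1 h2] := im_small_re d0 X dB.
rewrite -DE in hM h1 h2.
have him := im_nm d; rewrite -DE in him.
have hE : `|im u| = `|im d| / nm (1 - d) by rewrite iu normrM normfV (gtr0_norm n0).
have hu1 : 85/100 * D <= `|im u|.
  by rewrite hE ler_pdivlMr//; have := ler_wpM2l (ltW D0) b2; move: h2 D0; clear; lra.
have hu2 : `|im u| <= 11/10 * D.
  by rewrite hE ler_pdivrMr//; have := ler_wpM2l (ltW D0) b1; move: him D0; clear; lra.
have [||s [j1 [j2 [hs ius j12 j1h [j2h im1 im2 nr]]]]] := rotation_turn u1 ru (erefl _).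
- by move: hu1 D0; clear; lra.
- by move: hu2 D1; clear; lra.
have j2D : j2%:R * D <= 11.
  have := ler_wpM2l (ler0n R j2) hu1; move: j2h; clear; lra.
have j1D : 9/10 <= j1%:R * D.
  have := ler_wpM2l (ler0n R j1) hu2; move: j1h; clear; lra.
have le12 k : (k <= j2)%N -> k%:R * D <= 12.
  by move=> kj; apply: (early k j2) => //; move: j2D; clear; lra.
have late k : (j1 <= k)%N -> (k <= j2)%N -> r < nm (w k).
  move=> jk kj; apply: far; rewrite -DE; first exact: le12.
  apply: lt_le_trans (_ : j1%:R * D <= _); first by move: j1D; clear; lra.
  by rewrite ler_pM2r// ler_nat.
have zt k : (k <= j2)%N -> nm (1 + d * w k - u ^+ k) <= 4/1000.
  move=> kj; apply: (@zeta_rotation G A B d g w u (r / 2) D m) => //.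
  - by move: D1; clear; lra.
  - by rewrite divr_gt0//; move: r1 G1; clear; lra.
  - by apply: le12.
  - by have : D * A <= D * `|A| by [rewrite ler_pM2l]; move: DA; clear; lra.
  - by move: DGm; clear; lra.
  - by move: r1 G1; clear; lra.
  - by move: DB D1; clear; lra.
  - move=> j jk; have jj : j%:R * D <= 12 by apply: (early j k) => //; [exact: ltnW|exact: le12].
    by split; [have := big j jj; move: G1; clear; lra|exact: rel].
  - move=> j jk mj; have jj : j%:R * D <= 12 by apply: (early j k) => //; [exact: ltnW|exact: le12].
    have [e|l] := leP (j%:R * D) (1/100).
      have := start j e; have : m%:R <= j%:R :> R by rewrite ler_nat.
      by have := nm_ge0 (w 0%N); move: rm; clear; lra.
    by have := far j; rewrite -DE => /(_ jj l); have := nm_ge0 (w j); clear; lra.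
have sgn : s * im d = `|im d| /\ s * s = 1.
  have e : im d = s * `|im d|.
    by have := iu; rewrite ius hE => /(congr1 (fun x => x * nm (1 - d))); rewrite mulrA !divfK ?gt_eqF.
  by split; [rewrite {1}e mulrA; case: hs => ->; rewrite ?mulr1 ?mulrNN ?mul1r|case: hs => ->; clear; lra].
have near1 k : (j1 <= k)%N -> (k <= j2)%N -> nm (d * w k) <= 4/100.
  move=> jk kj; have -> : d * w k = (1 + d * w k - u ^+ k) + (u ^+ k - 1) by ring.
  by rewrite (le_trans (nmD _ _))//; have := zt k kj; have := nr k jk kj; clear; lra.
(* Re w |d|^2 equals s Im zeta |Im d| up to a negligible term, so Re w changes sign between j1 and
   j2 together with the rotation. *)
have axis k : (j1 <= k)%N -> (k <= j2)%N ->
   `|re (w k) * D ^+ 2 - (s * im (1 + d * w k)) * `|im d| | <= 4/100 * (B * D ^+ 2).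
  move=> jk kj; rewrite DE (re_of_zeta _ d0) -DE.
  have -> : re d * (re (1 + d * w k) - 1) + im d * im (1 + d * w k) -
     s * im (1 + d * w k) * `|im d| = re d * re (d * w k).
    rewrite -sgn.1 reD /=; have -> : s * im (1 + d * w k) * (s * im d) =
      (s * s) * (im (1 + d * w k) * im d) by ring.
    by rewrite sgn.2; ring.
  rewrite normrM mulrC; apply: ler_pM => //.
  exact: le_trans (re_nm _) (near1 k jk kj).
have dD2 : 0 < D ^+ 2 by rewrite exprn_gt0.
have BD : B * D ^+ 2 <= 1/1000/1000 * D.
  by rewrite expr2 mulrA ler_pM2r// mulrC.
have imz k : (k <= j2)%N -> `|s * im (1 + d * w k) - s * im (u ^+ k)| <= 4/1000.
  move=> kj; rewrite -mulrBr -imB normrM.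
  have -> : `|s| = 1 by case: hs => ->; rewrite ?normrN normr1.
  by rewrite mul1r (le_trans (im_nm _)) ?zt.
have neg1 : re (w j1) < 0.
  rewrite -(ltr_pM2r dD2) mul0r.
  have := axis j1 (leqnn _) (ltnW j12); have := imz j1 (ltnW j12).
  rewrite !ler_norml => /andP[_ y1] /andP[_ y2].
  have : s * im (1 + d * w j1) * `|im d| <= - (3/1000) * `|im d|.
    by rewrite ler_wpM2r//; move: y1 im1; clear; lra.
  by move: y2 BD h2 D0; clear; lra.
have pos2 : 0 <= re (w j2).
  rewrite -(ler_pM2r dD2) mul0r.
  have := axis j2 (ltnW j12) (leqnn _); have := imz j2 (leqnn _).
  rewrite !ler_norml => /andP[y1 _] /andP[y2 _].
  have : 3/1000 * `|im d| <= s * im (1 + d * w j2) * `|im d|.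
    by rewrite ler_wpM2r//; move: y1 im2; clear; lra.
  by move: y2 BD h2 D0; clear; lra.
(* At the first index past j1 with Re w >= 0 the preceding point has Re w < 0 and the step is close
   to 1, whence 0 <= Re w <= 2. *)
have ex : exists j, (j1 <= j)%N && (0 <= re (w j)) by exists j2; rewrite (ltnW j12).
case: (ex_minnP ex) => j /andP[jj1 rj] jm.
have jj2 : (j <= j2)%N by apply: jm; rewrite (ltnW j12).
have j1j : (j1 < j)%N.
  rewrite ltn_neqAle jj1 andbT; apply/eqP => e; move: rj; rewrite -e.
  by move: neg1; clear; lra.
have jp : j.-1.+1 = j by rewrite prednK//; exact: leq_ltn_trans j1j.
have jp1 : (j1 <= j.-1)%N by rewrite -ltnS jp.
have jp2 : (j.-1 <= j2)%N by rewrite (leq_trans _ jj2)// leq_pred.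
have rjp : re (w j.-1) < 0.
  rewrite ltNge; apply/negP => h; have := jm j.-1; rewrite jp1 h => /(_ isT).
  by rewrite -jp ltnn.
have rl := rel j.-1 (le12 _ jp2).
have bj := big _ (le12 _ jp2).
have bj' : 32 * G <= nm (w j.-1) by move: bj G1; clear; lra.
have nrr := gate_rel_near G1 gG d32 bj' rl.
rewrite jp in nrr.
have re2 : re (w j) <= 2.
  have := le_trans (re_le _) nrr; rewrite !reB /=.
  have q1 := near1 _ jp1 jp2; rewrite nmM in q1.
  have q2 : 2 * G / nm (w j.-1) <= 1/20.
    by rewrite ler_pdivrMr; move: bj G1; clear; lra.
  by move: q1 q2 rjp d32; clear; lra.
have wr := late j jj1 jj2.
have Lb : `|ln (nm (gate_mult d))| <= (B + 3) * D ^+ 2.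
  have := ln_gate_mult d32; rewrite -DE => l.
  have -> : ln (nm (gate_mult d)) = (ln (nm (gate_mult d)) - re d) + re d by ring.
  by rewrite (le_trans (ler_normD _ _))//; move: l h1; clear; lra.
have potj : `|gate_pot d g (w j)| <= C' * nm d.
  have : `|gate_pot d g (w j) - gate_pot d g (w 0%N) - j%:R * ln (nm (gate_mult d))| <=
     C * (nm d + j%:R * nm d ^+ 2).
    apply: drift => // i ij; have i2 : (i <= j2)%N by rewrite (leq_trans (ltnW ij)).
    have bi := big i (le12 i i2).
    split; [by move: bi G1; clear; lra| |exact: rel (le12 i i2)].
    have := nm_leB (u ^+ i) (u ^+ i - (1 + d * w i)).
    have -> : u ^+ i - (u ^+ i - (1 + d * w i)) = 1 + d * w i by ring.
    by rewrite nmX u1 expr1n nmC; have := zt i i2; clear; lra.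
  have p0 : `|gate_pot d g (w 0%N)| <= E * nm d.
    apply: gate_pot_small => //; first by move: a1 G1; clear; lra.
    - exact: le_trans a2 aA.
    - by rewrite -DE; move: DA; clear; lra.
  have jL : `|j%:R * ln (nm (gate_mult d))| <= 12 * (B + 3) * D.
    rewrite normrM (ger0_norm (ler0n _ _)).
    have := ler_wpM2l (ler0n R j) Lb.
    have B3 : 0 <= (B + 3) * D by rewrite mulr_ge0 ?(ltW D0)//; move: B0; clear; lra.
    have := ler_wpM2r B3 (le12 j jj2); clear; lra.
  have jC : C * (j%:R * D ^+ 2) <= 12 * C * D.
    have := ler_wpM2r (mulr_ge0 C0 (ltW D0)) (le12 j jj2); clear; lra.
  move: p0 jL jC; rewrite -DE /C' !ler_norml.
  move=> /andP[x1 x2] /andP[x3 x4] x5 /andP[x6 x7].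
  by apply/andP; split; move: x1 x2 x3 x4 x5 x6 x7; clear; lra.
have := crossing_bound G1 gG d0 X dB rj re2 _ _ potj.
have w1 : 1 <= nm (w j) by move: wr r1 G1; clear; lra.
have dw : nm d * nm (w j) <= 1/20 by rewrite -nmM; have := near1 j jj1 jj2; clear; lra.
by move=> /(_ w1 dw); move: r2 wr; clear; lra.
Qed.

Lemma gate_pass G A B rho : 1 <= G -> 0 <= B -> exists r s : R, [/\ rho <= r, 0 < s &
  forall d g w, nm g <= G -> d != 0 -> nm d < s -> `|re d^-1| <= B ->
  wide_start G A (w 0%N) -> gate_orbit G d g w ->
  exists k, [/\ forall i, (i <= k)%N -> 40 * G <= nm (w i), r - 3 <= nm (w k),
    nm (w k) <= r & re (w k) <= nm (w k) / 8]].
Proof.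
move=> G1 B0; have [C escape] := gate_no_escape A G1 B0.
pose r := `|C| + `|rho| + 100 * G + 100.
have n1 := ler_norm C; have n2 := ler_norm rho.
have n3 := normr_ge0 C; have n4 := normr_ge0 rho; have n5 := normr_ge0 A.
have rC : C <= r by rewrite /r; move: n1 n4 G1; clear; lra.
have rr : rho <= r by rewrite /r; move: n2 n3 G1; clear; lra.
have rG : 100 * G + 100 <= r by rewrite /r; move: n4 n3; clear; lra.
move: r rC rr rG => r rC rr rG.
have [s1 s10 {}escape] := escape r rC.
have r0 : 0 < r by move: rG G1; clear; lra.
pose Q := 1000 * (1 + `|A| + r ^+ 2 + r).
have rr0 : 0 <= r ^+ 2 := sqr_ge0 r.
have Q0 : 0 < Q by rewrite /Q; move: n5 r0 rr0; clear; lra.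
exists r, (Num.min s1 (1 / Q)); split => //; first by rewrite lt_min s10 divr_gt0.
move=> d g w gG d0; rewrite lt_min => /andP[ds]; rewrite ltr_pdivlMr// => dQ X wide orb.
have D0 : 0 < nm d by rewrite nm_gt0.
have [DA Dr2 [Dr D1]] : [/\ nm d * `|A| <= 1/1000, nm d * r ^+ 2 <= 1/1000 &
    nm d * r <= 1/1000 /\ nm d <= 1/1000].
  move: dQ (mulr_ge0 (ltW D0) n5) (mulr_ge0 (ltW D0) rr0) (mulr_ge0 (ltW D0) (ltW r0)) (D0).
  rewrite /Q; clear => y1 y2 y3 y4 y5.
  by split; [lra|lra|split; lra].
have [a1 a2 a3] := wide.
have aA := ler_norm A.
have d32 : nm d <= 1/32 by move: D1; clear; lra.
have small : nm d * (A + 1) <= 1/100.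
  have : nm d * A <= nm d * `|A| by rewrite ler_pM2l.
  by move: DA D1; clear; lra.
have start k : k%:R * nm d <= 1/100 -> (nm (w 0%N) + k%:R) / 2 <= nm (w k).
  by move=> h; have [] := gate_start G1 gG d0 wide orb small h.
have ex : exists k, (1/100 < k%:R * nm d) && (nm (w k) <= r).
  apply: contrapT => nex; apply: (escape d g w) => // k _ kd.
  by rewrite ltNge; apply/negP => h; apply: nex; exists k; rewrite kd.
case: (ex_minnP ex) => k /andP[kd wk] km.
have k0 : (0 < k)%N by rewrite lt0n; apply/eqP => k0; move: kd; rewrite k0 mul0r; clear; lra.
have big i : (i < k)%N -> 40 * G <= nm (w i).
  move=> ik; have [e|l] := leP (i%:R * nm d) (1/100).
    by have := start i e; have := ler0n R i; move: a1; clear; lra.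
  have [h|h] := ltP r (nm (w i)); first by move: rG h G1; clear; lra.
  by have := km i; rewrite l h => /(_ isT); rewrite leqNgt ik.
have kp : (k.-1 < k)%N by rewrite prednK.
have wp : r < nm (w k.-1).
  (* If k - 1 still belonged to the start phase, k would be of order 1 / |d| and the modulus there
     far larger than r. *)
  have [e|l] := leP (k.-1%:R * nm d) (1/100); last first.
    rewrite ltNge; apply/negP => h; have := km k.-1; rewrite l h => /(_ isT).
    by rewrite leqNgt kp.
  have kk : k%:R = k.-1%:R + 1 :> R by rewrite natr1 prednK.
  have := start _ e; have := nm_ge0 (w 0%N); rewrite kk in kd.
  have : 4 * r <= k.-1%:R.
    rewrite -(ler_pM2l D0); move: Dr kd D1; clear; lra.
  by move: r0; clear; lra.
have bp := big _ kp.
have bp' : 32 * G <= nm (w k.-1) by move: bp G1; clear; lra.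
have rel := orb k.-1 (fun i ik => big i (leq_ltn_trans ik kp)).
have near := gate_rel_near G1 gG d32 bp' rel; rewrite prednK// in near.
have [e1 e2] : 2 * G / nm (w k.-1) <= 1/20 /\ 2 * G / nm (w k.-1) <= 2 * G / r.
  split; first by rewrite ler_pdivrMr; move: bp G1; clear; lra.
  by rewrite ler_pM2l ?lef_pV2 ?posrE ?(lt_trans r0 wp)// ?(ltW wp)//; move: G1; clear; lra.
have wpu : nm (w k.-1) <= 2 * r.
  have := nm_leB (w k.-1) (- (w k - w k.-1)); rewrite opprK nmN.
  have -> : w k.-1 + (w k - w k.-1) = w k by ring.
  have -> : w k - w k.-1 = (w k - w k.-1 - 1) + 1 by ring.
  have := nmD (w k - w k.-1 - 1) 1; rewrite nm1.
  have : nm d * nm (w k.-1) <= 1/1000 * nm (w k.-1) by rewrite ler_wpM2r ?nm_ge0.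
  by move: near e1 D1 wk r0 rG G1; clear; lra.
have {}near : nm (w k - w k.-1 - 1) <= 6 * (nm d * r) + 2 * G / r.
  have : nm d * nm (w k.-1) <= nm d * (2 * r) by rewrite ler_pM2l.
  have : nm d <= nm d * r by rewrite ler_peMr ?(ltW D0)//; move: rG G1; clear; lra.
  by move: near e2; clear; lra.
have [eps epsE] : exists e, e = 6 * (nm d * r) + 2 * G / r by eexists.
have epsr : eps * r <= 2 * G + 1.
  have -> : eps * r = 6 * (nm d * r ^+ 2) + 2 * G by rewrite epsE; field; rewrite gt_eqF.
  by move: Dr2; clear; lra.
have eps1 : eps <= 1.
  have : 2 * G / r <= 1/2 by rewrite ler_pdivrMr//; move: rG G1; clear; lra.
  by rewrite epsE; move: Dr; clear; lra.
rewrite -epsE in near.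
have back : nm (w k.-1) - eps <= nm (w k - 1).
  have -> : w k - 1 = w k.-1 + (w k - w k.-1 - 1) by ring.
  by have := nm_leD (w k.-1) (w k - w k.-1 - 1); move: near; clear; lra.
have low : r - 3 <= nm (w k).
  by have := nmB (w k) 1; rewrite nm1; move: back eps1 wp; clear; lra.
have rew : 2 * re (w k) <= 1 + 2 * (2 * G + 1).
  have s := nm_sqr (w k - 1); rewrite reB imB /= subr0 in s.
  have s2 := nm_sqr (w k).
  have : (nm (w k) - eps) ^+ 2 <= nm (w k - 1) ^+ 2.
    rewrite ler_pXn2r ?nnegrE ?nm_ge0//; last by move: low eps1 rG G1; clear; lra.
    by move: back wp wk; clear; lra.
  have ep0 : 0 <= eps := le_trans (nm_ge0 _) near.
  have : eps * nm (w k) <= eps * r by rewrite ler_wpM2l.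
  by move: s s2 epsr (sqr_ge0 eps); clear; lra.
exists k; split => //.
  move=> i; rewrite leq_eqVlt => /predU1P[->|]; last exact: big.
  by move: low rG G1; clear; lra.
by move: rew low rG G1; clear; lra.
Qed.

End gate_passage.

(** * Normal form at 0 *)

Section continuous_families.
Variables (R : realType) (T : Type) (D : T -> R) (l0 : T).
Implicit Types (P Q : T -> Prop) (c : T -> R[i]) (F : T -> {poly R[i]}) (l : T).

(** [D] plays the role of the distance to [l0]; it is abstract because the parameter is in turn a
    multiplier, a point, a pair or a triple of complex numbers. *)
Definition near_param P := exists2 d, 0 < d & forall l, D l < d -> P l.

Definition ccont c := forall e, 0 < e -> near_param (fun l => nm (c l - c l0) < e).

Definition cfam F :=
  (exists n, forall l, (size (F l) <= n)%N) /\ forall k, ccont (fun l => (F l)`_k).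

Lemma param_and P Q : near_param P -> near_param Q -> near_param (fun l => P l /\ Q l).
Proof.
move=> [d d0 hd] [e e0 he]; exists (Num.min d e); first by rewrite lt_min d0.
by move=> l; rewrite lt_min => /andP[/hd ? /he].
Qed.

Lemma param_sub P Q : near_param P -> (forall l, P l -> Q l) -> near_param Q.
Proof. by move=> [d d0 hd] PQ; exists d => // l /hd /PQ. Qed.

Lemma ccont_cst (c : R[i]) : ccont (fun=> c).
Proof. by move=> e e0; exists 1 => // l _; rewrite subrr nm0. Qed.

Lemma ccont_ext c c' : c =1 c' -> ccont c -> ccont c'.
Proof. by move=> E h e /h H; refine (param_sub H _) => l; rewrite !E. Qed.

Lemma ccontD c c' : ccont c -> ccont c' -> ccont (fun l => c l + c' l).
Proof.
move=> h h' e e0; have e2 : 0 < e / 2 by rewrite divr_gt0.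
refine (param_sub (param_and (h _ e2) (h' _ e2)) _) => l [h1 h2].
have -> : c l + c' l - (c l0 + c' l0) = (c l - c l0) + (c' l - c' l0) by ring.
by have := nmD (c l - c l0) (c' l - c' l0); lra.
Qed.

Lemma ccontM c c' : ccont c -> ccont c' -> ccont (fun l => c l * c' l).
Proof.
move=> h h' e e0; set a := nm (c l0); set a' := nm (c' l0).
have a0 : 0 <= a := nm_ge0 _; have a'0 : 0 <= a' := nm_ge0 _.
have A : 0 < 1 + a + a' by lra.
pose k := Num.min 1 (e / (1 + a + a')).
have k0 : 0 < k by rewrite lt_min ltr01 divr_gt0.
have k1 : k <= 1 by rewrite ge_min lexx.
have k2 : k * (1 + a + a') <= e by rewrite -ler_pdivlMr// ge_min lexx orbT.
refine (param_sub (param_and (h _ k0) (h' _ k0)) _) => l [].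
have -> : c l * c' l - c l0 * c' l0 = (c l - c l0) * (c' l - c' l0)
  + (c l - c l0) * c' l0 + c l0 * (c' l - c' l0) by ring.
set x := c l - _; set y := c' l - _ => hx hy.
have := nmD (x * y + x * c' l0) (c l0 * y); have := nmD (x * y) (x * c' l0).
rewrite !nmM -/a -/a'; have := nm_ge0 x; have := nm_ge0 y.
move: (nm _) (nm _) (nm (_ + _)) hx hy; clear -a0 a'0 k0 k1 k2.
move: (nm x) (nm y) => X Y s1 s2 hx hy; nra.
Qed.

Lemma ccontV c : ccont c -> c l0 != 0 -> ccont (fun l => (c l)^-1).
Proof.
move=> h; rewrite -nm_gt0 => c0 e e0; set a := nm (c l0) in c0.
have k0 : 0 < Num.min (a / 2) (e * a ^+ 2 / 2).
  by rewrite lt_min !divr_gt0 ?mulr_gt0 ?exprn_gt0.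
refine (param_sub (h _ k0) _) => l; rewrite lt_min => /andP[h1 h2].
have h3 : a / 2 <= nm (c l) by have := nm_leB (c l0) (c l); rewrite nmC -/a; lra.
have cl : c l != 0 by rewrite -nm_gt0; lra.
have cl0 : c l0 != 0 by rewrite -nm_gt0.
have -> : (c l)^-1 - (c l0)^-1 = (c l0 - c l) / (c l * c l0) by field; rewrite cl cl0.
rewrite nm_div nmM -/a nmC ltr_pdivrMr ?mulr_gt0//; last by lra.
apply: (lt_le_trans h2).
have : e * a * (a / 2) <= e * a * nm (c l) by rewrite ler_wpM2l// ltW// mulr_gt0.
rewrite expr2; lra.
Qed.

Lemma ccontX c n : ccont c -> ccont (fun l => c l ^+ n).
Proof.
move=> h; elim: n => [|n IH]; first by apply: ccont_ext (ccont_cst 1) => l; rewrite expr0.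
by apply: ccont_ext (ccontM h IH) => l; rewrite exprS.
Qed.

Lemma ccont_sum n (c : nat -> T -> R[i]) : (forall k, ccont (c k)) ->
  ccont (fun l => \sum_(k < n) c k l).
Proof.
move=> h; elim: n => [|n IH]; first by apply: ccont_ext (ccont_cst 0) => l; rewrite big_ord0.
by apply: ccont_ext (ccontD IH (h n)) => l; rewrite big_ord_recr.
Qed.

Lemma ccont_bound c : ccont c -> near_param (fun l => nm (c l) <= nm (c l0) + 1).
Proof.
move=> /(_ 1 ltr01) H; refine (param_sub H _) => l h.
by have := nm_leB (c l) (c l0); lra.
Qed.

Lemma ccont_neq0 c : ccont c -> c l0 != 0 -> near_param (fun l => c l != 0).
Proof.
rewrite -nm_gt0 => h c0; refine (param_sub (h _ c0) _) => l; rewrite nmC => h1.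
by rewrite -nm_gt0; have := nm_leB (c l0) (c l); lra.
Qed.

Lemma cfam_ext F F' : F =1 F' -> cfam F -> cfam F'.
Proof.
move=> E [[n hn] h]; split; first by exists n => l; rewrite -E.
by move=> k; apply: ccont_ext (h k) => l; rewrite E.
Qed.

Lemma cfam_cst p : cfam (fun=> p).
Proof. by split; [exists (size p)|move=> k; exact: ccont_cst]. Qed.

Lemma cfamC c : ccont c -> cfam (fun l => (c l)%:P).
Proof.
move=> h; split; first by exists 1%N => l; exact: size_polyC_leq1.
move=> [|k]; first by apply: ccont_ext h => l; rewrite coefC.
by apply: ccont_ext (ccont_cst 0) => l; rewrite coefC.
Qed.

Lemma cfamD F F' : cfam F -> cfam F' -> cfam (fun l => F l + F' l).
Proof.
move=> [[n hn] h] [[n' hn'] h']; split.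
  exists (maxn n n') => l; rewrite (leq_trans (size_polyD _ _))// geq_max.
  by rewrite !leq_max hn hn' orbT.
by move=> k; apply: ccont_ext (ccontD (h k) (h' k)) => l; rewrite coefD.
Qed.

Lemma cfamM F F' : cfam F -> cfam F' -> cfam (fun l => F l * F' l).
Proof.
move=> [[n hn] h] [[n' hn'] h']; split.
  exists (n + n')%N => l; rewrite (leq_trans (size_polyMleq _ _))//.
  by rewrite (leq_trans (leq_pred _))// leq_add.
move=> k; apply: (@ccont_ext (fun l => \sum_(j < k.+1) (F l)`_j * (F' l)`_(k - j))).
  by move=> l; rewrite coefM.
apply: (@ccont_sum k.+1 (fun j l => (F l)`_j * (F' l)`_(k - j))) => j.
exact: ccontM.
Qed.

Lemma cfamX F n : cfam F -> cfam (fun l => F l ^+ n).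
Proof.
move=> h; elim: n => [|n IH]; first by apply: cfam_ext (cfam_cst 1) => l; rewrite expr0.
by apply: cfam_ext (cfamM h IH) => l; rewrite exprS.
Qed.

Lemma cfamN F : cfam F -> cfam (fun l => - F l).
Proof. by move=> h; apply: cfam_ext (cfamM (cfam_cst (-1)) h) => l; rewrite mulN1r. Qed.

Lemma cfam_drop F : cfam F -> cfam (fun l => drop_poly 1 (F l)).
Proof.
move=> [[n hn] h]; split.
  by exists n => l; rewrite size_drop_poly (leq_trans (leq_subr _ _)).
by move=> k; apply: ccont_ext (h (k + 1)%N) => l; rewrite coef_drop_poly.
Qed.

Lemma ccont_horner F z : cfam F -> ccont z -> ccont (fun l => (F l).[z l]).
Proof.
move=> [[n hn] h] hz; apply: (@ccont_ext (fun l => \sum_(k < n) (F l)`_k * z l ^+ k)).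
  by move=> l; rewrite (horner_coef_wide _ (hn l)).
apply: (@ccont_sum n (fun k l => (F l)`_k * z l ^+ k)) => k.
by apply: ccontM => //; exact: ccontX.
Qed.

Lemma cfam_bound F : cfam F ->
  exists2 C, 0 <= C & near_param (fun l => forall z, nm z <= 1 -> nm (F l).[z] <= C).
Proof.
move=> [[n hn] h]; pose C m := \sum_(k < m) (nm (F l0)`_k + 1).
exists (C n).
  by apply: sumr_ge0 => i _; have := nm_ge0 (F l0)`_i; lra.
have H : near_param (fun l => forall z, nm z <= 1 -> nm (\sum_(k < n) (F l)`_k * z ^+ k) <= C n).
  elim: n {hn} => [|n IH].
    by exists 1 => // l _ z _; rewrite big_ord0 nm0 /C big_ord0.
  refine (param_sub (param_and IH (ccont_bound (h n))) _) => l [h1 h2] z z1.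
  rewrite big_ord_recr /C big_ord_recr /= -/(C n).
  have h3 : nm ((F l)`_n * z ^+ n) <= nm (F l)`_n.
    rewrite nmM nmX -[leRHS]mulr1 ler_wpM2l ?nm_ge0//.
    by rewrite exprn_ile1 ?nm_ge0.
  have := nmD (\sum_(i < n) (F l)`_i * z ^+ i) ((F l)`_n * z ^+ n).
  have := h1 z z1; lra.
refine (param_sub H _) => l hl z z1; rewrite (horner_coef_wide _ (hn l)); exact: hl.
Qed.

End continuous_families.

Section pointwise_parameter.
Variable R : realType.

Lemma ccont_id (l0 : R[i]) : ccont (fun l => nm (l - l0)) l0 id.
Proof. by move=> e e0; exists e. Qed.

End pointwise_parameter.

Section normal_form.
Variable R : realType.
Implicit Types (l b be c : R[i]) (V Q : {poly R[i]}).

Definition quad_poly l : {poly R[i]} := l%:P * 'X + 'X ^+ 2.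

Definition nf_poly q V : {poly R[i]} := 'X^q * (1 + 'X * V).

(** U = [nf_poly q V] semiconjugates f to the map l^q U + b U^2 + be U^3 up to order q + m. The
    remainder is an exact polynomial, so the normal form stays within polynomial identities. *)
Definition nf_rel q m l b be V Q :=
  nf_poly q V \Po quad_poly l = (l ^+ q)%:P * nf_poly q V + b%:P * nf_poly q V ^+ 2
    + be%:P * nf_poly q V ^+ 3 + 'X^(q + m) * Q.

(** The new remainder when c X^(q+m) is added to U: for the right c the expression under [drop_poly]
    has zero constant term, and one more factor X is taken out of it. *)
Definition nf_next q m l b be V Q c := drop_poly 1 (Q + c%:P * ((l%:P + 'X) ^+ (q + m) - (l ^+ q)%:P)
  - b%:P * c%:P * (2 * nf_poly q V + c%:P * 'X^(q + m))
  - be%:P * c%:P * (3 * nf_poly q V ^+ 2 + 3 * c%:P * nf_poly q V * 'X^(q + m)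
     + c%:P ^+ 2 * 'X^(q + m) ^+ 2)).

Lemma drop1K (p : {poly R[i]}) : p`_0 = 0 -> drop_poly 1 p * 'X = p.
Proof.
move=> p0; have := poly_take_drop 1 p; rewrite expr1 => {2}<-.
suff -> : take_poly 1 p = 0 by rewrite add0r.
by apply/polyP => -[|i]; rewrite coef_take_poly coef0.
Qed.

Lemma Xn_comp_quad n l : 'X^n \Po quad_poly l = 'X^n * (l%:P + 'X) ^+ n.
Proof. by rewrite comp_Xn_poly -exprMn; congr (_ ^+ _); rewrite /quad_poly; ring. Qed.

Lemma quad_polyE l z : (quad_poly l).[z] = l * z + z ^+ 2.
Proof. by rewrite /quad_poly !hornerE. Qed.

(** Adding c times a power of X to U, of the order of the remainder, changes the coefficient there
    by c (l^(q+m+1) - l^q). At a primitive q-th root of unity this can be used to cancel it unless q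
    divides m + 1: only resonant orders survive. *)
Lemma nf_elim q m l b be V Q c : (0 < q)%N -> nf_rel q m.+1 l b be V Q ->
  Q`_0 + c * (l ^+ (q + m.+1) - l ^+ q) = 0 ->
  nf_rel q m.+2 l b be (V + c%:P * 'X^m) (nf_next q m.+1 l b be V Q c).
Proof.
move=> q0 H Q0.
have U' : nf_poly q (V + c%:P * 'X^m) = nf_poly q V + c%:P * 'X^(q + m.+1).
  by rewrite /nf_poly exprD [in RHS]exprS; ring.
rewrite /nf_rel U' /nf_next; set S := (X in drop_poly 1 X).
have S0 : S`_0 = 0.
  have P0 : (0 : R[i]) ^+ (q + m.+1) = 0 by rewrite expr0n addnS.
  have U0 : (nf_poly q V).[0] = 0.
    by rewrite hornerM hornerXn expr0n (gtn_eqF q0) mul0r.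
  rewrite -horner_coef0 /S; move: (nf_poly q V) U0 => U U0.
  rewrite !(hornerD, hornerN, hornerM, horner_exp, hornerC, hornerX) U0 P0.
  by rewrite horner_coef0 addr0 !(mulr0, addr0, subr0).
have {1}-> : 'X^(q + m.+2) * drop_poly 1 S = 'X^(q + m.+1) * S.
  by rewrite -{2}(drop1K S0) [(q + m.+2)%N]addnS exprSr; ring.
rewrite comp_polyD (comp_polyM c%:P) comp_polyC Xn_comp_quad [X in X + _]H /S.
ring.
Qed.

(** The first resonant order: U^2 starts with X^(2q), so the coefficient that cannot be removed is
    moved into b. *)
Lemma nf_next_quad q l V Q : nf_rel q q l 0 0 V Q ->
  nf_rel q q.+1 l Q`_0 0 V (drop_poly 1 (Q - (Q`_0)%:P * (1 + 'X * V) ^+ 2)).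
Proof.
rewrite /nf_rel => ->; set S := (X in drop_poly 1 X).
have S0 : S`_0 = 0.
  by rewrite -horner_coef0 /S !hornerE /= horner_coef0; ring.
have -> : 'X^(q + q.+1) * drop_poly 1 S = 'X^(q + q) * S.
  by rewrite -{2}(drop1K S0) addnS exprSr; ring.
by rewrite /S /nf_poly exprD; ring.
Qed.

Lemma nf_next_cube q l b V Q : nf_rel q (2 * q) l b 0 V Q ->
  nf_rel q (2 * q).+1 l b Q`_0 V (drop_poly 1 (Q - (Q`_0)%:P * (1 + 'X * V) ^+ 3)).
Proof.
rewrite /nf_rel => ->; set S := (X in drop_poly 1 X).
have S0 : S`_0 = 0.
  by rewrite -horner_coef0 /S !hornerE /= horner_coef0; ring.
have -> : 'X^(q + (2 * q).+1) * drop_poly 1 S = 'X^(q + 2 * q) * S.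
  by rewrite -{2}(drop1K S0) addnS exprSr; ring.
rewrite /S /nf_poly exprD (mulnC 2) exprM; ring.
Qed.

Lemma nf_start q l : nf_rel q 1 l 0 0 0 (drop_poly 1 ((l%:P + 'X) ^+ q - (l ^+ q)%:P)).
Proof.
rewrite /nf_rel /nf_poly mulr0 addr0 mulr1 Xn_comp_quad addn1.
set S := (X in drop_poly 1 X).
have S0 : S`_0 = 0.
  by rewrite -horner_coef0 /S !hornerE /= subrr.
have -> : 'X^(q.+1) * drop_poly 1 S = 'X^q * S.
  by rewrite -{2}(drop1K S0) exprSr; ring.
by rewrite /S; ring.
Qed.

Variables (q : nat) (l0 : R[i]).
Hypothesis (q0 : (0 < q)%N).
Hypothesis pl0 : q.-primitive_root l0.
Local Notation dist := (fun l => nm (l - l0)).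

Lemma nf_denom m : ~~ (q %| m)%N -> l0 ^+ (q + m) - l0 ^+ q != 0.
Proof.
by move=> qm; rewrite exprD (prim_expr_order pl0) mul1r subr_eq0 -(prim_order_dvd pl0).
Qed.

(** The corrections c have denominators that do not vanish at l0, so all data remain continuous
    there. The clauses on b and be record that each resonant term is still zero when its order is
    reached. *)
Lemma nf_family m : (m < 3 * q)%N -> exists (V Q : R[i] -> {poly R[i]}) (b be : R[i] -> R[i]),
  [/\ cfam dist l0 V, cfam dist l0 Q, ccont dist l0 b, ccont dist l0 be &
   near_param dist (fun l => nf_rel q m.+1 l (b l) (be l) (V l) (Q l)) /\
   ((m < q)%N -> b = fun=> 0) /\ ((m < 2 * q)%N -> be = fun=> 0)].
Proof.
have cX : cfam dist l0 (fun l => l%:P + 'X).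
  exact: cfamD (cfamC (@ccont_id R l0)) (cfam_cst _ _ _).
have clX n : ccont dist l0 (fun l => l ^+ n) by exact: ccontX (@ccont_id R l0).
elim: m => [|m IH] mq.
  exists (fun=> 0), (fun l => drop_poly 1 ((l%:P + 'X) ^+ q - (l ^+ q)%:P)), (fun=> 0), (fun=> 0).
  split => //; [exact: cfam_cst| |exact: ccont_cst|exact: ccont_cst|].
    by apply: cfam_drop; apply: cfamD (cfamX _ cX) _; apply: cfamN; exact: cfamC.
  by split => //; exists 1 => // l _; exact: nf_start.
have [V [Q [b [be [cV cQ cb cbe [rel [b0 be0]]]]]]] := IH (ltnW mq).
have cU : cfam dist l0 (fun l => nf_poly q (V l)).
  apply: cfamM (cfam_cst _ _ _) _; apply: cfamD (cfam_cst _ _ _) _.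
  exact: cfamM (cfam_cst _ _ _) cV.
have c1V : cfam dist l0 (fun l => 1 + 'X * V l).
  exact: cfamD (cfam_cst _ _ _) (cfamM (cfam_cst _ _ _) cV).
have [qm|qm] := boolP (q %| m.+1)%N; last first.
  pose c l := - (Q l)`_0 / (l ^+ (q + m.+1) - l ^+ q).
  have cden : ccont dist l0 (fun l => l ^+ (q + m.+1) - l ^+ q).
    by apply: ccontD => //; apply: ccont_ext (ccontM (ccont_cst _ _ (-1)) (clX q)) => l; rewrite mulN1r.
  have cc : ccont dist l0 c.
    apply: ccontM; last exact: ccontV cden (nf_denom qm).
    by apply: ccont_ext (ccontM (ccont_cst _ _ (-1)) (cQ.2 0%N)) => l; rewrite mulN1r.
  exists (fun l => V l + (c l)%:P * 'X^m), (fun l => nf_next q m.+1 l (b l) (be l) (V l) (Q l) (c l)), b, be.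
  split => //.
  - by apply: cfamD cV _; apply: cfamM (cfam_cst _ _ _); exact: cfamC.
  - rewrite /nf_next; apply: cfam_drop.
    have cP : cfam dist l0 (fun=> 'X^(q + m.+1)) by exact: cfam_cst.
    have kc := cfamC cc; have kb := cfamC cb; have kbe := cfamC cbe.
    have k2 : cfam dist l0 (fun=> 2) by exact: cfam_cst.
    have k3 : cfam dist l0 (fun=> 3) by exact: cfam_cst.
    refine (cfamD (cfamD (cfamD cQ _) (cfamN _)) (cfamN _)).
    + apply: cfamM kc _; apply: cfamD (cfamX _ cX) _; apply: cfamN; exact: cfamC.
    + apply: cfamM (cfamM kb kc) _; exact: cfamD (cfamM k2 cU) (cfamM kc cP).
    + apply: cfamM (cfamM kbe kc) _; apply: cfamD; last exact: cfamM (cfamX 2 kc) (cfamX 2 cP).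
      exact: cfamD (cfamM k3 (cfamX 2 cU)) (cfamM (cfamM (cfamM k3 kc) cU) cP).
  - split; last by split => h; [apply: b0|apply: be0]; exact: ltnW.
    refine (param_sub (param_and rel (ccont_neq0 cden (nf_denom qm))) _) => l [h1 h2].
    by apply: nf_elim => //; rewrite /c !mulNr divfK// addrN.
have /dvdnP[k kE] := qm.
have : (k == 1) || (k == 2).
  have : (0 < k)%N by case: k kE.
  have : (k < 3)%N by rewrite -(ltn_pmul2r q0) -kE.
  by case: k {kE} => [|[|[|]]].
case/orP => /eqP k1; rewrite {k}k1 ?mul1n in kE.
  have be_0 : be = fun=> 0 by apply: be0; rewrite kE leq_pmull.
  have b_0 : b = fun=> 0 by apply: b0; rewrite -kE.
  exists V, (fun l => drop_poly 1 (Q l - ((Q l)`_0)%:P * (1 + 'X * V l) ^+ 2)), (fun l => (Q l)`_0), be.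
  split => //.
  - apply: cfam_drop; apply: (cfamD cQ); apply: cfamN; apply: cfamM (cfamX _ c1V).
    exact: cfamC (cQ.2 0%N).
  - exact: cQ.2.
  - split; last by split => [|//]; rewrite kE ltnn.
    refine (param_sub rel _) => l; rewrite be_0 b_0 kE; exact: nf_next_quad.
have be_0 : be = fun=> 0 by apply: be0; rewrite kE.
exists V, (fun l => drop_poly 1 (Q l - ((Q l)`_0)%:P * (1 + 'X * V l) ^+ 3)), b, (fun l => (Q l)`_0).
split => //.
- apply: cfam_drop; apply: (cfamD cQ); apply: cfamN; apply: cfamM (cfamX _ c1V).
  exact: cfamC (cQ.2 0%N).
- exact: cQ.2.
- split; last by rewrite kE ltnn; split => //; rewrite ltnNge leq_pmull.
  refine (param_sub rel _) => l; rewrite be_0 kE; exact: nf_next_cube.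
Qed.

End normal_form.

(** * The gate coordinate *)

Section gate_coordinate.
Variable R : realType.
Implicit Types (l b be mu : R[i]).

Let chart_cst_ge0 (a c : R) : 0 <= a -> 0 <= c -> 0 <= (1 + 2 * a) + a * (1 + a) + c * (3 + a).
Proof. by move=> a0 c0; rewrite !addr_ge0 ?mulr_ge0 ?addr_ge0. Qed.

(** With e = 1 / w one has U' = mu U D where D = 1 - e + k e^2 + s, so w' = w / (mu D). Expanding 1
    / D as 1 + e + (1 - k) e^2 + O(e^3) yields the constant term and the coefficient of 1 / w. *)
Lemma chart_step mu b be (U rho : R[i]) (k0 K : R) : mu != 0 -> b != 0 -> U != 0 ->
  0 <= k0 -> 0 <= K ->
  let e := - (b * U) / mu in let w := - mu / (b * U) in
  let U' := mu * U + b * U ^+ 2 + be * U ^+ 3 + rho in let k := be * mu / b ^+ 2 in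
  nm k <= k0 -> nm (rho / (mu * U)) <= K * nm e ^+ 3 -> nm e * (1 + k0 + K) <= 1/2 ->
  U' != 0 /\ nm (- mu / (b * U') - (mu^-1 * w + mu^-1 + mu^-1 * (1 - k) / w))
    <= 2 * nm mu^-1 * ((1 + 2 * k0) + k0 * (1 + k0) + K * (3 + k0)) / nm w ^+ 2.
Proof.
move=> mu0 b0 U0 k00 K0 e w U' k hk hrho he.
set s := rho / (mu * U) in hrho.
have e0 : e != 0 by rewrite mulf_neq0 ?invr_eq0// oppr_eq0 mulf_neq0.
have weE : w = e^-1 by rewrite /w /e; field; rewrite mu0 b0 U0.
pose D := 1 - e + k * e ^+ 2 + s.
have UE : U' = mu * U * D.
  by rewrite /U' /D /s /k /e; field; rewrite mu0 b0 U0.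
have ne : 0 < nm e by rewrite nm_gt0.
have e1 : nm e <= 1/2 by move: he; nra.
have ske : nm (k * e ^+ 2) <= k0 * nm e.
  rewrite nmM nmX ler_pM ?exprn_ge0 ?nm_ge0// expr2.
  by move: (ne) e1; clear; nra.
have ss : nm s <= K * nm e.
  apply: le_trans hrho _; apply: ler_wpM2l => //.
  have : nm e ^+ 2 <= 1 by rewrite exprn_ile1 ?nm_ge0//; lra.
  by rewrite exprS; nra.
have D2 : 1/2 <= nm D.
  have := nm_leD 1 (- e + k * e ^+ 2 + s); rewrite !addrA -/D nm1.
  have := nmD (- e + k * e ^+ 2) s; have := nmD (- e) (k * e ^+ 2); rewrite nmN.
  by move: he; lra.
have D0 : D != 0 by rewrite -nm_gt0; lra.
split; first by rewrite UE !mulf_neq0.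
have EE : - mu / (b * (mu * U * D)) = mu^-1 * (e^-1 / D).
  by rewrite /e; field; rewrite mu0 b0 U0 D0.
rewrite UE weE; have DE : D = 1 - e + k * e ^+ 2 + s by [].
clearbody D; clearbody k s; clear UE weE U' w; clearbody e.
have -> : - mu / (b * (mu * U * D)) - (mu^-1 * e^-1 + mu^-1 + mu^-1 * (1 - k) / e^-1)
  = (mu^-1 * (e^-1 / D)) * (e ^+ 3 * (1 - 2 * k) - k * (1 - k) * e ^+ 4 - s * (1 + e + (1 - k) * e ^+ 2)).
  rewrite EE invrK; move: D0; rewrite DE => D0; field; rewrite mu0 e0 /=.
  by rewrite D0.
set T := e ^+ 3 * _ - _ - _.
rewrite nmM (nmM mu^-1) (nmM e^-1) !(nmV e) (nmV D).
have hT : nm T <= nm e ^+ 3 * ((1 + 2 * k0) + k0 * (1 + k0) + K * (3 + k0)).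
  have h1 : nm (e ^+ 3 * (1 - 2 * k)) <= nm e ^+ 3 * (1 + 2 * k0).
    rewrite nmM nmX ler_wpM2l ?exprn_ge0 ?nm_ge0//.
    by have := nmB 1 (2 * k); rewrite nm1 nmM nm_nat; lra.
  have hk1 : nm (1 - k) <= 1 + k0 by have := nmB 1 k; rewrite nm1; lra.
  have h2 : nm (k * (1 - k) * e ^+ 4) <= nm e ^+ 3 * (k0 * (1 + k0)).
    rewrite nmM nmX mulrC [nm e ^+ 4]exprSr -mulrA ler_wpM2l ?exprn_ge0 ?nm_ge0//.
    have : nm (k * (1 - k)) <= k0 * (1 + k0) by rewrite nmM ler_pM ?nm_ge0.
    by have := nm_ge0 (k * (1 - k)); nra.
  have h3 : nm (s * (1 + e + (1 - k) * e ^+ 2)) <= nm e ^+ 3 * (K * (3 + k0)).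
    rewrite nmM.
    have : nm (1 + e + (1 - k) * e ^+ 2) <= 3 + k0.
      have := nmD (1 + e) ((1 - k) * e ^+ 2); have := nmD 1 e; rewrite nm1 nmM nmX.
      have : nm (1 - k) * nm e ^+ 2 <= (1 + k0) * 1.
        rewrite ler_pM ?nm_ge0 ?exprn_ge0 ?nm_ge0//.
        by rewrite exprn_ile1 ?nm_ge0//; lra.
      by move: e1; clear; lra.
    have -> : nm e ^+ 3 * (K * (3 + k0)) = (K * nm e ^+ 3) * (3 + k0) by ring.
    by move=> ?; rewrite ler_pM ?nm_ge0.
  have := nmB (e ^+ 3 * (1 - 2 * k) - k * (1 - k) * e ^+ 4) (s * (1 + e + (1 - k) * e ^+ 2)).
  have := nmB (e ^+ 3 * (1 - 2 * k)) (k * (1 - k) * e ^+ 4).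
  by rewrite -/T !mulrDr; rewrite !mulrDr in h1 h2 h3; lra.
set C := 1 + 2 * k0 + _ + _ in hT *.
have C0 : 0 <= C by exact: chart_cst_ge0.
have hD : (nm D)^-1 <= 2 by rewrite -[2]invrK lef_pV2 ?posrE; lra.
have -> : 2 * nm mu^-1 * C / (nm e)^-1 ^+ 2 = nm mu^-1 * ((nm e)^-1 * 2) * (nm e ^+ 3 * C).
  by field; rewrite gt_eqF.
have Dp : 0 <= (nm D)^-1 by rewrite invr_ge0 nm_ge0.
rewrite ler_pM ?mulr_ge0 ?nm_ge0 ?invr_ge0 ?nm_ge0//.
by rewrite !ler_wpM2l ?nm_ge0 ?invr_ge0 ?nm_ge0.
Qed.

(* The gate coordinate is [w = - l^q / (b U(z))]; it turns [quad l] into a map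
   satisfying [gate_rel] with [d = 1 - l^q]. *)
Definition gate_coord q (b : R[i] -> R[i]) (V : R[i] -> {poly R[i]}) l z :=
  - l ^+ q / (b l * (nf_poly q (V l)).[z]).

Lemma nf_poly_size q (V : {poly R[i]}) C z : nm V.[z] <= C -> nm z * C <= 1/2 ->
  nm z ^+ q / 2 <= nm (nf_poly q V).[z] <= 2 * nm z ^+ q.
Proof.
move=> hV hz; rewrite /nf_poly !hornerE nmM nmX.
have h : nm (z * V.[z]) <= 1/2.
  by apply: le_trans hz; rewrite nmM ler_wpM2l ?nm_ge0.
have := nmD 1 (z * V.[z]); have := nm_leD 1 (z * V.[z]); rewrite nm1 => h1 h2.
have z0 : 0 <= nm z ^+ q by rewrite exprn_ge0 ?nm_ge0.
by apply/andP; split; move: h h1 h2 z0; clear; nra.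
Qed.

Lemma nf_rel_horner q m l b be (V Q : {poly R[i]}) : nf_rel q m l b be V Q -> forall z,
  (nf_poly q V).[quad l z] = l ^+ q * (nf_poly q V).[z] + b * (nf_poly q V).[z] ^+ 2
    + be * (nf_poly q V).[z] ^+ 3 + z ^+ (q + m) * Q.[z].
Proof.
rewrite /nf_rel; move: (nf_poly q V) => U H z.
have := congr1 (fun p => p.[z]) H; rewrite /= horner_comp quad_polyE -/(quad l z) => ->.
by rewrite !(hornerD, hornerM, horner_exp, hornerC, hornerX).
Qed.

(** The relation at l0 is exported because it is the source of the later proof that b(l0) is
    nonzero, by counting petals. The chart has a radius uniform in l, and there |w| is comparable to
    |z|^-q. *)
Lemma gate_chart q l0 : (0 < q)%N -> q.-primitive_root l0 ->
  exists (b : R[i] -> R[i]) (V : R[i] -> {poly R[i]}) Q0 be0,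
  [/\ ccont (fun l => nm (l - l0)) l0 b, cfam (fun l => nm (l - l0)) l0 V,
   nf_rel q (3 * q) l0 (b l0) be0 (V l0) Q0 &
   b l0 != 0 -> exists C r A, [/\ 0 < r, r <= 1, 0 < A & near_param (fun l => nm (l - l0)) (fun l =>
     l ^+ q != 0 /\ b l != 0 /\ exists2 g, nm g <= C & forall z, z != 0 -> nm z <= r ->
      [/\ gate_rel C (1 - l ^+ q) g (gate_coord q b V l z) (gate_coord q b V l (quad l z)),
       A^-1 / nm z ^+ q <= nm (gate_coord q b V l z),
       nm (gate_coord q b V l z) <= A / nm z ^+ q & nm (quad l z) <= 4 * nm z])]].
Proof.
move=> q0 pl0.
have [] := @nf_family R q l0 q0 pl0 (3 * q).-1; first by rewrite prednK ?muln_gt0.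
move=> V [Q [b [be [cV cQ cb cbe [rel _]]]]].
rewrite prednK ?muln_gt0// in rel.
have rel0 : nf_rel q (3 * q) l0 (b l0) (be l0) (V l0) (Q l0).
  by case: rel => d d0; apply; rewrite subrr nm0.
exists b, V, (Q l0), (be l0); split => // b0.
have cid := @ccont_id R l0.
have cq : ccont (fun l => nm (l - l0)) l0 (fun l => l ^+ q)  := ccontX q cid.
have l0q : l0 ^+ q = 1 := prim_expr_order pl0.
set B := nm (b l0); have B0 : 0 < B by rewrite nm_gt0.
have [CV CV0 bV] := cfam_bound cV; have [CQ CQ0 bQ] := cfam_bound cQ.
have nl0 : nm l0 = 1.
  by have : nm l0 ^+ q = 1 by [rewrite -nmX l0q nm1]; move/eqP; rewrite pexpr_eq1 ?nm_ge0// => /eqP.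
set E := nm (be l0) + 1.
have E0 : 0 <= E by rewrite /E; have := nm_ge0 (be l0); lra.
pose k0 := 8 * E / B ^+ 2; pose K := 4 * CQ * (8 / B) ^+ 3.
have k00 : 0 <= k0 by rewrite /k0 divr_ge0 ?mulr_ge0 ?exprn_ge0//; lra.
have K0 : 0 <= K by rewrite /K mulr_ge0 ?exprn_ge0 ?divr_ge0 ?mulr_ge0// ltW.
pose S := (1 + 2 * k0) + k0 * (1 + k0) + K * (3 + k0).
have S0 : 0 <= S by exact: chart_cst_ge0.
have t1 : 0 < 2 * (1 + CV) by lra.
have t2 : 0 < 16 * B * (1 + k0 + K) by rewrite !mulr_gt0//; lra.
pose r := Num.min 1 (Num.min (1 / (2 * (1 + CV))) (1 / (16 * B * (1 + k0 + K)))).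
have r0 : 0 < r by rewrite !lt_min ltr01 !divr_gt0.
have r1 : r <= 1 by rewrite ge_min lexx.
have rV : r * (2 * (1 + CV)) <= 1.
  by rewrite -ler_pdivlMr// !ge_min lexx orbT.
have rK : r * (16 * B * (1 + k0 + K)) <= 1.
  by rewrite -ler_pdivlMr// !ge_min lexx !orbT.
pose A := 8 * B + 8 / B.
have A0 : 0 < A by rewrite /A addr_gt0 ?divr_gt0 ?mulr_gt0.
exists (4 * S + 2 * (1 + k0)), r, A; split => //.
have B2 : 0 < B / 2 by rewrite divr_gt0.
have h12 : 0 < 1/2 :> R by lra.
have near_q := cq _ h12; have near_l := cid _ ltr01.
refine (param_sub (param_and (param_and (param_and rel (param_and near_q near_l)) (param_and bV bQ)) (param_and (cb _ B2) (ccont_bound cbe))) _) => l.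
rewrite /= l0q -/E -/B => -[[[lrel [lq ll]] [lV lQ]] [lb lbe]].
set mu := l ^+ q in lq *.
have mu1 : 1/2 <= nm mu by have := nm_leB 1 mu; rewrite nmC nm1; lra.
have mu2 : nm mu <= 2 by have := nm_leB mu 1; rewrite nm1; lra.
have b1 : B / 2 <= nm (b l) by have := nm_leB (b l0) (b l); rewrite nmC -/B; lra.
have b2 : nm (b l) <= 2 * B by have := nm_leB (b l) (b l0); rewrite -/B; lra.
have ml : nm l <= 2 by have := nm_leB l l0; rewrite nl0; lra.
have mu0 : mu != 0 by rewrite -nm_gt0; lra.
have bl0 : b l != 0 by rewrite -nm_gt0; lra.
split => //; split => //.
pose k := be l * mu / b l ^+ 2.
have hk : nm k <= k0.
  rewrite /k nm_div nmX nmM ler_pdivrMr ?exprn_gt0 ?nm_gt0//.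
  apply: (@le_trans _ _ (E * 2)); first by rewrite ler_pM ?nm_ge0.
  rewrite /k0 mulrAC ler_pdivlMr ?exprn_gt0//.
  have : (B / 2) ^+ 2 <= nm (b l) ^+ 2 by rewrite lerXn2r ?nnegrE ?nm_ge0 ?(ltW B2).
  by move/(ler_wpM2l E0); rewrite exprMn; lra.
have muV : nm mu^-1 <= 2.
  by rewrite nmV -[2]invrK lef_pV2 ?posrE; move: mu1; clear; lra.
have hk1 : nm (1 - k) <= 1 + k0 by have := nmB 1 k; rewrite nm1; lra.
exists (mu^-1 * (1 - k)).
  rewrite nmM; apply: (@le_trans _ _ (2 * (1 + k0))); first by rewrite ler_pM ?nm_ge0.
  lra.
move=> z z0 zr.
have nz : 0 < nm z by rewrite nm_gt0.
have z1 : nm z <= 1 := le_trans zr r1.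
have zq : 0 < nm z ^+ q by rewrite exprn_gt0.
have zqr : nm z ^+ q <= r.
  rewrite -(prednK q0) exprS; apply: le_trans zr.
  by rewrite -[leRHS]mulr1 ler_wpM2l ?nm_ge0// exprn_ile1 ?nm_ge0.
have /andP[U1 U2] : nm z ^+ q / 2 <= nm (nf_poly q (V l)).[z] <= 2 * nm z ^+ q.
  apply: (nf_poly_size q (lV z z1)).
  apply: (@le_trans _ _ (r * CV)); first by rewrite ler_wpM2r.
  by move: rV (r0); clear; lra.
set U := (nf_poly q (V l)).[z] in U1 U2.
have U0 : U != 0 by rewrite -nm_gt0; move: U1 zq; clear; lra.
pose e := - (b l * U) / mu.
have e1 : nm e <= 8 * B * nm z ^+ q.
  rewrite /e nm_div nmN nmM ler_pdivrMr ?nm_gt0//.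
  apply: (@le_trans _ _ (2 * B * (2 * nm z ^+ q))); first by rewrite ler_pM ?nm_ge0.
  have : 0 <= 8 * B * nm z ^+ q by rewrite !mulr_ge0 // ltW.
  move=> /ler_wpM2l/(_ _ _ mu1); clear; lra.
have e2 : B / 8 * nm z ^+ q <= nm e.
  rewrite /e nm_div nmN nmM ler_pdivlMr ?nm_gt0//.
  apply: (@le_trans _ _ (B / 2 * (nm z ^+ q / 2))); last first.
    by rewrite ler_pM ?(ltW B2)// divr_ge0// ltW.
  have : 0 <= B / 8 * nm z ^+ q by rewrite !mulr_ge0 ?invr_ge0// ltW.
  move=> /ler_wpM2l/(_ _ _ mu2); clear; lra.
pose rho := z ^+ (q + 3 * q) * (Q l).[z].
have relz : (nf_poly q (V l)).[quad l z] = mu * U + b l * U ^+ 2 + be l * U ^+ 3 + rho.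
  exact: nf_rel_horner lrel z.
have hrho : nm (rho / (mu * U)) <= K * nm e ^+ 3.
  rewrite nm_div /rho (nmM (z ^+ _)) nmX (nmM mu) ler_pdivrMr ?mulr_gt0 ?nm_gt0//.
  have hQ := lQ z z1.
  have h1 : (B / 8 * nm z ^+ q) ^+ 3 <= nm e ^+ 3.
    by rewrite lerXn2r ?nnegrE ?nm_ge0// !mulr_ge0 ?invr_ge0 ?(ltW zq) ?(ltW B0).
  have h2 : nm z ^+ q / 4 <= nm mu * nm U.
    have -> : nm z ^+ q / 4 = 1/2 * (nm z ^+ q / 2) by clear; lra.
    by apply: ler_pM => //; rewrite divr_ge0// ltW.
  apply: (@le_trans _ _ (K * (B / 8 * nm z ^+ q) ^+ 3 * (nm z ^+ q / 4))); last first.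
    apply: ler_pM => //; first by rewrite mulr_ge0// exprn_ge0// !mulr_ge0 ?invr_ge0 ?(ltW zq) ?(ltW B0).
      by rewrite divr_ge0// ltW.
    by rewrite ler_wpM2l.
  have -> : K * (B / 8 * nm z ^+ q) ^+ 3 * (nm z ^+ q / 4) = nm z ^+ (q + 3 * q) * CQ.
    by rewrite /K exprD mulnC exprM; field; rewrite gt_eqF.
  by rewrite ler_wpM2l// exprn_ge0// nm_ge0.
have he : nm e * (1 + k0 + K) <= 1/2.
  apply: (@le_trans _ _ (8 * B * r * (1 + k0 + K))); last by move: rK; clear; lra.
  rewrite ler_wpM2r//; first by move: k00 K0; clear; lra.
  by apply: (le_trans e1); rewrite ler_wpM2l// mulr_ge0// ltW.
have [U'0 main] := chart_step mu0 bl0 U0 k00 K0 hk hrho he.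
have wE : nm (gate_coord q b V l z) = (nm e)^-1.
  by rewrite /gate_coord -/U -/mu -nmV; congr nm; rewrite /e; field; rewrite mu0 bl0 U0.
have e0 : 0 < nm e by apply: lt_le_trans e2; rewrite mulr_gt0// divr_gt0.
split.
- rewrite /gate_rel /gate_mult.
  have -> : (1 - (1 - mu))^-1 = mu^-1 by congr (_^-1); ring.
  rewrite /gate_coord relz -/U -/mu; apply: (le_trans main).
  rewrite ler_wpM2r ?invr_ge0 ?exprn_ge0 ?nm_ge0//.
  rewrite -/S; have : nm mu^-1 * S <= 2 * S by rewrite ler_wpM2r.
  by move: k00; clear; lra.
- rewrite wE -invfM lef_pV2 ?posrE ?mulr_gt0//; apply: (le_trans e1).
  by rewrite ler_wpM2r ?(ltW zq)// /A lerDl divr_ge0// ltW.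
- rewrite wE -[A]invrK -invfM lef_pV2 ?posrE ?mulr_gt0 ?invr_gt0//; apply: le_trans e2.
  rewrite ler_wpM2r ?(ltW zq)//.
  have B8 : 0 < B / 8 by rewrite divr_gt0.
  rewrite -[leRHS]invrK lef_pV2 ?posrE ?invr_gt0// invf_div /A lerDr.
  by rewrite mulr_ge0 ?ltW.
- apply: le_trans (nm_quad_le z ml) _; rewrite expr2.
  by have := ler_wpM2l (ltW nz) z1; move: nz; clear; lra.
Qed.

End gate_coordinate.

(** * Petals and inverse branches *)

Section maximal_order.
Variable R : realType.
Implicit Types (l : R[i]) (p V Q A : {poly R[i]}).

Lemma poly_X_factor p : p != 0 -> exists s A, A`_0 != 0 /\ p = 'X^s * A.
Proof.
elim: (size p) {-2}p (leqnn (size p)) => [|n IH] {}p.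
  by rewrite leqn0 size_poly_eq0 => /eqP -> /eqP.
move=> sp p0; have [c0|c0] := eqVneq p`_0 0; last by exists 0%N, p; rewrite mul1r.
have pE := drop1K c0.
have [||s [A [A0 AE]]] := IH (drop_poly 1 p).
- by rewrite size_drop_poly leq_subLR.
- by apply: contraNneq p0 => E; rewrite -pE E mul0r.
- by exists s.+1, A; split => //; rewrite -pE AE exprSr; ring.
Qed.

Lemma iterpolyS l k : iterpoly l k.+1 = quad_poly l \Po iterpoly l k.
Proof.
rewrite /quad_poly comp_polyD comp_polyM comp_polyC comp_polyX rmorphXn /= comp_polyX.
by rewrite mul_polyC.
Qed.

Lemma iterpoly_lin l k : exists A, iterpoly l k = 'X * ((l ^+ k)%:P + 'X * A).
Proof.
elim: k => [|k [A AE]]; first by exists 0; rewrite expr0 mulr0 addr0 mulr1.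
have -> : iterpoly l k.+1 = l%:P * iterpoly l k + iterpoly l k ^+ 2 by rewrite mul_polyC.
rewrite AE; exists (l%:P * A + ((l ^+ k)%:P + 'X * A) ^+ 2).
have -> : (l ^+ k.+1)%:P = l%:P * (l ^+ k)%:P by rewrite exprS polyCM.
ring.
Qed.

Lemma nf_iter q m l V Q k : l ^+ q = 1 -> nf_rel q m l 0 0 V Q -> exists Qk,
  nf_poly q V \Po iterpoly l k = nf_poly q V + 'X^(q + m) * Qk /\
  Qk`_0 = Q`_0 * \sum_(j < k) (l ^+ j) ^+ (q + m).
Proof.
move=> lq; rewrite /nf_rel; move: (nf_poly q V) => U.
rewrite lq !mul0r !addr0 mul1r => rel.
elim: k => [|k [Qk [IH Qk0]]].
  by exists 0; rewrite comp_polyXr mulr0 addr0 big_ord0 mulr0 coef0.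
have [A AE] := iterpoly_lin l k.
exists (Qk + ((l ^+ k)%:P + 'X * A) ^+ (q + m) * (Q \Po iterpoly l k)); split.
  rewrite iterpolyS comp_polyA rel comp_polyD IH comp_polyM comp_Xn_poly {1}AE exprMn; ring.
rewrite coefD Qk0 big_ord_recr /= mulrDr; congr (_ + _).
rewrite -horner_coef0 !(hornerD, hornerM, horner_exp, hornerC, hornerX) horner_comp mul0r addr0.
by rewrite AE !(hornerD, hornerM, horner_exp, hornerC, hornerX) mul0r horner_coef0 mulrC.
Qed.

Lemma nf_iter_dvd q m l V Q k : q.-primitive_root l -> nf_rel q m l 0 0 V Q -> (q %| m)%N ->
  exists Qk, nf_poly q V \Po iterpoly l k = nf_poly q V + 'X^(q + m) * Qk /\
  Qk`_0 = k%:R * Q`_0.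
Proof.
move=> pl rel qm; have [Qk [h1 h2]] := nf_iter k (prim_expr_order pl) rel.
exists Qk; split => //; rewrite h2 mulrC; congr (_ * _).
rewrite (eq_bigr (fun=> 1)) ?sumr_const ?card_ord// => j _.
by rewrite exprAC; have /eqP -> : l ^+ (q + m) == 1 by [rewrite -(prim_order_dvd pl) dvdn_addr]; rewrite expr1n.
Qed.

Lemma comp_sub_dvd p D : exists E, p \Po ('X + D) - p = D * E.
Proof.
elim/poly_ind: p => [|p c [E IH]]; first by exists 0; rewrite comp_poly0 subrr mulr0.
exists ((p \Po ('X + D)) + 'X * E).
rewrite comp_polyD comp_polyM comp_polyX comp_polyC mulrDr.
set r := p \Po _ in IH *.
have -> : r * 'X + r * D + c%:P - (p * 'X + c%:P) = r * D + 'X * (r - p) by ring.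
by rewrite IH; ring.
Qed.

(** f^q is not the identity, since 5 escapes, so f^q(z) = z + a z^(s+1) + ... with a nonzero; the
    order of U o f^q - U is then exactly q + s for every V. *)
Lemma return_order q l : (0 < q)%N -> q.-primitive_root l -> exists s, forall V, exists E,
  nf_poly q V \Po iterpoly l q = nf_poly q V + 'X^(q + s) * E /\ E`_0 != 0.
Proof.
move=> q0 pl; have lq := prim_expr_order pl.
have nl : nm l = 1.
  by have : nm l ^+ q = 1 by [rewrite -nmX lq nm1]; move/eqP; rewrite pexpr_eq1 ?nm_ge0// => /eqP.
have [A0 A0E] := iterpoly_lin l q.
have A0n : A0 != 0.
  apply/eqP => A00; have := @escape_iter R l 5 q (ltac:(lra)).
  rewrite -iterpolyE A0E A00 mulr0 addr0 lq mulr1 hornerX nm_nat => /(_ (ltac:(lra))).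
  have : 2 <= 2 ^+ q :> R by rewrite -[leLHS]expr1 ler_eXn2l//; lra.
  lra.
have [s' [A [An AE]]] := poly_X_factor A0n.
exists s'.+1 => V; pose D := 'X^(s'.+2) * A.
have itE : iterpoly l q = 'X + D by rewrite A0E lq AE /D !exprS; ring.
have itE' : iterpoly l q = 'X * (1 + 'X^(s'.+1) * A) by rewrite itE /D exprS; ring.
pose G := 1 + 'X * V; have [E1 hE1] := comp_sub_dvd G D.
pose B := \sum_(i < q) (1 + 'X^(s'.+1) * A) ^+ i.
have BE : (1 + 'X^(s'.+1) * A) ^+ q - 1 = 'X^(s'.+1) * A * B.
  by rewrite subrX1 addrAC subrr add0r.
exists (A * B * (G \Po iterpoly l q) + 'X * A * E1); split; last first.
  rewrite -horner_coef0 !(hornerD, hornerM, horner_exp, hornerC, hornerX) !mul0r addr0.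
  rewrite horner_comp itE' !(hornerD, hornerM, horner_exp, hornerC, hornerX) !mul0r.
  rewrite addr0 mulr1 horner_coef0.
  rewrite mulf_neq0// /B horner_sum (eq_bigr (fun=> 1)); last first.
    by move=> i _; rewrite !(hornerD, hornerM, horner_exp, hornerC, hornerX) expr0n mul0r addr0 expr1n.
  by rewrite sumr_const card_ord pnatr_eq0 -lt0n.
rewrite /nf_poly -/G comp_polyM comp_Xn_poly {1}itE' exprMn.
have -> : (1 + 'X^(s'.+1) * A) ^+ q = 1 + 'X^(s'.+1) * A * B by rewrite -BE; ring.
have GE : G \Po iterpoly l q = G + D * E1 by rewrite itE -hE1; ring.
by rewrite GE /D exprD !exprS; ring.
Qed.

Lemma X_factor_eq s m A Q : A`_0 != 0 -> 'X^s * A = 'X^m * Q -> (m <= s)%N /\ (Q`_0 != 0 -> m = s).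
Proof.
move=> A0 E.
have key a b (B C : {poly R[i]}) : B`_0 != 0 -> 'X^a * B = 'X^b * C -> (b <= a)%N.
  move=> B0 EE; rewrite leqNgt; apply/negP => ab; move/eqP: B0; apply.
  have := congr1 (fun p => p`_a) EE; rewrite !coefXnM ltnn subnn ab.
  by [].
split; first exact: key A0 E.
by move=> Q0; apply/eqP; rewrite eqn_leq (key _ _ _ _ A0 E) (key _ _ _ _ Q0 (esym E)).
Qed.

(** Non-resonant orders are removed in turn. The process must stop at a resonant order with nonzero
    coefficient, because [return_order] bounds the order of every normal form; the bound is attained
    exactly there. The integer nu counts the cycles of petals. *)
Lemma nf_maximal q l : (0 < q)%N -> q.-primitive_root l -> exists nu V Q,
  [/\ (0 < nu)%N, nf_rel q (nu * q) l 0 0 V Q, Q`_0 != 0 &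
   forall m V' Q', nf_rel q m l 0 0 V' Q' -> (m <= nu * q)%N].
Proof.
move=> q0 pl; have lq := prim_expr_order pl.
have [s hs] := return_order q0 pl.
have bound m V Q : nf_rel q m l 0 0 V Q -> (m <= s)%N /\ ((q %| m)%N -> Q`_0 != 0 -> m = s).
  move=> rel; have [E [h1 E0]] := hs V.
  have [Qk [h2 Qk0]] := nf_iter q lq rel.
  have EQ : 'X^(q + s) * E = 'X^(q + m) * Qk by apply: (addrI (nf_poly q V)); rewrite -h1 -h2.
  have [h3 h4] := X_factor_eq E0 EQ.
  split; first by rewrite leq_add2l in h3.
  move=> qm Q0; apply/eqP; rewrite -(eqn_add2l q); apply/eqP; apply: h4.
  have [Q2 [h5 Q20]] := nf_iter_dvd q pl rel qm.
  have -> : Qk`_0 = Q2`_0.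
    have EE : 'X^(q + m) * Qk = 'X^(q + m) * Q2 by apply: (addrI (nf_poly q V)); rewrite -h2 -h5.
    by have := congr1 (fun p => p`_(q + m)) EE; rewrite !coefXnM ltnn subnn.
  by rewrite Q20 mulf_neq0// pnatr_eq0 -lt0n.
suff [m [V [Q [qm m0 rel Q0]]]] : exists m V Q, [/\ (q %| m)%N, (0 < m)%N, nf_rel q m l 0 0 V Q & Q`_0 != 0].
  have /dvdnP[nu nuE] := qm; rewrite nuE muln_gt0 in m0 rel.
  exists nu, V, Q; split => //; first by case/andP: m0.
  move=> m' V' Q' rel'; have [h _] := bound _ _ _ rel'; apply: (leq_trans h).
  by have [_ <-] := bound _ _ _ rel; rewrite // dvdn_mull.
apply: contrapT => none.
suff /(_ s)[V [Q rel]] : forall m, exists V Q, nf_rel q m.+1 l 0 0 V Q.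
  by have [] := bound _ _ _ rel; rewrite ltnn.
elim=> [|m [V [Q rel]]]; first by exists 0; eexists; exact: nf_start.
have [qm|qm] := boolP (q %| m.+1)%N.
  have Q0 : Q`_0 = 0.
    by apply/eqP; apply: contrapT => /negP Q0; apply: none; exists m.+1, V, Q.
  exists (V + 0%:P * 'X^m), (nf_next q m.+1 l 0 0 V Q 0); apply: nf_elim => //.
  by rewrite Q0 mul0r addr0.
have den := nf_denom pl qm.
set c := - Q`_0 / (l ^+ (q + m.+1) - l ^+ q).
exists (V + c%:P * 'X^m), (nf_next q m.+1 l 0 0 V Q c); apply: nf_elim => //.
by rewrite /c !mulNr divfK// addrN.
Qed.

End maximal_order.

(** * Approximate Fatou coordinate on the petals *)

Section petal_chart.
Variable R : realType.
Implicit Types (l b z : R[i]) (p V Q : {poly R[i]}).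

Lemma poly_bound p (r : R) : 0 <= r -> exists2 C, 0 <= C & forall z, nm z <= r -> nm p.[z] <= C.
Proof.
move=> r0; exists (\sum_(i < size p) nm p`_i * r ^+ i).
  by apply: sumr_ge0 => i _; rewrite mulr_ge0 ?nm_ge0 ?exprn_ge0.
move=> z hz; rewrite horner_coef; apply: (le_trans (nm_sum _ _ _)).
apply: ler_sum => i _; rewrite nmM nmX ler_wpM2l ?nm_ge0//.
by rewrite lerXn2r ?nnegrE ?nm_ge0.
Qed.

Lemma binom_expand n : exists P : {poly R[i]}, (1 + 'X) ^+ n = 1 + n%:R * 'X + 'X ^+ 2 * P.
Proof.
elim: n => [|n [P IH]]; first by exists 0; rewrite expr0; ring.
by exists (n%:R + P + 'X * P); rewrite exprS IH -natr1; ring.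
Qed.

(** The leading term of the Fatou coordinate for U o f = U + b U^(nu+1) + ..., in which f is close
    to the translation by 1. *)
Definition petal_coord nu b (U : {poly R[i]}) z := - 1 / (nu%:R * b * U.[z] ^+ nu).

(** On the right the power zN of z occurs only in the quotient t / zN, which is bounded; each
    summand has a factor z or t, so the error is O(z). *)
Lemma petal_step (nu : nat) (b zN g t P p1 z : R[i]) : (0 < nu)%N -> b != 0 -> zN != 0 -> g != 0 -> 1 + t != 0 ->
  (1 + t) ^+ nu = 1 + nu%:R * t + t ^+ 2 * P -> - t + b * (zN * g ^+ nu) = zN * (z * p1) / g ->
  - 1 / (nu%:R * b * (zN * (1 + t) ^+ nu * g ^+ nu)) + 1 / (nu%:R * b * (zN * g ^+ nu)) - 1 =
  - 1 / (nu%:R * b * g ^+ nu) * (nu%:R * (z * p1) / g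
    + nu%:R * b * g ^+ nu * (t * (nu%:R + t * P)) - t * (t / zN) * P) / (1 + t) ^+ nu.
Proof.
move=> nu0 b0 zN0 g0 t0 hP hp.
have n0 : nu%:R != 0 :> R[i] by rewrite pnatr_eq0 -lt0n.
have gn : g ^+ nu != 0 by rewrite expf_neq0.
have tn : (1 + t) ^+ nu != 0 by rewrite expf_neq0.
have -> : nu%:R * (z * p1) / g = nu%:R * (- t + b * (zN * g ^+ nu)) / zN.
  by rewrite hp; field; rewrite g0 zN0.
move: hP gn tn; move: (g ^+ nu) ((1 + t) ^+ nu) => G T hT G0 T0.
have -> : t * (t / zN) * P = (T - 1 - nu%:R * t) / zN by rewrite hT; field.
have -> : t * (nu%:R + t * P) = T - 1 by rewrite hT; ring.
by field; rewrite T0 n0 b0 G0 zN0.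
Qed.

Lemma petal_chart l q nu V Q : (0 < q)%N -> (0 < nu)%N -> l ^+ q = 1 ->
  nf_rel q (nu * q) l 0 0 V Q -> Q`_0 != 0 -> let U := nf_poly q V in
  exists r C, [/\ 0 < r, r <= 1, 0 <= C & forall z, z != 0 -> nm z <= r ->
   [/\ U.[z] != 0, U.[quad l z] != 0, nm (U.[z] / z ^+ q - 1) <= C * nm z,
     nm (U.[quad l z] / U.[z] - 1) <= C * nm z &
     nm (petal_coord nu Q`_0 U (quad l z) - petal_coord nu Q`_0 U z - 1) <= C * nm z]].
Proof.
move=> q0 nu0 lq rel; set b := Q`_0 => b0 U.
pose G : {poly R[i]} := 1 + 'X * V.
(* p is b G^(nu+1) - Q. It vanishes at 0 and compares Q with its value for the pure relation U + b
   U^(nu+1). *)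
pose p := b%:P * (G ^+ nu.+1 - 1) + (b%:P - Q).
have p0 : p`_0 = 0.
  rewrite -horner_coef0 /p /G !(hornerD, hornerN, hornerM, horner_exp, hornerC, hornerX).
  by rewrite !horner_coef0 mul0r addr0 expr1n -/b; ring.
pose p1 := drop_poly 1 p.
have pE z : p.[z] = z * p1.[z] by rewrite -{1}(drop1K p0) hornerM hornerX mulrC.
have [P hP] := binom_expand nu.
have [CV CV0 bV] := poly_bound V ler01; have [CQ CQ0 bQ] := poly_bound Q ler01.
have [Cp Cp0 bp] := poly_bound p1 ler01; have [CP CP0 bP] := poly_bound P ler01.
pose r := Num.min 1 (Num.min (1 / (2 * (1 + CV))) (1 / (4 * (1 + CQ)))).
have r0 : 0 < r by rewrite !lt_min ltr01 !divr_gt0//; lra.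
have r1 : r <= 1 by rewrite ge_min lexx.
have rV : r * (2 * (1 + CV)) <= 1 by rewrite -ler_pdivlMr ?ge_min ?lexx ?orbT//; lra.
have rQ : r * (4 * (1 + CQ)) <= 1 by rewrite -ler_pdivlMr ?ge_min ?lexx ?orbT//; lra.
pose B := nm b; have B0 : 0 < B by rewrite nm_gt0.
pose n : R := nu%:R; have n1 : 1 <= n by rewrite ler1n.
pose D := (1 / (n * B)) * 2 ^+ nu * (n * Cp * 2 + n * B * 2 ^+ nu * (2 * CQ * (n + CP)) + 2 * CQ * (2 * CQ) * CP) * 2 ^+ nu.
have D0 : 0 <= D by rewrite /D !(mulr_ge0, addr_ge0, exprn_ge0, invr_ge0, divr_ge0)//; lra.
exists r, (CV + 2 * CQ + D); split => //; first by rewrite !addr_ge0// mulr_ge0.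
move=> z z0 zr; have nz : 0 < nm z by rewrite nm_gt0.
have z1 : nm z <= 1 := le_trans zr r1.
set g := 1 + z * V.[z].
have hV := bV z z1; have hQ := bQ z z1.
have zg : nm (g - 1) <= CV * nm z.
  by rewrite /g addrAC subrr add0r nmM mulrC ler_wpM2r ?nm_ge0.
have zV : CV * nm z <= 1/2.
  have : nm z * CV <= r * CV by rewrite ler_wpM2r.
  by move: rV (r0); clear; lra.
have g1 : 1/2 <= nm g by move: (nm_leB 1 g) zg zV; rewrite nmC nm1; clear; lra.
have g2 : nm g <= 2 by move: (nm_leB g 1) zg zV; rewrite nm1; clear; lra.
have g0 : g != 0 by rewrite -nm_gt0; move: g1; clear; lra.
have UE : U.[z] = z ^+ q * g by rewrite /U /nf_poly !(hornerD, hornerM, horner_exp, hornerC, hornerX).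
have U0 : U.[z] != 0 by rewrite UE mulf_neq0 ?expf_neq0.
pose zN := z ^+ (nu * q); have zN0 : zN != 0 by rewrite expf_neq0.
pose t := zN * Q.[z] / g.
have U'E : U.[quad l z] = U.[z] * (1 + t).
  have := nf_rel_horner rel z; rewrite -/U lq !mul0r !addr0 mul1r => ->.
  by rewrite UE /t exprD -/zN; field.
have tQ : nm (t / zN) <= 2 * CQ.
  have -> : t / zN = Q.[z] / g by rewrite /t; field; rewrite g0 zN0.
  rewrite nm_div ler_pdivrMr ?nm_gt0//; apply: (le_trans hQ).
  by move: (ler_wpM2l CQ0 g1); clear; lra.
have zNz : nm zN <= nm z.
  rewrite /zN nmX; have : (0 < nu * q)%N by rewrite muln_gt0 nu0.
  by case: (nu * q)%N => // k _; rewrite exprS ler_piMr ?nm_ge0// exprn_ile1 ?nm_ge0.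
have tz : nm t <= 2 * CQ * nm z.
  have -> : t = (t / zN) * zN by rewrite divfK.
  by rewrite nmM ler_pM ?nm_ge0.
have t1 : nm t <= 1/2.
  apply: (le_trans tz); have : CQ * nm z <= CQ * r by rewrite ler_wpM2l.
  by move: rQ (r0); clear; lra.
have t2 : 1/2 <= nm (1 + t) by move: (nm_leD 1 t) t1; rewrite nm1; clear; lra.
have t0 : 1 + t != 0 by rewrite -nm_gt0; move: t2; clear; lra.
have Cz : 0 <= CV * nm z by rewrite mulr_ge0 ?nm_ge0.
have Qz : 0 <= 2 * CQ * nm z by rewrite !mulr_ge0 ?nm_ge0.
have Dz : 0 <= D * nm z by rewrite mulr_ge0 ?nm_ge0.
rewrite !mulrDl; split => //.
- by rewrite U'E mulf_neq0.
- have -> : U.[z] / z ^+ q = g by rewrite UE mulrC mulKf ?expf_neq0.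
  by move: zg Qz Dz; clear; lra.
- have -> : U.[quad l z] / U.[z] - 1 = t by rewrite U'E mulrC mulKf// addrC addKr.
  by move: tz Cz Dz; clear; lra.
have Uz : U.[z] ^+ nu = zN * g ^+ nu by rewrite UE exprMn -exprM mulnC.
have Uz' : U.[quad l z] ^+ nu = zN * (1 + t) ^+ nu * g ^+ nu by rewrite U'E exprMn Uz mulrAC.
have hPt : (1 + t) ^+ nu = 1 + nu%:R * t + t ^+ 2 * P.[t].
  have := congr1 (fun p => p.[t]) hP.
  by rewrite !(hornerD, hornerM, horner_exp, hornerC, hornerX) -polyC1 -polyC_natr !hornerC.
have hpt : - t + b * (zN * g ^+ nu) = zN * (z * p1.[z]) / g.
  rewrite -pE /p /G /t !(hornerD, hornerN, hornerM, horner_exp, hornerC, hornerX) -/g exprSr.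
  by field.
have main := petal_step nu0 b0 zN0 g0 t0 hPt hpt.
rewrite /petal_coord Uz Uz' -/b; clearbody t; clearbody zN g.
have -> : - 1 / (nu%:R * b * (zN * (1 + t) ^+ nu * g ^+ nu)) - - 1 / (nu%:R * b * (zN * g ^+ nu)) - 1
  = - 1 / (nu%:R * b * (zN * (1 + t) ^+ nu * g ^+ nu)) + 1 / (nu%:R * b * (zN * g ^+ nu)) - 1.
  by rewrite !mulNr opprK.
rewrite main.
suff : nm (- 1 / (nu%:R * b * g ^+ nu) * (nu%:R * (z * p1.[z]) / g + nu%:R * b * g ^+ nu * (t * (nu%:R + t * P.[t])) - t * (t / zN) * P.[t]) / (1 + t) ^+ nu) <= D * nm z.
  by move: Cz Qz; clear; lra.
have half (x : R[i]) : 1/2 <= nm x -> nm (x ^+ nu)^-1 <= 2 ^+ nu.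
  move=> hx; rewrite nmV nmX -exprVn lerXn2r ?nnegrE ?invr_ge0 ?nm_ge0//.
  by rewrite -[2]invrK lef_pV2 ?posrE; move: hx; clear; lra.
rewrite nmM /D.
set S := (_ + _ - _).
have hS : nm S <= (n * Cp * 2 + n * B * 2 ^+ nu * (2 * CQ * (n + CP)) + 2 * CQ * (2 * CQ) * CP) * nm z.
  have hp1 := bp z z1.
  have hPb : nm P.[t] <= CP by apply: bP; move: t1; clear; lra.
  have nn : nm nu%:R = n by rewrite nm_nat.
  have s1 : nm (nu%:R * (z * p1.[z]) / g) <= n * Cp * 2 * nm z.
    rewrite nm_div !nmM nn ler_pdivrMr ?nm_gt0//.
    apply: (@le_trans _ _ (n * (nm z * Cp))).
      by rewrite !ler_wpM2l ?nm_ge0//; move: n1; clear; lra.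
    have : 0 <= n * Cp * nm z by rewrite !mulr_ge0 ?nm_ge0//; move: n1; clear; lra.
    by move/ler_wpM2l => /(_ _ _ g1); clear; lra.
  have s2 : nm (nu%:R * b * g ^+ nu * (t * (nu%:R + t * P.[t]))) <= n * B * 2 ^+ nu * (2 * CQ * (n + CP)) * nm z.
    have -> : n * B * 2 ^+ nu * (2 * CQ * (n + CP)) * nm z = n * B * 2 ^+ nu * (2 * CQ * nm z * (n + CP)) by ring.
    rewrite !nmM nn -/B nmX; apply: ler_pM; rewrite ?mulr_ge0 ?exprn_ge0 ?nm_ge0//; try (move: n1; clear; lra).
      rewrite ler_wpM2l//; first by rewrite mulr_ge0 ?(ltW B0)//; move: n1; clear; lra.
      by rewrite lerXn2r ?nnegrE ?nm_ge0.
    apply: ler_pM; rewrite ?nm_ge0//; have := nmD (nu%:R : R[i]) (t * P.[t]); rewrite nn nmM.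
    have : nm t * nm P.[t] <= 1 * CP by rewrite ler_pM ?nm_ge0//; move: t1; clear; lra.
    by clear; lra.
  have s3 : nm (t * (t / zN) * P.[t]) <= 2 * CQ * (2 * CQ) * CP * nm z.
    have -> : 2 * CQ * (2 * CQ) * CP * nm z = 2 * CQ * nm z * (2 * CQ) * CP by ring.
    by rewrite !nmM; apply: ler_pM; rewrite ?mulr_ge0 ?nm_ge0//; apply: ler_pM; rewrite ?mulr_ge0 ?nm_ge0// -nmM.
  rewrite /S; set x1 := _ / g in s1 *; set x2 := _ * (_ * (_ + _)) in s2 *; set x3 := _ * P.[t] in s3 *.
  have := nmB (x1 + x2) x3; have := nmD x1 x2; move: s1 s2 s3; rewrite !mulrDl; clear; lra.
set K := (_ + _ + _) in hS *.
have hg : nm (- 1 / (nu%:R * b * g ^+ nu)) <= 1 / (n * B) * 2 ^+ nu.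
  rewrite nm_div nmN nm1 !nmM nm_nat -/n -/B invfM mulrA ler_wpM2l//.
    by rewrite mul1r invr_ge0 mulr_ge0 ?(ltW B0)//; move: n1; clear; lra.
  by rewrite -nmV; exact: half.
have -> : 1 / (n * B) * 2 ^+ nu * K * 2 ^+ nu * nm z = 1 / (n * B) * 2 ^+ nu * (K * nm z) * 2 ^+ nu by ring.
apply: ler_pM; rewrite ?nm_ge0//; last exact: half.
by rewrite nmM ler_pM ?nm_ge0.
Qed.

End petal_chart.

(** * Uniform limits of polynomials, square roots and inverse branches *)

Section polynomial_approximation.
Variable R : realType.
Implicit Types (v z a : R[i]) (r e M : R) (h g : R[i] -> R[i]) (p : {poly R[i]}).

(** Plays the part of holomorphic functions on a disc: the class admits sums, products, inverses and
    square roots of zero-free functions, and inherits the Cauchy estimates. *)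
Definition poly_limit v r h := forall e, 0 < e -> exists p, forall z, nm (z - v) <= r -> nm (p.[z] - h z) <= e.

Lemma poly_limit_poly v r p : poly_limit v r (horner p).
Proof. by move=> e e0; exists p => z _; rewrite subrr nm0 ltW. Qed.

Lemma poly_limit_ext v r h g : (forall z, nm (z - v) <= r -> h z = g z) ->
  poly_limit v r h -> poly_limit v r g.
Proof. by move=> E H e /H[p hp]; exists p => z hz; rewrite -E//; exact: hp. Qed.

Lemma poly_limit_le v r r' h : r' <= r -> poly_limit v r h -> poly_limit v r' h.
Proof. by move=> rr H e /H[p hp]; exists p => z hz; apply: hp; exact: le_trans rr. Qed.

Lemma poly_limitS v r h : (forall e, 0 < e -> exists2 g, poly_limit v r g &
  forall z, nm (z - v) <= r -> nm (g z - h z) <= e) -> poly_limit v r h.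
Proof.
move=> H e e0; have e2 : 0 < e / 2 by rewrite divr_gt0.
have [g hg gh] := H _ e2; have [p hp] := hg _ e2; exists p => z hz.
have := nm_tri (g z) p.[z] (h z); have := gh z hz; have := hp z hz; lra.
Qed.

Lemma poly_limit_bound v r h : 0 <= r -> poly_limit v r h ->
  exists2 M, 0 <= M & forall z, nm (z - v) <= r -> nm (h z) <= M.
Proof.
move=> r0 /(_ 1 ltr01)[p hp].
have [C C0 hC] := poly_bound (shift_poly v p) r0.
exists (C + 1); first lra.
move=> z hz; have := hC _ hz; rewrite shift_polyE subrK.
have := hp z hz; have := nm_leB (h z) p.[z]; rewrite nmC; lra.
Qed.

Lemma poly_limitD v r h g : poly_limit v r h -> poly_limit v r g -> poly_limit v r (fun z => h z + g z).
Proof.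
move=> H G e e0; have e2 : 0 < e / 2 by rewrite divr_gt0.
have [p hp] := H _ e2; have [p' hp'] := G _ e2; exists (p + p') => z hz.
have -> : (p + p').[z] - (h z + g z) = (p.[z] - h z) + (p'.[z] - g z) by rewrite hornerD; ring.
have := nmD (p.[z] - h z) (p'.[z] - g z); have := hp z hz; have := hp' z hz; lra.
Qed.

Lemma poly_limitM v r h g : 0 <= r -> poly_limit v r h -> poly_limit v r g -> poly_limit v r (fun z => h z * g z).
Proof.
move=> r0 H G; have [M M0 hM] := poly_limit_bound r0 H; have [N N0 hN] := poly_limit_bound r0 G.
move=> e e0; pose k := Num.min 1 (e / (M + N + 1)).
have A : 0 < M + N + 1 by lra.
have k0 : 0 < k by rewrite lt_min ltr01 divr_gt0.
have k1 : k <= 1 by rewrite ge_min lexx.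
have k2 : k * (M + N + 1) <= e by rewrite -ler_pdivlMr// ge_min lexx orbT.
have [p hp] := H _ k0; have [p' hp'] := G _ k0; exists (p * p') => z hz.
have -> : (p * p').[z] - h z * g z = (p.[z] - h z) * (p'.[z] - g z)
   + (p.[z] - h z) * g z + h z * (p'.[z] - g z) by rewrite hornerM; ring.
have := hp z hz; have := hp' z hz; set x := p.[z] - _; set y := p'.[z] - _ => hy hx.
have := nmD (x * y + x * g z) (h z * y); have := nmD (x * y) (x * g z).
have h1 : nm (x * y) <= k * 1 by rewrite nmM ler_pM ?nm_ge0// (le_trans hy).
have h2 : nm (x * g z) <= k * N by rewrite nmM ler_pM ?nm_ge0// hN.
have h3 : nm (h z * y) <= M * k by rewrite nmM ler_pM ?nm_ge0// hM.
by move: h1 h2 h3 k2; rewrite !mulrDr; clear; lra.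
Qed.

Lemma poly_limit_cst v r a : poly_limit v r (fun=> a).
Proof. by apply: poly_limit_ext (poly_limit_poly v r a%:P) => z _; rewrite hornerC. Qed.

Lemma poly_limit_lip v r h M z z' : 0 < r -> poly_limit v r h ->
  (forall z, nm (z - v) <= r -> nm (h z) <= M) -> nm (z - v) <= r / 2 -> nm (z' - v) <= r / 2 ->
  nm (h z - h z') <= 8 * M * nm (z - z') / r.
Proof.
move=> r0 H hM hz hz'; rewrite leNgt; apply/negP => lt.
set X := 8 * M * nm (z - z') / r in lt.
have zr : nm (z - v) <= r by move: hz r0; clear; lra.
have zr' : nm (z' - v) <= r by move: hz' r0; clear; lra.
pose D := nm (h z - h z') - X; have D0 : 0 < D by rewrite /D subr_gt0.
pose Y := 8 * nm (z - z') / r.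
have Y0 : 0 <= Y by rewrite /Y divr_ge0 ?mulr_ge0 ?nm_ge0// ltW.
have e0 : 0 < D / (2 * (3 + Y)) by rewrite divr_gt0// mulr_gt0//; lra.
have [p hp] := H _ e0; set e := D / _ in e0 hp.
have pM w : nm (w - v) <= r -> nm p.[w] <= M + e.
  move=> hw; have := hM w hw; have := hp w hw; have := nm_leB p.[w] (h w); lra.
have := poly_lip r0 pM hz hz'.
have -> : 8 * (M + e) * nm (z - z') / r = X + Y * e.
  by rewrite /X /Y; field; rewrite gt_eqF.
have := hp z zr; have := hp z' zr'.
have := nm_tri p.[z] (h z) (h z'); have := nm_tri p.[z'] p.[z] (h z'); rewrite (nmC (h z) p.[z]).
have : e * (2 * (3 + Y)) = D by rewrite divfK// gt_eqF// mulr_gt0//; lra.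
move=> E t1 t2 t3 t4 t5.
have : D <= 2 * e + Y * e by move: t1 t2 t3 t4 t5; rewrite /D; clear; lra.
have : 0 <= Y * e by rewrite mulr_ge0// ltW.
by rewrite -E; move: e0; clear; lra.
Qed.

Lemma geom_limit (u : nat -> R[i]) (c t : R) : 0 <= c -> 0 <= t -> t < 1 ->
  (forall n, nm (u n.+1 - u n) <= c * t ^+ n) -> exists a, forall n, nm (u n - a) <= c * t ^+ n / (1 - t).
Proof.
move=> c0 t0 t1 H; have d0 : 0 < 1 - t by lra.
have key n k : nm (u (n + k)%N - u n) <= c * t ^+ n / (1 - t) * (1 - t ^+ k).
  elim: k => [|k IH]; first by rewrite addn0 subrr nm0 expr0 subrr mulr0.
  have -> : u (n + k.+1)%N - u n = (u (n + k).+1 - u (n + k)%N) + (u (n + k)%N - u n).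
    by rewrite addnS; ring.
  apply: (le_trans (nmD _ _)); have := H (n + k)%N; rewrite exprD exprS.
  have -> : c * t ^+ n / (1 - t) * (1 - t * t ^+ k) = c * t ^+ n / (1 - t) * (1 - t ^+ k) + c * (t ^+ n * t ^+ k).
    by field; rewrite gt_eqF.
  by move: IH; clear; lra.
have b n k : nm (u (n + k)%N - u n) <= c * t ^+ n / (1 - t).
  apply: (le_trans (key n k)); rewrite ler_piMr ?divr_ge0 ?mulr_ge0 ?exprn_ge0 ?(ltW d0)//.
  by rewrite lerBlDr lerDl exprn_ge0.
have [a ha] := @bolzano R u (nm (u 0%N) + c * t ^+ 0 / (1 - t)) (fun n => ltac:(have := b 0%N n; have := nm_leB (u n) (u 0%N); rewrite add0n; lra)).
exists a => n; rewrite leNgt; apply/negP; rewrite -subr_gt0 => lt.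
have [m mn hm] := ha _ lt n.
have := b n (m - n)%N; rewrite subnKC// => h1.
have := nm_tri (u m) (u n) a; rewrite (nmC (u n) (u m)); lra.
Qed.

Lemma poly_limit_geom v r (h : nat -> R[i] -> R[i]) (c t : R) : 0 <= c -> 0 <= t -> t < 1 ->
  (forall n, poly_limit v r (h n)) ->
  (forall n z, nm (z - v) <= r -> nm (h n.+1 z - h n z) <= c * t ^+ n) ->
  exists2 g, poly_limit v r g & forall n z, nm (z - v) <= r -> nm (h n z - g z) <= c * t ^+ n / (1 - t).
Proof.
move=> c0 t0 t1 H hh.
have /(@choice _ _ _)[g hg] : forall z, exists a, nm (z - v) <= r -> forall n, nm (h n z - a) <= c * t ^+ n / (1 - t).
  move=> z; have [hz|hz] := leP (nm (z - v)) r; last by exists 0.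
  by have [a ha] := geom_limit c0 t0 t1 (fun n => hh n z hz); exists a.
exists g => [|n z hz]; last exact: hg.
apply: poly_limitS => e e0; have d0 : 0 < 1 - t by lra.
have [n hn] := @expr_lt R t (e * (1 - t) / (c + 1)) t0 t1 (ltac:(by rewrite divr_gt0 ?mulr_gt0// ltr_wpDl)).
exists (h n) => // z hz; apply: (le_trans (hg z hz n)).
rewrite ler_pdivrMr//; have := hn n (leqnn n); rewrite ltr_pdivlMr; last by rewrite ltr_wpDl.
have := exprn_ge0 n t0; move: (t ^+ n) => T T0 hT; rewrite mulrDr mulr1 in hT.
by move: T0 hT; clear; lra.
Qed.

Lemma small_eq0 (a : R[i]) (c t k : R) : 0 <= t -> t < 1 -> 0 <= c ->
  (forall n, nm a <= k * (c * t ^+ n)) -> a = 0.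
Proof.
move=> t0 t1 c0 H; apply/eqP; rewrite -nm_eq0 eq_le nm_ge0 andbT leNgt; apply/negP => a0.
have k1 : 0 < `|k| * c + 1 by rewrite ltr_wpDl// mulr_ge0.
have [n hn] := @expr_lt R t (nm a / (`|k| * c + 1)) t0 t1 (ltac:(by rewrite divr_gt0)).
have := hn n (leqnn n); rewrite ltr_pdivlMr// => h1; have h2 := H n.
have T0 := exprn_ge0 n t0; have hk := ler_norm k.
have : k * (c * t ^+ n) <= `|k| * (c * t ^+ n) by rewrite ler_wpM2r// mulr_ge0.
by move: h1 h2 T0; rewrite mulrDr mulr1; move: (t ^+ n) (`|k|) => T K; clear; lra.
Qed.

(** The fixed-point iteration y = 1 + h y, that is the Neumann series. *)
Lemma poly_limit_inv v r h (t : R) : 0 <= r -> 0 <= t -> t < 1 -> poly_limit v r h ->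
  (forall z, nm (z - v) <= r -> nm (h z) <= t) ->
  exists2 g, poly_limit v r g & forall z, nm (z - v) <= r -> (1 - h z) * g z = 1.
Proof.
move=> r0 t0 t1 H hb; pose u n z : R[i] := iter n (fun y => 1 + h z * y) 1.
have hu n : poly_limit v r (u n).
  elim: n => [|n IH]; first exact: poly_limit_cst.
  by apply: poly_limitD (poly_limit_cst _ _ _) _; exact: poly_limitM.
have du n z : nm (z - v) <= r -> nm (u n.+1 z - u n z) <= 1 * t ^+ n.
  move=> hz; rewrite mul1r; elim: n => [|n IH].
    by rewrite /u /= mulr1 addrAC subrr add0r expr0; apply: le_trans (ltW t1); exact: hb.
  have -> : u n.+2 z - u n.+1 z = h z * (u n.+1 z - u n z) by rewrite /u /=; ring.
  by rewrite nmM exprS ler_pM ?nm_ge0// hb.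
have [g gl hg] := poly_limit_geom ler01 t0 t1 hu du.
exists g => // z hz; apply/eqP; rewrite -subr_eq0; apply/eqP.
apply: (@small_eq0 _ 1 t (2 / (1 - t))) => // n.
have -> : (1 - h z) * g z - 1 = - (u n.+1 z - g z) + h z * (u n z - g z) by rewrite /u /=; ring.
have h1 := hg n.+1 z hz; have h2 := hg n z hz; have h3 := hb z hz.
have := nmD (- (u n.+1 z - g z)) (h z * (u n z - g z)); rewrite nmN nmM.
have h4 : nm (h z) * nm (u n z - g z) <= 1 * (1 * t ^+ n / (1 - t)).
  by rewrite ler_pM ?nm_ge0// (le_trans h3)// ltW.
have h5 : 1 * t ^+ n.+1 / (1 - t) <= 1 * t ^+ n / (1 - t).
  rewrite ler_wpM2r ?invr_ge0//; first by lra.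
  by rewrite !mul1r exprS ler_piMl ?exprn_ge0// ltW.
have -> : 2 / (1 - t) * (1 * t ^+ n) = 1 * t ^+ n / (1 - t) + 1 * t ^+ n / (1 - t) by ring.
by move: h1 h4 h5; clear; lra.
Qed.

(* [1 - s] is a square root of [1 - t] as soon as [s = (t + s^2) / 2]. *)
Lemma poly_limit_sqrt1 v r h (t : R) : 0 <= r -> 0 <= t -> t < 1 -> poly_limit v r h ->
  (forall z, nm (z - v) <= r -> nm (h z) <= t) ->
  exists2 g, poly_limit v r g & forall z, nm (z - v) <= r -> g z ^+ 2 = 1 - h z.
Proof.
move=> r0 t0 t1 H hb; pose u n z : R[i] := iter n (fun y => (h z + y * y) / 2) 0.
have hu n : poly_limit v r (u n).
  elim: n => [|n IH]; first exact: poly_limit_cst.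
  apply: poly_limitM (poly_limit_cst _ _ _) => //.
  by apply: poly_limitD => //; exact: poly_limitM.
have n2 : nm (2^-1 : R[i]) = 2^-1 by rewrite nmV nm_nat.
have bu n z : nm (z - v) <= r -> nm (u n z) <= t.
  move=> hz; elim: n => [|n IH]; first by rewrite nm0.
  rewrite /u /= -/(u n z) nmM n2 ler_pdivrMr//.
  have := nmD (h z) (u n z * u n z); rewrite nmM.
  have : nm (u n z) * nm (u n z) <= t * 1 by rewrite ler_pM ?nm_ge0// (le_trans IH)// ltW.
  have := hb z hz; lra.
have du n z : nm (z - v) <= r -> nm (u n.+1 z - u n z) <= 1 * t ^+ n.
  move=> hz; rewrite mul1r; elim: n => [|n IH].
    rewrite /u /= mulr0 addr0 subr0 expr0 nmM n2.
    by have := hb z hz; have := nm_ge0 (h z); lra.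
  have -> : u n.+2 z - u n.+1 z = (u n.+1 z - u n z) * ((u n.+1 z + u n z) / 2).
    have E k : u k.+1 z = (h z + u k z * u k z) / 2 by [].
    by rewrite (E n.+1) [X in _ - X](E n); field.
  rewrite nmM exprSr ler_pM ?nm_ge0// nmM n2.
  have := nmD (u n.+1 z) (u n z); have := bu n z hz; have := bu n.+1 z hz; lra.
have [g gl hg] := poly_limit_geom ler01 t0 t1 hu du.
have bg z : nm (z - v) <= r -> nm (g z) <= 2 / (1 - t).
  move=> hz; have := hg 0%N z hz; rewrite expr0 mulr1 /u /= sub0r nmN.
  have it0 : 0 < (1 - t)^-1 by rewrite invr_gt0; lra.
  by move: it0; lra.
exists (fun z => 1 + -1 * g z) => [|z hz].
  by apply: poly_limitD (poly_limit_cst _ _ _) _; apply: poly_limitM => //; exact: poly_limit_cst.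
suff E : g z - (h z + g z * g z) / 2 = 0.
  have -> : h z = 2 * g z - g z * g z - 2 * (g z - (h z + g z * g z) / 2) by field.
  by rewrite E; ring.
have it0 : 0 < (1 - t)^-1 by rewrite invr_gt0; lra.
apply: (@small_eq0 _ 1 t ((1 - t)^-1 + (3 / (1 - t)) * (1 - t)^-1)) => // n.
have -> : g z - (h z + g z * g z) / 2 = - (u n.+1 z - g z) + (u n z - g z) * ((u n z + g z) / 2).
  have -> : u n.+1 z = (h z + u n z * u n z) / 2 by [].
  by field.
have h1 := hg n.+1 z hz; have h2 := hg n z hz; have h3 := bu n z hz.
have := nmD (- (u n.+1 z - g z)) ((u n z - g z) * ((u n z + g z) / 2)); rewrite nmN (nmM (u n z - g z)) nmM n2.
have s0 : nm (u n z + g z) / 2 <= 3 / (1 - t).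
  have := nmD (u n z) (g z); have := bg z hz.
  have : 1 <= (1 - t)^-1 by rewrite -invr1 lef_pV2 ?posrE//; lra.
  move: h3 (t1); clear; lra.
have h4 : nm (u n z - g z) * (nm (u n z + g z) / 2) <= (1 * t ^+ n / (1 - t)) * (3 / (1 - t)).
  by rewrite ler_pM ?mulr_ge0 ?nm_ge0 ?invr_ge0.
have h5 : 1 * t ^+ n.+1 / (1 - t) <= 1 * t ^+ n / (1 - t).
  rewrite ler_wpM2r ?(ltW it0)//.
  by rewrite !mul1r exprS ler_piMl ?exprn_ge0// ltW.
have -> : ((1 - t)^-1 + 3 / (1 - t) * (1 - t)^-1) * (1 * t ^+ n) = 1 * t ^+ n / (1 - t) + (1 * t ^+ n / (1 - t)) * (3 / (1 - t)) by ring.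
by move: h1 h4 h5; clear; lra.
Qed.

Lemma linear_sqrt v r r' a : 0 < r' -> r' < r -> r < nm (a - v) ->
  exists s i, [/\ poly_limit v r' s, poly_limit v r' i &
   forall z, nm (z - v) <= r' -> s z ^+ 2 = z - a /\ (z - a) * i z = 1].
Proof.
move=> r'0 rr ra; have r0 : 0 < r by lra.
have av : a - v != 0 by rewrite -nm_gt0; lra.
have t0 : 0 <= r' / r by rewrite divr_ge0// ltW.
have t1 : r' / r < 1 by rewrite ltr_pdivrMr// mul1r.
pose h z := (z - v) / (a - v).
have hl : poly_limit v r' h.
  apply: poly_limitM (poly_limit_cst _ _ _); first exact: ltW.
  by apply: poly_limit_ext (poly_limit_poly v r' ('X - v%:P)) => z _; rewrite hornerXsubC.
have hb z : nm (z - v) <= r' -> nm (h z) <= r' / r.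
  move=> hz; rewrite nm_div; apply: ler_pM; rewrite ?nm_ge0 ?invr_ge0 ?nm_ge0//.
  by rewrite lef_pV2 ?posrE ?ltW//; lra.
have [s sl hs] := poly_limit_sqrt1 (ltW r'0) t0 t1 hl hb.
have [i il hi] := poly_limit_inv (ltW r'0) t0 t1 hl hb.
exists (fun z => sqrtc (v - a) * s z), (fun z => (v - a)^-1 * i z); split.
- by apply: poly_limitM (poly_limit_cst _ _ _) _ => //; exact: ltW.
- by apply: poly_limitM (poly_limit_cst _ _ _) _ => //; exact: ltW.
have va : v - a != 0 by rewrite -opprB oppr_eq0.
have zE z : z - a = (v - a) * (1 - h z) by rewrite /h; field.
move=> z hz; split; first by rewrite exprMn sqr_sqrtc hs// -zE.
by rewrite zE mulrACA mulfV// mul1r hi.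
Qed.

(** All roots lie outside the disc, so a square root is a product over the linear factors, each a
    constant times a square root of 1 - h with |h| <= r' / r. The inverse i is carried along for the
    perturbation in [poly_limit_sqrt]. *)
Lemma poly_sqrt v r r' p : 0 < r' -> r' < r -> (forall z, nm (z - v) <= r -> p.[z] != 0) ->
  exists s i, [/\ poly_limit v r' s, poly_limit v r' i &
   forall z, nm (z - v) <= r' -> s z ^+ 2 = p.[z] /\ p.[z] * i z = 1].
Proof.
move=> r'0 rr p0; have [rs pE] := closed_field_poly_normal p.
have c0 : lead_coef p != 0.
  rewrite lead_coef_eq0; apply/eqP => E; have := p0 v; rewrite subrr nm0 E horner0 eqxx => H.
  by have := H (ltac:(lra)).
have : forall a, a \in rs -> r < nm (a - v).
  move=> a ars; rewrite ltNge; apply/negP => /p0/eqP; apply.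
  by rewrite pE hornerZ (rootP _) ?mulr0// root_prod_XsubC.
rewrite {p0}pE; set c := lead_coef p in c0 *.
elim: rs => [|a rs IH] H.
  exists (fun=> sqrtc c), (fun=> c^-1); split; [exact: poly_limit_cst|exact: poly_limit_cst|].
  by move=> z _; rewrite big_nil hornerZ hornerC mulr1 sqr_sqrtc mulfV.
have [s [i [sl il h]]] := IH (fun b hb => H b (ltac:(by rewrite inE hb orbT))).
have [s' [i' [sl' il' h']]] := linear_sqrt r'0 rr (H a (mem_head _ _)).
exists (fun z => s' z * s z), (fun z => i' z * i z).
split; [exact: poly_limitM (ltW r'0) sl' sl|exact: poly_limitM (ltW r'0) il' il|].
move=> z hz; have [h1 h2] := h z hz; have [h3 h4] := h' z hz.
rewrite big_cons hornerZ hornerM hornerXsubC; rewrite hornerZ in h1 h2; rewrite exprMn h1 h3; split; first by ring.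
by rewrite -[RHS](mul1r 1) -{1}h4 -h2; ring.
Qed.

Lemma poly_limit_min v r h : 0 <= r -> poly_limit v r h -> (forall z, nm (z - v) <= r -> h z != 0) ->
  exists2 m, 0 < m & forall z, nm (z - v) <= r -> m <= nm (h z).
Proof.
move=> r0 H h0; apply: contrapT => none.
have pos n : 0 < n.+1%:R^-1 :> R by rewrite invr_gt0.
have /(@choice _ _ _)[u hu] : forall n : nat, exists z, nm (z - v) <= r /\ nm (h z) < n.+1%:R^-1.
  move=> n; apply: contrapT => nz; apply: none; exists (n.+1%:R^-1) => // z hz.
  by rewrite leNgt; apply/negP => lt; apply: nz; exists z.
have ub n : nm (u n) <= nm v + r by have [h1 _] := hu n; have := nm_leB (u n) v; lra.
have [a ha] := bolzano ub.
have av : nm (a - v) <= r.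
  rewrite leNgt; apply/negP; rewrite -subr_gt0 => lt.
  have [n _ hn] := ha _ lt 0%N; have [h1 _] := hu n.
  by have := nm_tri (u n) a v; rewrite (nmC a (u n)); lra.
have := h0 a av; rewrite -nm_gt0 => ha0.
have e0 : 0 < nm (h a) / 4 by rewrite divr_gt0.
have [p hp] := H _ e0.
have [d d0 hd] := ccont_horner (cfam_cst _ _ p) (@ccont_id R a) e0.
have [N hN] := nat_gt (4 / nm (h a)).
have [n Nn hn] := ha d d0 N; have [h1 h2] := hu n.
have h6 : nm (h (u n)) < nm (h a) / 4.
  apply: (lt_le_trans h2); rewrite -[leRHS]invrK lef_pV2 ?posrE ?invr_gt0// invf_div.
  by apply: (le_trans (ltW hN)); rewrite ler_nat ltnW.
have h3 := hd _ hn; have h4 := hp _ h1; have h5 := hp _ av.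
have := nm_leB (h a) p.[a]; have := nm_leB p.[a] p.[u n]; have := nm_leB p.[u n] (h (u n)).
rewrite (nmC (h a) p.[a]) (nmC p.[a] p.[u n]); move: ha0 h3 h4 h5 h6; clear; lra.
Qed.

(** A zero-free h is bounded below, so it equals p (1 - t) with a zero-free polynomial p
    approximating it and |t| <= 1/2; both factors have square roots. *)
Lemma poly_limit_sqrt v r r' h : 0 < r' -> r' < r -> poly_limit v r h ->
  (forall z, nm (z - v) <= r -> h z != 0) ->
  exists2 s, poly_limit v r' s & forall z, nm (z - v) <= r' -> s z ^+ 2 = h z.
Proof.
move=> r'0 rr H h0; have r0 : 0 < r by lra.
have [m m0 hm] := poly_limit_min (ltW r0) H h0.
have m4 : 0 < m / 4 by rewrite divr_gt0.
have [p hp] := H _ m4.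
have pm z : nm (z - v) <= r -> 3 / 4 * m <= nm p.[z].
  by move=> hz; have := hm z hz; have := hp z hz; have := nm_leB (h z) p.[z]; rewrite nmC; lra.
have p0 z : nm (z - v) <= r -> p.[z] != 0.
  by move=> /pm hz; rewrite -nm_gt0; lra.
have [s [i [sl il hs]]] := poly_sqrt r'0 rr p0.
pose t z := (p.[z] + -1 * h z) * i z.
have r'0' := ltW r'0.
have tl : poly_limit v r' t.
  apply: poly_limitM => //; apply: poly_limitD (poly_limit_poly _ _ _) _.
  by apply: poly_limitM (poly_limit_cst _ _ _) (poly_limit_le (ltW rr) H).
have tb z : nm (z - v) <= r' -> nm (t z) <= 1/2.
  move=> hz; have zr : nm (z - v) <= r by lra.
  have [_ h2] := hs z hz; have h3 := pm z zr; have h4 := hp z zr.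
  have : nm (p.[z] * i z) = 1 by rewrite h2 nm1.
  rewrite nmM /t nmM mulN1r => h5; have i0 := nm_ge0 (i z).
  have : 3 / 4 * m * nm (i z) <= 1.
    by apply: (@le_trans _ _ (nm p.[z] * nm (i z))); [rewrite ler_wpM2r|rewrite h5].
  have : nm (p.[z] - h z) * nm (i z) <= m / 4 * nm (i z) by rewrite ler_wpM2r.
  by clear; lra.
have h12 : 1/2 < 1 :> R by lra.
have [s' sl' hs'] := poly_limit_sqrt1 r'0' (ltac:(by rewrite divr_ge0) : 0 <= 1/2 :> R) h12 tl tb.
exists (fun z => s z * s' z) => [|z hz]; first exact: poly_limitM.
have [h1 h2] := hs z hz; rewrite exprMn h1 hs'// /t.
have -> : p.[z] * (1 - (p.[z] + -1 * h z) * i z) = p.[z] - (p.[z] - h z) * (p.[z] * i z) by ring.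
by rewrite h2; ring.
Qed.

Definition crit l : R[i] := - l / 2.

Lemma quad_crit l z : quad l z - quad l (crit l) = (z - crit l) ^+ 2.
Proof. by rewrite /quad /crit; field. Qed.

(** f y = u reads (y - c)^2 = u - f(c) with c the critical point, so each pull-back is a square
    root, available while the critical orbit avoids the disc. Every root costs a little of the
    radius, hence the induction over r' with r fixed. The bound 4 holds because an orbit that has
    left the disc of radius 4 cannot end at y. *)
Lemma inverse_branch l k x v r r' : nm l <= 2 -> iter k (quad l) x = v -> 0 < r' -> r' < r ->
  nm v + r <= 4 -> (forall j, (j < k)%N -> r < nm (iter j.+1 (quad l) (crit l) - v)) ->
  exists g, [/\ poly_limit v r' g, g v = x & forall y, nm (y - v) <= r' ->
    iter k (quad l) (g y) = y /\ nm (g y) <= 4].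
Proof.
move=> hl; elim: k x r' => [|k IH] x r' xv r'0 rr vr out.
  exists id; split; first by apply: poly_limit_ext (poly_limit_poly v r' 'X) => z _; rewrite hornerX.
    by rewrite -xv.
  by move=> y hy; split => //; have := nm_leB y v; lra.
pose r1 := (r + r') / 2.
have r1r : r1 < r by rewrite /r1; lra.
have r'1 : r' < r1 by rewrite /r1; lra.
have r10 : 0 < r1 by lra.
rewrite iterSr in xv.
have [g1 [gl1 gv1 hg1]] := IH _ r1 xv r10 r1r vr (fun j jk => out j (ltnW jk)).
pose h y := g1 y + - quad l (crit l).
have hlim : poly_limit v r1 h by apply: poly_limitD gl1 _; exact: poly_limit_cst.
have h0 y : nm (y - v) <= r1 -> h y != 0.
  move=> hy; rewrite /h subr_eq0; apply/eqP => E; have [h1 _] := hg1 y hy.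
  have := out k (ltnSn k); rewrite iterSr -E h1; move: hy r1r; clear; lra.
have [s sl hs] := poly_limit_sqrt r'0 r'1 hlim h0.
have vv : nm (v - v) <= r' by rewrite subrr nm0 ltW.
have sv : s v = x - crit l \/ s v = - (x - crit l).
  have : s v ^+ 2 == (x - crit l) ^+ 2 by rewrite hs// /h gv1 -quad_crit.
  by rewrite eqf_sqr => /orP[] /eqP; [left|right].
have [e [e2 ev]] : exists e : R[i], e ^+ 2 = 1 /\ e * s v = x - crit l.
  case: sv => ->; first by exists 1; rewrite expr1n mul1r.
  by exists (-1); rewrite mulrNN mul1r sqrrN expr1n.
exists (fun y => crit l + e * s y); split.
- apply: poly_limitD (poly_limit_cst _ _ _) _.
  by apply: poly_limitM (poly_limit_cst _ _ _) sl; exact: ltW.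
- by rewrite ev addrC subrK.
move=> y hy; have y1 : nm (y - v) <= r1 by lra.
have [h1 _] := hg1 y y1.
have qE : quad l (crit l + e * s y) = g1 y.
  apply: (addIr (- quad l (crit l))); rewrite quad_crit addrAC subrr add0r exprMn e2 mul1r.
  exact: hs.
have itE : iter k.+1 (quad l) (crit l + e * s y) = y by rewrite iterSr qE.
split => //; rewrite leNgt; apply/negP => lt.
have := @escape_gt R l (crit l + e * s y) 0 k.+1 hl (leq0n _) lt.
by rewrite itE; have := nm_leB y v; move: hy rr vr; clear; lra.
Qed.

End polynomial_approximation.

Lemma nm_dist (R : realType) (x y : R[i]) : `|nm x - nm y| <= nm (x - y).
Proof.
have h1 := nm_leB x y; have h2 := nm_leB y x; rewrite (nmC y x) in h2.
by rewrite ler_norml; apply/andP; split; move: h1 h2; lra.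
Qed.

Lemma nm_diff_shift (R : realType) (a d x y t : R[i]) :
  nm (a - d) <= nm (a - (x + t)) + nm (d - (y + t)) + nm (x - y).
Proof.
have -> : a - d = (a - (x + t)) - (d - (y + t)) + (x - y) by ring.
have := nmD (a - (x + t) - (d - (y + t))) (x - y); have := nmB (a - (x + t)) (d - (y + t)).
by move: (nm _) (nm _) (nm _) (nm _) (nm _) => ? ? ? ? ?; lra.
Qed.

(** * Dynamics in the petals and capture of the critical orbit *)

Section petal_orbits.
Variable R : realType.
Variables (l b : R[i]) (q nu : nat) (U : {poly R[i]}) (r C : R).
Implicit Types (x y z : R[i]).
Hypothesis q0 : (0 < q)%N.
Hypothesis nu0 : (0 < nu)%N.
Hypothesis l1 : nm l = 1.
Hypothesis b0 : b != 0.
Hypothesis r0 : 0 < r.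
Hypothesis r1 : r <= 1.
Hypothesis C0 : 0 <= C.
Hypothesis Cr : C * r <= 1/8.
Hypothesis U00 : U.[0] = 0.
Local Notation W := (petal_coord nu b U).
Hypothesis chart : forall z, z != 0 -> nm z <= r ->
   [/\ U.[z] != 0, U.[quad l z] != 0, nm (U.[z] / z ^+ q - 1) <= C * nm z,
     nm (U.[quad l z] / U.[z] - 1) <= C * nm z &
     nm (W (quad l z) - W z - 1) <= C * nm z].

Let l2 : nm l <= 2. Proof. by rewrite l1; lra. Qed.

Local Ltac cls := clear - R l b q nu U r C q0 nu0 l1 b0 r0 r1 C0 Cr U00 chart l2.

Lemma chart_small z : nm z <= r -> C * nm z <= 1/8.
Proof. by move=> zr; apply: le_trans Cr; rewrite ler_wpM2l. Qed.

Lemma petal_size : exists2 A, 0 < A & forall z, z != 0 -> nm z <= r ->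
  A^-1 / nm z ^+ (nu * q) <= nm (W z) <= A / nm z ^+ (nu * q).
Proof.
have nb : 0 < nu%:R * nm b by rewrite mulr_gt0 ?nm_gt0 ?ltr0n.
pose A := 2 ^+ nu * (nu%:R * nm b + (nu%:R * nm b)^-1).
have A0 : 0 < A by rewrite mulr_gt0 ?exprn_gt0// addr_gt0 ?invr_gt0.
exists A => // z z0 zr; have [U0 _ h _ _] := chart z0 zr.
have zq : 0 < nm z ^+ q by rewrite exprn_gt0 ?nm_gt0.
set s := U.[z] / z ^+ q in h; have hz := chart_small zr.
have s1 : 1/2 <= nm s by move: (nm_leB 1 s) h hz; rewrite nmC nm1; cls; lra.
have s2 : nm s <= 2 by move: (nm_leB s 1) h hz; rewrite nm1; cls; lra.
have UE : nm U.[z] = nm s * nm z ^+ q.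
  by rewrite -nmX -nmM /s divfK// expf_neq0.
clearbody s; have WE : nm (W z) = (nu%:R * nm b)^-1 * (nm s ^+ nu)^-1 / nm z ^+ (nu * q).
  rewrite /petal_coord nm_div nmN nm1 mul1r !nmM nm_nat nmX UE exprMn -exprM mulnC.
  by rewrite !invfM mulrA.
have sn1 : (1/2) ^+ nu <= nm s ^+ nu by rewrite lerXn2r ?nnegrE ?nm_ge0.
have sn2 : nm s ^+ nu <= 2 ^+ nu by rewrite lerXn2r ?nnegrE ?nm_ge0.
have s0 : 0 < nm s ^+ nu by rewrite exprn_gt0//; move: s1; cls; lra.
have zN : 0 <= (nm z ^+ (nu * q))^-1 by rewrite invr_ge0 exprn_ge0 ?nm_ge0.
rewrite WE; apply/andP; split; rewrite ler_wpM2r//.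
  rewrite -invfM lef_pV2 ?posrE ?(mulr_gt0 nb s0)// /A mulrC ler_pM ?(ltW nb) ?(ltW s0)//.
  by rewrite lerDl invr_ge0 ltW.
rewrite /A mulrC ler_pM ?invr_ge0 ?(ltW nb) ?(ltW s0)//; last by rewrite lerDr ltW.
have -> : 2 ^+ nu = ((1/2) ^+ nu)^-1 :> R by rewrite -exprVn mul1r invrK.
have h2 : 0 < (1/2) ^+ nu :> R by rewrite exprn_gt0// divr_gt0.
by rewrite lef_pV2 ?posrE.
Qed.

Definition in_petal R0 z := [/\ z != 0, nm z <= r & R0 <= re (W z)].

(** R0 is such that Re W >= R0 forces |z| <= r / 4 in the chart, and |f z| <= 3 |z| then keeps the
    image inside it. *)
Lemma petal_start : exists2 R0, 1 <= R0 & forall R1 z, R0 <= R1 -> in_petal R1 z ->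
  in_petal (R1 + 1/2) (quad l z) /\ re (W z) + 1/2 <= re (W (quad l z)).
Proof.
have [A A0 hA] := petal_size.
have r4 : 0 < r / 4 by rewrite divr_gt0.
exists (1 + A / (r / 4) ^+ (nu * q)).
  by rewrite lerDl divr_ge0 ?exprn_ge0 ?ltW.
move=> R1 z hR [z0 zr hz]; have [_ U'0 h1 _ h2] := chart z0 zr.
have nz : 0 < nm z by rewrite nm_gt0.
have rW : re (W z) + 1/2 <= re (W (quad l z)).
  have := re_ge (W (quad l z) - W z - 1); rewrite !reB /=.
  by have := chart_small zr; move: h2; cls; lra.
split => //.
have zr4 : nm z <= r / 4.
  rewrite -(@ler_pXn2r _ (nu * q)) ?nnegrE ?nm_ge0 ?muln_gt0 ?nu0 ?(ltW r4)//.
  have /andP[_ h3] := hA z z0 zr; have := re_le (W z) => h4.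
  have : A / (r / 4) ^+ (nu * q) <= A / nm z ^+ (nu * q) by lra.
  by rewrite ler_pM2l// lef_pV2 ?posrE ?exprn_gt0.
split.
- by apply: contraNneq U'0 => ->; rewrite U00.
- apply: (le_trans (nm_quad_le z l2)).
  have : nm z * nm z <= nm z * 1 by rewrite ler_wpM2l ?nm_ge0// (le_trans zr).
  by rewrite -expr2; move: zr4 (nz); cls; lra.
- by move: hz rW; cls; lra.
Qed.

Lemma petal_orbit : exists2 R0, 1 <= R0 & forall R1 z n, R0 <= R1 -> in_petal R1 z ->
  in_petal (R1 + n%:R / 2) (iter n (quad l) z).
Proof.
have [R0 R01 H] := petal_start; exists R0 => // R1 z n hR hz.
elim: n => [|n IH]; first by rewrite mul0r addr0.
rewrite -natr1 mulrDl addrA; apply: (H _ _ _ IH).1.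
by rewrite (le_trans hR)// lerDl divr_ge0.
Qed.

Lemma petal_small e : 0 < e -> exists M : R, forall R1 z, M <= R1 -> in_petal R1 z -> nm z <= e.
Proof.
move=> e0; have [A A0 hA] := petal_size.
exists (A / e ^+ (nu * q)) => R1 z hM [z0 zr hz].
have nz : 0 < nm z by rewrite nm_gt0.
rewrite -(@ler_pXn2r _ (nu * q)) ?nnegrE ?nm_ge0 ?muln_gt0 ?nu0 ?(ltW e0)//.
have /andP[_ h3] := hA z z0 zr; have h4 := re_le (W z).
have : A / e ^+ (nu * q) <= A / nm z ^+ (nu * q) by move: hM hz h3 h4; cls; lra.
by rewrite ler_pM2l// lef_pV2 ?posrE ?exprn_gt0.
Qed.

(** A step deviates from the translation by at most C |z|, and |z| tends to 0 uniformly on the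
    petal: after a number of steps independent of z the deviation is at most e per step. *)
Lemma petal_asymptotic : exists2 R0, 1 <= R0 & forall e, 0 < e -> exists2 K, 0 <= K &
  forall z n, in_petal R0 z -> nm (W (iter n (quad l) z) - (W z + n%:R)) <= e * n%:R + K.
Proof.
have [R0 R01 H] := petal_orbit; exists R0 => // e e0.
have key z n : in_petal R0 z -> nm (W (iter n (quad l) z) - (W z + n%:R)) <= n%:R.
  move=> hz; elim: n => [|n IH]; first by rewrite addr0 subrr nm0.
  have -> : W (iter n.+1 (quad l) z) - (W z + n.+1%:R) = (W (iter n.+1 (quad l) z) - W (iter n (quad l) z) - 1)
     + (W (iter n (quad l) z) - (W z + n%:R)) by rewrite -natr1; ring.
  have hzn := H _ _ n (lexx _) hz; have [zn0 znr zW] := hzn.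
  have [_ _ _ _ h] := chart zn0 znr.
  have := nmD (W (iter n.+1 (quad l) z) - W (iter n (quad l) z) - 1) (W (iter n (quad l) z) - (W z + n%:R)).
  by have := chart_small znr; move: h IH; rewrite -[n.+1%:R]natr1; cls; lra.
have [M hM] := petal_small (ltac:(by rewrite divr_gt0// ltr_wpDl) : 0 < e / (C + 1)).
have [N hN] := nat_gt (2 * M).
exists N%:R => [|z n hz]; first exact: ler0n.
elim: n => [|n IH]; first by rewrite addr0 subrr nm0 mulr0 add0r ler0n.
have -> : W (iter n.+1 (quad l) z) - (W z + n.+1%:R) = (W (iter n.+1 (quad l) z) - W (iter n (quad l) z) - 1)
   + (W (iter n (quad l) z) - (W z + n%:R)) by rewrite -natr1; ring.
have hzn := H _ _ n (lexx _) hz; have [zn0 znr zW] := hzn.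
have [_ _ _ _ h] := chart zn0 znr.
have [nN|Nn] := ltnP n N.
  suff [IH1 IH2] : nm (W (iter n (quad l) z) - (W z + n%:R)) <= n%:R /\ n.+1%:R <= N%:R :> R.
    have := nmD (W (iter n.+1 (quad l) z) - W (iter n (quad l) z) - 1) (W (iter n (quad l) z) - (W z + n%:R)).
    have := chart_small znr; have := mulr_ge0 (ltW e0) (ler0n R n.+1).
    by move: h IH1 IH2; rewrite -[n.+1%:R]natr1; cls; lra.
  by split; [exact: key|rewrite ler_nat].
have h2 : nm (iter n (quad l) z) <= e / (C + 1).
  apply: hM hzn; have : N%:R <= n%:R :> R by rewrite ler_nat.
  by move: hN R01; cls; lra.
have h3 : C * nm (iter n (quad l) z) <= e.
  have C1 : 0 < C + 1 by rewrite ltr_wpDl.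
  rewrite ler_pdivlMr// in h2; have := nm_ge0 (iter n (quad l) z).
  by move: h2; rewrite mulrDr mulr1 mulrC; cls; lra.
have := nmD (W (iter n.+1 (quad l) z) - W (iter n (quad l) z) - 1) (W (iter n (quad l) z) - (W z + n%:R)).
by move: h h3 IH; rewrite -[n.+1%:R]natr1 mulrDr mulr1; cls; lra.
Qed.

Lemma petal_coord_cont x : U.[x] != 0 -> ccont (fun z => nm (z - x)) x W.
Proof.
move=> U0; apply: ccontM (ccont_cst _ _ _) _; apply: ccontV; last first.
  by rewrite !mulf_neq0 ?expf_neq0// pnatr_eq0 -lt0n.
apply: ccontM (ccont_cst _ _ _) _; apply: ccontX.
exact: ccont_horner (cfam_cst _ _ U) (@ccont_id R x).
Qed.

Lemma petal_open R0 x : x != 0 -> nm x < r -> R0 < re (W x) -> exists2 d, 0 < d &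
  forall y, nm (y - x) <= d -> in_petal R0 y /\ nm (W y - W x) <= 1.
Proof.
move=> x0 xr xW; have [U0 _ _ _ _] := chart x0 (ltW xr).
have e0 : 0 < Num.min 1 (re (W x) - R0) by rewrite lt_min ltr01 subr_gt0.
have [d d0 hd] := petal_coord_cont U0 e0.
have nx : 0 < nm x by rewrite nm_gt0.
have d20 : 0 < Num.min (d / 2) (Num.min (nm x / 2) (r - nm x)).
  by rewrite !lt_min !divr_gt0// subr_gt0.
exists (Num.min (d / 2) (Num.min (nm x / 2) (r - nm x))) => // y.
rewrite !le_min => /and3P[y1 y2 y3].
have := hd y (ltac:(lra)); rewrite lt_min => /andP[h1 h2].
split; last exact: ltW.
split; first by rewrite -nm_gt0; have := nm_leB x y; rewrite nmC; lra.
  by have := nm_leB y x; lra.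
by have := re_ge (W y - W x); rewrite reB; lra.
Qed.

(* Otherwise the inverse branches of [f^m] at [f^m x] would be Lipschitz on the scale
   of [|f^m x|], and a point [(1 + t) f^m x] would have a preimage near [x], so that
   [W ((1 + t) f^m x) / W (f^m x)] would tend to [1]. *)
Lemma critical_capture : exists2 R0, 1 <= R0 & forall x c, x != 0 -> nm x < r -> R0 < re (W x) ->
  0 < c -> c <= 1/2 -> exists M, forall m, (M <= m)%N -> exists2 j, (0 < j)%N &
  nm (iter j (quad l) (crit l) - iter m (quad l) x) <= c * nm (iter m (quad l) x).
Proof.
have [Ra Ra1 Horb] := petal_orbit; have [Rb Rb1 Has] := petal_asymptotic.
exists (Num.max Ra Rb) => [|x c x0 xr]; first by rewrite le_max Ra1.
rewrite gt_max => /andP[xRa xRb] c0 c1.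
have xR : Num.max Ra Rb < re (W x) by rewrite gt_max xRa.
have [d d0 hd] := petal_open x0 xr xR.
have px y : nm (y - x) <= d -> [/\ in_petal Ra y, in_petal Rb y & nm (W y - W x) <= 1].
  by move=> /hd[[h1 h2]]; rewrite ge_max => /andP[h3 h4] h5; split.
(* k is the relative displacement t of the point whose preimage is taken. The inverse branch has
   Lipschitz constant 64 / (c |v|), so k <= d c / 64 keeps the preimage within d of x. *)
pose k := Num.min (c / 8) (d * c / 64).
have k0 : 0 < k by rewrite lt_min !divr_gt0 ?mulr_gt0.
have kc : k <= c / 8 by rewrite ge_min lexx.
have kd : k <= d * c / 64 by rewrite ge_min lexx orbT.
have [K K0 hK] := Has (k / 32) (ltac:(by rewrite divr_gt0)).
have e0 : 0 < k / (16 * (C + 1)) by rewrite divr_gt0// mulr_gt0// ltr_wpDl.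
have [M1 hM1] := petal_small e0.
have [N1 hN1] := nat_gt (2 * M1); have [N2 hN2] := nat_gt (16 * (2 * K + 1) / k).
exists (maxn N1 N2) => m; rewrite geq_max => /andP[mN1 mN2].
apply: contrapT => none; set v := iter m (quad l) x.
have [xa xb _] := px x (ltac:(by rewrite subrr nm0 ltW)).
have hv := Horb _ _ m (lexx _) xa; rewrite -/v in hv; have [v0 vr vW] := hv.
have nv : 0 < nm v by rewrite nm_gt0.
have v1 : nm v <= 1 := le_trans vr r1.
have cv : 0 < c * nm v by rewrite mulr_gt0.
have [|||j jm|g [gl gv hg]] := @inverse_branch R l m x v (c * nm v) (c * nm v / 2) l2 erefl.
- by rewrite divr_gt0.
- by move: cv; cls; lra.
- have : c * nm v <= 1 * 1 by rewrite ler_pM ?nm_ge0 ?(ltW c0)//; move: c1; cls; lra.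
  by move: v1; cls; lra.
- by rewrite ltNge; apply/negP => le; apply: none; exists j.+1.
pose y := (1 + k%:C) * v.
have yv : nm (y - v) = k * nm v.
  have -> : y - v = k%:C * v by rewrite /y; ring.
  by rewrite nmM nm_real gtr0_norm.
have kcv : k * nm v <= c / 8 * nm v by rewrite ler_wpM2r ?nm_ge0.
have gx : nm (g y - x) <= d.
  rewrite -{1}gv.
  have := @poly_limit_lip R v (c * nm v / 2) g 4 y v (ltac:(by rewrite divr_gt0)) gl (fun z hz => (hg z hz).2).
  rewrite subrr nm0 yv => h.
  apply: (le_trans (h _ _)); [by move: kcv (cv); cls; lra|by move: cv; cls; lra|].
  have -> : 8 * 4 * (k * nm v) / (c * nm v / 2) = k * 64 / c.
    by field; rewrite !gt_eqF.
  by rewrite ler_pdivrMr//; move: kd; cls; lra.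
have [ya yb yx] := px _ gx.
have [gy _] := hg y (ltac:(rewrite yv; move: kcv (cv); cls; lra)).
have := hK _ m yb; rewrite gy => hy.
have := hK _ m xb; rewrite -/v => hx.
have [y0 yr yW] := Horb _ _ m (lexx _) ya; rewrite gy in y0 yr yW.
have Wyv : nm (W y - W v) <= k / 16 * m%:R + 2 * K + 1.
  have := nm_diff_shift (W y) (W v) (W (g y)) (W x) m%:R.
  by move: hx hy yx; move: (nm _) (nm _) (nm _) (nm _) => t1 t2 t3 t4; cls; lra.
have vm : m%:R / 2 <= nm (W v) by have := re_le (W v); move: vW Ra1; cls; lra.
have vs : nm v <= k / (16 * (C + 1)).
  apply: (hM1 _ _ _ hv); have : N1%:R <= m%:R :> R by rewrite ler_nat.
  by move: hN1 Ra1; cls; lra.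
have Cv : C * nm v <= k / 16.
  have C1 : 0 < 16 * (C + 1) by rewrite mulr_gt0// ltr_wpDl.
  by rewrite ler_pdivlMr// in vs; move: vs (nv); rewrite !mulrDr mulr1; cls; lra.
have yE : nm y = (1 + k) * nm v.
  rewrite /y nmM -(rmorph1 (real_complex R)) -rmorphD nm_real gtr0_norm//.
  by rewrite addr_gt0.
have kle : k <= 1/16 by move: kc c1; cls; lra.
have Cy : C * nm y <= k / 8.
  by rewrite yE; move: Cv k0 kle; have := mulr_ge0 C0 (ltW nv); cls; nra.
have [Uv _ hv1 _ _] := chart v0 vr; have [Uy _ hy1 _ _] := chart y0 yr.
set sv := U.[v] / _ in hv1; set sy := U.[y] / _ in hy1.
have Ub : (1 + k / 2) * nm U.[v] <= nm U.[y].
  have -> : nm U.[v] = nm sv * nm v ^+ q by rewrite -nmX -nmM /sv divfK// expf_neq0.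
  have -> : nm U.[y] = nm sy * nm y ^+ q by rewrite -nmX -nmM /sy divfK// expf_neq0.
  rewrite yE exprMn mulrA mulrA; apply: ler_wpM2r; first by rewrite exprn_ge0 ?nm_ge0.
  have s1 : nm sv <= 1 + k / 16 by have := nm_leB sv 1; rewrite nm1; move: hv1 Cv; cls; lra.
  have s2 : 1 - k / 8 <= nm sy by have := nm_leB 1 sy; rewrite nmC nm1; move: hy1 Cy; cls; lra.
  have q1 : 1 + k <= (1 + k) ^+ q.
    by rewrite -(prednK q0) exprS ler_peMr ?exprn_ege1//; move: k0; cls; lra.
  apply: (@le_trans _ _ ((1 + k / 2) * (1 + k / 16))).
    by rewrite ler_wpM2l//; move: k0; cls; lra.
  apply: (@le_trans _ _ ((1 - k / 8) * (1 + k))); first by move: k0 kle; cls; nra.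
  by apply: ler_pM => //; move: k0 kle; cls; lra.
(* |W| scales like |U|^-nu, so moving outwards by 1 + k divides it by at least 1 + k / 2. The
   resulting gap is at least k m / 8, while the asymptotics bound it by k m / 16 + 2 K + 1. *)
have Wb : (1 + k / 2) * nm (W y) <= nm (W v).
  rewrite /petal_coord !nm_div nmN nm1 !mul1r !nmM !nmX.
  have p1 : 0 < nm (nu%:R : R[i]) * nm b by rewrite nm_nat mulr_gt0 ?nm_gt0 ?ltr0n.
  have p2 : 0 < nm U.[v] ^+ nu by rewrite exprn_gt0 ?nm_gt0.
  have p3 : 0 < nm U.[y] ^+ nu by rewrite exprn_gt0 ?nm_gt0.
  rewrite -[leRHS]mul1r (ler_pdivrMr _ _ (mulr_gt0 p1 p3)) mulrAC (ler_pdivlMr _ _ (mulr_gt0 p1 p2)) mul1r.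
  have k1 : 1 <= 1 + k / 2 by move: k0; cls; lra.
  have : (1 + k / 2) * nm U.[v] ^+ nu <= nm U.[y] ^+ nu.
    apply: (@le_trans _ _ (((1 + k / 2) * nm U.[v]) ^+ nu)).
      rewrite exprMn ler_wpM2r ?(ltW p2)//.
      by rewrite -(prednK nu0) exprS ler_peMr ?exprn_ege1// (le_trans _ k1).
    by rewrite lerXn2r ?nnegrE ?mulr_ge0 ?nm_ge0// (le_trans _ k1).
  by move/(ler_wpM2l (ltW p1)); rewrite mulrCA.
have m1 : 16 * (2 * K + 1) < m%:R * k.
  rewrite -ltr_pdivrMr//; apply: (lt_le_trans hN2); by rewrite ler_nat.
have := nm_leB (W v) (W y); rewrite nmC.
have : k / 4 * nm (W v) <= nm (W v) - nm (W y).
  have k4 : 0 <= 1 - k / 4 by move: kle; cls; lra.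
  have kk : 0 <= k / 4 - k * k / 8 by move: kle k0; cls; nra.
  have := ler_wpM2l k4 Wb; have := mulr_ge0 kk (nm_ge0 (W y)).
  by move: (nm (W y)) (nm (W v)) => Y V; cls; lra.
have : k / 4 * (m%:R / 2) <= k / 4 * nm (W v) by rewrite ler_wpM2l// divr_ge0// ltW.
by move: Wyv m1; cls; lra.
Qed.

(** * Sectors labelled by the nu-th roots of unity *)

Section sectors.
Variables (bet : R[i]) (th R0 : R).
Hypothesis betE : bet ^+ nu = - 1 / (nu%:R * b).
Hypothesis th0 : 0 < th.
Hypothesis thn : th * (16 * nu%:R ^+ 2) <= 1.
Hypothesis Crt : C * r <= th / 8.
Hypothesis R01 : 1 <= R0.
Hypothesis startR0 : forall R1 z, R0 <= R1 -> in_petal R1 z ->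
  in_petal (R1 + 1/2) (quad l z) /\ re (W z) + 1/2 <= re (W (quad l z)).
Local Notation Y z := (bet / U.[z]).

Local Ltac clt := clear - R l b q nu U r C bet th R0 q0 nu0 l1 b0 r0 r1 C0 Cr U00 chart l2 betE th0 thn Crt R01 startR0.

Let th1 : th <= 1/16.
Proof.
have n1 : 1 <= nu%:R ^+ 2 :> R by rewrite exprn_ege1// ler1n.
have := thn; have := th0; move: n1; clt; nra.
Qed.

(** With v = y / (zeta |y|), v^nu - 1 is v - 1 times a sum close to nu; so a coarse bound on y -
    zeta |y| and a good one on y^nu give a good one on y. *)
Lemma root_stay zeta y e : zeta ^+ nu = 1 -> 0 <= e -> nm (y - zeta * (nm y)%:C) * (2 * nu%:R ^+ 2) <= nm y ->
  nm (y ^+ nu - (nm y ^+ nu)%:C) <= e * nm y ^+ nu -> nm (y - zeta * (nm y)%:C) <= 2 * e * nm y.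
Proof.
move=> zn e0; have [->|y0] := eqVneq y 0; first by rewrite nm0 mulr0 subrr nm0 mulr0.
have yp : 0 < nm y by rewrite nm_gt0.
have nz : nm zeta = 1.
  have : nm zeta ^+ nu = 1 by rewrite -nmX zn nm1.
  by move/eqP; rewrite pexpr_eq1 ?nm_ge0// => /eqP.
have z0 : zeta != 0 by rewrite -nm_gt0 nz.
pose c : R[i] := zeta * (nm y)%:C; have nc : nm c = nm y by rewrite /c nmM nz mul1r nm_real gtr0_norm.
have c0 : c != 0 by rewrite -nm_gt0 nc.
have cn : c ^+ nu = (nm y ^+ nu)%:C by rewrite /c exprMn zn mul1r rmorphXn.
pose v := y / c; have yE : y = v * c by rewrite /v divfK.
have nv : nm v = 1 by rewrite /v nm_div nc divff ?gt_eqF.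
have E1 : y - zeta * (nm y)%:C = (v - 1) * c by rewrite -/c {1}yE; ring.
have E2 : y ^+ nu - (nm y ^+ nu)%:C = (v ^+ nu - 1) * c ^+ nu by rewrite {1}yE exprMn -cn; ring.
rewrite E1 E2 (nmM (v - 1)) (nmM (v ^+ nu - 1)) nmX nc => h0.
have h1 : nm (v - 1) * (2 * nu%:R ^+ 2) <= 1 by rewrite -(ler_pM2r yp) mul1r mulrAC.
rewrite (ler_pM2r (exprn_gt0 nu yp)) (ler_pM2r yp) subrX1 nmM => h2.
have n1 : 1 <= nu%:R :> R by rewrite ler1n.
suff S2 : 1/2 <= nm (\sum_(i < nu) v ^+ i).
  have : nm (v - 1) * (1/2) <= nm (v - 1) * nm (\sum_(i < nu) v ^+ i) by rewrite ler_wpM2l ?nm_ge0.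
  by move: h2; clt; lra.
have vi (i : nat) : nm (v ^+ i - 1) <= i%:R * nm (v - 1).
  elim: i => [|i IH]; first by rewrite expr0 subrr nm0 mul0r.
  have -> : v ^+ i.+1 - 1 = v * (v ^+ i - 1) + (v - 1) by rewrite exprS; ring.
  have := nmD (v * (v ^+ i - 1)) (v - 1); rewrite nmM nv mul1r -[i.+1%:R]natr1.
  by move: IH; clt; lra.
have S1 : nm (nu%:R - \sum_(i < nu) v ^+ i) <= nu%:R * (nu%:R * nm (v - 1)).
  have -> : nu%:R - \sum_(i < nu) v ^+ i = \sum_(i < nu) (1 - v ^+ i).
    by rewrite sumrB sumr_const card_ord.
  apply: (le_trans (nm_sum _ _ _)).
  have -> : nu%:R * (nu%:R * nm (v - 1)) = \sum_(i < nu) (nu%:R * nm (v - 1)).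
    by rewrite sumr_const card_ord -[RHS]mulr_natl.
  apply: ler_sum => i _; rewrite nmC; apply: (le_trans (vi i)).
  by rewrite ler_wpM2r ?nm_ge0// ler_nat ltnW.
have E3 : nu%:R * (nu%:R * nm (v - 1)) = nm (v - 1) * (2 * nu%:R ^+ 2) / 2 by field.
have := nm_leB (nu%:R : R[i]) (\sum_(i < nu) v ^+ i); rewrite nm_nat; rewrite E3 in S1.
by move: S1 h1 n1; clt; lra.
Qed.

Lemma coord_power z : Y z ^+ nu = W z.
Proof.
by rewrite exprMn betE exprVn /petal_coord [in RHS]invfM mulrA.
Qed.

Lemma cone_angle (w : R[i]) (t : R) : 0 <= t -> 0 <= re w -> `|im w| <= t * re w ->
  nm (w - (nm w)%:C) <= 2 * t * nm w.
Proof.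
move=> t0 rw h; have h1 := re_le w; have h2 := nm_reim w.
have := nm_reim (w - (nm w)%:C); rewrite reB imB /= subr0 distrC ger0_norm ?subr_ge0//.
have : t * re w <= t * nm w by rewrite ler_wpM2l.
rewrite (ger0_norm rw) in h2.
by move: h h1 h2; clt; lra.
Qed.

(** Y = bet / U is a nu-th root of W; its approximate direction zeta labels one of the nu cycles of
    petals. *)
Definition sector zeta z := [/\ in_petal R0 z, `|im (W z)| <= th * re (W z) &
  nm (Y z - zeta * (nm (Y z))%:C) <= 4 * th * nm (Y z)].

(** One step changes Y by a relative th / 8, which leaves it within 7 th of the direction zeta;
    since W stays in its cone, [root_stay] restores 4 th. *)
Lemma sector_step zeta z : zeta ^+ nu = 1 -> sector zeta z -> sector zeta (quad l z).
Proof.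
move=> zn [hz hc hy]; have [z0 zr zW] := hz.
have [pz rW] := startR0 (lexx _) hz; have [fz0 fzr fW] := pz.
have [Uz Uz' _ h1 h2] := chart z0 zr.
have Cz : C * nm z <= th / 8 by apply: le_trans Crt; rewrite ler_wpM2l.
have hz' : in_petal R0 (quad l z).
  by split => //; move: fW; clt; lra.
have hc' : `|im (W (quad l z))| <= th * re (W (quad l z)).
  have h3 := im_nm (W (quad l z) - W z - 1); rewrite !imB /= subr0 in h3.
  have h8 := ler_normD (im (W (quad l z)) - im (W z)) (im (W z)); rewrite subrK in h8.
  apply: (le_trans h8).
  have h5 := th0.
  have := re_ge (W (quad l z) - W z - 1); rewrite !reB /= => h4.
  have h6 : th * (re (W z) + 1 - th / 8) <= th * re (W (quad l z)).
    by rewrite ler_wpM2l ?(ltW h5)//; move: h4 h2 Cz; clt; lra.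
  have h7 : th * (th / 8) <= th * (1/2) by rewrite ler_wpM2l ?(ltW h5)//; have := th1; clt; lra.
  by move: h2 Cz h3 h6 h7 hc; rewrite !mulrDr; move: h5; clt; lra.
split => //.
have re0 : 0 <= re (W (quad l z)) by move: fW; have := R01; clt; lra.
have := cone_angle (ltW th0) re0 hc'; rewrite -coord_power nmX => h3.
have th2 : 0 <= 2 * th by have := th0; clt; lra.
suff h4 : nm (Y (quad l z) - zeta * (nm (Y (quad l z)))%:C) * (2 * nu%:R ^+ 2) <= nm (Y (quad l z)).
  have := root_stay zn th2 h4 h3; by clt; lra.
have nz : nm zeta = 1.
  have : nm zeta ^+ nu = 1 by rewrite -nmX zn nm1.
  by move/eqP; rewrite pexpr_eq1 ?nm_ge0// => /eqP.
set y := Y z in hy *; set y' := Y (quad l z).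
have E : y - y' = y' * (U.[quad l z] / U.[z] - 1) by rewrite /y /y'; field; rewrite Uz Uz'.
have d1 : nm (y - y') <= th / 8 * nm y'.
  by rewrite E nmM mulrC ler_wpM2r ?nm_ge0// (le_trans h1).
have d2 := nm_dist y y'.
have : nm (y' - zeta * (nm y')%:C) <= 7 * th * nm y'.
  have -> : y' - zeta * (nm y')%:C = (y - zeta * (nm y)%:C) - (y - y') + zeta * (nm y - nm y')%:C.
    by rewrite rmorphB /=; ring.
  have := nmD ((y - zeta * (nm y)%:C) - (y - y')) (zeta * (nm y - nm y')%:C).
  have := nmB (y - zeta * (nm y)%:C) (y - y'); rewrite (nmM zeta) nz mul1r nm_real.
  have yy : nm y <= nm y' + th / 8 * nm y' by have := nm_leB y y'; move: d1; clt; lra.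
  have h5 : 4 * th * nm y <= 4 * th * (nm y' + th / 8 * nm y').
    by rewrite ler_wpM2l//; have := th0; clt; lra.
  have h6 : th * (th * nm y') <= 1/16 * (th * nm y').
    by rewrite ler_wpM2r ?th1// mulr_ge0 ?nm_ge0 ?ltW// th0.
  have h7 : 0 <= th * nm y' by rewrite mulr_ge0 ?nm_ge0 ?ltW// th0.
  by move: hy d1 d2 h5 h6 h7; clt; lra.
have n0 : 0 <= 2 * nu%:R ^+ 2 :> R by rewrite mulr_ge0 ?exprn_ge0.
move=> /(ler_wpM2r n0) h5; apply: (le_trans h5).
have := ler_wpM2r (nm_ge0 y') thn; rewrite mul1r.
have := mulr_ge0 (mulr_ge0 (ltW th0) (exprn_ge0 2 (ler0n R nu))) (nm_ge0 y').
by clt; lra.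
Qed.

Lemma sector_iter zeta z n : zeta ^+ nu = 1 -> sector zeta z -> sector zeta (iter n (quad l) z).
Proof. by move=> zn h; elim: n => //= n; exact: sector_step. Qed.

Lemma sector_disjoint zeta z : sector 1 z -> sector zeta z -> nm (zeta - 1) <= 8 * th.
Proof.
move=> [[z0 zr _] _ h1] [_ _ h2]; have [U0 _ _ _ _] := chart z0 zr.
have y0 : 0 < nm (Y z).
  rewrite nm_gt0 mulf_neq0 ?invr_eq0//; apply/eqP => E.
  move/eqP: betE; rewrite E expr0n (gtn_eqF nu0) eq_sym mulf_eq0 oppr_eq0 oner_eq0 invr_eq0 /=.
  by rewrite mulf_eq0 (negbTE b0) pnatr_eq0 orbF (gtn_eqF nu0).
rewrite -(ler_pM2r y0); move: h1 h2; set y := Y z => h1 h2.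
have -> : nm (zeta - 1) * nm y = nm ((y - 1 * (nm y)%:C) - (y - zeta * (nm y)%:C)).
  have -> : (y - 1 * (nm y)%:C) - (y - zeta * (nm y)%:C) = (zeta - 1) * (nm y)%:C by ring.
  by rewrite (nmM (zeta - 1)) nm_real ger0_norm ?nm_ge0.
have := nmB (y - 1 * (nm y)%:C) (y - zeta * (nm y)%:C).
by move: h1 h2; clt; lra.
Qed.

Lemma nth_root (n : nat) (a : R[i]) : (0 < n)%N -> exists x, x ^+ n = a.
Proof.
move=> n0; have /closed_rootP[x] : size ('X^n - a%:P : {poly R[i]}) != 1%N.
  by rewrite size_XnsubC// -lt0n.
by rewrite /root !(hornerE, hornerXn) subr_eq0 => /eqP; exists x.
Qed.

Lemma sector_start zeta (R1 rho : R) : zeta ^+ nu = 1 -> 0 < rho -> exists x, [/\ sector zeta x,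
  x != 0, nm x < rho & R1 < re (W x)].
Proof.
move=> zn rho0.
have z0 : zeta != 0 by apply/eqP => E; move/eqP: zn; rewrite E expr0n (gtn_eqF nu0) eq_sym oner_eq0.
have nz : nm zeta = 1.
  have : nm zeta ^+ nu = 1 by rewrite -nmX zn nm1.
  by move/eqP; rewrite pexpr_eq1 ?nm_ge0// => /eqP.
have bet0 : bet != 0.
  apply/eqP => E; move/eqP: betE; rewrite E expr0n (gtn_eqF nu0) eq_sym mulf_eq0 oppr_eq0 oner_eq0 invr_eq0 /=.
  by rewrite mulf_eq0 (negbTE b0) pnatr_eq0 orbF (gtn_eqF nu0).
(* U starts with z^q, so near 0 on the ray through v0 the value of Y is close to a positive multiple
   of zeta. *)
have [v0 v0E] := nth_root (bet / zeta) q0.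
have vn0 : v0 != 0.
  apply/eqP => E; move/eqP: v0E; rewrite E expr0n (gtn_eqF q0) eq_sym mulf_eq0 invr_eq0.
  by rewrite (negbTE bet0) (negbTE z0).
have nv : 0 < nm v0 by rewrite nm_gt0.
have cinv : ccont (fun s : R[i] => nm (s - 1)) 1 (fun s => (s^-1) ^+ nu).
  by apply: ccontX; apply: ccontV (@ccont_id R 1) _; exact: oner_neq0.
have [d d0 hd] := cinv _ (ltac:(by rewrite divr_gt0// th0) : 0 < th / 4).
have [t1 [t10 t1r t1rho t1d t1R]] : exists t : R, [/\ 0 < t, t * nm v0 < r, t * nm v0 < rho,
    C * (t * nm v0) < Num.min d (th / 2) & 2 * (`|R1| + `|R0| + 1) * t <= 1].
  have m0 : 0 < Num.min d (th / 2) by rewrite lt_min d0 divr_gt0// th0.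
  pose m := Num.min d (th / 2); rewrite -/m in m0 *.
  have a0 : 0 < 2 * (`|R1| + `|R0| + 1) by have := normr_ge0 R1; have := normr_ge0 R0; clt; lra.
  pose t := Num.min (r / (2 * nm v0)) (Num.min (rho / (2 * nm v0)) (Num.min (m / (2 * (C + 1) * nm v0)) (2 * (`|R1| + `|R0| + 1))^-1)).
  have C1 : 0 < C + 1 by have := C0; clt; lra.
  have t0 : 0 < t by rewrite !lt_min !divr_gt0 ?invr_gt0 ?mulr_gt0//.
  have h1 : t * (2 * nm v0) <= r by rewrite -ler_pdivlMr ?mulr_gt0// ge_min lexx.
  have h2 : t * (2 * nm v0) <= rho by rewrite -ler_pdivlMr ?mulr_gt0// !ge_min lexx orbT.
  have h3 : t * (2 * (C + 1) * nm v0) <= m by rewrite -ler_pdivlMr ?mulr_gt0// !ge_min lexx !orbT.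
  have h4 : t <= (2 * (`|R1| + `|R0| + 1))^-1 by rewrite !ge_min lexx !orbT.
  have tv : 0 < t * nm v0 by rewrite mulr_gt0.
  exists t; split => //.
  - by move: h1 tv; clt; lra.
  - by move: h2 tv; clt; lra.
  - have : 0 <= C * (t * nm v0) by rewrite mulr_ge0 ?C0 ?ltW.
    by move: h3 tv; clt; lra.
  - by rewrite mulrC -ler_pdivlMr// mul1r.
pose x := t1%:C * v0.
have nx : nm x = t1 * nm v0 by rewrite /x nmM nm_real gtr0_norm.
have x0 : x != 0 by rewrite -nm_gt0 nx mulr_gt0.
have xr : nm x <= r by rewrite nx ltW.
have [Ux _ hs _ _] := chart x0 xr.
set s := U.[x] / x ^+ q in hs.
have sd : nm (s - 1) < Num.min d (th / 2) by apply: le_lt_trans hs _; rewrite nx.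
move: sd; rewrite lt_min => /andP[sd sth].
have s0 : s != 0 by rewrite /s mulf_neq0 ?invr_eq0 ?expf_neq0.
have UE : U.[x] = s * (t1%:C ^+ q * (bet / zeta)).
  by rewrite -v0E -exprMn -/x /s divfK// expf_neq0.
have tc0 : t1%:C != 0 :> R[i] by rewrite -nm_gt0 nm_real gtr0_norm.
have YE : Y x = zeta * (t1%:C ^+ q)^-1 * s^-1.
  by rewrite UE; field; rewrite z0 bet0 s0 expf_neq0.
clearbody s.
pose T := t1 ^- q; have T0 : 0 < T by rewrite invr_gt0 exprn_gt0.
have TE : (t1%:C ^+ q)^-1 = T%:C :> R[i] by rewrite /T fmorphV rmorphXn.
have WE : W x = (T ^+ nu)%:C * s^-1 ^+ nu.
  by rewrite -coord_power YE TE !exprMn zn mul1r rmorphXn.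
have := hd s sd; rewrite invr1 expr1n; set e := s^-1 ^+ nu => he.
have Tn : 0 < T ^+ nu by rewrite exprn_gt0.
have rWx : re (W x) = T ^+ nu * re e by rewrite WE reM /= mul0r subr0.
have iWx : im (W x) = T ^+ nu * im e by rewrite WE imM /= mul0r addr0.
have re1 : 1 - th / 4 <= re e by have := re_ge (e - 1); rewrite reB /=; move: he; clt; lra.
have ime : `|im e| <= th / 4 by have := im_nm (e - 1); rewrite imB /= subr0; move: he; clt; lra.
have th1' := th1; have th0' := th0.
have TR : 2 * (`|R1| + `|R0| + 1) <= T ^+ nu.
  have tle : t1 <= 1.
    have := normr_ge0 R1; have := normr_ge0 R0; move: t1R t10; clt; nra.
  have : t1 ^+ (q * nu) <= t1.
    have : (0 < q * nu)%N by rewrite muln_gt0 q0.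
    by case: (q * nu)%N => // k _; rewrite exprS ler_piMr ?(ltW t10)// exprn_ile1 ?(ltW t10).
  rewrite /T exprVn -exprM => h; rewrite -[leLHS]invrK lef_pV2 ?posrE ?exprn_gt0 ?invr_gt0//.
  apply: (le_trans h); have K0 : 0 < 2 * (`|R1| + `|R0| + 1).
    by have := normr_ge0 R1; have := normr_ge0 R0; clt; lra.
  by rewrite -div1r ler_pdivlMr// mulrC.
have rWbig : `|R1| + `|R0| + 1 <= re (W x).
  rewrite rWx; apply: (@le_trans _ _ (T ^+ nu * (1/2))); first by move: TR; clt; lra.
  by rewrite ler_pM2l//; move: re1 th1'; clt; lra.
exists x; split => //; [|by rewrite nx|]; last first.
  by have := ler_norm R1; have := normr_ge0 R0; move: rWbig; clt; lra.
split.
- by split => //; have := ler_norm R0; have := normr_ge0 R1; move: rWbig; clt; lra.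
- rewrite iWx rWx normrM (gtr0_norm Tn) mulrCA ler_pM2l//.
  have : th * (1 - th / 4) <= th * re e by rewrite ler_wpM2l// ltW.
  have : th * (th / 4) <= th * (1/2) by rewrite ler_wpM2l ?ltW//; move: th1'; clt; lra.
  by move: ime th0'; clt; lra.
have ns : 0 < nm s by rewrite nm_gt0.
rewrite YE TE.
clearbody T; have nY : nm (zeta * T%:C * s^-1) = T / nm s by rewrite nmM nmM nz mul1r nm_real gtr0_norm// nmV.
rewrite nY.
have -> : zeta * T%:C * s^-1 - zeta * (T / nm s)%:C = zeta * T%:C / s * (((nm s)%:C - s) / (nm s)%:C).
  have -> : (T / nm s)%:C = T%:C / (nm s)%:C :> R[i] by rewrite rmorphM fmorphV.
  have ns0 : (nm s)%:C != 0 :> R[i] by rewrite -nm_gt0 nm_real gtr0_norm.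
  by field; rewrite s0 ns0.
rewrite nmM nY mulrC ler_wpM2r ?divr_ge0 ?(ltW T0) ?(ltW ns)//.
rewrite nm_div nm_real (gtr0_norm ns) ler_pdivrMr//.
have h1 : nm ((nm s)%:C - s) <= 2 * nm (s - 1).
  have -> : (nm s)%:C - s = (nm s - 1)%:C - (s - 1) by rewrite rmorphB /=; ring.
  apply: (le_trans (nmB _ _)); rewrite nm_real.
  by have := nm_dist s 1; rewrite nm1; clt; lra.
have s2 : 1/2 <= nm s by have := nm_leB 1 s; rewrite nmC nm1; move: sth th1'; clt; lra.
have : 4 * th * (1/2) <= 4 * th * nm s by rewrite ler_wpM2l//; move: th0'; clt; lra.
by move: h1 sth th0'; clt; lra.
Qed.

(** A long orbit inside the sector ends at a point v with W v in a ten times narrower cone. Capture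
    provides a critical iterate y with y / v close to 1; then U v / U y is close to 1 as well, and y
    lies in the same sector. *)
Lemma sector_critical zeta : zeta ^+ nu = 1 -> exists2 j, (0 < j)%N & sector zeta (iter j (quad l) (crit l)).
Proof.
move=> zn; have th0' := th0; have th1' := th1.
have [Ra Ra1 cap] := critical_capture.
have [Rb Rb1 Has] := petal_asymptotic; have [Rc Rc1 Horb] := petal_orbit.
pose Rm := Ra + Rb + Rc + R0.
have [x [xs x0 xr xW]] := sector_start Rm zn r0.
have R01' := R01.
have xa : Ra < re (W x) by move: xW; rewrite /Rm; move: Rb1 Rc1 R01'; clt; lra.
have xb : in_petal Rb x by split => //; [exact: ltW|move: xW; rewrite /Rm; move: Ra1 Rc1 R01'; clt; lra].
have xc : in_petal Rc x by split => //; [exact: ltW|move: xW; rewrite /Rm; move: Ra1 Rb1 R01'; clt; lra].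
pose t := th / 10; have t0 : 0 < t by rewrite divr_gt0.
pose dist (p : R[i] * R[i] * R[i]) := nm (p.1.1 - 1) + nm (p.1.2 - 1) + nm (p.2 - 1).
have n1 p := nm_ge0 (p - 1 : R[i]).
have c1 : ccont dist (1, 1, 1) (fun p => p.1.1).
  by move=> e e0; exists e => // p; rewrite /dist /=; have := n1 p.1.2; have := n1 p.2; clt; lra.
have c2 : ccont dist (1, 1, 1) (fun p => p.1.2).
  by move=> e e0; exists e => // p; rewrite /dist /=; have := n1 p.1.1; have := n1 p.2; clt; lra.
have c3 : ccont dist (1, 1, 1) (fun p => p.2).
  by move=> e e0; exists e => // p; rewrite /dist /=; have := n1 p.1.1; have := n1 p.1.2; clt; lra.
(* U v / U y as a function of y / v and the normalised values of U / z^q at v and y, all close to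
   1. *)
pose F (p : R[i] * R[i] * R[i]) := (p.1.1 ^+ q)^-1 * p.1.2 * p.2^-1.
have cF : ccont dist (1, 1, 1) F.
  apply: ccontM; first apply: ccontM => //; apply: ccontV => /=; rewrite ?expr1n ?oner_neq0//.
  exact: ccontX.
have F1 : F (1, 1, 1) = 1 by rewrite /F /= expr1n invr1 !mulr1.
have tm : 0 < Num.min t (1/2) by rewrite lt_min t0 divr_gt0.
have [d [d0 hd]] : exists d, 0 < d /\ forall p, dist p < d ->
    [/\ nm (F p - 1) <= t, nm (F p - 1) <= 1/2 & nm (F p ^+ nu - 1) <= t].
  have [da da0 ha] := cF _ tm; have [db db0 hb] := ccontX nu cF t0.
  exists (Num.min da db); split; first by rewrite lt_min da0.
  move=> p; rewrite lt_min => /andP[/ha h1 /hb h2].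
  rewrite F1 lt_min in h1; rewrite F1 expr1n in h2.
  by case/andP: h1 => /ltW ? /ltW ?; split => //; exact: ltW.
pose c := Num.min (1/2) (d / 2).
have c0 : 0 < c by rewrite lt_min !divr_gt0.
have [M hM] := cap x c x0 xr xa c0 (ltac:(by rewrite ge_min lexx)).
have [K K0 hK] := Has (t / 4) (ltac:(by rewrite divr_gt0)).
have e0 : 0 < Num.min (r / 2) (d / (8 * (C + 1))).
  by rewrite lt_min !divr_gt0// mulr_gt0// ltr_wpDl.
have [M1 hM1] := petal_small e0.
have [N1 hN1] := nat_gt (2 * M1); have [N2 hN2] := nat_gt (4 * R0 + 2 * (nm (W x) + 2 * K) / t).
pose m := maxn M (maxn N1 N2).
have [j j0 hj] := hM m (leq_maxl _ _).
exists j => //; set y := iter j _ _ in hj *; set v := iter m (quad l) x in hj *.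
have vs : sector zeta v by exact: sector_iter.
have [[v0 vr vW] vc vy] := vs.
have hv := Horb _ _ m (lexx _) xc; rewrite -/v in hv.
have mN1 : N1%:R <= m%:R :> R by rewrite ler_nat /m !leq_max leqnn !orbT.
have mN2 : N2%:R <= m%:R :> R by rewrite ler_nat /m !leq_max leqnn !orbT.
have hM1R : M1 <= Rc + m%:R / 2 by move: hN1 mN1 Rc1; clt; lra.
have := hM1 _ _ hM1R hv; rewrite le_min => /andP[vr2 vd].
have nv : 0 < nm v by rewrite nm_gt0.
have c12 : c <= 1/2 by rewrite ge_min lexx.
have cd : c <= d / 2 by rewrite ge_min lexx orbT.
have yv : c * nm v <= 1/2 * nm v by rewrite ler_wpM2r ?nm_ge0.
have y1 : nm y <= 2 * nm v by have := nm_leB y v; move: hj yv nv; clt; lra.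
have y2 : 1/2 * nm v <= nm y by have := nm_leB v y; rewrite nmC; move: hj yv; clt; lra.
have y0 : y != 0 by rewrite -nm_gt0; move: y2 nv; clt; lra.
have yr : nm y <= r by move: y1 vr2; clt; lra.
have [Uv _ hv1 _ _] := chart v0 vr; have [Uy _ hy1 _ _] := chart y0 yr.
pose T := U.[v] / U.[y].
have TF : T = F (y / v, U.[v] / v ^+ q, U.[y] / y ^+ q).
  rewrite /F /T /= exprMn exprVn; field.
  by rewrite !expf_neq0// Uy.
have Cv : C * nm v <= d / 8.
  have C1 : 0 < 8 * (C + 1) by rewrite mulr_gt0// ltr_wpDl.
  by rewrite ler_pdivlMr// in vd; move: vd (nv); rewrite !mulrDr mulr1; clt; lra.
have dT : dist (y / v, U.[v] / v ^+ q, U.[y] / y ^+ q) < d.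
  rewrite /dist /=.
  have h1 : nm (y / v - 1) <= d / 2.
    have -> : y / v - 1 = (y - v) / v by field.
    by rewrite nm_div ler_pdivrMr//; apply: (le_trans hj); rewrite ler_wpM2r ?nm_ge0.
  have h2 : C * nm y <= C * (2 * nm v) by rewrite ler_wpM2l.
  by move: h1 h2 hv1 hy1 Cv d0; clt; lra.
have [T1 T2 T3] := hd _ dT; rewrite -TF in T1 T2 T3.
have YE : Y y = Y v * T by rewrite /T; field; rewrite Uv Uy.
have WE : W y = W v * T ^+ nu by rewrite -!coord_power YE exprMn.
clearbody T; have T12 : 1/2 <= nm T by have := nm_leB 1 T; rewrite nmC nm1; move: T2; clt; lra.
have as_ := hK x m xb; rewrite -/v in as_.
have := re_ge (W v - (W x + m%:R)); have := im_nm (W v - (W x + m%:R)).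
have rm : re (m%:R : R[i]) = m%:R by rewrite -(rmorph_nat (real_complex R)).
have im0 : im (m%:R : R[i]) = 0 by rewrite -(rmorph_nat (real_complex R)).
rewrite !reB !imB !reD !imD rm im0 addr0 => h1 h2.
have h3 := im_nm (W x); have h4 := re_ge (W x).
have mt : 4 * R0 * t + 2 * (nm (W x) + 2 * K) <= m%:R * t.
  have -> : 4 * R0 * t + 2 * (nm (W x) + 2 * K) = (4 * R0 + 2 * (nm (W x) + 2 * K) / t) * t.
    by field; rewrite gt_eqF.
  by rewrite ler_pM2r// (le_trans (ltW hN2)).
have t16 : t <= 1/160 by rewrite /t; move: th1'; clt; lra.
have thE : th = 10 * t by rewrite /t; field.
have m0 := ler0n R m; have Wx0 := nm_ge0 (W x).
have rv : (m%:R - t / 4 * m%:R) - K - nm (W x) <= re (W v) by move: h2 h4 as_; clt; lra.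
have iv : `|im (W v)| <= nm (W x) + t / 4 * m%:R + K.
  have : `|im (W v)| <= `|im (W v) - im (W x)| + `|im (W x)|.
    by have := ler_normD (im (W v) - im (W x)) (im (W x)); rewrite subrK.
  by move: h1 h3 as_; clt; lra.
have vc' : `|im (W v)| <= t * re (W v).
  apply: (le_trans iv); have := ler_wpM2l (ltW t0) rv.
  have q1 : t * (t * m%:R) <= 1/160 * (t * m%:R) by rewrite ler_wpM2r// mulr_ge0// ltW.
  have q2 : t * K <= 1/160 * K by rewrite ler_wpM2r.
  have q3 : t * nm (W x) <= 1/160 * nm (W x) by rewrite ler_wpM2r.
  have q4 : 0 <= R0 * t by rewrite mulr_ge0 ?(ltW t0)//; move: R01'; clt; lra.
  by move: mt q1 q2 q3 q4 K0 Wx0; rewrite !mulrBr; clt; lra.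
have rvbig : 2 * R0 <= re (W v).
  have : 4 * R0 + 2 * (nm (W x) + 2 * K) <= m%:R.
    have : 1 <= t^-1 by rewrite -invr1 lef_pV2 ?posrE//; move: t16; clt; lra.
    have : 0 <= 2 * (nm (W x) + 2 * K) by move: K0 Wx0; clt; lra.
    move=> a0 /(ler_wpM2l a0); move: hN2 mN2; rewrite mulr1; clt; lra.
  have : t / 4 * m%:R <= 1/2 * m%:R by rewrite ler_wpM2r//; move: t16; clt; lra.
  by move: rv R01' K0 Wx0; clt; lra.
have rv0 : 0 <= re (W v) by move: rvbig R01'; clt; lra.
have nWv : nm (W v) <= 2 * re (W v).
  have := nm_reim (W v); rewrite (ger0_norm rv0).
  have : t * re (W v) <= 1 * re (W v) by rewrite ler_wpM2r//; move: t16; clt; lra.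
  by move: vc'; clt; lra.
have dW : nm (W y - W v) <= 2 * t * re (W v).
  have -> : W y - W v = W v * (T ^+ nu - 1) by rewrite WE; ring.
  rewrite nmM; apply: (@le_trans _ _ (2 * re (W v) * t)); first by rewrite ler_pM ?nm_ge0.
  by clt; lra.
have rWy : re (W v) - 2 * t * re (W v) <= re (W y).
  by have := re_ge (W y - W v); rewrite reB; move: dW; clt; lra.
have iWy : `|im (W y)| <= 3 * t * re (W v).
  have : `|im (W y)| <= `|im (W y) - im (W v)| + `|im (W v)|.
    by have := ler_normD (im (W y) - im (W v)) (im (W v)); rewrite subrK.
  by have := im_nm (W y - W v); rewrite imB; move: dW vc'; clt; lra.
have t12 : t * re (W v) <= 1/160 * re (W v) by rewrite ler_wpM2r.
split.
- split; [exact: y0|exact: yr|]; move: rWy rvbig t12 R01'; clt; lra.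
- apply: (le_trans iWy); rewrite thE.
  have := ler_wpM2l (ltW t0) rWy.
  have : t * (t * re (W v)) <= t * (1/160 * re (W v)) by rewrite ler_wpM2l// ltW.
  have : 0 <= t * re (W v) by rewrite mulr_ge0// ltW.
  by rewrite mulrBr; clt; lra.
have vy' : nm (Y v - zeta * (nm (Y v))%:C) <= 2 * (2 * t) * nm (Y v).
  have t00 : 0 <= 2 * t by move: t0; clt; lra.
  apply: (root_stay zn t00).
    have n0 : 0 <= 2 * nu%:R ^+ 2 :> R by rewrite mulr_ge0 ?exprn_ge0.
    apply: (le_trans (ler_wpM2r n0 vy)).
    have := ler_wpM2r (nm_ge0 (Y v)) thn; rewrite mul1r.
    have := mulr_ge0 (mulr_ge0 (ltW th0) (exprn_ge0 2 (ler0n R nu))) (nm_ge0 (Y v)).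
    by clt; lra.
  have := cone_angle (ltW t0) rv0 vc'; rewrite -coord_power nmX; by clt; lra.
have nz : nm zeta = 1.
  have : nm zeta ^+ nu = 1 by rewrite -nmX zn nm1.
  by move/eqP; rewrite pexpr_eq1 ?nm_ge0// => /eqP.
rewrite YE; set a := Y v in vy' *; clearbody a.
have -> : a * T - zeta * (nm (a * T))%:C = T * (a - zeta * (nm a)%:C) + zeta * (nm a)%:C * (T - (nm T)%:C).
  by rewrite nmM rmorphM /=; ring.
apply: (le_trans (nmD _ _)); rewrite !(nmM T) (nmM (zeta * _)) (nmM zeta) nz mul1r nm_real ger0_norm ?nm_ge0// (nmM a).
have hT : nm (T - (nm T)%:C) <= 2 * t.
  have -> : T - (nm T)%:C = (T - 1) - (nm T - 1)%:C by rewrite rmorphB /=; ring.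
  apply: (le_trans (nmB _ _)); rewrite nm_real.
  by have := nm_dist T 1; rewrite nm1; move: T1; clt; lra.
have a0 := nm_ge0 a.
have s1 : nm T * nm (a - zeta * (nm a)%:C) <= nm T * (2 * (2 * t) * nm a) by rewrite ler_wpM2l ?nm_ge0.
have s2 : nm a * nm (T - (nm T)%:C) <= nm a * (2 * t) by rewrite ler_wpM2l.
have s3 : t * nm a * (1/2) <= t * nm a * nm T by rewrite ler_wpM2l// mulr_ge0// ltW.
by have := mulr_ge0 (ltW t0) a0; rewrite thE; move: s1 s2 s3; clt; lra.
Qed.

End sectors.

End petal_orbits.

(** * There is only one cycle of petals *)

Section one_petal.
Variable R : realType.
Implicit Types (l b z : R[i]).

Lemma petal_chart_small l q nu V Q (eta : R) : (0 < q)%N -> (0 < nu)%N -> l ^+ q = 1 ->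
  nf_rel q (nu * q) l 0 0 V Q -> Q`_0 != 0 -> 0 < eta -> let U := nf_poly q V in
  exists r C, [/\ 0 < r, r <= 1, 0 <= C, C * r <= eta & forall z, z != 0 -> nm z <= r ->
   [/\ U.[z] != 0, U.[quad l z] != 0, nm (U.[z] / z ^+ q - 1) <= C * nm z,
     nm (U.[quad l z] / U.[z] - 1) <= C * nm z &
     nm (petal_coord nu Q`_0 U (quad l z) - petal_coord nu Q`_0 U z - 1) <= C * nm z]].
Proof.
move=> q0 nu0 lq rel Q0 eta0 U.
have [r [C [r0 r1 C0 H]]] := petal_chart q0 nu0 lq rel Q0.
have C1 : 0 < C + 1 by rewrite ltr_wpDl.
exists (Num.min r (eta / (C + 1))), C; split => //.
- by rewrite lt_min r0 divr_gt0.
- by rewrite ge_min r1.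
- have h : Num.min r (eta / (C + 1)) * (C + 1) <= eta by rewrite -ler_pdivlMr// ge_min lexx orbT.
  have m0 : 0 <= Num.min r (eta / (C + 1)) by rewrite le_min (ltW r0) divr_ge0// ltW.
  by move: h m0; move: (Num.min _ _) => m; rewrite mulrDr mulr1; lra.
by move=> z z0; rewrite le_min => /andP[zr _]; exact: H.
Qed.

Lemma nf_poly0 q (V : {poly R[i]}) : (0 < q)%N -> (nf_poly q V).[0] = 0.
Proof. by move=> q0; rewrite hornerM hornerXn expr0n (gtn_eqF q0) mul0r. Qed.

Lemma prim_nm1 l q : (0 < q)%N -> l ^+ q = 1 -> nm l = 1.
Proof.
move=> q0 lq; have : nm l ^+ q = 1 by rewrite -nmX lq nm1.
by move/eqP; rewrite pexpr_eq1 ?nm_ge0// => /eqP.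
Qed.

Lemma unity_root_neq1 n : (1 < n)%N -> exists2 z : R[i], z ^+ n = 1 & z != 1.
Proof.
move=> n1; have /closed_rootP[z] : size (\poly_(i < n) (1 : R[i])) != 1%N.
  by rewrite size_poly_eq ?oner_neq0// gtn_eqF.
rewrite /root horner_poly => /eqP; under eq_bigr do rewrite mul1r.
move=> h; exists z; first by apply/eqP; rewrite -subr_eq0 subrX1 h mulr0.
apply/eqP => z1; move: h; rewrite z1; under eq_bigr do rewrite expr1n.
by rewrite sumr_const card_ord => /eqP; rewrite pnatr_eq0 -leqn0 leqNgt ltnW.
Qed.

(** The critical orbit enters every sector and sectors are forward invariant, so the sectors of 1
    and of another root zeta would share a point of that orbit; th is chosen too small for these
    sectors to meet. *)
Lemma petal_number l q nu V Q : (0 < q)%N -> (0 < nu)%N -> l ^+ q = 1 ->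
  nf_rel q (nu * q) l 0 0 V Q -> Q`_0 != 0 -> nu = 1%N.
Proof.
move=> q0 nu0 lq rel Q0; apply/eqP; apply: contraT => nu1.
have [zeta zn z1] : exists2 z : R[i], z ^+ nu = 1 & z != 1.
  by apply: unity_root_neq1; rewrite ltn_neqAle eq_sym nu1.
have nz : 0 < nm (zeta - 1) by rewrite nm_gt0 subr_eq0.
have n2 : 0 < 16 * nu%:R ^+ 2 :> R by rewrite mulr_gt0// exprn_gt0// ltr0n.
pose th := Num.min (16 * nu%:R ^+ 2)^-1 (nm (zeta - 1) / 16).
have th0 : 0 < th by rewrite lt_min invr_gt0 n2 divr_gt0.
have thn : th * (16 * nu%:R ^+ 2) <= 1 by rewrite -ler_pdivlMr// mul1r ge_min lexx.
have thz : th <= nm (zeta - 1) / 16 by rewrite ge_min lexx orbT.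
have eta0 : 0 < Num.min (1/8) (th / 8) by rewrite lt_min !divr_gt0.
have [r [C [r0 r1 C0 Cr H]]] := petal_chart_small q0 nu0 lq rel Q0 eta0.
move: Cr; rewrite le_min => /andP[Cr Crt].
have l1 := prim_nm1 q0 lq; have U00 := nf_poly0 V q0.
have [bet betE] := nth_root (- 1 / (nu%:R * Q`_0)) nu0.
have [R0 R01 startR0] := petal_start q0 nu0 l1 Q0 r0 r1 C0 Cr U00 H.
have E1 : (1 : R[i]) ^+ nu = 1 by rewrite expr1n.
have crit_ z (zn' : z ^+ nu = 1) : exists2 j, (0 < j)%N & sector Q`_0 nu (nf_poly q V) r bet th R0 z (iter j (quad l) (crit l)).
  by apply: (sector_critical (q := q) (nu := nu)); try eassumption.
have [j j0 hj] := crit_ _ E1; have [k k0 hk] := crit_ _ zn.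
have hj' : sector Q`_0 nu (nf_poly q V) r bet th R0 1 (iter (j + k) (quad l) (crit l)).
  by rewrite addnC iterD; apply: (sector_iter (q := q)); try eassumption.
have hk' : sector Q`_0 nu (nf_poly q V) r bet th R0 zeta (iter (j + k) (quad l) (crit l)).
  by rewrite iterD; apply: (sector_iter (q := q)); try eassumption.
have : nm (zeta - 1) <= 8 * th by exact: (sector_disjoint nu0 Q0 H betE hj' hk').
by move: thz nz; clear; lra.
Qed.

(** The maximal order is q, as nu = 1; if b vanished, the same V would give a normal form of order 2
    q. *)
Lemma nf_first_order l q b be V Q : (0 < q)%N -> q.-primitive_root l ->
  nf_rel q (3 * q) l b be V Q -> b != 0 /\ exists Q', nf_rel q q l 0 0 V Q' /\ Q'`_0 = b.
Proof.
move=> q0 pl rel; have lq := prim_expr_order pl.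
have e2 : 'X^(2 * q) = 'X^q ^+ 2 :> {poly R[i]} by rewrite mulnC exprM.
have e3 : 'X^(q + 2 * q) = 'X^q ^+ 3 :> {poly R[i]} by rewrite -(mulSn 2 q) mulnC exprM.
have e4 : 'X^(q + 3 * q) = 'X^q ^+ 4 :> {poly R[i]} by rewrite -(mulSn 3 q) mulnC exprM.
have e5 : 'X^(q + q) = 'X^q ^+ 2 :> {poly R[i]} by rewrite exprD expr2.
have relb : nf_rel q q l 0 0 V (b%:P * (1 + 'X * V) ^+ 2 + be%:P * 'X^q * (1 + 'X * V) ^+ 3 + 'X^(2 * q) * Q).
  rewrite /nf_rel; apply: (etrans rel); rewrite e4 e5 ?e2 /nf_poly; ring.
have Q'0 : (b%:P * (1 + 'X * V) ^+ 2 + be%:P * 'X^q * (1 + 'X * V) ^+ 3 + 'X^(2 * q) * Q)`_0 = b.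
  rewrite -horner_coef0 !(hornerD, hornerM, horner_exp, hornerC, hornerX) !mul0r addr0 !expr0n.
  by rewrite muln_eq0 (gtn_eqF q0) /=; ring.
split; last by eexists; split; [exact: relb|].
apply/eqP => b0; have [nu [V1 [Q1 [nu0 rel1 Q10 hmax]]]] := nf_maximal q0 pl.
have nu1 := petal_number q0 nu0 lq rel1 Q10; rewrite {}nu1 mul1n in rel1 hmax.
have rel2 : nf_rel q (2 * q) l 0 0 V (be%:P * (1 + 'X * V) ^+ 3 + 'X^q * Q).
  rewrite /nf_rel; apply: (etrans rel); rewrite b0 e4 e3 /nf_poly; ring.
have := hmax _ _ _ rel2; rewrite leqNgt -[X in (X < _)%N]mul1n ltn_mul2r q0.
by [].
Qed.

End one_petal.

(** * Interior of the filled Julia set at the parabolic parameter *)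

Section interior_is_basin.
Variable R : realType.
Implicit Types (l x y z : R[i]) (r : R) (A : R[i] -> Prop).

(** An abstract basin: the exclusion of other interior points uses the parabolic basin only through
    these clauses, above all that it contains the critical point. *)
Definition basin_data l r A :=
  [/\ 0 < r /\ nm l <= 2, (forall z, A z -> forall e, 0 < e -> exists N, forall n, (N <= n)%N -> nm (iter n (quad l) z) <= e),
   (forall z, A z -> exists2 d, 0 < d & forall y, nm (y - z) < d -> A y),
   (forall z, A (quad l z) <-> A z) &
   [/\ forall z, (forall n, nm (iter n (quad l) z) <= r /\ iter n (quad l) z != 0) -> A z,
    A (crit l) & ~ filled_int l 0]].

(** The margin between 3 and the escape radius 4 leaves room for discs around filled points on which
    inverse branches are taken. *)
Lemma filled_nm3 l z : nm l <= 2 -> filled l z -> nm z <= 3.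
Proof.
move=> hl Kz; rewrite leNgt; apply/negP => z3.
have [n hn] := @expr_gt R (nm z - 2) 2 (ltac:(by move: z3; lra)).
have := iter_quad_lower n hl (ltW z3); have := Kz n.
have : (nm z - 2) ^+ n <= (nm z - 2) ^+ (2 ^ n).
  by apply: ler_weXn2l; [move: z3; lra|exact/ltnW/ltn_expl].
by move: hn; lra.
Qed.

Lemma poly_limit_two_const M r s k : 0 < r -> 0 < s -> s <= r -> 0 < k -> exists2 e, 0 < e &
  forall (h : R[i] -> R[i]) a, poly_limit a r h -> (forall z, nm (z - a) <= r -> nm (h z) <= M) ->
    (forall z, nm (z - a) <= s -> nm (h z) <= e) ->
  forall z, nm (z - a) <= r / 2 -> nm (h z) <= k.
Proof.
move=> r0 s0 sr k0; have k2 : 0 < k / 2 by rewrite divr_gt0.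
have [e e0 he] := @poly_two_const R (M + 1) r s (k / 2) r0 s0 k2.
exists (e / 2); first by rewrite divr_gt0.
move=> h a hl hM hs z hz.
have m0 : 0 < Num.min (e / 2) (Num.min (k / 2) 1) by rewrite !lt_min ltr01 k2 divr_gt0.
have [p hp] := hl _ m0.
have hp' w : nm (w - a) <= r -> [/\ nm (p.[w] - h w) <= e / 2, nm (p.[w] - h w) <= k / 2 & nm (p.[w] - h w) <= 1].
  by move=> /hp; rewrite !le_min => /and3P[].
have zr : nm (z - a) <= r by move: hz r0; lra.
have : nm p.[z] <= k / 2.
  apply: (he p a) => // w hw.
    have [_ _ h1] := hp' w hw; have := hM w hw; have := nm_leB p.[w] (h w); move: h1; lra.
  have [h1 _ _] := hp' w (le_trans hw sr); have := hs w hw; have := nm_leB p.[w] (h w); move: h1; lra.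
by have [_ h1 _] := hp' z zr; have := nm_leB (h z) p.[z]; rewrite nmC; move: h1; lra.
Qed.

Lemma iter_cont l n x e : 0 < e -> exists2 d, 0 < d & forall y, nm (y - x) < d ->
  nm (iter n (quad l) y - iter n (quad l) x) < e.
Proof.
move=> e0; have [d d0 hd] := iter_quad_cont n l x e0.
by exists d => // y; apply: hd; rewrite subrr nm0.
Qed.

Section with_basin.
Variables (l : R[i]) (r : R) (A : R[i] -> Prop).
Hypothesis HA : basin_data l r A.

Let l2 : nm l <= 2. Proof. by case: HA => -[]. Qed.
Let r0 : 0 < r. Proof. by case: HA => -[]. Qed.
Local Ltac cls := clear - R l r A HA l2 r0.

Lemma basin_iter z n : A (iter n (quad l) z) <-> A z.
Proof. by case: HA => _ _ _ h _; elim: n => //= n <-; exact: h. Qed.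

(** The critical orbit lies in A and tends to 0, so it keeps a distance from any nonzero point
    outside A; inverse branches of all iterates exist on discs of a common size there. *)
Lemma basin_sep x : ~ A x -> x != 0 -> exists2 d, 0 < d & forall j, d < nm (iter j.+1 (quad l) (crit l) - x).
Proof.
case: HA => _ A1 _ _ [_ Ac _] nA x0; have nx : 0 < nm x by rewrite nm_gt0.
have [N hN] := A1 _ Ac _ (ltac:(by rewrite divr_gt0) : 0 < nm x / 2).
have [d d0 hd] : exists2 d, 0 < d & forall j, (j < N)%N -> d < nm (iter j.+1 (quad l) (crit l) - x).
  elim: N {hN} => [|N [d d0 hd]]; first by exists 1.
  have h0 : 0 < nm (iter N.+1 (quad l) (crit l) - x).
    by rewrite nm_gt0 subr_eq0; apply/eqP => E; apply: nA; rewrite -E; apply/basin_iter.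
  exists (Num.min d (nm (iter N.+1 (quad l) (crit l) - x) / 2)); first by rewrite lt_min d0 divr_gt0.
  move=> j; rewrite ltnS leq_eqVlt => /predU1P[->|/hd h]; rewrite gt_min; last by rewrite h.
  by apply/orP; right; rewrite ltr_pdivrMr//; move: h0; cls; lra.
exists (Num.min d (nm x / 4)); first by rewrite lt_min d0 divr_gt0.
move=> j; have [/hd h|jN] := ltnP j N; first by rewrite gt_min h.
rewrite gt_min; apply/orP; right; have := hN j.+1 (leqW jN).
by have := nm_leB x (iter j.+1 (quad l) (crit l)); rewrite nmC; move: nx; cls; lra.
Qed.

Section returns.
Variable m : nat -> nat.
Hypothesis mj : forall j, (j <= m j)%N.

(** The behaviour of a rotation domain: the iterates f^(m j) tend to the identity uniformly near
    x. *)
Definition returns x rho := forall e, 0 < e -> exists J, forall j, (J <= j)%N -> forall y, nm (y - x) <= rho ->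
  nm (iter (m j) (quad l) y - y) <= e.

Definition recurrent x := exists2 rho, 0 < rho & returns x rho.

Lemma recurrent_open x : recurrent x -> exists2 d, 0 < d & forall y, nm (y - x) < d -> recurrent y.
Proof.
move=> [rho rho0 H]; have r2 : 0 < rho / 2 by rewrite divr_gt0.
exists (rho / 2) => // y hy; exists (rho / 2) => // e /H[J hJ]; exists J => j Jj w hw.
by apply: hJ => //; have := nm_tri y w x; move: hw hy; cls; lra.
Qed.

Lemma recurrent_filled x : recurrent x -> filled l x.
Proof.
move=> [rho rho0 H]; apply: contrapT => nK.
have [N hN] := escape_large (nm x + 1) l2 nK.
have [J hJ] := H 1 ltr01; pose j := maxn N J.
have := hJ j (leq_maxr _ _) x; rewrite subrr nm0 => /(_ (ltW rho0)) h1.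
have := hN (m j) (leq_trans (leq_maxl _ _) (mj j)).
by have := nm_leB (iter (m j) (quad l) x) x; move: h1; cls; lra.
Qed.

Lemma recurrent_int x : recurrent x -> filled_int l x.
Proof. by move=> /recurrent_open[d d0 hd]; exists d => // y /hd/recurrent_filled. Qed.

Lemma recurrent_neq0 x : recurrent x -> x != 0.
Proof.
case: HA => _ _ _ _ [_ _ n0] /recurrent_int h; apply/eqP => E; apply: n0.
by rewrite -E.
Qed.

Lemma recurrent_not_basin x : recurrent x -> ~ A x.
Proof.
move=> rx; have x0 := recurrent_neq0 rx; case: HA => _ A1 _ _ _ Ax.
have nx : 0 < nm x by rewrite nm_gt0.
have x4 : 0 < nm x / 4 by rewrite divr_gt0.
have [N hN] := A1 _ Ax _ x4; case: rx => rho rho0 /(_ _ x4)[J hJ].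
pose j := maxn N J.
have := hJ j (leq_maxr _ _) x; rewrite subrr nm0 => /(_ (ltW rho0)) h1.
have := hN (m j) (leq_trans (leq_maxl _ _) (mj j)).
by have := nm_leB x (iter (m j) (quad l) x); rewrite nmC; move: h1 nx; cls; lra.
Qed.

(** Around x the inverse branches of f^(m j) live on discs of fixed size. Near a recurrent xi they
    are close to the identity on a tiny disc, hence by the two-constants estimate on a disc
    containing x. This makes that disc filled and bounds the forward iterates, and the same estimate
    carries the return property from xi to x. *)
Lemma recurrent_closed x : x != 0 -> (forall d, 0 < d -> exists2 y, nm (y - x) < d & recurrent y) ->
  recurrent x.
Proof.
move=> x0 Hx.
have nAx : ~ A x.
  move=> Ax; case: HA => _ _ A2 _ _; have [d d0 hd] := A2 _ Ax.
  by have [y yx ry] := Hx _ d0; exact: (recurrent_not_basin ry (hd _ yx)).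
have [d' d'0 hd'] := basin_sep nAx x0.
pose d := Num.min d' (1/2); have d0 : 0 < d by rewrite lt_min d'0 divr_gt0.
have d1 : d <= 1/2 by rewrite ge_min lexx orbT.
have hd j : d < nm (iter j.+1 (quad l) (crit l) - x) by apply: le_lt_trans (hd' j); rewrite ge_min lexx.
clearbody d.
have d32 : 0 < d / 32 by rewrite divr_gt0.
have [xi xix rxi] := Hx _ d32.
have Kxi := recurrent_filled rxi; have xi3 := filled_nm3 l2 Kxi.
have [rho rho0 Hrho] := rxi.
pose rr := 3 * d / 8; have rr0 : 0 < rr by rewrite /rr; move: d0; cls; lra.
pose s := Num.min (d / 64) (rho * rr / 64).
have s0 : 0 < s by rewrite lt_min !divr_gt0 ?mulr_gt0.
have sd : s <= d / 64 by rewrite ge_min lexx.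
have srho : s <= rho * rr / 64 by rewrite ge_min lexx orbT.
have branch : exists J, forall j, (J <= j)%N -> exists g, [/\ poly_limit xi (d / 4) g,
    forall y, nm (y - xi) <= d / 4 -> iter (m j) (quad l) (g y) = y /\ nm (g y) <= 4 &
    forall y, nm (y - xi) <= s -> nm (g y - xi) <= rho].
  have [J hJ] := Hrho s s0; exists J => j Jj.
  have := hJ j Jj xi; rewrite subrr nm0 => /(_ (ltW rho0)); set v := iter (m j) _ _ => vxi.
  have vK : nm v <= 3 by apply: (filled_nm3 l2); apply/filled_iter.
  have [||i _|g [gl gv hg]] := @inverse_branch R l (m j) xi v (d / 2) rr l2 erefl rr0.
  - by rewrite /rr; move: d0; cls; lra.
  - by move: vK d1; cls; lra.
  - by have := hd i; have := nm_tri v (iter i.+1 (quad l) (crit l)) x; have := nm_tri xi v x;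
      move: vxi xix sd d0; cls; lra.
  have inc y : nm (y - xi) <= d / 4 -> nm (y - v) <= rr.
    by move=> hy; have := nm_tri xi y v; rewrite (nmC xi v) /rr; move: hy vxi sd d0; cls; lra.
  exists g; split.
  - by move=> e /gl[p hp]; exists p => w hw; exact/hp/inc.
  - by move=> y /inc/hg.
  move=> y hy; rewrite -gv.
  have yv : nm (y - v) <= 2 * s by have := nm_tri xi y v; rewrite (nmC xi v); move: hy vxi; cls; lra.
  have := @poly_limit_lip R v rr g 4 y v rr0 gl (fun z hz => (hg z hz).2).
  rewrite subrr nm0 => h; apply: (le_trans (h _ _)).
  + by rewrite /rr; move: yv sd d0; cls; lra.
  + by move: rr0; cls; lra.
  rewrite ler_pdivrMr//; move: yv srho; cls; lra.
have [J1 hJ1] := branch.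
have d4 : 0 < d / 4 by rewrite divr_gt0.
have sd4 : s <= d / 4 by move: sd d0; cls; lra.
(* the inverse branches converge to the identity on the disc of radius d / 8 *)
have conv e : 0 < e -> exists J, forall j, (J <= j)%N -> forall y, nm (y - xi) <= d / 8 ->
    exists2 w, nm (w - y) <= e & iter (m j) (quad l) w = y.
  move=> e0; have [k k0 hk] := @poly_limit_two_const 8 (d / 4) s e d4 s0 sd4 e0.
  have [J2 hJ2] := Hrho k k0; exists (maxn J1 J2) => j; rewrite geq_max => /andP[j1 j2] y hy.
  have [g [gl hg gs]] := hJ1 j j1.
  have y4 : nm (y - xi) <= d / 4 by move: hy d0; cls; lra.
  exists (g y); last by have [] := hg y y4.
  have -> : g y - y = g y + -1 * y by ring.
  apply: (hk (fun y => g y + -1 * y) xi) => //; last by move: hy; cls; lra.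
  - apply: poly_limitD gl _; apply: poly_limitM (poly_limit_cst _ _ _) _; first exact: ltW.
    by apply: poly_limit_ext (poly_limit_poly xi (d / 4) 'X) => w _; rewrite hornerX.
  - move=> w hw; rewrite mulN1r; have [_ h1] := hg w hw; have := nmB (g w) w.
    by have := nm_leB w xi; move: hw h1 xi3 d1; cls; lra.
  - move=> w hw; rewrite mulN1r; have [h1 _] := hg w (le_trans hw sd4).
    by have := hJ2 j j2 (g w) (gs w hw); rewrite h1 nmC.
have Kd y : nm (y - xi) <= d / 8 -> filled l y.
  (* For an escaping y, a point w close to y with f^(m j) w = y would be outside the escape radius
     at time n <= m j, while y itself is inside. *)
  move=> hy; apply: contrapT => /not_filled[n hn].
  have [e e0 he] := iter_cont l n y (ltac:(by rewrite subr_gt0) : 0 < nm (iter n (quad l) y) - 4).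
  have [J hJ] := conv (e / 2) (ltac:(by rewrite divr_gt0)).
  pose j := maxn n J; have [w wy hw] := hJ j (leq_maxr _ _) y hy.
  have h1 : 4 < nm (iter n (quad l) w).
    have := he w (ltac:(move: wy e0; cls; lra)).
    by have := nm_leB (iter n (quad l) y) (iter n (quad l) w); rewrite nmC; cls; lra.
  have := escape_gt l2 (leq_trans (leq_maxl n J) (mj j)) h1; rewrite hw.
  by have := nm_leB y xi; move: hy xi3 d1; cls; lra.
have d8 : 0 < d / 8 by rewrite divr_gt0.
exists (d / 32) => // e e0.
have m0 : 0 < Num.min rho (d / 8) by rewrite lt_min rho0.
have [k k0 hk] := @poly_two_const R 8 (d / 8) (Num.min rho (d / 8)) e d8 m0 e0.
have [J hJ] := Hrho k k0; exists J => j Jj y hy.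
have -> : iter (m j) (quad l) y - y = (iterpoly l (m j) - 'X).[y].
  by rewrite hornerD hornerN hornerX iterpolyE.
apply: (hk _ xi).
- move=> w hw; rewrite hornerD hornerN hornerX iterpolyE.
  have := Kd w hw (m j); have := nmB (iter (m j) (quad l) w) w; have := Kd w hw 0%N.
  by rewrite /=; cls; lra.
- move=> w; rewrite le_min => /andP[hw _]; rewrite hornerD hornerN hornerX iterpolyE.
  exact: hJ.
- by have := nm_tri x y xi; rewrite (nmC x xi); move: hy xix d0; cls; lra.
Qed.

(* Along the ray from [x] away from [0] a recurrent point never leaves the recurrent set,
   which is bounded. *)
Lemma no_recurrent x : ~ recurrent x.
Proof.
move=> rx; have x0 := recurrent_neq0 rx; have nx : 0 < nm x by rewrite nm_gt0.
pose B := [set t : R | 1 <= t /\ forall u, 1 <= u -> u <= t -> recurrent (u%:C * x)].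
have B1 : B 1.
  split => // u u1 u2; have -> : u = 1 by apply/eqP; rewrite eq_le u1 u2.
  by rewrite rmorph1 mul1r.
have nt t : 1 <= t -> nm (t%:C * x) = t * nm x.
  by move=> t1; rewrite nmM nm_real ger0_norm//; move: t1; cls; lra.
have Bb : has_sup B.
  split; first by exists 1.
  exists (4 / nm x) => t [t1 ht]; have := recurrent_filled (ht t t1 (lexx _)).
  by move=> /filled_nm; rewrite nt// ler_pdivlMr.
pose T := sup B.
have T1 : 1 <= T by have := ub_le_sup Bb.2 B1.
have Bd u : 1 <= u -> u < T -> recurrent (u%:C * x).
  move=> u1 uT; have := sup_adherent (ltac:(by rewrite subr_gt0) : 0 < T - u) Bb.
  rewrite -/T subKr => -[t [_ ht] ut]; apply: ht => //; exact: ltW.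
have diff a b : nm (a%:C * x - b%:C * x) = `|a - b| * nm x.
  by rewrite -mulrBl -rmorphB nmM nm_real.
have rT : recurrent (T%:C * x).
  have [T1'|T1'] := ltP 1 T; last first.
    have -> : T = 1 by apply/eqP; rewrite eq_le T1 T1'.
    by rewrite rmorph1 mul1r.
  apply: recurrent_closed.
    by rewrite -nm_gt0 nt// mulr_gt0//; move: T1; cls; lra.
  move=> d d0; pose u := Num.max 1 (T - d / (2 * nm x)).
  have uT : u < T by rewrite gt_max T1' ltrBlDr ltrDl divr_gt0// mulr_gt0.
  have u2 : T - d / (2 * nm x) <= u by rewrite le_max lexx orbT.
  exists (u%:C * x); last by apply: Bd => //; rewrite le_max lexx.
  rewrite diff distrC gtr0_norm ?subr_gt0//.
  apply: (@le_lt_trans _ _ (d / (2 * nm x) * nm x)).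
    by rewrite ler_wpM2r ?nm_ge0//; move: u2; cls; lra.
  have -> : d / (2 * nm x) * nm x = d / 2 by field; rewrite gt_eqF.
  by move: d0; cls; lra.
have [d d0 hd] := recurrent_open rT.
have dx : 0 < d / (2 * nm x) by rewrite divr_gt0// mulr_gt0.
have dxE : d / (2 * nm x) * nm x = d / 2 by field; rewrite gt_eqF.
have : B (T + d / (2 * nm x)).
  split; first by move: T1 dx; cls; lra.
  move=> u u1 u2; have [uT|Tu] := ltP u T; first exact: Bd.
  apply: hd; rewrite diff ger0_norm ?subr_ge0//.
  apply: (@le_lt_trans _ _ (d / 2)); last by move: d0; cls; lra.
  by rewrite -dxE ler_wpM2r ?nm_ge0//; move: u2; cls; lra.
move=> /(ub_le_sup Bb.2); rewrite -/T; move: dx; cls; lra.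
Qed.

End returns.

(** If z is interior but outside A, its orbit leaves the disc of radius r infinitely often. Along
    such times the iterates converge uniformly near z to some g. Pulling points near g z back to
    points near z shows that the iterate over the difference of two such times is close to the
    identity, so g z would be recurrent. *)
Lemma interior_basin z : filled_int l z -> A z.
Proof.
move=> iz; apply: contrapT => nA; have [e e0 he] := iz.
have itz n := filled_int_iter n l2 iz.
have zn0 n : iter n (quad l) z != 0.
  by case: HA => _ _ _ _ [_ _ n0]; apply/eqP => E; apply: n0; have := itz n; rewrite E.
have far N : exists n, (N <= n)%N /\ r < nm (iter n (quad l) z).
  apply: contrapT => none; apply: nA; apply/(basin_iter _ N).
  case: HA => _ _ _ _ [A4 _ _]; apply: A4 => n; rewrite -iterD; split; last exact: zn0.
  by rewrite leNgt; apply/negP => lt; apply: none; exists (n + N)%N; rewrite leq_addl.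
have /(@choice _ _ _)[nk hnk] := far.
pose h k := iter (nk k) (quad l).
have [e4 e40 e4E] : exists2 t, 0 < t & t = e / 4 by exists (e / 4); rewrite ?divr_gt0.
have e20 : 0 < e / 2 by rewrite divr_gt0.
have hb k y : nm (y - z) <= e / 2 -> nm (h k y) <= 4.
  by move=> hy; have := he y (ltac:(move: hy e0; cls; lra)); exact.
have hL k y y' : nm (y - z) <= e4 -> nm (y' - z) <= e4 -> nm (h k y - h k y') <= 64 / e * nm (y - y').
  move=> hy hy'; have := @poly_lip R (iterpoly l (nk k)) z (e / 2) 4 y y' e20.
  rewrite !iterpolyE => /(_ _ _ _)H.
  have := H (fun w hw => ltac:(rewrite iterpolyE; exact: hb)) (ltac:(move: hy; rewrite e4E; cls; lra)) (ltac:(move: hy'; rewrite e4E; cls; lra)).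
  have -> : 8 * 4 * nm (y - y') / (e / 2) = 64 / e * nm (y - y') by field; rewrite gt_eqF.
  by [].
have [g [s [smono hs]]] := @ascoli_seq R h z e4 4 (64 / e)
   (fun k y hy => hb k y (ltac:(move: hy e0; rewrite e4E; cls; lra))) (ltW e40) (ltac:(by rewrite divr_ge0// ltW)) hL.
have sge j : (j <= s j)%N.
  by elim: j => // j IH; apply: (leq_ltn_trans IH); exact: smono.
have nsge j : (j <= nk (s j))%N by apply: leq_trans (sge j) _; have [] := hnk (s j).
pose x := g z.
have zz : nm (z - z) <= e4 by rewrite subrr nm0 ltW.
have vx j : nm (h (s j) z - x) <= j.+1%:R^-1 := hs j z zz.
have inv0 d : 0 < d -> exists J, forall j, (J <= j)%N -> j.+1%:R^-1 <= d :> R.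
  move=> d0; have [J hJ] := nat_gt d^-1; exists J => j Jj.
  rewrite -[leRHS]invrK lef_pV2 ?posrE ?invr_gt0//; apply: (le_trans (ltW hJ)).
  by rewrite ler_nat ltnW.
have xr : r <= nm x.
  rewrite leNgt; apply/negP; rewrite -subr_gt0 => lt.
  have [J hJ] := inv0 _ lt; have := le_trans (vx J) (hJ J (leqnn _)).
  by have [_] := hnk (s J); have := nm_leB (h (s J) z) x; rewrite /h; cls; lra.
have x0 : x != 0 by rewrite -nm_gt0; move: xr r0; lra.
have nAx : ~ A x.
  move=> Ax; case: HA => _ _ A2 _ _; have [d d0 hd] := A2 _ Ax.
  have [J hJ] := inv0 (d / 2) (ltac:(by rewrite divr_gt0)).
  apply: nA; apply/(basin_iter _ (nk (s J))); apply: hd.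
  by have := le_trans (vx J) (hJ J (leqnn _)); rewrite /h; move: d0; cls; lra.
have [d' d'0 hd'] := basin_sep nAx x0.
pose d := Num.min d' 1; have d0 : 0 < d by rewrite lt_min d'0 ltr01.
have d1 : d <= 1 by rewrite ge_min lexx orbT.
have hd j : d < nm (iter j.+1 (quad l) (crit l) - x) by apply: le_lt_trans (hd' j); rewrite ge_min lexx.
clearbody d.
(* The later index is pushed so far that the difference m j of the two times is at least j. *)
pose j' j := (j + nk (s j))%N.
pose m j := (nk (s (j' j)) - nk (s j))%N.
have mE j : (m j + nk (s j) = nk (s (j' j)))%N.
  by rewrite /m subnK//; apply: leq_trans (leq_addl j _) (nsge _).
have mj j : (j <= m j)%N by rewrite /m leq_subRL ?(leq_trans (leq_addl j _) (nsge _))// addnC nsge.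
apply: (@no_recurrent m mj x).
pose k := Num.min (d / 16) (e4 * d / 16 / 16).
have k0 : 0 < k by rewrite lt_min !divr_gt0 ?mulr_gt0.
have kd : k <= d / 16 by rewrite ge_min lexx.
have ke : k <= e4 * d / 16 / 16 by rewrite ge_min lexx orbT.
exists k => // eps eps0.
have [J1 hJ1] := inv0 k k0; have [J2 hJ2] := inv0 (eps / 2) (ltac:(by rewrite divr_gt0)).
exists (maxn J1 J2) => j; rewrite geq_max => /andP[j1 j2] y hy.
have := vx j; set v := h (s j) z => hv; have vk := le_trans hv (hJ1 j j1).
have v3 : nm v <= 3.
  apply: (filled_nm3 l2); apply/(filled_iter _ _ l2); apply: he; rewrite subrr nm0//.
have [||i _|G [Gl Gv hG]] := @inverse_branch R l (nk (s j)) z v (d / 2) (d / 4) l2 erefl (ltac:(by rewrite divr_gt0)).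
- by move: d0; cls; lra.
- by move: v3 d1; cls; lra.
- by have := hd i; have := nm_tri v (iter i.+1 (quad l) (crit l)) x; move: vk kd d0; cls; lra.
have yv : nm (y - v) <= 2 * k by have := nm_tri x y v; rewrite (nmC x v); move: hy vk; cls; lra.
have [hGy _] := hG y (ltac:(move: yv kd d0; cls; lra)).
have d4 : 0 < d / 4 by rewrite divr_gt0.
have Gz : nm (G y - z) <= e4.
  rewrite -Gv.
  have := @poly_limit_lip R v (d / 4) G 4 y v d4 Gl (fun w hw => (hG w hw).2).
  rewrite subrr nm0 => hh; apply: (le_trans (hh _ _)).
  + by move: yv kd d0; cls; lra.
  + by move: d0; cls; lra.
  by rewrite ler_pdivrMr//; move: yv ke; cls; lra.
have -> : iter (m j) (quad l) y - y = (h (s (j' j)) (G y) - g (G y)) - (h (s j) (G y) - g (G y)).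
  by rewrite /h -mE iterD hGy; ring.
have j'j : (j <= j' j)%N by rewrite leq_addr.
have q1 := hs (j' j) (G y) Gz; have q2 := hs j (G y) Gz.
have q3 := hJ2 j j2; have q4 := hJ2 (j' j) (leq_trans j2 j'j).
apply: (le_trans (nmB _ _)); move: (le_trans q1 q4) (le_trans q2 q3); cls; lra.
Qed.

End with_basin.

End interior_is_basin.

(** * The parabolic basin *)

Section parabolic_basin.
Variable R : realType.
Implicit Types (l b z : R[i]).

(** The coefficient of z^(2q) in U o f^n grows linearly with n, whereas the Cauchy estimates bound
    it if all iterates are bounded near 0. *)
Lemma zero_not_interior q l V Q : (0 < q)%N -> q.-primitive_root l -> nf_rel q q l 0 0 V Q ->
  Q`_0 != 0 -> ~ filled_int l 0.
Proof.
move=> q0 pl rel Q0 [e e0 he]; have Qp : 0 < nm Q`_0 by rewrite nm_gt0.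
have [M M0 hM] := poly_bound (nf_poly q V) (ler0n R 4).
have e2 : 0 < e / 2 by rewrite divr_gt0.
have [n hn] := nat_gt ((M / (e / 2) ^+ (q + q) + nm (nf_poly q V)`_(q + q)) / nm Q`_0).
have [Qn [h1 h2]] := nf_iter_dvd n pl rel (dvdnn q).
have := @nm_coef_le_div R (nf_poly q V \Po iterpoly l n) M (e / 2) (q + q) e2 (fun z hz => ltac:(
  rewrite horner_comp iterpolyE; apply: hM; apply: he; rewrite subr0; move: hz e0; lra)).
rewrite h1; move: (nf_poly q V) hn => U hn; rewrite coefD coefXnM ltnn subnn h2.
have := nm_leB (n%:R * Q`_0) (- U`_(q + q)); rewrite opprK nmN nmM nm_nat [_ + U`_(q + q)]addrC.
by move: hn; rewrite ltr_pdivrMr//; lra.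
Qed.

Lemma wide_lower (x y : R[i]) (n : R) : 0 <= n -> - (nm x / 4) <= re x ->
  nm (y - (x + n%:C)) <= n / 8 -> nm x / 3 <= nm y.
Proof.
move=> n0 hx hy; have x0 := nm_ge0 x.
have sq : (3 / 5 * (nm x + n)) ^+ 2 <= nm (x + n%:C) ^+ 2.
  have E : nm (x + n%:C) ^+ 2 = nm x ^+ 2 + 2 * n * re x + n ^+ 2.
    by rewrite !nm_sqr reD imD /=; ring.
  rewrite E; have : n * - (nm x / 4) <= n * re x by rewrite ler_wpM2l.
  have : 0 <= (nm x - n) ^+ 2 by rewrite sqr_ge0.
  by rewrite !expr2; have := mulr_ge0 x0 n0; have := mulr_ge0 x0 x0; have := mulr_ge0 n0 n0; lra.
have : 3 / 5 * (nm x + n) <= nm (x + n%:C).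
  rewrite -(@ler_pXn2r _ 2) ?nnegrE ?nm_ge0//.
  by move: x0 n0; lra.
have := nm_leB (x + n%:C) y; rewrite nmC; move: hy x0 n0; lra.
Qed.

(** A consists of the points whose orbit enters the petal Re W >= R0. Nonzero orbits staying near 0
    enter it, since W moves by about 1 at each step; wide starts stay near 0 by [wide_lower]; the
    critical point enters it by [sector_critical] with nu = 1. *)
Lemma parabolic_basin q l V Q : (0 < q)%N -> q.-primitive_root l -> nf_rel q q l 0 0 V Q ->
  Q`_0 != 0 -> let W z := - 1 / (Q`_0 * (nf_poly q V).[z]) in exists r T A,
  [/\ basin_data l r A,
   forall z, z != 0 -> nm z <= r -> T <= nm (W z) -> - (nm (W z) / 4) <= re (W z) -> A z,
   forall z, A z -> forall B e, 0 < e -> exists n, [/\ iter n (quad l) z != 0, nm (iter n (quad l) z) <= e &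
     B <= re (W (iter n (quad l) z))] &
   forall z, z != 0 -> nm z <= r -> (nf_poly q V).[z] != 0].
Proof.
move=> q0 pl rel Q0 W; have lq := prim_expr_order pl; have l1 := prim_nm1 q0 lq.
have l2 : nm l <= 2 by rewrite l1; lra.
have rel1 : nf_rel q (1 * q) l 0 0 V Q by rewrite mul1n.
pose U := nf_poly q V; pose th : R := 1 / 16.
have th0 : 0 < th by rewrite divr_gt0.
have t8 : 0 < th / 8 by rewrite divr_gt0.
have [r [C [r0 r1 C0 Crt H]]] := petal_chart_small q0 (ltn0Sn 0) lq rel1 Q0 t8.
rewrite -/U in H; have Cr : C * r <= 1/8 by move: Crt; rewrite /th; lra.
have U00 : U.[0] = 0 := nf_poly0 V q0.
have [Ra Ra1 start] := petal_start q0 (ltn0Sn 0) l1 Q0 r0 r1 C0 Cr U00 H.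
have [Rb Rb1 orb] := petal_orbit q0 (ltn0Sn 0) l1 Q0 r0 r1 C0 Cr U00 H.
have small := petal_small q0 (ltn0Sn 0) Q0 C0 Cr H.
pose R0 := Num.max Ra Rb.
have R01 : 1 <= R0 by rewrite le_max Ra1.
have Ra0 : Ra <= R0 by rewrite le_max lexx.
have Rb0 : Rb <= R0 by rewrite le_max lexx orbT.
have WE z : petal_coord 1 Q`_0 U z = W z by rewrite /petal_coord mul1r expr1.
pose P R1 z := in_petal Q`_0 1 U r R1 z.
pose A z := exists n, P R0 (iter n (quad l) z).
have Pmon R1 R2 z : R2 <= R1 -> P R1 z -> P R2 z.
  by move=> R12 [h1 h2 h3]; split => //; exact: le_trans R12 h3.
have orb' R1 z n : R0 <= R1 -> P R1 z -> P (R1 + n%:R / 2) (iter n (quad l) z).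
  by move=> hR; apply: orb; exact: le_trans hR.
have step z : z != 0 -> nm z <= r -> nm (W (quad l z) - (W z + 1)) <= 1/8.
  move=> z0 zr; have [_ _ _ _] := H z z0 zr; rewrite !WE opprD addrA => h.
  by apply: (le_trans h); apply: le_trans Cr; rewrite ler_wpM2l.
have step0 z : z != 0 -> nm z <= r -> quad l z != 0.
  by move=> z0 zr; have [_ h _ _ _] := H z z0 zr; apply: contraNneq h => ->; rewrite U00.
have walk z n : (forall k, (k < n)%N -> iter k (quad l) z != 0 /\ nm (iter k (quad l) z) <= r) ->
    nm (W (iter n (quad l) z) - (W z + (n%:R : R)%:C)) <= n%:R / 8.
  elim: n => [|n IH] h; first by rewrite addr0 subrr nm0 mul0r.
  have [h1 h2] := h n (ltnSn n); have h3 := step _ h1 h2.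
  have h4 := IH (fun k kn => h k (ltnW kn)).
  have -> : W (iter n.+1 (quad l) z) - (W z + (n.+1%:R : R)%:C) =
    (W (quad l (iter n (quad l) z)) - (W (iter n (quad l) z) + 1)) + (W (iter n (quad l) z) - (W z + (n%:R : R)%:C)).
    by rewrite /= -[n.+1%:R]natr1 rmorphD rmorph1; ring.
  apply: (le_trans (nmD _ _)); rewrite -[n.+1%:R]natr1; move: h3 h4; lra.
have stay z : (forall n, nm (iter n (quad l) z) <= r /\ iter n (quad l) z != 0) -> A z.
  move=> h; have [n hn] := nat_gt (8 / 7 * (R0 - re (W z))).
  exists n; have [h1 h2] := h n; split => //; rewrite WE.
  have := walk z n (fun k _ => conj (h k).2 (h k).1).
  have := re_ge (W (iter n (quad l) z) - (W z + (n%:R : R)%:C)).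
  by rewrite reB reD /=; move: hn; clear; lra.
have ent z : A z -> forall B e, 0 < e -> exists N, forall n, (N <= n)%N ->
    P (Num.max B R0) (iter n (quad l) z) /\ nm (iter n (quad l) z) <= e.
  move=> [n0 hn0] B e e0; have [M hM] := small e e0.
  have [k hk] := nat_gt (2 * (`|B| + `|R0| + `|M|)).
  exists (k + n0)%N => n kn; rewrite -(subnK (leq_trans (leq_addl k n0) kn)) iterD.
  have kn' : (k <= n - n0)%N by rewrite leq_subRL ?(leq_trans (leq_addl k n0) kn)// addnC.
  have h := orb' _ _ (n - n0)%N (lexx _) hn0.
  have kR : k%:R <= (n - n0)%:R :> R by rewrite ler_nat.
  have b1 := ler_norm B; have b2 := ler_norm R0; have b3 := ler_norm M.
  have b4 := normr_ge0 B; have b5 := normr_ge0 M; have b6 := normr_ge0 R0.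
  split.
    apply: (Pmon (R0 + (n - n0)%:R / 2)) => //; rewrite ge_max; apply/andP; split;
    move: hk kR b1 b2 b3 b4 b5 b6 R01; clear; lra.
  apply: (hM (R0 + (n - n0)%:R / 2)) => //.
  by move: hk kR b1 b2 b3 b4 b5 b6 R01; clear; lra.
have [AA AA0 hA] := petal_size (ltn0Sn 0) Q0 C0 Cr H.
have r4 : 0 < r / 4 by rewrite divr_gt0.
(* From a wide start |W| never falls below a third of its initial value, so this T keeps the orbit
   in |z| <= r / 4, with room for one more step. *)
pose T := 3 * (AA / (r / 4) ^+ (1 * q) + 1).
exists r, T, A; split.
- split => //.
  + by move=> z Az e e0; have [N hN] := ent z Az 0 e e0; exists N => n /hN[].
  + move=> z Az; have r2 : 0 < r / 2 by rewrite divr_gt0.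
    have [N hN] := ent z Az (R0 + 1) _ r2; have [hP hs] := hN N (leqnn _).
    have [x0 xr xW] := hP.
    have xr' : nm (iter N (quad l) z) < r by move: hs r0; clear; lra.
    have xW' : R0 < re (petal_coord 1 Q`_0 U (iter N (quad l) z)).
      by move: xW; rewrite ge_max => /andP[h _]; move: h; clear; lra.
    have [d d0 hd] := petal_open (ltn0Sn 0) Q0 H x0 xr' xW'.
    have [d' d'0 hd'] := iter_cont l N z d0.
    by exists d' => // y /hd'/ltW/hd[h _]; exists N.
  + move=> z; split=> [[n h]|[n h]]; first by exists n.+1; rewrite iterSr.
    exists n; rewrite -iterSr; apply: (Pmon (R0 + 1%:R / 2)); first by rewrite lerDl divr_ge0.
    exact: (orb' _ _ 1%N (lexx _) h).
  + split; [exact: stay| |exact: zero_not_interior rel Q0].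
    have [bet betE] := nth_root (- 1 / (1%:R * Q`_0)) (ltn0Sn 0).
    have thn : th * (16 * 1%:R ^+ 2) <= 1 by rewrite /th expr1n; lra.
    have start' R1 z : R0 <= R1 -> in_petal Q`_0 1 U r R1 z -> in_petal Q`_0 1 U r (R1 + 1 / 2) (quad l z) /\
       re (petal_coord 1 Q`_0 U z) + 1 / 2 <= re (petal_coord 1 Q`_0 U (quad l z)).
      by move=> hR; apply: start; exact: le_trans hR.
    have [j _ [hj _ _]] : exists2 j, (0 < j)%N & sector Q`_0 1 U r bet th R0 1 (iter j (quad l) (crit l)).
      by apply: (sector_critical (q := q) (nu := 1)); try eassumption; rewrite ?expr1n.
    by exists j.
- move=> z z0 zr zT zW; apply: stay.
  suff h n : forall k, (k < n)%N -> iter k (quad l) z != 0 /\ nm (iter k (quad l) z) <= r.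
    by move=> n; have [] := h n.+1 n (ltnSn n).
  elim: n => // -[|n] IH k; first by case: k.
  rewrite ltnS leq_eqVlt => /predU1P[->|]; last exact: IH.
  have hw := walk z n (fun k kn => IH k (ltnW kn)).
  have [y0 yr] := IH n (ltnSn n).
  have n0 : 0 <= n%:R :> R by [].
  have big := wide_lower n0 zW hw.
  split; first exact: step0.
  have y4 : nm (iter n (quad l) z) <= r / 4.
    rewrite -(@ler_pXn2r _ (1 * q)) ?nnegrE ?nm_ge0 ?mul1n ?(ltW r4)//.
    have /andP[_] := hA _ y0 yr; rewrite WE mul1n => h3.
    have : AA / (r / 4) ^+ q <= AA / nm (iter n (quad l) z) ^+ q.
      by move: zT big h3; rewrite /T mul1n; clear; lra.
    by rewrite ler_pM2l// lef_pV2 ?posrE ?exprn_gt0 ?nm_gt0.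
  apply: (le_trans (nm_quad_le _ l2)).
  have : nm (iter n (quad l) z) * nm (iter n (quad l) z) <= nm (iter n (quad l) z) * 1.
    by rewrite ler_wpM2l ?nm_ge0// (le_trans yr).
  by rewrite -expr2; move: y4 (nm_ge0 (iter n (quad l) z)); clear; lra.
- move=> z Az B e e0; have [N hN] := ent z Az B e e0; exists N.
  have [[h1 h2 h3] h4] := hN N (leqnn _); split => //.
  by move: h3; rewrite WE ge_max => /andP[].
- by move=> z z0 zr; have [] := H z z0 zr.
Qed.

End parabolic_basin.

(** * Stability and implosion *)

Section stability.
Variable R : realType.
Implicit Types (l z : R[i]).

Lemma ccont_fst l0 z0 c : ccont (fun l => nm (l - l0)) l0 c ->
  ccont (fun p : R[i] * R[i] => Num.max (nm (p.1 - l0)) (nm (p.2 - z0))) (l0, z0) (fun p => c p.1).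
Proof.
move=> h e /h[d d0 hd]; exists d => // p; rewrite gt_max => /andP[h1 _]; exact: hd.
Qed.

Lemma gate_coord_cont q b V l0 z0 : ccont (fun l => nm (l - l0)) l0 b ->
  cfam (fun l => nm (l - l0)) l0 V -> b l0 != 0 -> (nf_poly q (V l0)).[z0] != 0 ->
  forall e : R, 0 < e -> exists2 d, 0 < d & forall l z, nm (l - l0) < d -> nm (z - z0) < d ->
    nm (gate_coord q b V l z - gate_coord q b V l0 z0) < e.
Proof.
move=> cb cV b0 U0 e e0.
pose D (p : R[i] * R[i]) := Num.max (nm (p.1 - l0)) (nm (p.2 - z0)).
have cU : cfam D (l0, z0) (fun p => nf_poly q (V p.1)).
  apply: cfamM (cfam_cst _ _ _) _; apply: cfamD (cfam_cst _ _ _) _.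
  apply: cfamM (cfam_cst _ _ _) _; split; first by case: cV => -[n hn] _; exists n => p; exact: hn.
  by move=> k; exact: ccont_fst (cV.2 k).
have c2 : ccont D (l0, z0) (fun p => p.2).
  by move=> a a0; exists a => // p; rewrite /D gt_max => /andP[_].
have c1 : ccont D (l0, z0) (fun p => - p.1 ^+ q).
  apply: (@ccont_ext _ _ _ _ (fun p => -1 * p.1 ^+ q)) => [p|]; first by rewrite mulN1r.
  apply: ccontM (ccont_cst _ _ _) _.
  exact: (ccont_fst z0 (c := fun l => l ^+ q) (ccontX q (@ccont_id R l0))).
have cw : ccont D (l0, z0) (fun p => gate_coord q b V p.1 p.2).
  apply: ccontM c1 _; apply: ccontV; last by rewrite mulf_neq0.
  apply: ccontM; last exact: ccont_horner cU c2.
  exact: ccont_fst cb.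
have [d d0 hd] := cw e e0; exists d => // l z h1 h2.
by have := hd (l, z); apply; rewrite /D gt_max h1.
Qed.

Lemma gate_rel_le (G G' : R) d g w w' : G <= G' -> gate_rel G d g w w' -> gate_rel G' d g w w'.
Proof.
rewrite /gate_rel => GG h; apply: (le_trans h).
by rewrite ler_wpM2r ?invr_ge0 ?exprn_ge0 ?nm_ge0.
Qed.

Definition chart_at q (b : R[i] -> R[i]) V (C r A : R) l :=
  [/\ l ^+ q != 0, b l != 0, 1/2 <= nm l & nm l <= 2] /\ 1/2 <= nm (l ^+ q) /\ nm (l ^+ q) <= 2 /\
  exists2 g, nm g <= C & forall z, z != 0 -> nm z <= r ->
      [/\ gate_rel C (1 - l ^+ q) g (gate_coord q b V l z) (gate_coord q b V l (quad l z)),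
       A^-1 / nm z ^+ q <= nm (gate_coord q b V l z),
       nm (gate_coord q b V l z) <= A / nm z ^+ q & nm (quad l z) <= 4 * nm z].

(** At l0 the gate coordinate is the petal coordinate, since l0^q = 1 and b is common; this links
    the basin at l0 to the gate for nearby l. *)
Lemma gate_setup q l0 : (0 < q)%N -> q.-primitive_root l0 ->
  exists (b : R[i] -> R[i]) (V : R[i] -> {poly R[i]}) (C r A T rB : R) (Bas : R[i] -> Prop),
  [/\ [/\ ccont (fun l => nm (l - l0)) l0 b, cfam (fun l => nm (l - l0)) l0 V & b l0 != 0],
    [/\ 0 < r, r <= 1/16, 1 <= C, 0 < A & A * r <= 1],
    near_param (fun l => nm (l - l0)) (chart_at q b V C r A),
    basin_data l0 rB Bas &
    [/\ forall z, z != 0 -> nm z <= r -> T <= nm (gate_coord q b V l0 z) ->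
       - (nm (gate_coord q b V l0 z) / 4) <= re (gate_coord q b V l0 z) -> Bas z,
    forall z, Bas z -> forall B e, 0 < e -> exists n, [/\ iter n (quad l0) z != 0,
      nm (iter n (quad l0) z) <= e & B <= re (gate_coord q b V l0 (iter n (quad l0) z))] &
    forall z, z != 0 -> nm z <= r -> (nf_poly q (V l0)).[z] != 0]].
Proof.
move=> q0 pl; have lq := prim_expr_order pl; have l1 := prim_nm1 q0 lq.
have [b [V [Q0 [be0 [cb cV rel H]]]]] := gate_chart q0 pl.
have [b0 [Q' [rel' Q'0]]] := nf_first_order q0 pl rel.
have [C [r [A [r0 r1 A0 near]]]] := H b0.
have Q'n : Q'`_0 != 0 by rewrite Q'0.
have [rB [T [Bas [hB hwide henter hU]]]] := parabolic_basin q0 pl rel' Q'n.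
have wE z : - 1 / (Q'`_0 * (nf_poly q (V l0)).[z]) = gate_coord q b V l0 z.
  by rewrite /gate_coord lq Q'0.
have rB0 : 0 < rB by case: hB => -[].
pose rr := Num.min (Num.min r rB) (Num.min (1/16) A^-1).
have rr0 : 0 < rr by rewrite !lt_min r0 rB0 invr_gt0 A0 divr_gt0.
have rrr : rr <= r by rewrite !ge_min lexx.
have rrB : rr <= rB by rewrite !ge_min lexx !orbT.
have cq : ccont (fun l => nm (l - l0)) l0 (fun l => l ^+ q) := ccontX q (@ccont_id R l0).
have h12 : 0 < 1/2 :> R by rewrite divr_gt0.
exists b, V, (Num.max 1 C), rr, A, T, rB, Bas; split => //.
- split => //; first by rewrite !ge_min lexx !orbT.
    by rewrite le_max lexx.
  by rewrite mulrC -ler_pdivlMr// mul1r !ge_min lexx !orbT.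
- refine (param_sub (param_and near (param_and (cq _ h12) (@ccont_id R l0 _ h12))) _) => l.
  move=> [[lq0 [bl0 [g gC hg]]] [h1 h2]]; rewrite /= lq in h1 h2.
  split; first split => //.
  + by have := nm_leB l0 l; rewrite nmC l1; move: h2; lra.
  + by have := nm_leB l l0; rewrite l1; move: h2; lra.
  split; first by have := nm_leB 1 (l ^+ q); rewrite nmC nm1; move: h1; lra.
  split; first by have := nm_leB (l ^+ q) 1; rewrite nm1; move: h1; lra.
  exists g; first by rewrite le_max gC orbT.
  move=> z z0 zr; have [k1 k2 k3 k4] := hg z z0 (le_trans zr rrr); split => //.
  by apply: gate_rel_le k1; rewrite le_max lexx orbT.
split.
- by move=> z z0 zr; rewrite -wE; apply: hwide => //; exact: le_trans rrB.
- by move=> z Bz B e e0; have [n hn] := henter z Bz B e e0; exists n; rewrite -wE.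
- by move=> z z0 zr; apply: hU => //; exact: le_trans rrB.
Qed.

Lemma gate_coord0 q b V l : (0 < q)%N -> gate_coord q b V l 0 = 0.
Proof. by move=> q0; rewrite /gate_coord nf_poly0// mulr0 invr0 mulr0. Qed.

Lemma gate_coord_small (q : nat) (A r G : R) z (w : R) : (0 < q)%N -> 0 < r -> 0 < A -> z != 0 ->
  A / r ^+ q <= G -> G <= w -> w <= A / nm z ^+ q -> nm z <= r.
Proof.
move=> q0 r0 A0 z0 h1 h2 h3.
rewrite -(@ler_pXn2r _ q) ?nnegrE ?nm_ge0 ?(ltW r0)//.
have : A / r ^+ q <= A / nm z ^+ q := le_trans h1 (le_trans h2 h3).
by rewrite ler_pM2l// lef_pV2 ?posrE ?exprn_gt0 ?nm_gt0.
Qed.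

(** Such a z lies in the basin, so an iterate enters the chart with w far to the right, and this
    persists for l near l0 and y near z. [gate_stay] then keeps w outside the disc of radius 40 G,
    that is the orbit near 0, so y is filled. *)
Lemma stability q l0 z : (0 < q)%N -> q.-primitive_root l0 -> filled_int l0 z ->
  exists eta T, 0 < eta /\ near_param (fun l => nm (l - l0)) (fun l => 1 - l ^+ q != 0 ->
    T <= `|re (1 - l ^+ q)^-1| -> forall y, nm (y - z) < eta -> filled l y).
Proof.
move=> q0 pl iz; have lq := prim_expr_order pl.
have [b [V [C [r [A [T [rB [Bas [[cb cV b0] [r0 r1 C1 A0 Ar] near hB [_ henter hU]]]]]]]]]] := gate_setup q0 pl.
have Bz := interior_basin hB iz.
have r4 : 0 < r / 4 by rewrite divr_gt0.
pose G := Num.max C (A / (r / 4) ^+ q).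
have CG : C <= G by rewrite le_max lexx.
have AG : A / (r / 4) ^+ q <= G by rewrite le_max lexx orbT.
have G1 : 1 <= G := le_trans C1 CG.
clearbody G.
have [n [x0 xr xW]] := henter z Bz (100 * G) (r / 8) (ltac:(by rewrite divr_gt0)).
set x := iter n (quad l0) z in x0 xr xW.
set w0 := gate_coord q b V l0 x in xW.
have [T' [s [s0 hstay]]] := gate_stay (nm w0 + 1) G1.
have Ux : (nf_poly q (V l0)).[x] != 0 by apply: hU => //; move: xr r0; clear; lra.
have [d d0 hd] := gate_coord_cont cb cV b0 Ux ltr01.
have m0 : 0 < Num.min d (r / 8) by rewrite lt_min d0 divr_gt0.
have [d' d'0 hd'] := iter_quad_cont n l0 z m0.
have cq : ccont (fun l => nm (l - l0)) l0 (fun l => l ^+ q) := ccontX q (@ccont_id R l0).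
have nd : near_param (fun l => nm (l - l0)) (fun l => nm (l - l0) < Num.min d d').
  by exists (Num.min d d') => //; rewrite lt_min d0.
exists d', T'; split => //.
refine (param_sub (param_and (param_and near nd) (cq s s0)) _) => l.
rewrite /= lq lt_min => -[[[[lq0 bl l12 l2] [mu1 [mu2 [g gC hg]]]] /andP[ld ld']] ls] dn hT y hy.
have := hd' l y ld' hy; rewrite -/x lt_min; set v := iter n (quad l) y => /andP[vx vr].
pose w j := gate_coord q b V l (iter j (quad l) v).
have w0E : nm (w 0%N - w0) < 1 by exact: hd.
have ws : wide_start G (nm w0 + 1) (w 0%N).
  have h1 := re_le w0; have h2 := nm_leB w0 (w 0%N); have h3 := nm_leB (w 0%N) w0.
  have h4 := re_ge (w 0%N - w0); rewrite reB in h4; rewrite nmC in h2.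
  by split; move: h1 h2 h3 h4 w0E xW G1; have := nm_ge0 (w 0%N); clear; lra.
have vr4 : nm v <= r / 4 by have := nm_leB v x; move: vr xr; clear; lra.
(* While w is large the point lies in the disc of radius r / 4, and its image, at most four times
   larger, is still in the chart. *)
have inr j : (forall i, (i < j)%N -> 40 * G <= nm (w i)) -> nm (iter j (quad l) v) <= r.
  elim: j => [|j IH] h; first by move: vr4 r0; clear; lra.
  have hj := IH (fun i ij => h i (ltnW ij)); have wj := h j (ltnSn j).
  have zj : iter j (quad l) v != 0.
    apply/eqP => E; move: wj; rewrite /w E gate_coord0// nm0; move: G1; clear; lra.
  have [_ _ k3 k4] := hg _ zj hj; apply: (le_trans k4).
  have := @gate_coord_small q A (r / 4) G _ _ q0 r4 A0 zj AG _ k3.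
  move=> h5; have := h5 (ltac:(rewrite -/(w j); move: wj G1; clear; lra)); clear; lra.
have orb : gate_orbit G (1 - l ^+ q) g w.
  move=> j h; have hj := inr j (fun i ij => h i (ltnW ij)).
  have zj : iter j (quad l) v != 0.
    apply/eqP => E; move: (h j (leqnn _)); rewrite /w E gate_coord0// nm0; move: G1; clear; lra.
  have [k1 _ _ _] := hg _ zj hj; exact: gate_rel_le CG k1.
have gG : nm g <= G := le_trans gC CG.
have ds : nm (1 - l ^+ q) < s by rewrite nmC.
have all := hstay _ _ _ gG dn ds hT ws orb.
apply: filled_tail => // N; exists (N + n)%N; first exact: leq_addr.
rewrite iterD -/v; have := inr N (fun i _ => all i); move: r1; clear; lra.
Qed.

End stability.

(** * Implosion when |Re (1 / d)| is bounded *)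

Section implosion.
Variable R : realType.
Implicit Types (l z : R[i]).

(** Solving the relation backwards gives u = mu v - 1 + ..., so the coordinate - mu w follows a gate
    relation along backward orbits, with multiplier mu in place of 1 / mu. *)
Lemma gate_inverse (C G : R) (g mu u v : R[i]) : 1 <= C -> nm g <= C -> 1/2 <= nm mu -> nm mu <= 2 ->
  1 <= nm u -> 16 * C + 8 * (C * (1 + 4 * C)) <= G -> 2 * (1 + 4 * C) <= nm (- mu * v) ->
  gate_rel C (1 - mu) g u v -> gate_rel G (1 - mu^-1) (- mu ^+ 2 * g) (- mu * v) (- mu * u).
Proof.
move=> C1 gC m1 m2 u1 CG hP; rewrite /gate_rel /gate_mult !subKr invrK.
have m0 : mu != 0 by rewrite -nm_gt0; move: m1; clear; lra.
have u0 : u != 0 by rewrite -nm_gt0; move: u1; clear; lra.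
set E := v - _ => hE.
have vE : mu * v = u + 1 + mu * g / u + mu * E by rewrite /E; field; rewrite u0 m0.
have P0 : - mu * v != 0 by rewrite -nm_gt0; move: hP C1; clear; lra.
have v0 : v != 0 by move: P0; rewrite mulf_eq0 negb_or => /andP[].
have iu : (nm u)^-1 <= 1 by rewrite invf_le1//; move: u1; clear; lra.
have iu0 : 0 <= (nm u)^-1 by rewrite invr_ge0 nm_ge0.
have hE1 : nm E <= C * (nm u)^-1 ^+ 2 by rewrite exprVn.
have hd : nm (mu * v - u) <= 1 + 4 * C.
  have -> : mu * v - u = 1 + (mu * g / u + mu * E) by rewrite vE; ring.
  have h1 := nmD 1 (mu * g / u + mu * E); have h2 := nmD (mu * g / u) (mu * E).
  have h3 : nm (mu * g / u) <= 2 * C.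
    rewrite 2!nmM nmV -[2 * C]mulr1; apply: ler_pM => //; first by rewrite mulr_ge0 ?nm_ge0.
    by apply: ler_pM => //; exact: nm_ge0.
  have h4 : nm (mu * E) <= 2 * C.
    rewrite nmM; apply: ler_pM => //; try exact: nm_ge0.
    apply: (le_trans hE1); rewrite -[leRHS]mulr1; apply: ler_wpM2l; first by move: C1; clear; lra.
    by rewrite expr_le1.
  rewrite nm1 in h1; move: h1 h2 h3 h4; clear; lra.
have hu : nm (- mu * v) / 2 <= nm u.
  have := nm_leB (mu * v) u; move: hP hd; rewrite mulNr nmN; clear; lra.
set P := - mu * v in P0 hP hu *.
have nP : 0 < nm P by rewrite nm_gt0.
have iuP : (nm u)^-1 <= 2 * (nm P)^-1.
  rewrite -[2 * _]invrK lef_pV2 ?posrE; first by rewrite invfM invrK mulrC.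
    by rewrite nm_gt0.
  by rewrite invr_gt0 mulr_gt0 ?invr_gt0.
have -> : - mu * u - (mu * P + mu + - mu ^+ 2 * g / P) =
    mu ^+ 2 * E + mu ^+ 2 * g * (u^-1 * (mu * v - u) * (- P^-1)) .
  have -> : mu ^+ 2 * E = mu * (mu * v - u - 1) - mu ^+ 2 * g / u by rewrite vE; field.
  by rewrite /P; field; rewrite v0 m0 u0.
have mm : nm (mu ^+ 2) <= 4 by rewrite nmX; move: m2 (nm_ge0 mu); clear; nra.
apply: (le_trans (nmD _ _)); rewrite -exprVn.
set p := (nm P)^-1 in iuP *; have p0 : 0 <= p by rewrite invr_ge0 nm_ge0.
have h1 : nm (mu ^+ 2 * E) <= 4 * (C * (4 * p ^+ 2)).
  rewrite nmM; apply: ler_pM => //; try exact: nm_ge0.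
  apply: (le_trans hE1); apply: ler_wpM2l; first by move: C1; clear; lra.
  by move: iuP iu0 p0; clear; nra.
have h2 : nm (mu ^+ 2 * g * (u^-1 * (mu * v - u) * (- P^-1))) <= 4 * C * (2 * p * (1 + 4 * C) * p).
  have gen (a y1 y2 y3 : R[i]) : nm (a * g * (y1 * y2 * (- y3))) = nm a * nm g * (nm y1 * nm y2 * nm y3).
    by rewrite [LHS]nmM [nm (a * g)]nmM [nm (y1 * y2 * - y3)]nmM nmN [nm (y1 * y2)]nmM.
  rewrite gen !nmV -/p.
  apply: ler_pM; rewrite ?mulr_ge0 ?nm_ge0 ?invr_ge0//; try exact: nm_ge0.
    by apply: ler_pM => //; exact: nm_ge0.
  by apply: ler_wpM2r => //; apply: ler_pM => //; exact: nm_ge0.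
have : 0 <= (G - (16 * C + 8 * (C * (1 + 4 * C)))) * p ^+ 2 by rewrite mulr_ge0 ?sqr_ge0// subr_ge0.
by move: h1 h2; clear; lra.
Qed.

Lemma small_preim l (u : R[i]) : 1/2 <= nm l ->
  exists2 y, quad l y = u & (nm u <= 1/16 -> nm y <= 4 * nm u).
Proof.
move=> hl; have [y yE hy] := quad_open l 0 u; exists y => // hu.
rewrite quad0 !subr0 in hy.
have y4 : nm y <= 1/4.
  rewrite -(@ler_pXn2r _ 2) ?nnegrE ?nm_ge0//.
  by apply: (le_trans hy); apply: (le_trans hu); rewrite expr2; lra.
have : nm u = nm y * nm (l + y) by rewrite -yE -nmM; congr nm; rewrite /quad; ring.
have := nm_leD l y; move: (nm_ge0 y) hl y4; clear; nra.
Qed.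

Lemma basin_filled l r A z : basin_data l r A -> A z -> filled l z.
Proof.
move=> [[_ hl] h _ _ _] /h/(_ 4 ltac:(by rewrite ltr0n))[N hN]; apply: filled_tail => // n.
by exists (N + n)%N; [exact: leq_addl|apply: hN; exact: leq_addr].
Qed.

Lemma basin_not_bd l r A z : basin_data l r A -> filled_bd l z -> ~ A z.
Proof.
move=> H bz Az; apply: (filled_bd_int bz); have [_ _ /(_ z Az)[d d0 hd] _ _] := H.
by exists d => // y /hd; exact: basin_filled H.
Qed.

(** A segment from a basin point to an escaping point, both near 0, meets the boundary, but possibly
    at 0 itself. Multiplying the escaping point by 1 + i c with c small gives a second segment, and
    the two cannot both pass through 0. *)
Lemma bd_near0 l r A (p : R[i]) (e : R) : basin_data l r A -> A p -> p != 0 -> nm p < e ->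
  exists x, [/\ filled_bd l x, x != 0 & nm x < e].
Proof.
move=> H Ap p0 pe; have Kp := basin_filled H Ap.
have e0 : 0 < e := le_lt_trans (nm_ge0 p) pe.
have [_ _ _ _ [_ _ n0]] := H.
have [y ye nKy] : exists2 y, nm y < e & ~ filled l y.
  apply: contrapT => h; apply: n0; exists e => // y; rewrite subr0 => ye.
  by apply: contrapT => nK; apply: h; exists y.
have y0 : y != 0 by apply/eqP => E; apply: nKy; rewrite E; exact: filled0.
have [d d0 hd] := escape_open nKy.
pose c : R := Num.min d (e - nm y) / (2 * (1 + nm y)).
have ny : 0 < 1 + nm y by rewrite ltr_wpDr ?nm_ge0.
have c0 : 0 < c by rewrite divr_gt0 ?mulr_gt0// lt_min d0 subr_gt0.
have cy : nm ((0 +i* c) * y) < Num.min d (e - nm y).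
  have -> : nm ((0 +i* c) * y) = c * nm y.
    by rewrite nmM; congr (_ * _); rewrite /nm expr0n add0r sqrtr_sqr gtr0_norm.
  rewrite /c mulrAC ltr_pdivrMr ?mulr_gt0//.
  have : 0 < Num.min d (e - nm y) by rewrite lt_min d0 subr_gt0.
  by move: ny; move: (Num.min _ _) (nm_ge0 y) => m; clear; nra.
move: cy; rewrite lt_min => /andP[cd ce].
pose y' := y + (0 +i* c) * y.
have nKy' : ~ filled l y' by apply: (hd l); rewrite ?subrr ?nm0// /y' addrC addKr.
have y'e : nm y' < e by rewrite (le_lt_trans (nmD _ _))//; move: ce; clear; lra.
have conv (t : R) (v : R[i]) : 0 <= t -> t <= 1 -> nm v < e -> nm (p + t%:C * (v - p)) < e.
  move=> t0 t1 ve; have -> : p + t%:C * (v - p) = (1 - t)%:C * p + t%:C * v.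
    by rewrite rmorphB rmorph1; ring.
  rewrite (le_lt_trans (nmD _ _))// 2!nmM !nm_real !ger0_norm ?subr_ge0//.
  have : 0 <= (1 - t) * (e - nm p) by rewrite mulr_ge0 ?subr_ge0// ltW.
  have := mulr_ge0 t0 (ltW (eq_ind_r (fun b => is_true b) ve (subr_gt0 (nm v) e))).
  have [t12|t12] := leP t (1/2).
    have : 0 < (1 - t) * (e - nm p) by rewrite mulr_gt0 ?subr_gt0//; move: t12; clear; lra.
    by clear; lra.
  have : 0 < t * (e - nm v) by rewrite mulr_gt0 ?subr_gt0//; move: t12; clear; lra.
  by clear; lra.
have [t [t0 t1 bt]] := bd_between Kp nKy.
have [s [s0 s1 bs]] := bd_between Kp nKy'.
have [E|n1] := eqVneq (p + t%:C * (y - p)) 0; last by exists (p + t%:C * (y - p)); split => //; exact: conv.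
have [E'|n2] := eqVneq (p + s%:C * (y' - p)) 0; last by exists (p + s%:C * (y' - p)); split => //; exact: conv.
exfalso; have h1 : t%:C * y = (t - 1)%:C * p.
  by move: E; rewrite rmorphB rmorph1 => /eqP; rewrite addr_eq0 => /eqP E; rewrite mulrBl mul1r {2}E; ring.
have h2 : s%:C * y' = (s - 1)%:C * p.
  by move: E'; rewrite rmorphB rmorph1 => /eqP; rewrite addr_eq0 => /eqP E'; rewrite mulrBl mul1r {2}E'; ring.
have h3 : (s * (t - 1))%:C * (1 + (0 +i* c)) = (t * (s - 1))%:C.
  apply: (mulIf p0); rewrite 2!rmorphM.
  transitivity (s%:C * (1 + (0 +i* c)) * ((t - 1)%:C * p)); first by ring.
  rewrite -h1; transitivity (t%:C * (s%:C * y')); first by rewrite /y'; ring.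
  by rewrite h2; ring.
have : im ((s * (t - 1))%:C * (1 + (0 +i* c))) = 0 by rewrite h3.
rewrite imM imD reD /= add0r mul0r addr0 => /eqP.
rewrite mulf_eq0 [c == 0]gt_eqF// orbF mulf_eq0 => /orP[/eqP sz|].
  by move/eqP: h2; rewrite sz mul0r eq_sym mulf_eq0 (negbTE p0) orbF sub0r rmorphN oppr_eq0 oner_eq0.
rewrite subr_eq0 => /eqP tz; move/eqP: h1; rewrite tz subrr mul0r mul1r (negbTE y0).
by [].
Qed.

(** A Julia point x for l0 near 0 is not in the basin, so w(x) points to the left and P = - mu w has
    a wide start. Its small preimages remain boundary points for l, and [gate_pass] applies to P. At
    the end Re P is at most |P| / 8, so w is on the attracting side, and |P| <= r2 keeps |z| away
    from 0 uniformly in l. *)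
Lemma implosion_point q l0 (b : R[i] -> R[i]) V (C r A T B rB : R) Bas : (0 < q)%N -> l0 ^+ q = 1 ->
  ccont (fun l => nm (l - l0)) l0 b -> cfam (fun l => nm (l - l0)) l0 V -> b l0 != 0 ->
  0 < r -> r <= 1/16 -> 1 <= C -> 0 < A -> A * r <= 1 ->
  near_param (fun l => nm (l - l0)) (chart_at q b V C r A) -> basin_data l0 rB Bas ->
  (forall z, z != 0 -> nm z <= r -> T <= nm (gate_coord q b V l0 z) ->
       - (nm (gate_coord q b V l0 z) / 4) <= re (gate_coord q b V l0 z) -> Bas z) ->
  (forall z, Bas z -> forall e, 0 < e -> exists n, iter n (quad l0) z != 0 /\
      nm (iter n (quad l0) z) <= e) ->
  (forall z, z != 0 -> nm z <= r -> (nf_poly q (V l0)).[z] != 0) -> nm l0 < 2 -> 0 <= B ->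
  exists2 c, 0 < c & near_param (fun l => nm (l - l0)) (fun l => 1 - l ^+ q != 0 ->
    `|re (1 - l ^+ q)^-1| <= B -> exists z, [/\ filled_bd l z, c <= nm z, nm z <= r,
      T + 1 <= nm (gate_coord q b V l z) &
      - (nm (gate_coord q b V l z) / 5) <= re (gate_coord q b V l z)]).
Proof.
move=> q0 lq cb cV b0 r0 r1 C1 A0 Ar near hB hwide henter hU hl0 B0.
have r4 : 0 < r / 4 by rewrite divr_gt0.
pose G := 16 * C + 8 * (C * (1 + 4 * C)) + A / (r / 4) ^+ q + `|T|.
have K0 : 0 <= A / (r / 4) ^+ q by rewrite divr_ge0 ?exprn_ge0// ltW.
have CC : 0 <= C * (1 + 4 * C) by rewrite mulr_ge0//; move: C1; clear; lra.
have CC1 : 1 + 4 * C <= C * (1 + 4 * C) by rewrite ler_peMl//; move: C1; clear; lra.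
have GC : 16 * C + 8 * (C * (1 + 4 * C)) <= G.
  by rewrite /G; move: K0 (normr_ge0 T); clear; lra.
have GA : A / (r / 4) ^+ q <= G by rewrite /G; move: C1 CC (normr_ge0 T); clear; lra.
have GT : T <= G by rewrite /G; move: C1 CC K0 (ler_norm T); clear; lra.
have G1 : 1 <= G by move: GC C1 CC; clear; lra.
clearbody G.
have near0 : chart_at q b V C r A l0 by case: near => d d0; apply; rewrite subrr nm0.
have [_ [_ [_ [g0 _ hg0]]]] := near0.
pose e := Num.min (r / 2) (A * (100 * G + 100))^-1.
have e0 : 0 < e by rewrite lt_min divr_gt0// invr_gt0 mulr_gt0//; move: G1; clear; lra.
have [p' Ap'] : exists p, Bas p by case: hB => _ _ _ _ [_ h _]; exists (crit l0).
have [n [p0 pe]] := henter p' Ap' (e / 2) (ltac:(by rewrite divr_gt0)).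
have Ap : Bas (iter n (quad l0) p').
  by clear -hB Ap'; case: hB => _ _ _ h _; elim: n => //= n IH; apply/h.
have pe' : nm (iter n (quad l0) p') < e by apply: (le_lt_trans pe); move: e0; move: (e) => t; clear; lra.
have [x [bx x0 xe]] := bd_near0 hB Ap p0 pe'.
move: xe; rewrite lt_min => /andP[/ltW xr2 xe].
have xr : nm x <= r by move: xr2 r0; clear; lra.
set W := gate_coord q b V l0 x.
have Wbig : 100 * G + 100 <= nm W.
  have [_ h _ _] := hg0 x x0 xr; apply: le_trans h.
  have nx : 0 < nm x by rewrite nm_gt0.
  rewrite -[leLHS]invrK -invfM lef_pV2 ?posrE ?invr_gt0 ?mulr_gt0 ?exprn_gt0//; last by move: G1; clear; lra.
  have h1 : nm x ^+ q <= nm x by rewrite -[leRHS]expr1 ler_wiXn2l//; [exact: ltW|move: xr r1; clear; lra].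
  rewrite -ler_pdivlMl// -invfM; apply: (le_trans h1); exact: ltW.
have nwide : re W < - (nm W / 4).
  rewrite ltNge; apply/negP => h; apply: (basin_not_bd hB bx); apply: hwide => //.
  by rewrite -/W; move: Wbig GT G1; clear; lra.
have Ux : (nf_poly q (V l0)).[x] != 0 by exact: hU.
have [d d0 hd] := gate_coord_cont cb cV b0 Ux ltr01.
have B1 : 0 <= 1 + B by move: B0; clear; lra.
have [r2 [s [rr2 s0 hpass]]] := gate_pass (2 * nm W + 1) (2 * `|T| + 5) G1 B1.
exists (2 * A * `|r2|)^-1.
  rewrite invr_gt0 !mulr_gt0// normr_gt0; apply/eqP => E.
  by move: rr2 (normr_ge0 T); rewrite E; clear; lra.
have cq : ccont (fun l => nm (l - l0)) l0 (fun l => l ^+ q) := ccontX q (@ccont_id R l0).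
have md : 0 < Num.min d (r / 2) by rewrite lt_min d0 divr_gt0.
have [d1 d10 hlow] := bd_lower_semicont hl0 bx md.
pose d2 := Num.min (Num.min d d1) (2 - nm l0).
have nd : near_param (fun l => nm (l - l0)) (fun l => nm (l - l0) < d2).
  by exists d2 => //; rewrite !lt_min d0 d10 subr_gt0.
pose s' := Num.min (s / 2) (Num.min (1/100) (1 / (2 * nm W + 2))).
have s'0 : 0 < s' by rewrite !lt_min !divr_gt0// ltr_wpDl ?mulr_ge0 ?nm_ge0.
refine (param_sub (param_and (param_and near nd) (cq s' s'0)) _) => l.
rewrite /= lq => -[[]].
set mu := l ^+ q; set w := gate_coord q b V l.
move=> [[mu0 _ l12 l2] [mu1 [mu2 [g gC hg]]]].
rewrite !lt_min => /andP[/andP[ld ld1] ld2] /and3P[ls ls1 ls2] dn hB'.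
have [x'] := hlow l ld1; rewrite lt_min => bx' /andP[x'd x'r].
have hW : nm (w x' - W) < 1 by exact: hd.
have x'r2 : nm x' <= r by move: (nm_leB x' x) x'r xr2; clear; lra.
(* Away from 0 this is an arbitrary preimage; its size is controlled only while u is small. *)
have /(@choice _ _ _)[pre hpre] : forall u, exists y, quad l y = u /\ (nm u <= 1/16 -> nm y <= 4 * nm u).
  by move=> u; have [y y1 y2] := small_preim u l12; exists y.
pose z j := iter j pre x'.
have zE j : quad l (z j.+1) = z j := (hpre (z j)).1.
have bz j : filled_bd l (z j) by elim: j => // j IH; apply: filled_bd_preim => //; rewrite zE.
pose P j := - mu * w (z j).
have z0 j : 40 * G <= nm (P j) -> z j != 0.
  move=> h; apply/eqP => E; move: h; rewrite /P E /w gate_coord0// mulr0 nm0; move: G1; clear; lra.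
have wP j : nm (w (z j)) <= 2 * nm (P j) /\ nm (P j) <= 2 * nm (w (z j)).
  rewrite /P; move: (w (z j)) mu1 mu2 => v; rewrite nmM nmN.
  move: (nm mu) (nm v) (nm_ge0 v) => m t; clear => h1 h2 h3.
  by split; nra.
have zr j : nm (z j) <= r -> 40 * G <= nm (P j) -> nm (z j) <= r / 4.
  move=> h1 h2; have [_ _ h3 _] := hg _ (z0 j h2) h1.
  apply: (gate_coord_small q0 r4 A0 (z0 j h2) GA _ h3); rewrite -/w.
  by move: (wP j).2 h2 G1; clear; lra.
have pr j : nm (z j) <= r / 4 -> nm (z j.+1) <= r.
  move=> h; have := (hpre (z j)).2 (ltac:(move: h r1; clear; lra)); rewrite -/(z j.+1).
  by move: h; clear; lra.
have inr j : (forall i, (i < j)%N -> 40 * G <= nm (P i)) -> nm (z j) <= r.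
  elim: j => [//|j IH] h; apply: pr; apply: zr (h j (ltnSn j)).
  by apply: IH => i ij; apply: h; exact: ltnW.
have gG : nm (- mu ^+ 2 * g) <= G.
  rewrite nmM nmN nmX; apply: le_trans GC.
  have : nm mu ^+ 2 <= 4 by move: mu2 (nm_ge0 mu); clear; nra.
  by move: gC (nm_ge0 g) C1 CC; move: (nm mu ^+ 2) => t; clear; nra.
have orb : gate_orbit G (1 - mu^-1) (- mu ^+ 2 * g) P.
  move=> j h; have hj := h j (leqnn _).
  have zj := inr j (fun i ij => h i (ltnW ij)).
  have zj1 := pr _ (zr _ zj hj).
  have zn : z j.+1 != 0 by apply/eqP => E; have := zE j; rewrite E quad0 => /esym/eqP; rewrite (negbTE (z0 _ hj)).
  have [k1 k2 _ _] := hg _ zn zj1; rewrite zE -/w in k1.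
  apply: (gate_inverse C1 gC mu1 mu2 _ GC _ k1).
    apply: le_trans k2; rewrite -/w -invfM invf_ge1 ?mulr_gt0 ?exprn_gt0 ?nm_gt0//.
    apply: le_trans Ar; rewrite ler_pM2l//; apply: le_trans (zj1).
    by rewrite -[leRHS]expr1 ler_wiXn2l ?nm_ge0//; move: zj1 r1; clear; lra.
  by apply: le_trans hj; move: GC CC CC1 C1; clear; lra.
have m1 : mu - 1 != 0 by rewrite subr_eq0 eq_sym -subr_eq0.
have dn' : 1 - mu^-1 != 0.
  have -> : 1 - mu^-1 = (mu - 1) / mu by field.
  by rewrite mulf_neq0 ?invr_eq0.
(* Hence the bound B for the forward gate becomes 1 + B for the backward one. *)
have d'E : (1 - mu^-1)^-1 = 1 - (1 - mu)^-1.
  by field; rewrite ?mu0 ?m1 ?dn.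
have hB'' : `|re (1 - mu^-1)^-1| <= 1 + B.
  rewrite d'E reB /= (le_trans (ler_normB _ _))// normr1; move: hB'; clear; lra.
have d's : nm (1 - mu^-1) < s.
  have -> : 1 - mu^-1 = (mu - 1) / mu by field.
  rewrite nm_div ltr_pdivrMr; last by move: mu1; clear; lra.
  by move: ls mu1 s0; clear; nra.
have mP : nm (P 0%N + w x') <= 1/2.
  have -> : P 0%N + w x' = (1 - mu) * w x' by rewrite /P /z /=; ring.
  rewrite nmM nmC; have := nm_leB (w x') W; move: ls2 hW (nm_ge0 W) (nm_ge0 (w x')).
  rewrite ltr_pdivlMr; last by have := nm_ge0 W; clear; lra.
  by move: (nm_ge0 (mu - 1)); clear; nra.
have ws : wide_start G (2 * nm W + 1) (P 0%N).
  have e1 : nm (P 0%N + W) <= 3/2.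
    have -> : P 0%N + W = (P 0%N + w x') - (w x' - W) by ring.
    by apply: (le_trans (nmB _ _)); move: mP hW; clear; lra.
  have h1 := nm_leB (P 0%N) (- W); have h2 := nm_leB (- W) (P 0%N).
  rewrite opprK nmN in h1; rewrite nmC opprK nmN in h2.
  have h3 := re_ge (P 0%N + W); rewrite reD in h3.
  split; move: e1 h1 h2 h3 nwide Wbig G1; have := nm_ge0 (P 0%N); clear; lra.
have [k [kall k1 k2 k3]] := hpass _ _ _ gG dn' d's hB'' ws orb.
have hk := kall k (leqnn _); have zk := inr k (fun i ik => kall i (ltnW ik)).
have [_ c1 _ _] := hg _ (z0 _ hk) zk.
have mPk : P k + w (z k) = (1 - mu) * w (z k) by rewrite /P; ring.
have nPk : nm (P k + w (z k)) <= nm (w (z k)) / 100.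
  by rewrite mPk nmM nmC; move: ls1 (nm_ge0 (w (z k))); clear; nra.
exists (z k); rewrite -/w; split => //.
- have r2p : 0 < r2 by move: rr2 (normr_ge0 T); clear; lra.
  rewrite gtr0_norm// -[leRHS]invrK lef_pV2 ?posrE ?invr_gt0 ?nm_gt0 ?z0 ?mulr_gt0//.
  have nz : 0 < nm (z k) by rewrite nm_gt0 z0.
  have : (nm (z k))^-1 <= (nm (z k) ^+ q)^-1.
    rewrite lef_pV2 ?posrE ?exprn_gt0//.
    by rewrite -[leRHS]expr1 ler_wiXn2l ?nm_ge0//; move: zk r1; clear; lra.
  move=> /le_trans; apply; rewrite -[leLHS](mulKf (lt0r_neq0 A0)) mulrCA.
  have -> : 2 * A * r2 = A * (2 * r2) by ring.
  rewrite ler_pM2l//; apply: (le_trans c1); rewrite -/w.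
  by move: (wP k).1 k2; clear; lra.
- move: (wP k).2 k1 rr2 (ler_norm T); clear; lra.
- have h1 := re_ge (P k + w (z k)); have h2 := re_le (P k + w (z k)).
  rewrite reD in h1 h2; have h3 := nm_leD (P k) (w (z k)).
  by move: h1 h2 h3 nPk k3; have := nm_ge0 (w (z k)); clear; lra.
Qed.

(** Otherwise the points of [implosion_point], for parameters tending to l0, would accumulate at a
    boundary point of the filled set at l0 on the attracting side, hence in the basin. The margins,
    + 1 in the modulus and 1/5 against 1/4 in the angle, survive the passage to the limit. *)
Lemma implosion q l0 B : (0 < q)%N -> q.-primitive_root l0 -> 0 <= B ->
  exists2 eta, 0 < eta & near_param (fun l => nm (l - l0)) (fun l => 1 - l ^+ q != 0 ->
    `|re (1 - l ^+ q)^-1| <= B -> exists2 z, filled_bd l z & forall x, filled_bd l0 x -> eta <= nm (x - z)).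
Proof.
move=> q0 pl B0; have lq := prim_expr_order pl.
have [b [V [C [r [A [T [rB [Bas [[cb cV b0] [r0 r1 C1 A0 Ar] near hB [hwide henter hU]]]]]]]]]] := gate_setup q0 pl.
have henter' z : Bas z -> forall e, 0 < e -> exists n, iter n (quad l0) z != 0 /\ nm (iter n (quad l0) z) <= e.
  by move=> Bz e e0; have [n [h1 h2 _]] := henter z Bz 0 e e0; exists n.
have hl0 : nm l0 < 2 by rewrite (prim_nm1 q0 lq); lra.
have hwide' z : z != 0 -> nm z <= r -> `|T| <= nm (gate_coord q b V l0 z) ->
       - (nm (gate_coord q b V l0 z) / 4) <= re (gate_coord q b V l0 z) -> Bas z.
  by move=> z0 zr hT; apply: hwide => //; exact: le_trans (ler_norm T) hT.
have [c c0 hc] := implosion_point q0 lq cb cV b0 r0 r1 C1 A0 Ar near hB hwide' henter' hU hl0 B0.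
apply: contrapT => nH.
have /(@choice _ _ _)[u hu] : forall n : nat, exists lz : R[i] * R[i],
    [/\ nm (lz.1 - l0) < n.+1%:R^-1, exists2 x, filled_bd l0 x & nm (x - lz.2) < n.+1%:R^-1 ,
     c <= nm lz.2, nm lz.2 <= r &
    `|T| + 1 <= nm (gate_coord q b V lz.1 lz.2) /\
      - (nm (gate_coord q b V lz.1 lz.2) / 5) <= re (gate_coord q b V lz.1 lz.2)].
  move=> n; apply: contrapT => nex; apply: nH.
  have n0 : 0 < n.+1%:R^-1 :> R by rewrite invr_gt0.
  exists n.+1%:R^-1 => //.
  have nd : near_param (fun l => nm (l - l0)) (fun l => nm (l - l0) < n.+1%:R^-1) by exists n.+1%:R^-1.
  refine (param_sub (param_and hc nd) _) => l [h1 h2] dn hB'.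
  have [z [h3 h4 h5 h6 h7]] := h1 dn hB'; exists z => // x bx.
  rewrite leNgt; apply/negP => xz; apply: nex; exists (l, z); split => //; by exists x.
have [z hz] := @bolzano R (fun n => (u n).2) r (fun n => let: And5 _ _ _ h _ := hu n in h).
have late (e : R) : 0 < e -> exists n, nm ((u n).1 - l0) < e /\ (nm ((u n).2 - z) < e /\ n.+1%:R^-1 < e).
  move=> e0; have [N hN] := nat_gt e^-1; have [n Nn hn] := hz e e0 N; exists n.
  have h : n.+1%:R^-1 < e.
    rewrite -[e]invrK ltf_pV2 ?posrE ?invr_gt0//; apply: (lt_le_trans hN).
    by rewrite ler_nat ltnW// ltnS.
  by split=> //; have [h1 _ _ _ _] := hu n; exact: lt_trans h1 h.
have bz : filled_bd l0 z.
  apply: filled_bd_closed => e e0; have [n [_ [h2 h3]]] := late (e / 2) (ltac:(by rewrite divr_gt0)).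
  have [_ [x bx hx] _ _ _] := hu n; exists x => //.
  apply: (le_lt_trans (nm_tri (u n).2 _ _)); rewrite [ltRHS]splitr; apply: ltrD h2.
  exact: lt_trans hx h3.
have cz : c / 2 <= nm z.
  have [n [_ [h2 h3]]] := late (c / 2) (ltac:(by rewrite divr_gt0)).
  have [_ _ h4 _ _] := hu n; have := nm_leB (u n).2 z; move: h4 h2; clear; lra.
have z0 : z != 0 by rewrite -nm_gt0; move: cz c0; clear; lra.
have zr : nm z <= r.
  apply/ler_addgt0Pr => e e0; have [n [_ [h2 h3]]] := late e e0.
  have [_ _ _ h4 _] := hu n; have := nm_leB z (u n).2; rewrite nmC; move: h4 h2; clear; lra.
apply: (basin_not_bd hB bz).
have h24 : 0 < 1/48 :> R by rewrite divr_gt0.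
have [d d0 hd] := gate_coord_cont cb cV b0 (hU z z0 zr) h24.
have [n [h1 [h2 _]]] := late d d0.
have := hd _ _ h1 h2; have [_ _ _ _ [h3 h4]] := hu n; move: h3 h4.
set w := gate_coord q b V (u n).1 _; set W := gate_coord q b V l0 z => h3 h4 h5.
have h6 := nm_leB w W; have h7 := nm_leB W w; have h8 := re_le (w - W); rewrite reB in h8.
rewrite nmC in h7.
apply: hwide' => //; rewrite -/W; move: h3 h4 h5 h6 h7 h8 (normr_ge0 T); clear; lra.
Qed.

(** By compactness a failure yields Julia points for parameters tending to l0 that accumulate at a
    filled point z away from the limit Julia set. So z is interior, and by [stability] a
    neighbourhood of z is filled for these parameters, which leaves no place for the boundary points
    near z. *)
Lemma stability_unif q l0 (e : R) : (0 < q)%N -> q.-primitive_root l0 -> 0 < e ->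
  exists T, near_param (fun l => nm (l - l0)) (fun l => 1 - l ^+ q != 0 ->
    T <= `|re (1 - l ^+ q)^-1| -> forall z, filled_bd l z -> exists2 x, filled_bd l0 x & nm (x - z) < e).
Proof.
move=> q0 pl e0; apply: contrapT => nH.
have /(@choice _ _ _)[u hu] : forall n : nat, exists lz : R[i] * R[i],
    [/\ nm (lz.1 - l0) < n.+1%:R^-1, n%:R <= `|re (1 - lz.1 ^+ q)^-1|,
     1 - lz.1 ^+ q != 0, filled_bd lz.1 lz.2 & forall x, filled_bd l0 x -> e <= nm (x - lz.2)].
  move=> n; apply: contrapT => nex; apply: nH; exists n%:R, n.+1%:R^-1; first by rewrite invr_gt0.
  move=> l hl dn hn z bz; apply: contrapT => nx; apply: nex; exists (l, z); split => //= x bx.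
  by rewrite leNgt; apply/negP => h; apply: nx; exists x.
have [z hz] := @bolzano R (fun n => (u n).2) 4 (fun n => let: And5 _ _ _ h _ := hu n in filled_nm h.1).
have late (d : R) (m : nat) : 0 < d -> exists2 n, (m <= n)%N & nm ((u n).1 - l0) < d /\ nm ((u n).2 - z) < d.
  move=> d0; have [N hN] := nat_gt d^-1; have [n Nn hn] := hz d d0 (maxn m N); exists n.
    by rewrite (leq_trans _ Nn)// leq_maxl.
  split=> //; have [h1 _ _ _ _] := hu n; apply: lt_trans h1 _.
  rewrite -[d]invrK ltf_pV2 ?posrE ?invr_gt0//; apply: (lt_le_trans hN).
  by rewrite ler_nat ltnW// ltnS (leq_trans _ Nn)// leq_maxr.
have Kz : filled l0 z.
  apply: contrapT => /escape_open[d d0 hd]; have [n _ [h1 h2]] := late d 0%N d0.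
  by have [_ _ _ [Kn _] _] := hu n; exact: hd h1 h2 Kn.
case: (filled_bdP Kz) => [bz|iz].
  have [n _ [_ h2]] := late e 0%N e0; have [_ _ _ _ /(_ z bz)] := hu n.
  by rewrite nmC leNgt h2.
have [eta [T [eta0 [d d0 hd]]]] := stability q0 pl iz.
have [N hN] := nat_gt T.
have m0 : 0 < Num.min d (eta / 2) by rewrite lt_min d0 divr_gt0.
have [n Nn []] := late _ N m0; rewrite !lt_min => /andP[h1 _] /andP[_ h2].
have [_ k1 k2 k3 _] := hu n.
have k4 : T <= n%:R by apply: (le_trans (ltW hN)); rewrite ler_nat.
apply: (filled_bd_int k3); exists (eta / 2); first by rewrite divr_gt0.
move=> y hy; apply: (hd _ h1 k2 (le_trans k4 k1)).
by have := nm_tri (u n).2 y z; move: h2 hy; clear; lra.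
Qed.

End implosion.

(** * Convergence of the Julia sets *)

Section convergence.
Variable R : realType.
Implicit Types (l : R[i]).

(** Uniformity in x comes from compactness of the boundary at l0. *)
Lemma bd_lower_unif l0 (e : R) : nm l0 < 2 -> 0 < e -> near_param (fun l => nm (l - l0))
  (fun l => forall x, filled_bd l0 x -> exists2 z, filled_bd l z & nm (z - x) < e).
Proof.
move=> hl0 e0; apply: contrapT => nH.
have /(@choice _ _ _)[u hu] : forall n : nat, exists lx : R[i] * R[i],
    [/\ nm (lx.1 - l0) < n.+1%:R^-1, filled_bd l0 lx.2 & forall z, filled_bd lx.1 z -> e <= nm (z - lx.2)].
  move=> n; apply: contrapT => nex; apply: nH; exists n.+1%:R^-1; first by rewrite invr_gt0.
  move=> l hl x bx; apply: contrapT => nz; apply: nex; exists (l, x); split => //= z bz.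
  by rewrite leNgt; apply/negP => h; apply: nz; exists z.
have [x hx] := @bolzano R (fun n => (u n).2) 4 (fun n => let: And3 _ h _ := hu n in filled_nm h.1).
have bx : filled_bd l0 x.
  apply: filled_bd_closed => d d0; have [n _ hn] := hx d d0 0%N; exists (u n).2 => //.
  by have [] := hu n.
have e2 : 0 < e / 2 by rewrite divr_gt0.
have [d d0 hd] := bd_lower_semicont hl0 bx e2.
have [N hN] := nat_gt d^-1; have [n Nn hn] := hx _ e2 N; have [h1 _ h2] := hu n.
have [|z bz hz] := hd (u n).1.
  apply: (lt_trans h1); rewrite -[d]invrK ltf_pV2 ?posrE ?invr_gt0//; apply: (lt_le_trans hN).
  by rewrite ler_nat ltnW.
have := h2 z bz; rewrite leNgt => /negP; apply.
apply: (le_lt_trans (nm_tri x _ _)); rewrite [e]splitr; apply: ltrD => //.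
by rewrite nmC.
Qed.

(** The q-th roots of unity are powers of l0, finite in number, so those other than l0 lie at a
    positive distance. *)
Lemma root_isolated q l0 : q.-primitive_root l0 ->
  near_param (fun l => nm (l - l0)) (fun l => l != l0 -> 1 - l ^+ q != 0).
Proof.
move=> pl.
have /(_ q)[d d0 hd] : forall m, exists2 d : R, 0 < d & forall i, (i < m)%N -> l0 ^+ i != l0 -> d <= nm (l0 ^+ i - l0).
  elim => [|m [d d0 hd]]; first by exists 1.
  have [E|ne] := eqVneq (l0 ^+ m) l0.
    by exists d => // i; rewrite ltnS leq_eqVlt => /predU1P[->|im]; [rewrite E eqxx|exact: hd].
  exists (Num.min d (nm (l0 ^+ m - l0))); first by rewrite lt_min d0 nm_gt0 subr_eq0.
  move=> i; rewrite ltnS leq_eqVlt ge_min => /predU1P[->|im] h; first by rewrite lexx orbT.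
  by rewrite hd.
exists d => // l hl ne; rewrite subr_eq0 eq_sym; apply/eqP => /(prim_rootP pl)[i E].
by move: ne hl; rewrite E => ne; rewrite ltNge hd.
Qed.

Lemma cvg_normc (u : nat -> R[i]) l : u n @[n --> \oo] --> (l : R[i]^o) ->
  forall e : R, 0 < e -> exists N, forall n, (N <= n)%N -> nm (u n - l) < e.
Proof.
move=> /(@cvgrPdist_lt R[i] R[i]^o) h e e0; have [|N _ hN] := h (e%:C); first by rewrite ltcR.
exists N => n Nn; have := hN n Nn; rewrite distrC normc_def ltcR.
by rewrite /nm; case: (u n - l).
Qed.

End convergence.

Theorem theorem1p1 (R : realType) (p : int) (q : nat)
    (lambda0 : R[i]) (lambda : nat -> R[i])
    (q_ge1 : (1 <= q)%N)
    (lambda0E : lambda0 = cis (2 * pi * p%:~R / q%:R))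
    (lambda0_prim : q.-primitive_root lambda0)
    (lambda_neq : forall n, (1 <= n)%N -> lambda n != lambda0)
    (lambda_cvg : lambda n @[n --> \oo] --> (lambda0 : R[i]^o)) :
  hausdorff_cvg (fun n => julia_set (quad_map (lambda n)))
                (julia_set (quad_map lambda0)) <->
  (`|complex.Re (1 / (1 - lambda n ^+ q))| @[n --> \oo] --> +oo).
Proof.
have n1 : nm lambda0 = 1 by rewrite lambda0E nm_cis.
have hl0 : nm lambda0 < 2 by rewrite n1; lra.
have near P : near_param (fun l => nm (l - lambda0)) P ->
    exists N, forall n, (N <= n)%N -> P (lambda n).
  move=> [d d0 hd]; have [N hN] := cvg_normc lambda_cvg d0.
  by exists N => n /hN; exact: hd.
have [N0 hN0] : exists N, forall n, (N <= n)%N -> nm (lambda n) <= 2 /\ 1 - lambda n ^+ q != 0.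
  have [N hN] := near _ (root_isolated lambda0_prim).
  have [M hM] := cvg_normc lambda_cvg ltr01.
  (* The 1 discards the index 0, at which [lambda] may equal [lambda0]. *)
  exists (maxn 1 (maxn N M)) => n; rewrite !geq_max => /and3P[h1 h2 h3]; split.
    by have := hM n h3; have := nm_leB (lambda n) lambda0; rewrite n1; lra.
  by apply: hN => //; exact: lambda_neq.
rewrite hausdorff_cvgP cvgryPge; split=> [H A|H e e0].
  (* If the real part were below A in modulus for a large n, implosion with the bound |A| would give
     a Julia point at distance at least eta from the limit Julia set, against Hausdorff
     convergence. *)
  have [eta eta0 /near[N1 hN1]] := implosion q_ge1 lambda0_prim (normr_ge0 A).
  (* Julia points have modulus at most 4, so a chordal distance below d means a Euclidean one below
     (1 + 4)^2 d <= eta; 1/5 is 1 / (1 + 4), as [chordal_near] requires. *)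
  pose d := Num.min (1 / 5) (eta / 25).
  have d0 : 0 < d by rewrite lt_min !divr_gt0.
  have [N2 hN2] := H d d0; exists (maxn N0 (maxn N1 N2)) => // n.
  rewrite /= !geq_max => /and3P[k0 k1 k2]; have [h2 hn] := hN0 n k0.
  rewrite leNgt; apply/negP => hA; have [|z bz gap] := hN1 n k1 hn.
    by rewrite -[_^-1]mul1r (le_trans (ltW hA))// ler_norm.
  have [/(_ (Some z)) hz _] := hN2 n k2; have [|y] := hz.
    by rewrite julia_quad//; exists z.
  rewrite julia_quad ?ltW// => -[x bx <-]; rewrite sphere_ballE => hx.
  have x4 := filled_nm bx.1; have x0 := nm_ge0 x.
  have d5 : d <= 1 / 5 by rewrite ge_min lexx.
  have d25 : d <= eta / 25 by rewrite ge_min lexx orbT.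
  have [|w [<-] hw] := chordal_near _ hx.
    by move: d0 d5 x4 x0; clear; nra.
  have := gap x bx; rewrite nmC leNgt => /negP; apply; apply: (lt_le_trans hw).
  have : (1 + nm x) ^+ 2 <= 25 by move: x4 x0; clear; nra.
  by move: d0 d25; move: (_ ^+ 2) => t; clear; nra.
have e2 : 0 < e / 2 by rewrite divr_gt0.
have [T /near[N1 hN1]] := stability_unif q_ge1 lambda0_prim e2.
have /near[N2 hN2] := bd_lower_unif hl0 e2.
have [N3 _ hN3] := H T; exists (maxn (maxn N0 N3) (maxn N1 N2)) => n.
rewrite /= !geq_max => /andP[/andP[k0 k3] /andP[k1 k2]]; have [h2 hn] := hN0 n k0.
rewrite (julia_quad h2) (julia_quad (ltW hl0)); split=> [_ [z bz <-]|_ [x bx <-]].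
  have [|x bx hx] := hN1 n k1 hn _ z bz; first by have := hN3 n k3; rewrite /= mul1r.
  exists (Some x); first by exists x.
  by rewrite sphere_ballE (le_lt_trans (chordal_le _ _))// mulrC -ltr_pdivlMr.
have [z bz hz] := hN2 n k2 x bx; exists (Some z); first by exists z.
by rewrite sphere_ballE (le_lt_trans (chordal_le _ _))// mulrC -ltr_pdivlMr.
Qed.
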